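(* Let $(\mu_n)_{n\in\mathbb{N}}\subset\mathcal{M}^{P}_{\mathrm{cap}}(\mathbb{R}^d)$ be a sequence of capacitary measures of uniformly bounded torsion, $\sup_nP(\mu_n)<+\infty$. Then, up to a subsequence, one of the following situations occurs: (i) (Compactness) There is a sequence $x_n\in\mathbb{R}^d$ such that the translated measures $\mu_n(x_n+\cdot)$ $\gamma$-converge. (ii) (Vanishing) The sequence of resolvents $R_{\mu_n}$ converges to zero in the operator norm of $\mathcal{L}(L^2(\mathbb{R}^d))$. Moreover, $\|w_{\mu_n}\|_\infty\to0$ and $\lambda_1(\mu_n)\to+\infty$ as $n\to\infty$. (iii) (Dichotomy) There are capacitary measures $\mu_n^1$ and $\mu_n^2$ such that: - $\mathrm{dist}(\Omega_{\mu_n^1},\Omega_{\mu_n^2})\to+\infty$ as $n\to\infty$; - $\mu_n\prec\mu_n^1\wedge\mu_n^2$ for every $n\in\mathbb{N}$; - $d_\gamma(\mu_n,\mu_n^1\wedge\mu_n^2)\to0$ as $n\to\infty$; - $\|R_{\mu_n}-R_{\mu_n^1\wedge\mu_n^2}\|_{\mathcal{L}(L^2(\mathbb{R}^d))}\to0$ as $n\to\infty$.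
   Context: For $E\subset\mathbb{R}^d$, $\mathrm{cap}(E)=\inf\{\|u\|_{H^1}^2: u\in H^1(\mathbb{R}^d),\ u=1\text{ a.e. in a neighbourhood of }E\}$; functions in $H^1(\mathbb{R}^d)$ are identified with their quasi-continuous representatives, defined up to sets of zero capacity. A capacitary measure is a regular Borel measure $\mu$ on $\mathbb{R}^d$, possibly $+\infty$-valued, such that $\mathrm{cap}(E)=0$ implies $\mu(E)=0$. Two capacitary measures $\mu,\nu$ are identified if $\int u^2\,d\mu=\int u^2\,d\nu$ for every $u\in H^1(\mathbb{R}^d)$; the resulting set is $\mathcal{M}_{\mathrm{cap}}(\mathbb{R}^d)$. Write $\mu\prec\nu$ if $\int u^2\,d\mu\le\int u^2\,d\nu$ for every $u\in H^1(\mathbb{R}^d)$. Set $H^1_\mu=\{u\in H^1(\mathbb{R}^d):\int u^2\,d\mu<+\infty\}$. For suitable $f$, $J_{\mu,f}(u)=\frac12\int|\nabla u|^2\,dx+\frac12\int u^2\,d\mu-\int fu\,dx$. The torsion is $P(\mu)=-\inf\{J_{\mu,1}(u):u\in H^1_\mu\cap L^1(\mathbb{R}^d)\}\in[0,+\infty]$, and $\mathcal{M}^P_{\mathrm{cap}}(\mathbb{R}^d)$ is the set of $\mu\in\mathcal{M}_{\mathrm{cap}}(\mathbb{R}^d)$ with $P(\mu)<+\infty$. For such $\mu$ the torsion function $w_\mu\in H^1_\mu\cap L^1(\mathbb{R}^d)$ is the unique minimizer of $J_{\mu,1}$ in $H^1_\mu$, and the set of finiteness of $\mu$ is $\Omega_\mu=\{w_\mu>0\}$.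 The $\gamma$-distance is $d_\gamma(\mu,\nu)=\|w_\mu-w_\nu\|_{L^1}$ for $\mu,\nu\in\mathcal{M}^P_{\mathrm{cap}}(\mathbb{R}^d)$; $\gamma$-convergence of a sequence means convergence with respect to $d_\gamma$ to some element of $\mathcal{M}^P_{\mathrm{cap}}(\mathbb{R}^d)$. For $\mu\in\mathcal{M}^P_{\mathrm{cap}}(\mathbb{R}^d)$, the resolvent $R_\mu:L^2(\mathbb{R}^d)\to L^2(\mathbb{R}^d)$ maps $f$ to the unique minimizer of $J_{\mu,f}$ in $H^1_\mu$, i.e. the solution of $-\Delta u+\mu u=f$, $u\in H^1_\mu$; and $\lambda_1(\mu)=\min\{\int|\nabla u|^2dx+\int u^2d\mu: u\in H^1_\mu,\ \int u^2dx=1\}$. For $\mu,\nu$ the measure $\mu\wedge\nu$ is $(\mu\wedge\nu)(E)=\inf\{\mu(A)+\nu(E\setminus A): A\subset E\text{ Borel}\}$ for Borel $E$, where each measure is represented in its equivalence class by the one which equals $+\infty$ on every set of positive capacity contained in the complement of its set of finiteness. (When $\Omega_\mu\cap\Omega_\nu=\emptyset$ this measure equals $\mu$ on $\Omega_\mu$, $\nu$ on $\Omega_\nu$ and $+\infty$ on sets of positive capacity outside $\Omega_\mu\cup\Omega_\nu$.) *)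

(* Defs.v *)
From HB Require Import structures.
From mathcomp Require Import all_boot all_order all_algebra.
From mathcomp Require Import all_classical all_reals all_analysis.
From mathcomp Require Import measurable_realfun ring.
Set Implicit Arguments.
Unset Strict Implicit.
Unset Printing Implicit Defensive.
Import Order.TTheory GRing.Theory Num.Theory.
Import numFieldNormedType.Exports.
Local Open Scope classical_set_scope.
Local Open Scope ring_scope.

Fact rV_display : measure_display.
Proof. exact: default_measure_display. Qed.

Section borel_rV.
Context (R : realType) (n : nat).

Definition borel_rV : set (set 'rV[R]_n) := <<s [set U | open U] >>.

Let borel_rV0 : borel_rV set0.
Proof. exact: sigma_algebra0. Qed.

Let borel_rVC A : borel_rV A -> borel_rV (~` A).
Proof. exact: sigma_algebraC. Qed.

Let borel_rV_bigcup (F : (set 'rV[R]_n)^nat) :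
  (forall i, borel_rV (F i)) -> borel_rV (\bigcup_i (F i)).
Proof. exact: sigma_algebra_bigcup. Qed.

HB.instance Definition _ := @isMeasurable.Build rV_display 'rV[R]_n
  borel_rV borel_rV0 borel_rVC borel_rV_bigcup.

Lemma open_measurable_rV (U : set 'rV[R]_n) : open U -> measurable U.
Proof. by move=> oU; exact: sub_sigma_algebra. Qed.

End borel_rV.

Lemma continuous_measurable_rV (R : realType) (m n : nat)
    (f : 'rV[R]_m -> 'rV[R]_n) :
  continuous f -> measurable_fun setT f.
Proof.
move=> /continuousP cf; apply: (measurability [set U : set 'rV[R]_n | open U] erefl).
by move=> _ [U oU <-]; rewrite setTI; apply: open_measurable_rV; apply: cf.
Qed.

Lemma continuous_measurable_rVR (R : realType) (m : nat) (f : 'rV[R]_m -> R) :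
  continuous f -> measurable_fun setT f.
Proof.
move=> /continuousP cf; apply: (measurability _ (RGenOpens.measurableE R)).
move=> _ [_ [a [b ->]] <-]; rewrite setTI; apply: open_measurable_rV.
by apply: cf; exact: interval_open.
Qed.

Section cons_rV.
Context (R : realType) (n : nat).
Implicit Types (p : measurableTypeR R * 'rV[R]_n) (v : 'rV[R]_n.+1).

Definition cons_rV p : 'rV[R]_n.+1 :=
  \row_(i < n.+1) if unlift ord0 i is Some j then p.2 ord0 j else p.1.

Definition uncons_rV v : measurableTypeR R * 'rV[R]_n :=
  (v ord0 ord0, \row_(j < n) v ord0 (lift ord0 j)).

Lemma cons_rVK : cancel cons_rV uncons_rV.
Proof.
move=> [t v]; rewrite /uncons_rV /cons_rV; congr pair.
  by rewrite mxE unlift_none.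
by apply/rowP => j; rewrite !mxE liftK.
Qed.

Lemma measurable_uncons_rV : measurable_fun setT uncons_rV.
Proof.
apply/measurable_fun_pairP; split.
  by apply: continuous_measurable_rVR => v; exact: coord_continuous.
apply: continuous_measurable_rV => v.
move=> A /nbhs_ballP[e /= e0 eA]; apply/nbhs_ballP; exists e => //= w [_ vw].
by apply: eA; split=> // i j; rewrite !mxE; exact: vw.
Qed.

Lemma measurable_ball_rV (v : 'rV[R]_n) e : measurable (ball v e).
Proof. by apply: open_measurable_rV; exact: ball_open. Qed.

Lemma measurable_cons_rV : measurable_fun setT cons_rV.
Proof.
apply: (measurability [set U : set 'rV[R]_n.+1 | open U] erefl).
move=> _ [U oU <-]; rewrite setTI.
pose B (i : rat * 'rV[rat]_n * rat) : set (measurableTypeR R * 'rV[R]_n) :=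
  ball (ratr i.1.1 : R) (ratr i.2) `*`
  ball (map_mx ratr i.1.2 : 'rV[R]_n) (ratr i.2).
pose J := [set i | B i `<=` cons_rV @^-1` U].
have mB i : measurable (B i).
  by apply: measurableX; [exact: measurable_ball | exact: measurable_ball_rV].
suff -> : cons_rV @^-1` U = \bigcup_(i in J) B i.
  rewrite bigcup_mkcond; apply: countable_bigcupT_measurable => // i.
  by case: ifP => // _; exact: measurable0.
rewrite eqEsubset; split; last by move=> p [i Ji Bi]; exact: Ji.
move=> [t v] /= Utv.
have /nbhs_ballP [e /= e0 eU] : nbhs (cons_rV (t, v)) U.
  exact: open_nbhs_nbhs.
have ratapprox (x r : R) : 0 < r -> exists q : rat, `|ratr q - x| < r.
  move=> r0; have : x - r < x + r by rewrite ltrBlDr -addrA ltrDl addr_gt0.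
  move=> /rat_in_itvoo[q]; rewrite in_itv/= => /andP[h1 h2]; exists q.
  by rewrite ltr_distl h1.
have [r r0e] : exists r : rat, (0 : R) < ratr r < e / 2.
  have : (0 : R) < e / 2 by rewrite divr_gt0.
  by move=> /rat_in_itvoo[r]; rewrite in_itv/= => ?; exists r.
have [r0 re] := andP r0e.
have [q tq] := ratapprox t _ r0.
have /choice[f vf] (j : 'I_n) := ratapprox (v ord0 j) _ r0.
have inB t' (v' : 'rV[R]_n) :
    B (q, \row_j f j, r) (t', v') <->
    `|ratr q - t'| < ratr r /\ forall j, `|ratr (f j) - v' ord0 j| < ratr r.
  rewrite /B /=; split => -[/= h1 h2]; split => //.
    by move=> j; have := h2.2 ord0 j; rewrite !mxE.
  by split=> // i j; rewrite !mxE !ord1; exact: h2.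
exists (q, \row_j f j, r); last exact/inB.
move=> [t' v'] /inB[tq' vf']; apply: eU; split=> // i j; rewrite !ord1 !mxE.
have D (x y z : R) : `|z - x| < ratr r -> `|z - y| < ratr r -> `|x - y| < e.
  move=> zx zy; have -> : x - y = (z - y) - (z - x) by ring.
  apply: (le_lt_trans (ler_normB _ _)).
  by rewrite (splitr e) ltrD// (lt_trans _ re).
case: unliftP => [k|] _ /=.
  exact: D (vf k) (vf' k).
exact: D tq tq'.
Qed.

End cons_rV.

Section image_measure.
Local Open Scope ereal_scope.
Context (R : realType) d d' (T : measurableType d) (T' : measurableType d').
Context (f : {mfun T >-> T'}) (m : {measure set T -> \bar R}).

Definition image_measure (A : set T') : \bar R := pushforward m f A.

Let mpre A : measurable A -> measurable (f @^-1` A).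
Proof. by move=> mA; rewrite -[_ @^-1` _]setTI; exact: measurable_funPT. Qed.

Let image0 : image_measure set0 = 0.
Proof. by rewrite /image_measure /pushforward preimage_set0 measure0. Qed.

Let image_ge0 A : 0 <= image_measure A.
Proof. exact: measure_ge0. Qed.

Let image_sigma_additive : semi_sigma_additive image_measure.
Proof.
move=> F mF tF mUF; rewrite /image_measure /pushforward preimage_bigcup.
apply: measure_semi_sigma_additive.
- by move=> n; exact: mpre.
- apply/trivIsetP => /= i j _ _ ij; rewrite -preimage_setI.
  by move/trivIsetP : tF => /(_ _ _ _ _ ij) ->//; rewrite preimage_set0.
- by rewrite -preimage_bigcup; exact: mpre.
Qed.

HB.instance Definition _ := isMeasure.Build _ _ _
  image_measure image0 image_ge0 image_sigma_additive.

End image_measure.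

HB.instance Definition _ (R : realType) (n : nat) :=
  isMeasurableFun.Build _ _ _ _ (@cons_rV R n) (@measurable_cons_rV R n).

Section lebesgue_cons.
Local Open Scope ereal_scope.
Context (R : realType) (n : nat).
Variable m : {sigma_finite_measure set 'rV[R]_n -> \bar R}.

Let prod : {measure set (measurableTypeR R * 'rV[R]_n)%type -> \bar R} :=
  (@lebesgue_measure R) \x m.

Definition lebesgue_cons : set 'rV[R]_n.+1 -> \bar R :=
  image_measure (@cons_rV R n) prod.

HB.instance Definition _ := Measure.on lebesgue_cons.

Let lebesgue_cons_sigma_finite : sigma_finite setT lebesgue_cons.
Proof.
have /sigma_finiteP[F [TF ndF Foo]] := sigma_finiteT (@lebesgue_measure R).
have /sigma_finiteP[G [TG ndG Goo]] := sigma_finiteT m.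
exists (fun k => @uncons_rV R n @^-1` (F k `*` G k)).
  rewrite -preimage_bigcup -[LHS](@preimage_setT _ _ (@uncons_rV R n)).
  congr (_ @^-1` _); rewrite -setXTT TF TG predeqE => -[x y]; split.
    move=> [/= [i _ Fix] [k _ Gky]]; exists (maxn i k) => //; split.
    - by move: x Fix; exact/subsetPset/ndF/leq_maxl.
    - by move: y Gky; exact/subsetPset/ndG/leq_maxr.
  by move=> [i _ []/= ? ?]; split; exists i.
move=> k; have [mF Fk] := Foo k; have [mG Gk] := Goo k; split.
  rewrite -[_ @^-1` _]setTI; apply: measurable_uncons_rV => //.
  exact: measurableX.
rewrite /lebesgue_cons /image_measure /pushforward -comp_preimage.
rewrite (_ : _ \o _ = id); last by apply/funext => p; exact: cons_rVK.
have -> : prod (id @^-1` (F k `*` G k)) = lebesgue_measure (F k) * m (G k).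
  exact: product_measure1E.
by rewrite lte_mul_pinfty// ge0_fin_numE.
Qed.

HB.instance Definition _ := Measure_isSigmaFinite.Build _ _ _ lebesgue_cons
  lebesgue_cons_sigma_finite.

End lebesgue_cons.

Fixpoint lebesgue_rV (R : realType) (n : nat) :
    {sigma_finite_measure set 'rV[R]_n -> \bar R} :=
  if n is k.+1 then lebesgue_cons (lebesgue_rV R k) else \d_(0 : 'rV[R]_0).

Section translate.
Context (R : realType) (n : nat).

Definition sub_rV (x y : 'rV[R]_n) : 'rV[R]_n := y - x.

Let measurable_sub_rV x : measurable_fun setT (sub_rV x).
Proof.
apply: continuous_measurable_rV => y.
by apply: (@continuousB _ _ _ id (cst x)); [exact: cvg_id|exact: cst_continuous].
Qed.

HB.instance Definition _ x :=
  isMeasurableFun.Build _ _ _ _ (sub_rV x) (measurable_sub_rV x).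

(* A |-> mu (x + A) *)
Definition translate (x : 'rV[R]_n) (mu : {measure set 'rV[R]_n -> \bar R}) :
  {measure set 'rV[R]_n -> \bar R} := image_measure (sub_rV x) mu.

End translate.

Section sobolev.
Local Open Scope ereal_scope.
Context (R : realType) (n : nat).
Local Notation E := 'rV[R]_n.
Local Notation leb := (lebesgue_rV R n).
Implicit Types (u v f : E -> R) (A U : set E) (i : 'I_n).

Definition partial i u (x : E) : R := 'D_(delta_mx ord0 i) u x.

Fixpoint Ck (k : nat) u : Prop :=
  continuous u /\
  if k is k'.+1 then
    forall i, (forall x, derivable u x (delta_mx ord0 i)) /\ Ck k' (partial i u)
  else True.

Definition test_function u : Prop :=
  (forall k, Ck k u) /\ compact (closure [set x | u x != 0%R]).

Definition weak_gradient u (g : 'I_n -> E -> R) : Prop :=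
  forall i, g i \in Lfun leb 2%:E /\
    forall phi, test_function phi ->
      \int[leb]_x (u x * partial i phi x)%:E = - \int[leb]_x (g i x * phi x)%:E.

Definition H1 : set (E -> R) :=
  [set u | u \in Lfun leb 2%:E /\ exists g, weak_gradient u g].

(* the weak gradient, defined up to Lebesgue-negligible sets *)
Definition gradient u : 'I_n -> E -> R := get (weak_gradient u).

Definition dirichlet u : \bar R :=
  \int[leb]_x (\sum_(i < n) gradient u i x ^+ 2)%:E.

Definition cap A : \bar R :=
  ereal_inf [set \int[leb]_x (u x ^+ 2)%:E + dirichlet u | u in
    [set u | H1 u /\ exists U, [/\ open U, A `<=` U &
                                  {ae leb, forall x, U x -> u x = 1%R}]]].

Definition quasi_continuous u : Prop :=
  forall e : R, (0 < e)%R -> exists U,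
    [/\ open U, cap U < e%:E & {within ~` U, continuous u}].

(* The Borel quasi-continuous representatives of the elements of H^1: two of
   them that agree Lebesgue-a.e. agree outside a set of zero capacity. Every
   integral against a capacitary measure below is taken on such functions. *)
Definition H1q : set (E -> R) := [set u | H1 u /\ quasi_continuous u].

End sobolev.

Section capacitary.
Local Open Scope ereal_scope.
Context (R : realType) (n : nat).
Local Notation E := 'rV[R]_n.
Local Notation leb := (lebesgue_rV R n).
Implicit Types (mu nu la : {measure set E -> \bar R}) (u v w f : E -> R).

(* A regular Borel measure is the outer extension of its restriction to the
   Borel sets, so that a set has measure 0 iff it is contained in a Borel set of
   measure 0: this is negligibility. *)
Definition capacitary mu : Prop :=
  forall A : set E, cap A = 0 -> mu.-negligible A.

Definition sqint mu u : \bar R := \int[mu]_x (u x ^+ 2)%:E.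

Definition cap_equiv mu nu : Prop :=
  forall u, H1q u -> sqint mu u = sqint nu u.

Definition cap_le mu nu : Prop :=
  forall u, H1q u -> sqint mu u <= sqint nu u.

Definition H1mu mu : set (E -> R) := [set u | H1q u /\ sqint mu u < +oo].

Definition energy mu f u : \bar R :=
  (2^-1)%:E * dirichlet u + (2^-1)%:E * sqint mu u - \int[leb]_x (f x * u x)%:E.

Definition is_minimizer (J : (E -> R) -> \bar R) (K : set (E -> R)) u : Prop :=
  K u /\ forall v, K v -> J u <= J v.

Definition H1mu_L1 mu : set (E -> R) :=
  [set u | H1mu mu u /\ u \in Lfun leb 1].

Definition torsion mu : \bar R :=
  - ereal_inf [set energy mu (cst 1%R) u | u in H1mu_L1 mu].

Definition finite_torsion mu : Prop := capacitary mu /\ torsion mu < +oo.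

Definition is_torsion_function mu w : Prop :=
  is_minimizer (energy mu (cst 1%R)) (H1mu_L1 mu) w.

Definition torsion_function mu : E -> R := get (is_torsion_function mu).

(* The quasi-continuous torsion function, hence the set of finiteness, is only
   defined up to a set of zero capacity: Om is one of its versions. *)
Definition finiteness_set mu (Om : set E) : Prop :=
  exists2 w, is_torsion_function mu w & Om = [set x | (0 < w x)%R].

Definition d_gamma mu nu : \bar R :=
  'N[leb]_1[EFin \o (torsion_function mu \- torsion_function nu)%R].

Definition resolvent mu f : E -> R :=
  get (is_minimizer (energy mu f) (H1mu mu)).

Definition opnorm2 (T : (E -> R) -> (E -> R)) : \bar R :=
  ereal_sup [set 'N[leb]_2%:E[EFin \o T f] | f in
    [set f | f \in Lfun leb 2%:E /\ 'N[leb]_2%:E[EFin \o f] <= 1]].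

Definition lambda1 mu : \bar R :=
  ereal_inf [set dirichlet u + sqint mu u | u in
    [set u | H1mu mu u /\ \int[leb]_x (u x ^+ 2)%:E = 1]].

Definition saturated mu : Prop :=
  exists2 Om, finiteness_set mu Om &
    forall A, measurable A -> A `<=` ~` Om -> 0 < cap A -> mu A = +oo.

Definition is_wedge mu nu la : Prop :=
  exists mu' nu' : {measure set E -> \bar R},
    [/\ capacitary mu' /\ capacitary nu', cap_equiv mu mu' /\ cap_equiv nu nu',
        saturated mu' /\ saturated nu' &
        forall A, measurable A ->
          la A = ereal_inf [set mu' B + nu' (A `\` B) | B in
                              [set B | measurable B /\ B `<=` A]]].

End capacitary.

(* Real-valued infimum, equal to 0 when A or B is empty, since the distance is
   only meaningful between nonempty sets. *)
Definition euclidean_dist (R : realType) (n : nat) (A B : set 'rV[R]_n) : R :=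
  inf [set Num.sqrt (\sum_(i < n) (x ord0 i - y ord0 i) ^+ 2) | x in A & y in B].

(* Main.v *)
Require Import Defs.
From HB Require Import structures.
From mathcomp Require Import all_boot all_order all_algebra.
From mathcomp Require Import all_classical all_reals all_analysis.
From mathcomp Require Import measurable_realfun ring lra.
Set Implicit Arguments.
Unset Strict Implicit.
Unset Printing Implicit Defensive.
Import Order.TTheory GRing.Theory Num.Theory.
Import numFieldNormedType.Exports.
Local Open Scope classical_set_scope.
Local Open Scope ring_scope.

(** Write E(u) for the energy of u: its Dirichlet integral plus the integral of u^2 against mu.
Testing with the torsion function w bounds the square of the integral of |v| by C E(v), so the
Nash inequality controls all the norms involved in terms of P(mu).  If w_n tends to zero in L^1
locally uniformly in translations, then w_n tends to 0 in L^oo, and Barta's inequality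
int u^2/(w + e) <= E(u) gives vanishing.  Otherwise, after translating, a subsequence of w_n
converges in L^1_loc (Rellich) to some w <> 0 with 1 + Delta w >= 0.  If no mass is lost,
the convergence holds in L^1 and w is the torsion function of the measure (1 + Delta w)/w on {w > 0},
+oo elsewhere.  If mass is lost, there are annuli of growing width carrying little of w_n; making
mu_n infinite on them costs little torsion, because it only requires cutting off w_n there, and
little resolvent norm, because the torsion function of mu_n restricted to the annulus is small. *)

(** The measures are arbitrary, so nothing is known of w beyond its weak equation; every estimate
    comes from testing it with truncations, minima, cutoffs and quotients. [gradient] is chosen by
    [get] and has no pointwise calculus: chain and product rules are replaced by inequalities
    between finite differences. Two points are finer than almost-everywhere reasoning. A capacitary
    measure may charge Lebesgue-null sets, so limits in the energy space are taken quasi-everywhere.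
    And the pieces of the dichotomy must be described by their finiteness sets {w1 > 0} and {w2 >
    0}: a function cut off on the annuli is admissible for their wedge only if it vanishes
    quasi-everywhere off these sets, which is shown by truncating it with multiples of the torsion
    functions. The distance of the finiteness sets is 0 by default if one of them is empty. The mass
    kept near the centre and the mass lost, both larger than the L^1 error of the cut, keep them
    nonempty. The positive functional 1 + Delta w is represented by a measure by Daniell's method,
    and the representation is extended to quasi-continuous functions, since these are the test
    functions of the limit equation. *)

(** * Positive semidefinite forms and quadratic minimisation *)

Section psd_form.
Variables (R : realType) (V : lmodType R).

(** The form is bilinear only on the domain [S]: the forms below act on plain functions and take
    default values off their domain. Semidefinite is all one can ask, since functions are not
    identified almost everywhere. *)
Record psd (S : set V) (b : V -> V -> R) : Prop := Psd {
  psd_dom0 : S 0;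
  psd_domP : forall a u v, S u -> S v -> S (a *: u + v);
  psd_sym : forall u v, S u -> S v -> b u v = b v u;
  psd_lin : forall a u v w, S u -> S v -> S w ->
    b (a *: u + v) w = a * b u w + b v w;
  psd_ge0 : forall u, S u -> 0 <= b u u }.

Variables (S : set V) (b : V -> V -> R) (B : psd S b).

Lemma psd_domZ a u : S u -> S (a *: u).
Proof. by move=> Su; rewrite -[_ *: _]addr0; apply: (psd_domP B) => //; exact: (psd_dom0 B). Qed.

Lemma psd_domD u v : S u -> S v -> S (u + v).
Proof. by move=> Su Sv; rewrite -[u]scale1r; apply: (psd_domP B). Qed.

Lemma psd_domN u : S u -> S (- u).
Proof. by move=> Su; rewrite -scaleN1r; apply: psd_domZ. Qed.

Lemma psd_domB u v : S u -> S v -> S (u - v).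
Proof. by move=> Su Sv; apply: psd_domD => //; exact: psd_domN. Qed.

Lemma psdDl u v w : S u -> S v -> S w -> b (u + v) w = b u w + b v w.
Proof. by move=> Su Sv Sw; rewrite -[u]scale1r (psd_lin B)// scale1r mul1r. Qed.

Lemma psd0l w : S w -> b 0 w = 0.
Proof.
move=> Sw; have S0 := psd_dom0 B; have := psdDl S0 S0 Sw.
by rewrite addr0 -[LHS]addr0 => /addrI <-.
Qed.

Lemma psdZl a u w : S u -> S w -> b (a *: u) w = a * b u w.
Proof.
by move=> Su Sw; rewrite -[_ *: _]addr0 (psd_lin B)// ?psd0l// ?addr0//; exact: (psd_dom0 B).
Qed.

Lemma psdNl u w : S u -> S w -> b (- u) w = - b u w.
Proof. by move=> Su Sw; rewrite -scaleN1r psdZl// mulN1r. Qed.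

Lemma psdBl u v w : S u -> S v -> S w -> b (u - v) w = b u w - b v w.
Proof. by move=> Su Sv Sw; rewrite psdDl ?psdNl//; exact: psd_domN. Qed.

Lemma psdDr u v w : S u -> S v -> S w -> b w (u + v) = b w u + b w v.
Proof.
move=> Su Sv Sw; rewrite (psd_sym B) ?psdDl//; last exact: psd_domD.
by rewrite (psd_sym B Su)// (psd_sym B Sv).
Qed.

Lemma psdZr a u w : S u -> S w -> b w (a *: u) = a * b w u.
Proof.
by move=> Su Sw; rewrite (psd_sym B) ?psdZl ?(psd_sym B Su)//; exact: psd_domZ.
Qed.

Lemma psdNr u w : S u -> S w -> b w (- u) = - b w u.
Proof. by move=> Su Sw; rewrite -scaleN1r psdZr// mulN1r. Qed.

Lemma psdBr u v w : S u -> S v -> S w -> b w (u - v) = b w u - b w v.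
Proof. by move=> Su Sv Sw; rewrite psdDr ?psdNr//; exact: psd_domN. Qed.

Lemma psd_sqD u v : S u -> S v -> b (u + v) (u + v) = b u u + 2 * b u v + b v v.
Proof.
move=> Su Sv; have Suv := psd_domD Su Sv.
by rewrite psdDl// !psdDr// (psd_sym B Sv Su); ring.
Qed.

Lemma psd_sqB u v : S u -> S v -> b (u - v) (u - v) = b u u - 2 * b u v + b v v.
Proof.
move=> Su Sv; have Sv' := psd_domN Sv.
by rewrite psd_sqD// psdNr// psdNl// psdNr//; ring.
Qed.

Lemma psd_sqZ a u : S u -> b (a *: u) (a *: u) = a ^+ 2 * b u u.
Proof. by move=> Su; rewrite psdZl ?psdZr// ?mulrA//; exact: psd_domZ. Qed.

Lemma psd_sqDZ u v t : S u -> S v ->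
  b (u + t *: v) (u + t *: v) = b u u + 2 * t * b u v + t ^+ 2 * b v v.
Proof.
move=> Su Sv; have Stv := psd_domZ t Sv.
by rewrite psd_sqD// psdZr// psd_sqZ//; ring.
Qed.

Lemma parallelogram u v : S u -> S v ->
  b (u - v) (u - v) + b (u + v) (u + v) = 2 * b u u + 2 * b v v.
Proof. by move=> Su Sv; rewrite psd_sqB// psd_sqD//; ring. Qed.

Lemma psd_CS u v : S u -> S v -> b u v ^+ 2 <= b u u * b v v.
Proof.
move=> Su Sv; have P t := psd_ge0 B (psd_domD Su (psd_domZ t Sv)).
have {}P t : 0 <= b u u + 2 * t * b u v + t ^+ 2 * b v v by rewrite -psd_sqDZ.
have u0 := psd_ge0 B Su; have := psd_ge0 B Sv; rewrite le_eqVlt => /predU1P[v0|v0].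
  rewrite -v0 mulr0; have [->|uv0] := eqVneq (b u v) 0; first by rewrite expr0n.
  (* For [b v v = 0] the quadratic in t is affine, and this t gives it the value -1. *)
  have := P (- (b u u + 1) / (2 * b u v)); rewrite -v0 mulr0 addr0.
  have -> : b u u + 2 * (- (b u u + 1) / (2 * b u v)) * b u v = -1 by field.
  by rewrite ler0N1.
have := P (- b u v / b v v).
have -> : b u u + 2 * (- b u v / b v v) * b u v + (- b u v / b v v) ^+ 2 * b v v =
  (b u u * b v v - b u v ^+ 2) / b v v by field; rewrite gt_eqF.
by rewrite pmulr_lge0 ?invr_gt0// subr_ge0.
Qed.

Lemma psd_CS_sqrt u v : S u -> S v ->
  `|b u v| <= Num.sqrt (b u u) * Num.sqrt (b v v).
Proof.
move=> Su Sv; rewrite -sqrtrM ?(psd_ge0 B)// -sqrtr_sqr ler_wsqrtr//.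
exact: psd_CS.
Qed.

Lemma psd_AMGM u v e : 0 < e -> S u -> S v ->
  2 * b u v <= e * b u u + e^-1 * b v v.
Proof.
move=> e0 Su Sv.
have := psd_ge0 B (psd_domD (psd_domZ e Su) (psd_domN Sv)).
have eu := psd_domZ e Su.
rewrite psd_sqB// psd_sqZ// psdZl// => h.
rewrite -subr_ge0.
have -> : e * b u u + e^-1 * b v v - 2 * b u v =
   (e ^+ 2 * b u u - 2 * (e * b u v) + b v v) / e by field; rewrite gt_eqF.
by rewrite divr_ge0// ltW.
Qed.

Lemma psd_sqD_le u v : S u -> S v -> b (u + v) (u + v) <= 2 * b u u + 2 * b v v.
Proof.
by move=> Su Sv; rewrite -parallelogram// lerDr (psd_ge0 B)//; exact: psd_domB.
Qed.

Lemma psd_sqB_le u v : S u -> S v -> b (u - v) (u - v) <= 2 * b u u + 2 * b v v.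
Proof.
by move=> Su Sv; rewrite -parallelogram// lerDl (psd_ge0 B)//; exact: psd_domD.
Qed.

Lemma psd_sqrt_triangle u v : S u -> S v ->
  Num.sqrt (b (u + v) (u + v)) <= Num.sqrt (b u u) + Num.sqrt (b v v).
Proof.
move=> Su Sv; rewrite -[leRHS]ger0_norm ?addr_ge0// -sqrtr_sqr.
rewrite ler_wsqrtr// psd_sqD// sqrrD !sqr_sqrtr ?(psd_ge0 B)//.
by have := le_trans (ler_norm _) (psd_CS_sqrt Su Sv); lra.
Qed.

(* Minimisation of q(u)/2 - l(u): the parallelogram law makes minimising
   sequences q-Cauchy. *)
Section minimization.
Variables (l : V -> R).
Hypothesis ll : forall a u v, S u -> S v -> l (a *: u + v) = a * l u + l v.
Let F u := 2^-1 * b u u - l u.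

Lemma quad_parallelogram m u v : S u -> S v ->
  m <= F (2^-1 *: (u + v)) -> b (u - v) (u - v) <= 4 * (F u - m) + 4 * (F v - m).
Proof.
move=> Su Sv; have Suv := psd_domD Su Sv; rewrite /F psd_sqZ//.
have -> : l (2^-1 *: (u + v)) = 2^-1 * (l u + l v).
  have -> : 2^-1 *: (u + v) = 2^-1 *: u + (2^-1 *: v + 0).
    by rewrite addr0 scalerDr.
  have S0 := psd_dom0 B.
  have l0 : l 0 = 0.
    by have := ll 1 S0 S0; rewrite scale1r mul1r addr0 -[LHS]addr0 => /addrI <-.
  by rewrite !ll// ?l0; [ring|exact: (psd_domP B)].
have := parallelogram Su Sv.
move=> h1 h2; lra.
Qed.

Lemma quad_euler (K : set V) u v : S u -> S v -> (forall t, K (u + t *: v)) ->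
  (forall w, K w -> F u <= F w) -> b u v = l v.
Proof.
move=> Su Sv Kt Fu.
have P t : 0 <= t * (b u v - l v) + t ^+ 2 * (b v v / 2).
  have := Fu _ (Kt t); rewrite /F psd_sqDZ// [u + _]addrC ll//.
  lra.
have v0 := psd_ge0 B Sv.
set c := b u v - l v in P.
suff : c = 0 by rewrite /c => /eqP; rewrite subr_eq0 => /eqP.
apply/eqP/negPn/negP => c0.
have := P (- c / (b v v + 1)).
have -> : - c / (b v v + 1) * c + (- c / (b v v + 1)) ^+ 2 * (b v v / 2) =
  - ((c / (b v v + 1)) ^+ 2 * (b v v / 2 + 1)).
  by field; rewrite gt_eqF// ltr_wpDl.
rewrite oppr_ge0 => h.
have : 0 < (c / (b v v + 1)) ^+ 2 * (b v v / 2 + 1).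
  apply: mulr_gt0; last by rewrite ltr_wpDl// divr_ge0.
  by rewrite exprn_even_gt0//= mulf_neq0// invr_neq0// gt_eqF// ltr_wpDl.
by rewrite ltNge h.
Qed.

(** The quadratic t -> F(u + t v) stays above m and starts within e of it, which bounds its slope at
    0. The Euler equation can thus be obtained in the limit along a minimising sequence, without
    semicontinuity of F. *)
Lemma quad_approx_euler (K : set V) m e u v : S u -> S v -> (forall t, K (u + t *: v)) ->
  (forall w, K w -> m <= F w) -> F u <= m + e -> (b u v - l v) ^+ 2 <= 2 * e * b v v.
Proof.
move=> Su Sv Kt Fm Fu.
have P t : - e <= t * (b u v - l v) + t ^+ 2 * (b v v / 2).
  have := Fm _ (Kt t); move: Fu; rewrite /F psd_sqDZ// [u + _]addrC ll//.
  lra.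
have e0 : 0 <= e by have := P 0; rewrite mul0r expr0n mul0r addr0 oppr_le0.
have := psd_ge0 B Sv; set c := b u v - l v in P *; rewrite le_eqVlt => /predU1P[v0|v0].
  rewrite -v0 mulr0; suff -> : c = 0 by rewrite expr0n.
  apply/eqP/negPn/negP => c0; have := P (- (e + 1) / c); rewrite -v0 mul0r mulr0 addr0.
  by rewrite -mulrA mulVf// mulr1 lerN2; lra.
have := P (- c / b v v).
have -> : - c / b v v * c + (- c / b v v) ^+ 2 * (b v v / 2) = - (c ^+ 2 / (2 * b v v)).
  by field; rewrite gt_eqF.
by rewrite lerN2 ler_pdivrMr ?mulr_gt0// mulrCA mulrA.
Qed.

Lemma quad_diff u v : S u -> S v -> b u (v - u) = l v - l u ->
  F v - F u = 2^-1 * b (v - u) (v - u).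
Proof.
move=> Su Sv; rewrite psdBr// => h; rewrite /F psd_sqB// (psd_sym B Sv Su).
lra.
Qed.

End minimization.
End psd_form.

Lemma psdD (R : realType) (V : lmodType R) (S1 S2 : set V) b1 b2 :
  psd S1 b1 -> psd S2 b2 ->
  psd (S1 `&` S2) (fun u v : V => b1 u v + b2 u v).
Proof.
move=> B1 B2; split.
- by split; [exact: (psd_dom0 B1)|exact: (psd_dom0 B2)].
- by move=> a u v [? ?] [? ?]; split; [exact: (psd_domP B1)|exact: (psd_domP B2)].
- by move=> u v [? ?] [? ?]; rewrite (psd_sym B1)// (psd_sym B2).
- by move=> a u v w [? ?] [? ?] [? ?]; rewrite (psd_lin B1)// (psd_lin B2)//; ring.
- by move=> u [? ?]; rewrite addr_ge0 ?(psd_ge0 B1) ?(psd_ge0 B2).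
Qed.

Lemma psd_sub (R : realType) (V : lmodType R) (S S' : set V) b :
  psd S b -> S' `<=` S -> S' 0 -> (forall a u v, S' u -> S' v -> S' (a *: u + v)) ->
  psd S' b.
Proof.
move=> B sub d0 dP; split => //.
- by move=> u v /sub ? /sub ?; exact: (psd_sym B).
- by move=> a u v w /sub ? /sub ? /sub ?; exact: (psd_lin B).
- by move=> u /sub ?; exact: (psd_ge0 B).
Qed.

(** * Integration of real-valued functions *)

Notation mf u := (measurable_fun [set: _] u).
Notation integ mu u := (mu.-integrable [set: _] (EFin \o u)).

Section measurability.
Context d (T : measurableType d) (R : realType).
Implicit Types u v : T -> R.

Lemma mfD u v : mf u -> mf v -> mf (u + v). Proof. exact: measurable_funD. Qed.
Lemma mfB u v : mf u -> mf v -> mf (u - v). Proof. exact: measurable_funB. Qed.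
Lemma mfM u v : mf u -> mf v -> mf (u * v). Proof. exact: measurable_funM. Qed.
Lemma mfN u : mf u -> mf (- u). Proof. exact: measurable_funN. Qed.
Lemma mfZ a u : mf u -> mf (a *: u).
Proof. by move=> mu; apply: measurable_funM. Qed.
Lemma mf_cst a : mf (cst a : T -> R). Proof. exact: measurable_cst. Qed.
Lemma mf_norm u : mf u -> mf (fun x => `|u x|).
Proof. by move=> mu; apply: measurableT_comp. Qed.
Lemma mf_max u v : mf u -> mf v -> mf (u \max v). Proof. exact: measurable_maxr. Qed.
Lemma mf_min u v : mf u -> mf v -> mf (u \min v). Proof. exact: measurable_minr. Qed.
Lemma mf_indic (A : set T) : measurable A -> mf (\1_A : T -> R).
Proof. by move=> mA; exact: measurable_indic. Qed.
Lemma mset_lt u v : mf u -> mf v -> measurable [set x | u x < v x].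
Proof. by move=> ? ?; rewrite -[X in measurable X]setTI; exact: measurable_fun_ltr. Qed.
Lemma mset_le u v : mf u -> mf v -> measurable [set x | u x <= v x].
Proof. by move=> ? ?; rewrite -[X in measurable X]setTI; exact: measurable_fun_ler. Qed.
Lemma mset_eq u v : mf u -> mf v -> measurable [set x | u x = v x].
Proof.
move=> mu mv; rewrite -[X in measurable X]setTI.
rewrite (_ : [set x | _] = [set x | u x == v x]).
  exact: measurable_fun_eqr.
by apply/seteqP; split=> x /= /eqP.
Qed.

End measurability.

(** [fine] gives 0 to an infinite integral: identities for [It] therefore ask for [integ], while
    [It_ge0] does not. *)
HB.lock Definition It d (T : measurableType d) (R : realType)
  (mu : {measure set T -> \bar R}) (f : T -> R) : R :=
  fine (\int[mu]_x (f x)%:E)%E.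

Section integral.
Context d (T : measurableType d) (R : realType) (mu : {measure set T -> \bar R}).
Implicit Types (u v f g : T -> R) (a : R).

Lemma integ_mf u : integ mu u -> mf u.
Proof. by move=> /measurable_int/measurable_EFinP. Qed.

Lemma integD u v : integ mu u -> integ mu v -> integ mu (u + v).
Proof. by move=> iu iv; exact: integrableD iu iv. Qed.

Lemma integN u : integ mu u -> integ mu (- u).
Proof. by move=> iu; exact: integrableN iu. Qed.

Lemma integB u v : integ mu u -> integ mu v -> integ mu (u - v).
Proof. by move=> iu iv; apply: integD => //; exact: integN. Qed.

Lemma integZ a u : integ mu u -> integ mu (a *: u).
Proof. by move=> iu; exact: integrableZl iu. Qed.

Lemma integ0 : integ mu (0 : T -> R).
Proof. exact: integrable0. Qed.

Lemma integ_le u v : mf u -> (forall x, `|u x| <= v x) -> integ mu v -> integ mu u.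
Proof.
move=> mu_ uv iv; apply: le_integrable iv => //; first exact/measurable_EFinP.
by move=> x _ /=; rewrite lee_fin (le_trans (uv x))// ler_norm.
Qed.

Lemma integ_abs u : integ mu u -> integ mu (fun x => `|u x|).
Proof. exact: integrable_norm. Qed.

Lemma integ_sum I (r : seq I) (F : I -> T -> R) : (forall i, integ mu (F i)) ->
  integ mu (\sum_(i <- r) F i).
Proof.
move=> mF; elim: r => [|i r IH]; first by rewrite big_nil; exact: integ0.
by rewrite big_cons; exact: integD.
Qed.

Lemma ItE u : integ mu u -> (It mu u)%:E = (\int[mu]_x (u x)%:E)%E.
Proof. by move=> iu; rewrite unlock fineK//; exact: integrable_fin_num iu. Qed.

Lemma ItD u v : integ mu u -> integ mu v -> It mu (u + v) = It mu u + It mu v.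
Proof. by move=> iu iv; rewrite !unlock; exact: RintegralD. Qed.

Lemma ItN u : integ mu u -> It mu (- u) = - It mu u.
Proof.
move=> iu; rewrite !unlock; have := RintegralZl (-1) measurableT iu.
rewrite mulN1r => <-; congr fine; apply: eq_integral => x _.
by rewrite mulN1r.
Qed.

Lemma ItB u v : integ mu u -> integ mu v -> It mu (u - v) = It mu u - It mu v.
Proof. by move=> iu iv; rewrite ItD ?ItN//; exact: integN. Qed.

Lemma ItZ a u : integ mu u -> It mu (a *: u) = a * It mu u.
Proof. by move=> iu; rewrite !unlock; exact: RintegralZl. Qed.

Lemma It0 : It mu (0 : T -> R) = 0.
Proof. by rewrite unlock integral0_eq. Qed.

Lemma It_sum I (r : seq I) (F : I -> T -> R) : (forall i, integ mu (F i)) ->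
  It mu (\sum_(i <- r) F i) = \sum_(i <- r) It mu (F i).
Proof.
move=> mF; elim: r => [|i r IH]; first by rewrite !big_nil It0.
by rewrite !big_cons ItD ?IH//; exact: integ_sum.
Qed.

Lemma It_le u v : integ mu u -> integ mu v -> (forall x, u x <= v x) ->
  It mu u <= It mu v.
Proof. by move=> iu iv uv; rewrite !unlock; apply: le_Rintegral. Qed.

Lemma It_ge0 u : (forall x, 0 <= u x) -> 0 <= It mu u.
Proof. by move=> u0; rewrite unlock; apply: Rintegral_ge0. Qed.

Lemma It_abs u : integ mu u -> `|It mu u| <= It mu (fun x => `|u x|).
Proof. by move=> iu; rewrite !unlock; exact: le_normr_Rintegral. Qed.

Lemma It_ext u v : u =1 v -> It mu u = It mu v.
Proof. by move=> /funext->. Qed.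

Lemma integ_ge0P u : mf u -> (forall x, 0 <= u x) ->
  integ mu u <-> (\int[mu]_x (u x)%:E < +oo)%E.
Proof.
move=> mfu u0; split=> [iu|h]; first by rewrite -ItE// ltry.
apply/integrableP; split; first exact/measurable_EFinP.
by under eq_integral do rewrite /= ger0_norm//.
Qed.

Lemma It_ae u v : mf u -> mf v -> {ae mu, forall x, u x = v x} ->
  It mu u = It mu v.
Proof.
move=> mfu mfv uv; rewrite !unlock; congr fine; apply: ae_eq_integral => //.
- exact/measurable_EFinP.
- exact/measurable_EFinP.
- by apply: filterS uv => x -> .
Qed.

Lemma integ_ae u v : integ mu u -> mf v -> {ae mu, forall x, u x = v x} ->
  integ mu v.
Proof.
move=> iu mfv uv; apply/integrableP; split; first exact/measurable_EFinP.
move/integrableP: (iu) => [_]; apply: le_lt_trans.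
rewrite le_eqVlt; apply/orP; left; apply/eqP; apply: ae_eq_integral => //.
- by apply: measurableT_comp => //; exact/measurable_EFinP.
- by apply: measurableT_comp => //; exact/measurable_EFinP/(integ_mf iu).
- by apply: filterS uv => x /= ->.
Qed.

Lemma It_le_ae u v : integ mu u -> integ mu v ->
  {ae mu, forall x, u x <= v x} -> It mu u <= It mu v.
Proof.
move=> iu iv uv.
have [mu_ mv] := (integ_mf iu, integ_mf iv).
rewrite (@It_ae u (u \min v))//; last 2 first.
- exact: mf_min.
- by apply: filterS uv => x h; rewrite /= min_l.
apply: It_le => //; last by move=> x /=; rewrite ge_min lexx orbT.
apply: integ_ae iu _ _; first exact: mf_min.
by apply: filterS uv => x h; rewrite /= min_l.
Qed.

Lemma It_eq0_ae u : integ mu u -> (forall x, 0 <= u x) -> It mu u = 0 ->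
  {ae mu, forall x, u x = 0}.
Proof.
move=> iu u0 Iu0; have mu_ := integ_mf iu.
have : (\int[mu]_(x in setT) `|(u x)%:E| = 0)%E.
  by under eq_integral do rewrite /= ger0_norm//; rewrite -ItE// Iu0.
move/ae_eq_integral_abs => /(_ measurableT) H.
have {H} := (H ((measurable_EFinP _ _).2 mu_)).
by apply: filterS => x /(_ I)[].
Qed.

Lemma It_le0_ae u : integ mu u -> (forall x, 0 <= u x) -> It mu u <= 0 ->
  {ae mu, forall x, u x = 0}.
Proof.
by move=> iu u0 h; apply: It_eq0_ae => //; apply/eqP; rewrite eq_le h It_ge0.
Qed.

(** The limit is nonnegative only almost everywhere, hence the absolute values. Integrability of the
    limit belongs to the conclusion; this is how limits inherit membership in L^1 and L^2. *)
Lemma It_fatou (f : nat -> T -> R) u (C : R) : (forall n, integ mu (f n)) ->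
  (forall n x, 0 <= f n x) -> mf u -> (forall n, It mu (f n) <= C) ->
  {ae mu, forall x, f n x @[n --> \oo] --> u x} ->
  [/\ integ mu (fun x => `|u x|) & It mu (fun x => `|u x|) <= C].
Proof.
move=> jf f0 mfu fC [N [mN N0 subN]].
have fN x : (~` N) x -> f n x @[n --> \oo] --> u x.
  by move=> Nx; apply: contrapT => h; apply: Nx; apply: subN.
have mNC : measurable (~` N) by exact: measurableC.
have mau : mf (fun x => `|u x|) by exact: mf_norm.
have mEau : measurable_fun setT (EFin \o (fun x => `|u x|)) by exact/measurable_EFinP.
have H : (\int[mu]_x (`|u x|)%:E <= C%:E)%E.
  rewrite (ge0_negligible_integral mN)// setTD.
  have mff n : measurable_fun (~` N) (EFin \o f n).
    by apply: measurable_funTS; apply/measurable_EFinP; exact: integ_mf (jf n).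
  have F := @fatou _ _ _ mu (~` N) mNC (fun n => EFin \o f n) mff (fun n x _ => f0 n x).
  refine (le_trans _ (le_trans F _)).
    rewrite le_eqVlt; apply/orP; left; apply/eqP; apply: eq_integral => x.
    rewrite inE => Nx; have fx := fN _ Nx.
    have cE : (EFin \o f n) x @[n --> \oo] --> (u x)%:E.
      by apply: cvg_EFin fx; apply: nearW.
    have [/= -> _] := cvg_limn_einf_sup cE.
    rewrite ger0_norm//; have -> : u x = limn (fun n => f n x) by apply/esym/cvg_lim.
    by apply: limr_ge; [apply/cvg_ex; exists (u x)|apply: nearW].
  rewrite limn_einf_lim; apply: lime_le; first exact: is_cvg_einfs.
  apply: nearW => n; apply: (@le_trans _ _ (\int[mu]_(x in ~` N) (f n x)%:E)%E).
    by apply: ereal_inf_lbound; exists n => /=.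
  rewrite -setTD -(ge0_negligible_integral mN)//; last by move=> x _; rewrite lee_fin.
    by rewrite -ItE// lee_fin.
  by apply/measurable_EFinP; exact: integ_mf (jf n).
have iu : integ mu (fun x => `|u x|).
  by apply/integ_ge0P => //; apply: le_lt_trans H _; rewrite ltry.
by split=> //; rewrite -lee_fin ItE.
Qed.

Lemma It_dom (f : nat -> T -> R) u g : (forall n, mf (f n)) -> mf u ->
  {ae mu, forall x, f n x @[n --> \oo] --> u x} -> integ mu g ->
  (forall n x, `|f n x| <= g x) ->
  integ mu u /\ It mu (f n) @[n --> \oo] --> It mu u.
Proof.
move=> mff mfu fu ig fg.
have [] := @dominated_convergence _ _ _ mu setT measurableT
  (fun n => EFin \o f n) (EFin \o u) (EFin \o g).
- by move=> n; apply/measurable_EFinP.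
- exact/measurable_EFinP.
- by apply: filterS fu => x fx _; apply: cvg_EFin fx; apply: nearW.
- by [].
- by apply: aeW => x n _ /=; rewrite lee_fin.
move=> iu _ H; split=> //.
have {}H : (\int[mu]_x (f n x)%:E)%E @[n --> \oo] --> (It mu u)%:E by rewrite ItE.
rewrite (_ : (fun n => It mu (f n)) = (fun n => fine (\int[mu]_x (f n x)%:E)%E)).
  exact: fine_cvg H.
by apply/funext => n; rewrite unlock.
Qed.

Definition sqi u := mf u /\ integ mu (u * u).
Definition ip u v := It mu (u * v).

Lemma sqi_Lfun u : u \in Lfun mu 2%:E <-> sqi u.
Proof.
split=> [h|[mu_ iu]].
  have := Lfun2_integrable_sqr h; move: h; rewrite inE => /andP[/[!inE]/= mu_ _] h.
  by split=> //; rewrite (_ : u * u = fun x => u x ^+ 2)//; apply/funext => x; rewrite expr2.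
apply/andP; split; first by rewrite inE.
rewrite inE/= /finite_norm unlock; apply: poweR_lty.
apply: (@le_lt_trans _ _ (\int[mu]_x ((u * u) x)%:E)%E); last by rewrite -ItE// ltry.
rewrite le_eqVlt; apply/orP; left; apply/eqP; apply: eq_integral => x _.
by congr (_%:E); rewrite powR_mulrn ?normr_ge0// real_normK ?num_real// expr2.
Qed.

Lemma sqiM u v : sqi u -> sqi v -> integ mu (u * v).
Proof.
move=> [mu_ iu] [mv iv]; apply: (@integ_le _ (u * u + v * v)); first exact: mfM.
  move=> x; rewrite !fctE normrM.
  have := sqr_ge0 (`|u x| - `|v x|); rewrite sqrrB.
  have e (a : R) : a * a = `|a| ^+ 2 by rewrite -normrX ger0_norm ?sqr_ge0.
  rewrite !e => h.
  have := mulr_ge0 (normr_ge0 (u x)) (normr_ge0 (v x)).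
  move: h; rewrite -mulr_natr; lra.
exact: integD.
Qed.

Lemma sqi_dom a u v : sqi u -> sqi v -> sqi (a *: u + v).
Proof.
move=> su sv; split; first by apply: mfD; [apply: mfZ; case: su|case: sv].
have -> : (a *: u + v) * (a *: u + v) =
    (a ^+ 2) *: (u * u) + ((2 * a) *: (u * v) + v * v).
  by apply/funext => x; rewrite !fctE /=; rewrite /GRing.scale/=; ring.
by apply: integD; [apply: integZ; case: su|apply: integD; [apply/integZ/sqiM|case: sv]].
Qed.

Lemma psd_ip : psd sqi ip.
Proof.
split.
- by split; [exact: mf_cst|rewrite mul0r; exact: integ0].
- by move=> a u v; exact: sqi_dom.
- by move=> u v _ _; rewrite /ip mulrC.
- move=> a u v w su sv sw; rewrite /ip mulrDl.
  have -> : (a *: u) * w = a *: (u * w).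
    by apply/funext => x; rewrite !fctE /GRing.scale/= mulrA.
  by rewrite ItD ?ItZ//; [exact: sqiM|apply: integZ; exact: sqiM|exact: sqiM].
- by move=> u _; apply: It_ge0 => x; rewrite fctE -expr2 sqr_ge0.
Qed.

Lemma sqi_le u v : sqi v -> mf u -> (forall x, `|u x| <= `|v x|) -> sqi u.
Proof.
move=> [mv iv] mu_ uv; split=> //; apply: (@integ_le _ (v * v)) => //.
  exact: mfM.
move=> x; rewrite !fctE normrM.
have -> : v x * v x = `|v x| * `|v x| by rewrite -normrM ger0_norm// -expr2 sqr_ge0.
exact: ler_pM.
Qed.

Lemma ip_le u v : sqi u -> sqi v -> (forall x, `|u x| <= `|v x|) -> ip u u <= ip v v.
Proof.
move=> su sv uv; apply: It_le; [exact: sqiM|exact: sqiM|].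
move=> x; rewrite !fctE.
have e (a : R) : a * a = `|a| * `|a| by rewrite -normrM ger0_norm// -expr2 sqr_ge0.
by rewrite (e (u x)) (e (v x)); exact: ler_pM.
Qed.

Lemma sqi_abs u : sqi u -> sqi (fun x => `|u x|).
Proof.
move=> su; apply: (sqi_le su) => [|x]; first by apply: mf_norm; case: su.
by rewrite normr_id.
Qed.

Lemma ip_abs u : ip (fun x => `|u x|) (fun x => `|u x|) = ip u u.
Proof.
by congr It; apply/funext => x; rewrite !fctE -normrM ger0_norm// -expr2 sqr_ge0.
Qed.

Lemma sqi_ae u v : sqi u -> mf v -> {ae mu, forall x, u x = v x} -> sqi v.
Proof.
move=> [mu_ iu] mv uv; split=> //; apply: integ_ae iu _ _; first exact: mfM.
by apply: filterS uv => x; rewrite !fctE => ->.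
Qed.

Lemma ip_ae u v u' v' : mf u -> mf v -> mf u' -> mf v' ->
  {ae mu, forall x, u x = u' x} -> {ae mu, forall x, v x = v' x} ->
  ip u v = ip u' v'.
Proof.
move=> mu_ mv mu' mv' uu vv; apply: It_ae; [exact: mfM|exact: mfM|].
by apply: filterS2 uu vv => x; rewrite !fctE => -> ->.
Qed.

Lemma ip_eq0_ae u : sqi u -> ip u u = 0 -> {ae mu, forall x, u x = 0}.
Proof.
move=> su u0; have := It_eq0_ae (sqiM su su) _ u0.
move=> /(_ (fun x => _)); have h x : 0 <= (u * u) x by rewrite fctE -expr2 sqr_ge0.
move=> /(_ h); apply: filterS => x; rewrite fctE => /eqP.
by rewrite mulf_eq0 orbb => /eqP.
Qed.

End integral.

#[global] Hint Resolve mf_cst : core.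

(** * Real sequences and completeness of L^2 *)

Section sequences.
Variable R : realType.
Implicit Types (v : nat -> R) (l e : R).

Lemma cvg_epsP v l : v n @[n --> \oo] --> l <->
  (forall e, 0 < e -> exists N, forall n, (N <= n)%N -> `|v n - l| <= e).
Proof.
split=> [/cvgrPdistC_le h e e0|h].
  by have [N _ hN] := h _ e0; exists N => n Nn; exact: hN.
apply/cvgrPdistC_le => e e0; have [N hN] := h _ e0.
by exists N => // n /= Nn; exact: hN.
Qed.

Lemma cauchy_eps_cvg v :
  (forall e, 0 < e -> exists N, forall m n, (N <= m)%N -> (N <= n)%N ->
     `|v m - v n| <= e) ->
  exists l, v n @[n --> \oo] --> l.
Proof.
move=> h; apply/cvg_ex/cauchy_cvgP/cauchy_ballP => e e0.
have [N hN] := h _ (divr_gt0 e0 (ltr0n _ 2)); rewrite !near_map2.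
exists ([set n | (N <= n)%N], [set n | (N <= n)%N]); first by split; exists N.
move=> [m n] /= [mN nN]; rewrite /ball/=.
by apply: le_lt_trans (hN _ _ mN nN) _; rewrite ltr_pdivrMr// ltr_pMr// ltr1n.
Qed.

Lemma half_pow_gt0 k : 0 < (2^-1 : R) ^+ k.
Proof. by rewrite exprn_gt0// invr_gt0. Qed.

Lemma half_pow_small e : 0 < e -> exists N, forall n, (N <= n)%N -> (2^-1 : R) ^+ n <= e.
Proof.
move=> e0.
have H : `|2^-1 : R| < 1 by rewrite ger0_norm ?invr_ge0// invf_lt1// ltr1n.
have [N hN] := (cvg_epsP _ _).1 (cvg_expr H) _ e0.
by exists N => n /hN; rewrite subr0 ger0_norm// exprn_ge0// invr_ge0.
Qed.

Lemma geom_cvg v C : (forall k, `|v k.+1 - v k| <= C * 2^-1 ^+ k) ->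
  exists2 l, v n @[n --> \oo] --> l & forall k, `|v k - l| <= 2 * C * 2^-1 ^+ k.
Proof.
move=> h.
have C0 : 0 <= C by have := le_trans (normr_ge0 _) (h 0%N); rewrite expr0 mulr1.
have H k j : `|v (k + j)%N - v k| <= 2 * C * 2^-1 ^+ k - 2 * C * 2^-1 ^+ (k + j).
  elim: j => [|j IH]; first by rewrite addn0 !subrr normr0.
  rewrite addnS (_ : v _ - v k = (v (k + j).+1 - v (k + j)%N) + (v (k + j)%N - v k)).
    apply: (le_trans (ler_normD _ _)); have := h (k + j)%N.
    by rewrite exprS; move: IH; lra.
  by ring.
have H' k j : `|v (k + j)%N - v k| <= 2 * C * 2^-1 ^+ k.
  apply: (le_trans (H k j)); rewrite lerBlDr lerDl.
  by apply: mulr_ge0; [exact: mulr_ge0|apply: ltW; exact: half_pow_gt0].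
have [l vl] : exists l, v n @[n --> \oo] --> l.
  apply: cauchy_eps_cvg => e e0.
  have [|N hN] := @half_pow_small (e / (4 * C + 1)).
    by rewrite divr_gt0// ltr_wpDl// mulr_ge0.
  exists N => m n Nm Nn; rewrite -(subnKC Nm) -(subnKC Nn).
  rewrite (_ : _ - _ = (v (N + (m - N))%N - v N) - (v (N + (n - N))%N - v N)); last by ring.
  apply: (le_trans (ler_normB _ _)); apply: (le_trans (lerD (H' _ _) (H' _ _))).
  have := hN _ (leqnn N); rewrite ler_pdivlMr ?ltr_wpDl ?mulr_ge0// => h1.
  have := half_pow_gt0 N; lra.
exists l => // k; rewrite -normrN opprB.
have : `|v n - v k| @[n --> \oo] --> `|l - v k|.
  by apply: cvg_norm; apply: cvgB => //; exact: cvg_cst.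
move=> hh; have -> : `|l - v k| = limn (fun n => `|v n - v k|) by apply/esym/cvg_lim.
apply: limr_le; first by apply/cvg_ex; exists `|l - v k|.
by exists k => // n /= kn; rewrite -(subnKC kn).
Qed.

Lemma homo_ltn_ge (s : nat -> nat) : {homo s : m n / (m < n)%N} ->
  forall n, (n <= s n)%N.
Proof. by move=> hs; elim=> // n IH; apply: leq_ltn_trans IH (hs _ _ _). Qed.

Lemma cvg_subseq v l (s : nat -> nat) : {homo s : m n / (m < n)%N} ->
  v n @[n --> \oo] --> l -> v (s n) @[n --> \oo] --> l.
Proof.
move=> hs /cvg_epsP h; apply/cvg_epsP => e /h[N hN]; exists N => n Nn; apply: hN.
exact: leq_trans Nn (homo_ltn_ge hs n).
Qed.

Lemma fast_subseq (c : nat -> nat -> R) (eps : nat -> R) :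
  (forall k, 0 < eps k) ->
  (forall e, 0 < e -> exists N, forall m n, (N <= m)%N -> (N <= n)%N -> c m n <= e) ->
  exists2 s : nat -> nat, {homo s : m n / (m < n)%N} &
    forall k m n, (s k <= m)%N -> (s k <= n)%N -> c m n <= eps k.
Proof.
move=> e0 h.
have /choice[N hN] k : exists N, forall m n, (N <= m)%N -> (N <= n)%N -> c m n <= eps k.
  exact: h.
pose s := fix s k := if k is k'.+1 then maxn (N k) (s k').+1 else N 0%N.
have sN k : (N k <= s k)%N by case: k => //= k; rewrite leq_maxl.
exists s; last by move=> k m n km kn; apply: (hN k); exact: leq_trans (sN _) _.
by apply: homo_ltn => [? ? ?|k]; [exact: ltn_trans|rewrite /= leq_max ltnSn orbT].
Qed.

Lemma leq_homo_ltn (s : nat -> nat) : {homo s : m n / (m < n)%N} ->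
  {homo s : m n / (m <= n)%N}.
Proof.
by move=> hs m n; rewrite leq_eqVlt => /predU1P[->//|/hs/ltnW].
Qed.

End sequences.

Section L2.
Context d (T : measurableType d) (R : realType) (mu : {measure set T -> \bar R}).
Implicit Types (u v f g : T -> R).

Lemma It_bounded_ae (f : nat -> T -> R) C : (forall n, integ mu (f n)) ->
  (forall n x, 0 <= f n x) -> (forall n m x, (n <= m)%N -> f n x <= f m x) ->
  (forall n, It mu (f n) <= C) ->
  {ae mu, forall x, exists M, forall n, f n x <= M}.
Proof.
move=> jf f0 fnd fC.
pose g x := limn (fun n => (f n x)%:E).
have ndE x : nondecreasing_seq (fun n => (f n x)%:E).
  by move=> n m nm; rewrite lee_fin fnd.
have mfE n : measurable_fun setT (fun x => (f n x)%:E).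
  by apply/measurable_EFinP; exact: integ_mf (jf n).
have mg : measurable_fun setT g.
  apply: (emeasurable_fun_cvg (fun n x => (f n x)%:E)) => // x _.
  exact: ereal_nondecreasing_is_cvgn.
have g0 x : (0 <= g x)%E.
  by apply: lime_ge; [exact: ereal_nondecreasing_is_cvgn|apply: nearW => n; rewrite lee_fin].
have ig : mu.-integrable setT g.
  apply/integrableP; split => //.
  rewrite (eq_integral _ _ (fun x _ => gee0_abs (g0 x))).
  rewrite (monotone_convergence mu measurableT mfE); last 2 first.
  - by move=> n x _; rewrite lee_fin.
  - by move=> x _; exact: ndE.
  apply: (@le_lt_trans _ _ C%:E); last by rewrite ltry.
  apply: lime_le.
    apply: ereal_nondecreasing_is_cvgn => m n mn; apply: ge0_le_integral => // x _; rewrite lee_fin //; exact: fnd.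
  by apply: nearW => n; rewrite -ItE// lee_fin.
have := integrable_ae measurableT ig.
apply: filterS => x /(_ Logic.I) gx; exists (fine (g x)) => n.
rewrite -lee_fin fineK//.
rewrite /g; apply: lime_ge; first exact: ereal_nondecreasing_is_cvgn.
by exists n => // m /= nm; exact: ndE.
Qed.

(** Riesz-Fischer. One subsequence converges almost everywhere; the whole sequence then converges in
    L^2 by Fatou's lemma applied against that subsequence. *)
Lemma L2_complete (u : nat -> T -> R) : (forall n, sqi mu (u n)) ->
  (forall e : R, 0 < e -> exists N, forall m n, (N <= m)%N -> (N <= n)%N ->
     ip mu (u m - u n) (u m - u n) <= e) ->
  exists v (s : nat -> nat), [/\ sqi mu v, {homo s : m n / (m < n)%N},
    {ae mu, forall x, u (s n) x @[n --> \oo] --> v x} &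
    ip mu (u n - v) (u n - v) @[n --> \oo] --> 0].
Proof.
move=> su uC; have B := psd_ip mu.
(* With squared gaps at most 8^-k, the sum of 4^k [D k]^2 has integral at most 2, so it is bounded
   almost everywhere and |[D k]| decays like 2^-k. *)
have e0 k : 0 < (8^-1 : R) ^+ k by rewrite exprn_gt0// invr_gt0.
have [s hs sP] := fast_subseq e0 uC.
pose D k := u (s k.+1) - u (s k).
have sD k : sqi mu (D k) by apply: (psd_domB B).
pose g K := \sum_(k < K) (4 ^+ k) *: (D k * D k).
have iD k : integ mu (4 ^+ k *: (D k * D k)) by apply: integZ; exact: sqiM.
have D0 k x : 0 <= (4 ^+ k *: (D k * D k)) x.
  by rewrite !fctE /GRing.scale/= mulr_ge0 ?exprn_ge0// -expr2 sqr_ge0.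
have gE K x : g K x = \sum_(k < K) (4 ^+ k *: (D k * D k)) x.
  by rewrite /g; elim/big_rec2: _ => // i y1 y2 _ <-.
have [] := @It_bounded_ae g 2.
- by move=> n; exact: integ_sum.
- by move=> n x; rewrite gE sumr_ge0.
- move=> n m x nm; rewrite !gE -(subnKC nm) big_split_ord/= lerDl sumr_ge0//.
- move=> n; rewrite /g It_sum//.
  apply: (@le_trans _ _ (\sum_(k < n) 2^-1 ^+ k)).
    apply: ler_sum => k _; rewrite ItZ; last exact: sqiM.
    have := sP k _ _ (leq_homo_ltn hs (leqnSn k)) (leqnn (s k)).
    rewrite -/(D k) /ip => h.
    apply: (le_trans (ler_wpM2l (exprn_ge0 _ _) h)); first by [].
    rewrite -exprMn (_ : 4 * 8^-1 = 2^-1 :> R)//; by field.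
  have : \sum_(k < n) (2^-1 : R) ^+ k = 2 - 2 * 2^-1 ^+ n.
    elim: n => [|n IH]; first by rewrite big_ord0 expr0 mulr1 subrr.
    by rewrite big_ord_recr/= IH exprS; lra.
  by move=> ->; rewrite lerBlDr lerDl mulr_ge0// ltW// half_pow_gt0.
move=> N [mN N0 subN].
have uN x : ~ N x -> exists l : R, u (s n) x @[n --> \oo] --> l.
  move=> Nx; have [M gM] : exists M, forall n, g n x <= M.
    by apply: contrapT => h; apply: Nx; apply: subN.
  have M0 : 0 <= M by apply: le_trans (gM 0%N); rewrite gE big_ord0.
  have [|l ul _] := @geom_cvg R (fun n => u (s n) x) (Num.sqrt M); last by exists l.
  move=> k; rewrite -[leRHS]ger0_norm; last first.
    by rewrite mulr_ge0 ?sqrtr_ge0// ltW// half_pow_gt0.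
  rewrite -ler_sqr ?nnegrE// !real_normK ?num_real// exprMn sqr_sqrtr//.
  have -> : ((2^-1 : R) ^+ k) ^+ 2 = (4 ^+ k)^-1.
    by rewrite -exprVn -exprM mulnC exprM; congr (_ ^+ _); field.
  rewrite ler_pdivlMr ?exprn_gt0// mulrC.
  apply: le_trans (gM k.+1); rewrite gE big_ord_recr/=.
  rewrite [leRHS]addrC !fctE /GRing.scale/= -expr2 lerDl sumr_ge0// => i _; exact: D0.
have /choice[v0 hv0] : forall x, exists l : R, ~ N x -> u (s n) x @[n --> \oo] --> l.
  move=> x; have [Nx|Nx] := pselect (N x); first by exists 0.
  by have [l ul] := uN _ Nx; exists l.
(* [v0] is chosen pointwise; cutting it off on the null set makes [v] an everywhere limit of
   measurable functions. *)
pose v := v0 * \1_(~` N).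
have vcv x : ~ N x -> u (s n) x @[n --> \oo] --> v x.
  move=> Nx; rewrite /v fctE indicE mem_set// mulr1; exact: hv0.
have mv : mf v.
  apply: (measurable_fun_cvg (h := fun n => u (s n) * \1_(~` N))).
    move=> n; apply: mfM; first by case: (su (s n)).
    by apply: mf_indic; exact: measurableC.
  move=> x _; rewrite /v; have [Nx|Nx] := pselect (N x).
    have e (w : T -> R) : (w * \1_(~` N)) x = 0.
      by rewrite /GRing.mul /= indicE memNset ?mulr0//; exact.
    by under eq_fun do rewrite e; rewrite e; exact: cvg_cst.
  by rewrite fctE; apply: cvgM; [exact: hv0|exact: cvg_cst].
have aev : {ae mu, forall x, u (s n) x @[n --> \oo] --> v x}.
  exists N; split=> // x /= h; apply: contrapT => Nx; apply: h; exact: vcv.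
have key e : 0 < e -> exists M, forall n, (M <= n)%N ->
    sqi mu (u n - v) /\ ip mu (u n - v) (u n - v) <= e.
  move=> /uC[M hM]; exists M => n Mn.
  have mun : mf (u n - v) by apply: mfB => //; case: (su n).
  have [|||||i1 i2] := @It_fatou _ _ _ mu
    (fun m => (u n - u (s (m + M)%N)) * (u n - u (s (m + M)%N)))
    ((u n - v) * (u n - v)) e.
  - by move=> m; apply: sqiM; apply: (psd_domB B).
  - by move=> m x; rewrite fctE -expr2 sqr_ge0.
  - exact: mfM.
  - move=> m; apply: hM => //; apply: leq_trans (homo_ltn_ge hs _); exact: leq_addl.
  - apply: filterS aev => x hx; rewrite !fctE.
    have : u (s (m + M)%N) x @[m --> \oo] --> v x.
      by rewrite (cvg_shiftn M (fun m => u (s m) x)).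
    by move=> h; apply: cvgM; apply: cvgB => //; exact: cvg_cst.
  have E : (fun x => `|((u n - v) * (u n - v)) x|) = (u n - v) * (u n - v).
    by apply/funext => x; rewrite fctE ger0_norm// -expr2 sqr_ge0.
  by rewrite E in i1 i2; split.
have sv : sqi mu v.
  have [M hM] := key 1 ltr01; have [s1 _] := hM _ (leqnn M).
  have -> : v = u M - (u M - v) by rewrite opprB addrC subrK.
  exact: (psd_domB B).
exists v, s; split => //.
apply/cvg_epsP => e /key[M hM]; exists M => n /hM[_ h].
by rewrite subr0 ger0_norm//; apply: (psd_ge0 B); apply: (psd_domB B).
Qed.

End L2.

(** * Lebesgue measure on R^n: translations, cubes, uniqueness *)

Section shift1.
Variable R : realType.

Definition shift1 (c : R) (x : measurableTypeR R) : measurableTypeR R := x + c.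

Lemma measurable_shift1 c : measurable_fun setT (shift1 c).
Proof. by apply: measurable_funD => //; exact: measurable_cst. Qed.

HB.instance Definition _ c :=
  isMeasurableFun.Build _ _ _ _ (shift1 c) (measurable_shift1 c).

Lemma lebesgue_measure_shift (c : R) (A : set (measurableTypeR R)) : measurable A ->
  lebesgue_measure (shift1 c @^-1` A) = lebesgue_measure A.
Proof.
move=> mA; apply/esym.
apply: (@lebesgue_measure_unique R (image_measure (shift1 c) (@lebesgue_measure R))) => //.
move=> X [[a b] _ <-] /=.
have E : shift1 c @^-1` `]a, b] = `](a - c), (b - c)]%classic.
  by apply/seteqP; split=> x /=; rewrite !in_itv/= ltrBlDr lerBrDr.
rewrite /image_measure /pushforward E.
have := @lebesgue_measure_itv R `]a, b].
have := @lebesgue_measure_itv R `]a - c, b - c].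
rewrite /= !lte_fin ltrD2r => -> ->.
by case: ifP => // _; rewrite -!EFinB; congr (_%:E); ring.
Qed.

End shift1.

Section lebesgue_rV_shift.
Variable R : realType.

Definition shiftv n (c x : 'rV[R]_n) : 'rV[R]_n := x + c.

Lemma measurable_shiftv n (c : 'rV[R]_n) : measurable_fun setT (shiftv c).
Proof.
apply: continuous_measurable_rV => y.
by apply: (@continuousD _ _ _ id (cst c)); [exact: cvg_id|exact: cst_continuous].
Qed.

HB.instance Definition _ n (c : 'rV[R]_n) :=
  isMeasurableFun.Build _ _ _ _ (shiftv c) (measurable_shiftv c).

Definition shiftp n (c0 : R) (c : 'rV[R]_n) (p : measurableTypeR R * 'rV[R]_n) :=
  (shift1 c0 p.1, shiftv c p.2).

Lemma measurable_shiftp n c0 (c : 'rV[R]_n) : measurable_fun setT (shiftp c0 c).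
Proof.
apply/measurable_fun_pairP; split.
  by apply: (measurableT_comp (measurable_shift1 c0)); exact: measurable_fst.
by apply: (measurableT_comp (measurable_shiftv c)); exact: measurable_snd.
Qed.

HB.instance Definition _ n c0 (c : 'rV[R]_n) :=
  isMeasurableFun.Build _ _ _ _ (shiftp c0 c) (measurable_shiftp c0 c).

(** Induction on the dimension: the image of the product measure under the shift agrees with it on
    measurable rectangles, which determine a product measure. *)
Lemma lebesgue_rV_shift n (c : 'rV[R]_n) (A : set 'rV[R]_n) : measurable A ->
  lebesgue_rV R n (shiftv c @^-1` A) = lebesgue_rV R n A.
Proof.
elim: n c A => [|n IH] c A mA.
  congr (lebesgue_rV R 0 _); apply/seteqP.
  have e (x : 'rV[R]_0) : x + c = x by apply/matrixP => i [].
  by split=> x /=; rewrite /shiftv e.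
rewrite /= /lebesgue_cons /image_measure /pushforward.
set P := (_ \x _)%E.
pose c0 := c ord0 ord0; pose c' : 'rV[R]_n := \row_j c ord0 (lift ord0 j).
have mcA : measurable (@cons_rV R n @^-1` A).
  by rewrite -[X in measurable X]setTI; exact: measurable_cons_rV.
have E : @cons_rV R n @^-1` (shiftv c @^-1` A) = shiftp c0 c' @^-1` (@cons_rV R n @^-1` A).
  apply/seteqP; split=> -[t v] /=; rewrite /shiftv /shiftp/= => h;
    (suff <- : cons_rV (t, v) + c = cons_rV (shift1 c0 t, shiftv c' v) by []) ||
    (suff -> : cons_rV (t, v) + c = cons_rV (shift1 c0 t, shiftv c' v) by []);
  apply/rowP => i; rewrite !mxE; case: unliftP => [j ->|->] /=; rewrite ?mxE//.
rewrite E; apply/esym.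
apply: (@product_measure_unique _ _ _ _ _ (@lebesgue_measure R) (lebesgue_rV R n)
  (image_measure (shiftp c0 c') P) _ _ mcA) => B D mB mD.
transitivity (lebesgue_measure (shift1 c0 @^-1` B) *
  lebesgue_rV R n (shiftv c' @^-1` D))%E; last by rewrite lebesgue_measure_shift ?IH.
apply: (@product_measure1E _ _ _ _ _ lebesgue_measure (lebesgue_rV R n)
  (shift1 c0 @^-1` B) (shiftv c' @^-1` D)).
- by rewrite -[X in measurable X]setTI; exact: measurable_shift1.
- by rewrite -[X in measurable X]setTI; exact: measurable_shiftv.
Qed.

(** Half-open, so that the cubes of a grid are disjoint. *)
Definition cube n (a : 'rV[R]_n) (r : R) : set 'rV[R]_n :=
  [set x | forall i, a ord0 i <= x ord0 i < a ord0 i + r].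

Lemma measurable_coord n (i : 'I_n) : measurable_fun setT (fun x : 'rV[R]_n => x ord0 i).
Proof. by apply: continuous_measurable_rVR => v; exact: coord_continuous. Qed.

Lemma measurable_cube n (a : 'rV[R]_n) r : measurable (cube a r).
Proof.
have -> : cube a r = \bigcap_(i in [set: 'I_n])
    [set x : 'rV[R]_n | a ord0 i <= x ord0 i < a ord0 i + r].
  by apply/seteqP; split=> x h i; [move=> _; exact: h|exact: h].
apply: fin_bigcap_measurable => [|i _]; first exact: finite_finset.
rewrite (_ : [set x | _] = [set x : 'rV[R]_n | a ord0 i <= x ord0 i] `&`
  [set x : 'rV[R]_n | x ord0 i < a ord0 i + r]).
  by apply: measurableI; [apply: mset_le|apply: mset_lt] => //; exact: measurable_coord.
by apply/seteqP; split=> x /=; [move=> /andP[]|move=> [-> ->]].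
Qed.

Lemma lebesgue_cube n (a : 'rV[R]_n) r : 0 <= r ->
  lebesgue_rV R n (cube a r) = (r ^+ n)%:E.
Proof.
move=> r0; elim: n a => [|n IH] a.
  rewrite /= diracE mem_set// => i; by case: i.
have mC := measurable_cube a r.
rewrite /= /lebesgue_cons /image_measure /pushforward.
pose a' : 'rV[R]_n := \row_j a ord0 (lift ord0 j).
have -> : @cons_rV R n @^-1` (cube a r) = `[a ord0 ord0, a ord0 ord0 + r[%classic `*` cube a' r.
  apply/seteqP; split=> -[t v] /=.
    move=> h; split.
      by have := h ord0; rewrite mxE unlift_none in_itv.
    by move=> j; have := h (lift ord0 j); rewrite !mxE liftK.
  rewrite in_itv/= => -[h1 h2] i; rewrite !mxE; case: unliftP => [j ->|->] //=.
  by have := h2 j; rewrite !mxE.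
transitivity (lebesgue_measure (`[a ord0 ord0, (a ord0 ord0 + r)%R[%classic : set (measurableTypeR R)) *
     lebesgue_rV R n (cube a' r))%E.
  by apply: product_measure1E; [exact: measurable_itv|exact: measurable_cube].
have := @lebesgue_measure_itv R `[a ord0 ord0, a ord0 ord0 + r[.
rewrite /= lte_fin ltrDl => ->.
rewrite exprS EFinM -(IH a').
case: ifPn => [_|]; first by rewrite -EFinB (_ : _ - _ = r)//; ring.
by rewrite -leNgt => r0'; have -> : r = 0 by apply/eqP; rewrite eq_le r0' r0.
Qed.

Definition orect n (a b : 'rV[R]_n) : set 'rV[R]_n :=
  [set x | forall i, a ord0 i < x ord0 i < b ord0 i].

Lemma open_orect n (a b : 'rV[R]_n) : open (orect a b).
Proof.
rewrite openE => x /= hx; 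
apply: (@filter_forall _ _ (fun i (y : 'rV[R]_n) => a ord0 i < y ord0 i < b ord0 i) (nbhs x)) => i.
have ci : (fun x : 'rV[R]_n => x ord0 i) @ x --> x ord0 i by exact: coord_continuous.
have /andP[h1 h2] := hx i.
near=> y; apply/andP; split; near: y.
  exact: (cvgr_gt _ ci).
exact: (cvgr_lt _ ci).
Unshelve. all: by end_near. Qed.

(** Rectangles with rational corners form a countable base, and rectangles are stable under
    intersection: they are the pi-system behind [measure_rV_unique]. *)
Lemma rect_sigma n : <<s [set orect p.1 p.2 | p in [set: 'rV[R]_n * 'rV[R]_n]] >> =
  @borel_rV R n.
Proof.
apply/seteqP; split; apply: smallest_sub; try exact: smallest_sigma_algebra.
  by move=> _ [[a b] _ <-]; apply: sub_sigma_algebra; exact: open_orect.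
move=> U /= oU.
pose B (i : 'rV[rat]_n * 'rV[rat]_n) : set 'rV[R]_n :=
  orect (map_mx ratr i.1) (map_mx ratr i.2).
pose J := [set i | B i `<=` U].
have sG : sigma_algebra setT <<s [set orect p.1 p.2 | p in [set: 'rV[R]_n * 'rV[R]_n]] >>.
  exact: smallest_sigma_algebra.
suff -> : U = \bigcup_(i in J) B i.
  rewrite bigcup_mkcond.
  apply: (@countable_bigcupT_measurable _ (g_sigma_algebraType
     [set orect p.1 p.2 | p in [set: 'rV[R]_n * 'rV[R]_n]])) => // i.
  case: ifP => _; last exact: sigma_algebra0.
  by apply: sub_sigma_algebra; exists (map_mx ratr i.1, map_mx ratr i.2).
rewrite eqEsubset; split; last by move=> p [i Ji Bi]; exact: Ji.
move=> v Uv; have /nbhs_ballP[e /= e0 eU] : nbhs v U by exact: open_nbhs_nbhs.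
have ratapprox (x y : R) : x < y -> exists q : rat, x < ratr q < y.
  by move=> /rat_in_itvoo[q]; rewrite in_itv/=; exists q.
have /choice[f hf] (j : 'I_n) : exists q : rat, v ord0 j - e < ratr q < v ord0 j.
  by apply: ratapprox; rewrite ltrBlDr ltrDl.
have /choice[g hg] (j : 'I_n) : exists q : rat, v ord0 j < ratr q < v ord0 j + e.
  by apply: ratapprox; rewrite ltrDl.
exists (\row_j f j, \row_j g j); last first.
  by move=> j; rewrite !mxE; have /andP[_ ->] := hf j; have /andP[-> _] := hg j.
move=> w hw; apply: eU; split=> // i j; rewrite !ord1 /ball/= ltr_distlC.
have := hw j; rewrite !mxE => /andP[h1 h2].
have /andP[h3 _] := hf j; have /andP[_ h4] := hg j.
by rewrite (lt_trans h3 h1) (lt_trans h2 h4).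
Qed.

Lemma orect_setI n (a b a' b' : 'rV[R]_n) : orect a b `&` orect a' b' =
  orect (\row_i Num.max (a ord0 i) (a' ord0 i)) (\row_i Num.min (b ord0 i) (b' ord0 i)).
Proof.
apply/seteqP; split=> x /=.
  by move=> [h1 h2] i; rewrite !mxE gt_max lt_min; have /andP[-> ->] := h1 i; have /andP[-> ->] := h2 i.
move=> h; split=> i; have := h i; rewrite !mxE gt_max lt_min => /andP[/andP[h1 h2] /andP[h3 h4]];
  exact/andP.
Qed.

Lemma measure_rV_unique n (m1 m2 : {measure set 'rV[R]_n -> \bar R}) :
  (forall a b, m1 (orect a b) = m2 (orect a b)) ->
  (forall a b, (m1 (orect a b) < +oo)%E) ->
  forall A, measurable A -> m1 A = m2 A.
Proof.
move=> E F A mA.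
apply: (@g_sigma_algebra_measure_unique _ _ _ [set orect p.1 p.2 | p in [set: 'rV[R]_n * 'rV[R]_n]]
   _ (fun k => orect (const_mx (- k%:R)) (const_mx k%:R))).
- by move=> _ [p _ <-]; apply: open_measurable_rV; exact: open_orect.
- by move=> k; exists (const_mx (- k%:R), const_mx k%:R).
- apply/seteqP; split=> // x _.
  exists (\sum_i (Num.trunc `|x ord0 i|).+1)%N => // i; rewrite !mxE -ltr_norml.
  rewrite (bigD1 i)//= natrD ltr_wpDr//; exact: truncnS_gt.
- by move=> _ _ [p _ <-] [q _ <-]; rewrite orect_setI; eexists (_, _).
- by move=> _ [p _ <-].
- by move=> k.
- by rewrite rect_sigma.
Qed.

End lebesgue_rV_shift.

(** * Measures with a density *)

Section dens.
Context d (T : measurableType d) (R : realType) (mu : {measure set T -> \bar R}).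
Variables (f : T -> R).
Hypotheses (f0 : forall x, 0 <= f x) (mf_ : measurable_fun setT f).
Local Open Scope ereal_scope.

Definition dens (A : set T) : \bar R := \int[mu]_(x in A) (f x)%:E.

Lemma dens0 : dens set0 = 0.
Proof. by rewrite /dens integral_set0. Qed.

Lemma dens_ge0 A : 0 <= dens A.
Proof. by apply: integral_ge0 => x _; rewrite lee_fin. Qed.

Let mEf : measurable_fun setT (EFin \o f).
Proof. exact/measurable_EFinP. Qed.

Lemma dens_semi : semi_sigma_additive dens.
Proof.
move=> F mF tF mUF; rewrite /dens ge0_integral_bigcup//; last 2 first.
- exact: measurable_funS mEf.
- by move=> x _; rewrite lee_fin.
by apply: is_cvg_ereal_nneg_natsum_cond => n _ _; exact: dens_ge0.
Qed.

Definition dens_measure : {measure set T -> \bar R} :=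
  HB.pack dens (isMeasure.Build _ _ _ dens dens0 dens_ge0 dens_semi).

Import HBNNSimple.

Lemma integral_dens (g : T -> \bar R) : (forall x, 0 <= g x) -> measurable_fun setT g ->
  \int[dens_measure]_x g x = \int[mu]_x (g x * (f x)%:E).
Proof.
move=> g0 mg; pose h := nnsfun_approx measurableT mg.
have -> : \int[dens_measure]_x g x = lim (\int[dens_measure]_x (h n x)%:E @[n --> \oo]).
  have fE x : g x = lim ((h n x)%:E @[n --> \oo]).
    by apply/esym/cvg_lim => //; exact: cvg_nnsfun_approx.
  under eq_integral => x _ do rewrite fE.
  apply: monotone_convergence => //.
  - by move=> n; apply/measurable_EFinP.
  - by move=> n x _ //=; rewrite lee_fin.
  - by move=> x _ a b ab; rewrite lee_fin; exact/lefP/nd_nnsfun_approx.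
have -> : \int[mu]_x (g x * (f x)%:E) = lim (\int[mu]_x ((h n x)%:E * (f x)%:E) @[n --> \oo]).
  have fg x : g x * (f x)%:E = lim ((h n x)%:E * (f x)%:E @[n --> \oo]).
    by apply/esym/cvg_lim => //; apply: cvgeZr => //; exact: cvg_nnsfun_approx.
  under eq_integral => x _ do rewrite fg.
  apply: monotone_convergence => [//| | |].
  - by move=> n; apply/emeasurable_funM => //; exact/measurable_EFinP.
  - by move=> n x Ex /=; rewrite mule_ge0 ?lee_fin ?f0.
  - by move=> x Ex a b ab/=; rewrite lee_wpmul2r ?lee_fin ?f0//; exact/lefP/nd_nnsfun_approx.
suff suf n : \int[mu]_x ((h n x)%:E * (f x)%:E) = \int[dens_measure]_x (h n x)%:E.
  by under [in RHS]eq_fun do rewrite suf.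
transitivity (\int[dens_measure]_x
   (\sum_(y \in range (h n)) (y * \1_(h n @^-1` [set y]) x)%:E)); last first.
  by apply: eq_integral => t tE; rewrite /= fimfunE -fsumEFin.
have indich r : measurable_fun setT (fun x => (r * \1_(h n @^-1` [set r]) x)%:E).
  by apply/measurable_EFinP; exact: measurable_funM.
rewrite ge0_integral_fsum//; last by move=> m y _; exact: nnfun_muleindic_ge0.
transitivity (\int[mu]_x (\sum_(y \in range (h n))
    (y * \1_(h n @^-1` [set y]) x)%:E * (f x)%:E)).
  apply: eq_integral => x _.
  rewrite -ge0_mule_fsuml => [|y]; last exact: nnfun_muleindic_ge0.
  by rewrite fsumEFin // -(fimfunE _ x).
rewrite ge0_integral_fsum//; last 2 first.
  - by move=> y; apply: emeasurable_funM => //; apply: measurable_funTS.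
  - by move=> m y _; rewrite mule_ge0 ?lee_fin ?f0// -lee_fin nnfun_muleindic_ge0.
apply: eq_fsbigr => r rhn.
have r0 : (0 <= r)%R by move: rhn; rewrite inE => -[t _ <-].
under [RHS]eq_integral do rewrite EFinM.
rewrite integralZl_indic_nnsfun => //.
under eq_integral do rewrite EFinM -muleA.
rewrite ge0_integralZl//.
- congr (_ * _); rewrite integral_indic// setIT.
  rewrite -[RHS]/(\int[mu]_(x in h n @^-1` [set r]) (f x)%:E) [RHS]integral_mkcond.
  by apply: eq_integral => x _; rewrite muleC epatch_indic.
- by apply: emeasurable_funM => //; exact/measurable_EFinP.
- by move=> t _; rewrite mule_ge0 ?lee_fin ?f0.
Qed.

End dens.

(** * Smooth bump functions *)

Section smooth1.
Variable R : realType.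
Implicit Types (t x : R) (f g : R -> R).

(** t^-n exp(-1/t), continued by 0. The power n is carried along because the span of these functions
    is closed under differentiation ([is_derive_psi]). *)
Definition psi n t : R := if 0 < t then t^-1 ^+ n * expR (- t^-1) else 0.

Lemma psi_ge0 n t : 0 <= psi n t.
Proof.
by rewrite /psi; case: ifPn => // t0; rewrite mulr_ge0 ?expR_ge0// exprn_ge0// invr_ge0 ltW.
Qed.

(** The term of degree n + 1 in the exponential series of 1/t beats t^-n. Applied to [n.+1], the
    linear bound makes the difference quotient of [psi n] at 0 tend to 0. *)
Lemma psi_le n t : 0 <= t -> psi n t <= (n.+1)`!%:R * t.
Proof.
move=> t0; rewrite /psi; case: ifPn => [tp|_]; last by rewrite mulr_ge0.
have y0 : 0 <= t^-1 by rewrite invr_ge0.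
have := expR_ge1Dxn n y0; rewrite expRN => h.
rewrite ler_pdivrMr ?expR_gt0// -mulrA -ler_pdivrMl ?ltr0n ?fact_gt0//.
rewrite mulrC.
have : t^-1 ^+ n.+1 / (n.+1)`!%:R <= expR t^-1 by apply: le_trans h; rewrite lerDr.
move=> /(ler_wpM2l (ltW tp)); rewrite exprS !mulrA mulfV ?gt_eqF// mul1r.
by rewrite mulrC.
Qed.

Lemma is_derive_psi n t : is_derive t 1 (psi n) (psi n.+2 t - n%:R * psi n.+1 t).
Proof.
have [t0|t0|->] := ltgtP t 0.
- rewrite /psi !ltNge (ltW t0) /= mulr0 subrr.
  apply: (@near_eq_is_derive _ _ _ (cst 0)) => //.
    by near=> z; rewrite ltNge ltW//; near: z; exact: lt_nbhsl.
- have tn : t != 0 by rewrite gt_eqF.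
  pose F z : R := z^-1 ^+ n * expR (- z^-1).
  apply: (@near_eq_is_derive _ _ _ F) => //.
    by near=> z; rewrite /psi ifT//; near: z; exact: lt_nbhsr.
  have d1 : is_derive t 1 (fun z : R => z^-1) (- t ^- 2).
    by have := @is_deriveV R id t 1 1 tn (is_derive_id _ _); rewrite /= /GRing.scale/= mulr1.
  have d2 : is_derive t 1 (fun z : R => expR (- z^-1)) (expR (- t^-1) * (t ^- 2)).
    apply: (@is_derive1_comp _ expR (fun z => - z^-1)).
    have := is_deriveN d1; by rewrite opprK.
  have d3 : is_derive t 1 (fun z : R => z^-1 ^+ n) (n%:R * t^-1 ^+ n.-1 * (- t ^- 2)).
    elim: (n) => [|m IH] /=.
      have := is_derive_cst (1 : R) t (1 : R); rewrite !mul0r.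
      by under [in X in _ -> X]eq_fun do rewrite expr0.
    have -> : (fun z : R => z^-1 ^+ m.+1) = (fun z => z^-1) * (fun z => z^-1 ^+ m).
      by apply/funext => z; rewrite exprS.
    refine (is_derive_eq (is_deriveM d1 IH) _); rewrite /GRing.scale/=.
    by case: (m) => [|m'] /=; rewrite ?exprS -?natr1 ?expr0; ring.
  refine (is_derive_eq (is_deriveM d3 d2) _); rewrite /psi t0 /GRing.scale/= -!exprVn.
  case: n {F d3} => [|n] /=; rewrite ?exprS ?expr0; ring.
- rewrite {2 3}/psi ltxx mulr0 subrr.
  suff H : h^-1 *: (psi n (h *: 1 + 0) - psi n 0) @[h --> 0^'] --> (0 : R).
    by apply: DeriveDef; [apply/cvg_ex; exists 0|apply/cvg_lim].
  apply/cvgrPdist_le => e e0.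
  have C0 : 0 < (n.+2)`!%:R :> R by rewrite ltr0n fact_gt0.
  near=> h; rewrite sub0r normrN {2}/psi ltxx subr0 addr0 /GRing.scale/= mulr1.
  have hn : h != 0 by near: h; exact: nbhs_dnbhs_neq.
  rewrite {1}/psi; case: ifPn => [h0|_]; last by rewrite mulr0 normr0 ltW.
  have -> : h^-1 * (h^-1 ^+ n * expR (- h^-1)) = psi n.+1 h by rewrite /psi h0 exprS mulrA.
  rewrite ger0_norm ?psi_ge0//; apply: (le_trans (psi_le _ (ltW h0))).
  rewrite -ler_pdivlMl//; apply: le_trans (ler_norm _) _.
  near: h; apply: dnbhs0_le; by rewrite mulr_gt0 ?invr_gt0.
Unshelve. all: by end_near. Qed.

(** A syntactic class closed under derivation, so that regularity of every order follows by
    induction without estimates. *)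
Inductive smooth1 : (R -> R) -> Prop :=
| smooth1_psi n a c : smooth1 (fun t => psi n (a * t + c))
| smooth1D f g : smooth1 f -> smooth1 g -> smooth1 (fun t => f t + g t)
| smooth1M f g : smooth1 f -> smooth1 g -> smooth1 (fun t => f t * g t)
| smooth1Z a f : smooth1 f -> smooth1 (fun t => a * f t).

Lemma smooth1_derive f : smooth1 f ->
  exists2 f', smooth1 f' & forall t, is_derive t 1 f (f' t).
Proof.
elim=> {f} [n a c|f g sf [f' sf' df] sg [g' sg' dg]|f g sf [f' sf' df] sg [g' sg' dg]|
  a f sf [f' sf' df]].
- exists (fun t => a * (psi n.+2 (a * t + c) + (- n%:R) * psi n.+1 (a * t + c))).
    apply: smooth1Z; apply: smooth1D; first exact: smooth1_psi.
    by apply: smooth1Z; exact: smooth1_psi.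
  move=> t; have d1 : is_derive t 1 (fun t => a * t + c) a.
    have := is_deriveD (is_deriveZ a (is_derive_id t 1)) (is_derive_cst c t (1 : R)).
    by rewrite addr0 /GRing.scale/= mulr1.
  refine (is_derive_eq (@is_derive1_comp _ (psi n) (fun t => a * t + c) t _ _ (is_derive_psi n _) d1) _).
  by ring.
- by exists (fun t => f' t + g' t); [exact: smooth1D|move=> t; exact: is_deriveD].
- exists (fun t => f t * g' t + g t * f' t).
    by apply: smooth1D; exact: smooth1M.
  by move=> t; exact: is_deriveM.
- exists (fun t => a * f' t); first exact: smooth1Z.
  by move=> t; exact: is_deriveZ.
Qed.

Lemma smooth1_continuous f : smooth1 f -> continuous f.
Proof.
move=> /smooth1_derive[f' _ df] t; apply: differentiable_continuous.
by apply/derivable1_diffP; exact: ex_derive.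
Qed.

Definition bump1 (a b : R) t := psi 0 (1 * t + - a) * psi 0 ((-1) * t + b).

(** The recursion is that of 1 - (1 - b)^k for b = [bump1 a b] ([bumpkE]): smooth for each k, and
    tending to the indicator of the open interval. The base case 0 is written as a multiple of
    [bump1] so as to lie in [smooth1]. *)
Fixpoint bumpk (a b : R) k : R -> R :=
  if k is k'.+1 then fun t => bumpk a b k' t + (bump1 a b t + (-1) * (bump1 a b t * bumpk a b k' t))
  else fun t => 0 * bump1 a b t.

Lemma smooth1_bumpk a b k : smooth1 (bumpk a b k).
Proof.
have s : smooth1 (bump1 a b) by apply: smooth1M; exact: smooth1_psi.
elim: k => [|k IH]; first exact: smooth1Z.
by apply: smooth1D => //; apply: smooth1D => //; apply: smooth1Z; exact: smooth1M.
Qed.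

Lemma psi0_lt1 t : psi 0 t < 1.
Proof.
rewrite /psi; case: ifPn => // t0; rewrite expr0 mul1r expR_lt1 oppr_lt0.
by rewrite invr_gt0.
Qed.

Lemma bump1_01 a b t : 0 <= bump1 a b t < 1.
Proof.
rewrite /bump1 mulr_ge0 ?psi_ge0//=.
by apply: (le_lt_trans (ler_wpM2l (psi_ge0 _ _) (ltW (psi0_lt1 _)))); rewrite mulr1 psi0_lt1.
Qed.

Lemma bump1_gt0 a b t : (0 < bump1 a b t) = (a < t < b).
Proof.
rewrite /bump1 /psi mul1r mulN1r subr_gt0 [- t + b]addrC subr_gt0.
case: (ltP a t) => h1 /=; last by rewrite mul0r ltxx.
case: (ltP t b) => h2 /=; last by rewrite mulr0 ltxx.
by rewrite !expr0 !mul1r mulr_gt0// expR_gt0.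
Qed.

Lemma bumpkE a b k t : bumpk a b k t = 1 - (1 - bump1 a b t) ^+ k.
Proof.
elim: k => [|k IH] /=; first by rewrite mul0r expr0 subrr.
by rewrite IH exprS; ring.
Qed.

Lemma bumpk_01 a b k t : 0 <= bumpk a b k t <= 1.
Proof.
have /andP[b0 b1] := bump1_01 a b t.
rewrite bumpkE subr_ge0 exprn_ile1 ?subr_ge0 ?(ltW b1)//= ?lerBlDr ?lerDl//.
by rewrite exprn_ge0// subr_ge0 ltW.
Qed.

Lemma bumpk_out a b k t : ~~ (a < t < b) -> bumpk a b k t = 0.
Proof.
rewrite -bump1_gt0 -leNgt => h; have /andP[b0 _] := bump1_01 a b t.
by rewrite bumpkE (_ : bump1 a b t = 0) ?subr0 ?expr1n ?subrr//; apply/eqP; rewrite eq_le h.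
Qed.

Lemma bumpk_cvg a b t : a < t < b -> bumpk a b k t @[k --> \oo] --> (1 : R).
Proof.
rewrite -bump1_gt0 => h; have /andP[b0 b1] := bump1_01 a b t.
have -> : (fun k => bumpk a b k t) = (fun k => 1 - (1 - bump1 a b t) ^+ k).
  by apply/funext => k; exact: bumpkE.
suff H : (fun k => (1 - bump1 a b t) ^+ k) @ \oo --> (0 : R).
  by have := cvgB (cvg_cst (1 : R)) H; rewrite subr0; exact.
apply: cvg_expr; rewrite ger0_norm ?subr_ge0 ?(ltW b1)//.
by rewrite ltrBlDr ltrDl.
Qed.

End smooth1.

Section testfun.
Variables (R : realType) (n : nat).
Local Notation E := 'rV[R]_n.

Definition prodfun (F : 'I_n -> R -> R) (x : E) : R := \prod_i F i (x ord0 i).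

Lemma prodfun_derive (F : 'I_n -> R -> R) (i : 'I_n) (f' : R) (x : E) : is_derive (x ord0 i) 1 (F i) f' ->
  is_derive x (delta_mx ord0 i : E) (prodfun F)
    ((\prod_(j | j != i) F j (x ord0 j)) * f').
Proof.
move=> dF; set C := \prod_(j | _) _.
have E1 h : prodfun F (h *: (delta_mx ord0 i : E) + x) = F i (h *: 1 + x ord0 i) * C.
  rewrite /prodfun (bigD1 i)//= !mxE !eqxx mulr1 /GRing.scale/= mulr1; congr (_ * _).
  by apply: eq_bigr => j ji; rewrite !mxE (negbTE ji) andbF mulr0 add0r.
have E0 : prodfun F x = F i (x ord0 i) * C by rewrite /prodfun (bigD1 i).
have H : h^-1 *: (prodfun F (h *: (delta_mx ord0 i : E) + x) - prodfun F x) @[h --> 0^'] --> C * f'.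
  under eq_fun do rewrite E1 E0 -mulrBl /GRing.scale/= mulrA.
  rewrite [C * _]mulrC; apply: cvgM; last exact: cvg_cst.
  have [d1 d2] := dF; rewrite -d2.
  exact: d1.
by apply: DeriveDef; [apply/cvg_ex; exists (C * f')|apply/cvg_lim].
Qed.

Lemma prodfun_continuous F : (forall i, smooth1 (F i)) -> continuous (prodfun F).
Proof.
move=> sF; rewrite /prodfun; elim: (index_enum _) => [|i r IH] x.
  rewrite (_ : (fun x : E => _) = cst 1); first exact: cst_continuous.
  by apply/funext => y; rewrite big_nil.
rewrite (_ : (fun x : E => _) =
    (fun y : E => F i (y ord0 i) * \prod_(j <- r) F j (y ord0 j))); last first.
  by apply/funext => y; rewrite big_cons.
have ci : continuous (fun y : E => F i (y ord0 i)).
  move=> y; apply: (@continuous_comp _ _ _ (fun x : E => x ord0 i) (F i)).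
    exact: coord_continuous.
  exact: smooth1_continuous.
by apply: continuousM; [exact: ci|exact: IH].
Qed.

Lemma Ck_prodfun k F : (forall i, smooth1 (F i)) -> Ck k (prodfun F).
Proof.
elim: k F => [|k IH] F sF; split=> //; try exact: prodfun_continuous.
have /choice[F' hF'] i : exists f' : R -> R, smooth1 f' /\ forall t : R, is_derive t 1 (F i) (f' t).
  by have [f' ? ?] := smooth1_derive (sF i); exists f'.
move=> i; split.
  by move=> x; have := prodfun_derive ((hF' i).2 (x ord0 i)); case.
have -> : partial i (prodfun F) = prodfun (fun j => if j == i then F' i else F j).
  apply/funext => x; have [_ d] := prodfun_derive ((hF' i).2 (x ord0 i)).
  rewrite /partial d /prodfun [in RHS](bigD1 i)//= eqxx mulrC; congr (_ * _).
  by apply: eq_bigr => j /negbTE ->.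
by apply: IH => j; case: ifP => _ //; exact: (hF' i).1.
Qed.

Lemma CkD k u v : Ck k (u : E -> R) -> Ck k v -> Ck k (u + v).
Proof.
elim: k u v => [|k IH] u v /= [cu Hu] [cv Hv]; (split; first by move=> x; exact: cvgD (cu x) (cv x)) => //.
move=> i; have [du Cu] := Hu i; have [dv Cv] := Hv i; split.
  by move=> x; exact: derivableD.
have -> : partial i (u + v) = partial i u + partial i v; last exact: IH.
by apply/funext => x; rewrite /partial deriveD.
Qed.

Lemma CkZ k a u : Ck k (u : E -> R) -> Ck k (a *: u).
Proof.
elim: k u => [|k IH] u /= [cu Hu]; (split; first by move=> x; exact: (cvgZl_tmp (cu x))) => //.
move=> i; have [du Cu] := Hu i; split.
  by move=> x; exact: derivableZ.
have -> : partial i (a *: u) = a *: partial i u; last exact: IH.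
by apply/funext => x; rewrite /partial deriveZ.
Qed.

Lemma compact_supp (u : E -> R) (A : set E) : bounded_set A ->
  (forall x, u x != 0 -> A x) -> compact (closure [set x | u x != 0]).
Proof.
move=> [M [Mr bM]] uA; apply: bounded_closed_compact; last exact: closed_closure.
exists (M + 1); split; first by rewrite num_real.
move=> M' MM' x xu.
have cl : closed [set y : E | `|y| <= M + 1].
  apply: (@closed_comp _ _ (fun y : E => `|y|) [set t | t <= M + 1]).
    by move=> y _; exact: norm_continuous.
  exact: closed_le.
suff : [set y : E | `|y| <= M + 1] x by move=> h; exact: le_trans h (ltW MM').
rewrite ((closure_id _).1 cl); apply: closureS xu => y /uA /bM; apply.
by rewrite ltrDl.
Qed.

Lemma test_functionD u v : @test_function R n u -> test_function v -> test_function (u + v).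
Proof.
move=> [Cu cu] [Cv cv]; split; first by move=> k; exact: CkD.
have bb (w : E -> R) : compact (closure [set x | w x != 0]) -> bounded_set [set x | w x != 0].
  by move=> /compact_bounded[M [Mr h]]; exists M; split=> // y /h hy x /subset_closure/hy.
apply: (@compact_supp _ ([set x | u x != 0] `|` [set x | v x != 0])).
  have [M1 [r1 h1]] := bb _ cu; have [M2 [r2 h2]] := bb _ cv.
  exists (Num.max M1 M2); split; first by rewrite num_real.
  by move=> M; rewrite gt_max => /andP[m1 m2] x [hx|hx]; [exact: h1 hx|exact: h2 hx].
move=> x /=; rewrite fctE => h; have [u0|] := eqVneq (u x) 0; last by left.
by right; rewrite u0 add0r in h.
Qed.

Lemma test_functionZ a u : @test_function R n u -> test_function (a *: u).
Proof.
move=> [Cu cu]; split; first by move=> k; exact: CkZ.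
apply: (@compact_supp _ [set x | u x != 0]).
  by have /compact_bounded[M [Mr h]] := cu; exists M; split=> // y /h hy x /subset_closure/hy.
by move=> x /=; rewrite fctE /GRing.scale/= mulf_eq0 negb_or => /andP[].
Qed.

Definition tbump (a b : E) k : E -> R := prodfun (fun i => bumpk (a ord0 i) (b ord0 i) k).

Lemma tbump_01 a b k x : 0 <= tbump a b k x <= 1.
Proof.
apply/andP; split; first by apply: prodr_ge0 => i _; have /andP[] := bumpk_01 (a ord0 i) (b ord0 i) k (x ord0 i).
by apply: prodr_ile1 => i *; exact: bumpk_01.
Qed.

Lemma tbump_out a b k x : ~ orect a b x -> tbump a b k x = 0.
Proof.
move=> /existsNP[i /negP h]; rewrite /tbump /prodfun (bigD1 i)//= bumpk_out ?mul0r//.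
Qed.

Lemma tbump_cvg a b x : orect a b x -> tbump a b k x @[k --> \oo] --> (1 : R).
Proof.
move=> h; rewrite /tbump /prodfun; elim: (index_enum _) => [|i r IH].
  by under eq_fun do rewrite big_nil; exact: cvg_cst.
rewrite (_ : (fun k => _) = (fun k => bumpk (a ord0 i) (b ord0 i) k (x ord0 i) *
    \prod_(j <- r) bumpk (a ord0 j) (b ord0 j) k (x ord0 j))); last first.
  by apply/funext => k; rewrite big_cons.
suff : bumpk (a ord0 i) (b ord0 i) k (x ord0 i) *
    \prod_(j <- r) bumpk (a ord0 j) (b ord0 j) k (x ord0 j) @[k --> \oo] --> (1 * 1 : R).
  by rewrite mulr1.
by apply: cvgM => //; exact: bumpk_cvg.
Qed.

Lemma bounded_orect (a b : E) : bounded_set (orect a b).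
Proof.
exists (`|a| + `|b|); split; first by rewrite num_real.
move=> M h x hx; apply: le_trans (ltW h).
rewrite [leLHS]mx_normrE; apply: bigmax_le => [|[i j] _]; first by rewrite addr_ge0.
rewrite !ord1 /= ; have /andP[h1 h2] := hx j.
have ca : `|a ord0 j| <= `|a|.
  by rewrite [leRHS]mx_normrE; apply: (le_bigmax _ (fun p : 'I_1 * 'I_n => `|a p.1 p.2|) (ord0, j)).
have cb : `|b ord0 j| <= `|b|.
  by rewrite [leRHS]mx_normrE; apply: (le_bigmax _ (fun p : 'I_1 * 'I_n => `|b p.1 p.2|) (ord0, j)).
move: ca cb; rewrite !ler_norml => /andP[a1 a2] /andP[b1 b2].
apply/andP; split; lra.
Qed.

Lemma test_tbump a b k : test_function (tbump a b k).
Proof.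
split; first by move=> k'; apply: Ck_prodfun => i; exact: smooth1_bumpk.
apply: (@compact_supp _ (orect a b)); first exact: bounded_orect.
by move=> x; apply: contra_neqP => h; rewrite tbump_out.
Qed.

End testfun.

(** * Translations and test functions in L^2 *)

Section L2_rV.
Variables (R : realType) (n : nat).
Local Notation E := 'rV[R]_n.
Local Notation leb := (lebesgue_rV R n).
Implicit Types (u v g phi : E -> R) (a b c x : E) (i : 'I_n).

Definition sh c u : E -> R := fun x => u (x + c).

Lemma mf_sh c u : mf u -> mf (sh c u).
Proof. by move=> mu; exact: measurableT_comp mu (measurable_shiftv c). Qed.

Lemma mset_sh c (A : set E) : measurable A -> measurable [set x | A (x + c)].
Proof.
move=> mA; rewrite -[X in measurable X]setTI; exact: measurable_shiftv.
Qed.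

Lemma ge0_integral_sh c (f : E -> \bar R) : measurable_fun setT f ->
  (forall x, 0 <= f x)%E -> (\int[leb]_x f (x + c)%R = \int[leb]_x f x)%E.
Proof.
move=> mf0 f0.
have := @ge0_integral_pushforward _ _ _ _ R (shiftv c) (measurable_shiftv c) leb setT f measurableT mf0.
move=> /(_ (fun y _ => f0 y)); rewrite preimage_setT => <-.
apply: eq_measure_integral => A mA _; exact: lebesgue_rV_shift.
Qed.

Lemma It_sh_ge0 c u : mf u -> (forall x, 0 <= u x) -> It leb (sh c u) = It leb u.
Proof.
move=> mu u0; rewrite !unlock /sh (ge0_integral_sh c (f := EFin \o u))//.
exact/measurable_EFinP.
Qed.

Lemma integ_sh c u : integ leb u -> integ leb (sh c u).
Proof.
move=> iu; have mu := integ_mf iu.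
apply/integrableP; split; first by apply/measurable_EFinP; apply: mf_sh.
have := ge0_integral_sh c (f := fun x => (`|u x|)%:E).
move=> ->.
- by move/integrableP: iu => [].
- by apply/measurable_EFinP; exact: mf_norm.
- by move=> x; rewrite lee_fin.
Qed.

Lemma It_sh c u : integ leb u -> It leb (sh c u) = It leb u.
Proof.
move=> iu; have ia := integ_abs iu; have [mu ma] := (integ_mf iu, integ_mf ia).
pose w x := `|u x|; have E1 : u = (w + u) - w by rewrite addrC addKr.
have iwu := integD ia iu.
rewrite E1 (_ : sh c _ = sh c (w + u) - sh c w)//.
rewrite !ItB//; try exact: integ_sh.
have e1 : It leb (sh c (w + u)) = It leb (w + u).
  apply: It_sh_ge0; first exact: integ_mf iwu.
  by move=> x; rewrite fctE /w; have := ler_norm (- u x); rewrite normrN; lra.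
by rewrite e1 [It leb (sh c w)]It_sh_ge0// => x; rewrite /w.
Qed.

Lemma sqi_sh c u : sqi leb u -> sqi leb (sh c u).
Proof.
by move=> [mu iu]; split; [exact: mf_sh|exact: (integ_sh c iu)].
Qed.

Lemma ip_sh c u v : sqi leb u -> sqi leb v -> ip leb (sh c u) (sh c v) = ip leb u v.
Proof. by move=> su sv; rewrite /ip -(It_sh c (sqiM su sv)). Qed.

Lemma shD c c' u : sh c (sh c' u) = sh (c + c') u.
Proof. by apply/funext => x; rewrite /sh addrA. Qed.

Lemma sh0 u : sh 0 u = u.
Proof. by apply/funext => x; rewrite /sh addr0. Qed.

Lemma ip_sh_adj c u v : sqi leb u -> sqi leb v -> ip leb (sh c u) v = ip leb u (sh (- c) v).
Proof.
move=> su sv; rewrite -[in RHS](ip_sh c)//; last exact: sqi_sh.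
by rewrite shD subrr sh0.
Qed.

Lemma ae_sh c (P : E -> Prop) : {ae leb, forall x, P x} -> {ae leb, forall x, P (x + c)}.
Proof.
move=> [N [mN N0 PN]]; exists [set x | N (x + c)]; split.
- exact: mset_sh.
- by have := lebesgue_rV_shift c mN; rewrite N0.
- by move=> x /= h; exact: PN.
Qed.

Lemma orect_fin a b : (leb (orect a b) < +oo)%E.
Proof.
have [k hk] : exists k : nat, orect a b `<=` cube (const_mx (- k%:R)) (k%:R *+ 2).
  have [M [Mr hM]] := bounded_orect a b.
  have [k hk] : exists k : nat, M + 1 < k%:R.
    by exists (Num.trunc `|M + 1|).+1; apply: le_lt_trans (ler_norm _) (truncnS_gt _).
  exists k => x hx i; have := hM (M + 1) (ltr_pwDr ltr01 (lexx M)) x hx.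
  rewrite /= => xM; rewrite mxE.
  have ca : `|x ord0 i| <= `|x|.
    by rewrite [leRHS]mx_normrE; apply: (le_bigmax _ (fun p : 'I_1 * 'I_n => `|x p.1 p.2|) (ord0, i)).
  have : `|x ord0 i| < k%:R by apply: le_lt_trans hk; exact: le_trans xM.
  by rewrite ltr_norml => /andP[h1 h2]; rewrite ltW//= mulr2n addKr.
apply: le_lt_trans (le_measure _ _ _ hk) _; rewrite ?inE//.
- by apply: open_measurable_rV; exact: open_orect.
- exact: measurable_cube.
apply: (@le_lt_trans _ _ ((k%:R *+ 2) ^+ n)%:E); last by rewrite ltry.
by rewrite le_eqVlt; apply/orP; left; apply/eqP; apply: lebesgue_cube; rewrite mulrn_wge0.
Qed.

Lemma morect a b : measurable (orect a b).
Proof. by apply: open_measurable_rV; exact: open_orect. Qed.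

Lemma integ_indic (A : set E) : measurable A -> (leb A < +oo)%E -> integ leb (\1_A : E -> R).
Proof.
move=> mA fA; have h0 (x : E) : 0 <= \1_A x :> R by rewrite indicE.
apply/integrableP; split; first by apply/measurable_EFinP; apply: mf_indic.
rewrite (eq_integral (fun x => (\1_A x)%:E)); last by move=> x _ /=; rewrite ger0_norm.
by rewrite integral_indic// setIT.
Qed.

Lemma It_indic (A : set E) : measurable A -> It leb (\1_A : E -> R) = fine (leb A).
Proof. by move=> mA; rewrite unlock integral_indic// setIT. Qed.

Lemma sqi_indic (A : set E) : measurable A -> (leb A < +oo)%E -> sqi leb (\1_A : E -> R).
Proof.
move=> mA fA; split; first exact: mf_indic.
rewrite (_ : _ * _ = \1_A); first exact: integ_indic.
by apply/funext => x; rewrite /GRing.mul/= indicE; case: (x \in A); rewrite ?mulr1 ?mulr0.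
Qed.

Lemma test_bound phi : test_function phi ->
  exists M a b, [/\ 0 <= M, mf phi & forall x, `|phi x| <= M * \1_(orect a b) x].
Proof.
move=> [Cphi cphi]; have [cont _] := Cphi 0%N.
have mphi : mf phi by exact: continuous_measurable_rVR.
have [M1 [r1 h1]] := compact_bounded cphi.
have [M2 [r2 h2]] : bounded_set (phi @` closure [set x | phi x != 0]).
  apply: compact_bounded; apply: continuous_compact => //.
  exact: continuous_subspaceT.
exists (Num.max (M2 + 1) 0), (const_mx (- (M1 + 2))), (const_mx (M1 + 2)); split => //.
  by rewrite le_max lexx orbT.
move=> x; have [x0|x0] := eqVneq (phi x) 0.
  by rewrite x0 normr0 mulr_ge0// le_max lexx orbT.
have cx : closure [set x | phi x != 0] x by exact: subset_closure.
rewrite indicE mem_set ?mulr1.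
  by rewrite le_max (h2 (M2 + 1))// ltrDl.
move=> i; rewrite !mxE -ltr_norml.
have xM : `|x| <= M1 + 1 by apply: (h1 (M1 + 1)) => //; rewrite ltrDl.
have ca : `|x ord0 i| <= `|x|.
  by rewrite [leRHS]mx_normrE; apply: (le_bigmax _ (fun p : 'I_1 * 'I_n => `|x p.1 p.2|) (ord0, i)).
by apply: le_lt_trans ca (le_lt_trans xM _); rewrite ltrD2l ltr1n.
Qed.

Lemma sqi_bounded u M a b : mf u -> (forall x, `|u x| <= M * \1_(orect a b) x) -> sqi leb u.
Proof.
move=> mu hu; apply: (@sqi_le _ _ _ _ _ (M *: \1_(orect a b))) => //.
  rewrite -[X in sqi _ X]addr0; apply: sqi_dom.
    by apply: sqi_indic; [exact: morect|exact: orect_fin].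
  exact: psd_dom0 (psd_ip leb).
by move=> x; apply: (le_trans (hu x)); exact: ler_norm.
Qed.

Lemma test_sqi phi : test_function phi -> sqi leb phi.
Proof. by move=> /test_bound[M [a [b [_ mphi hphi]]]]; exact: sqi_bounded hphi. Qed.

(** The functions [tbump] tend boundedly to the indicator of an open rectangle. Hence v+ dx and v-
    dx agree on rectangles, then on Borel sets, and comparing them on {v > 0} and on {v < 0} kills
    both. *)
Lemma test_ortho_eq0 v : sqi leb v ->
  (forall phi, test_function phi -> ip leb v phi = 0) -> {ae leb, forall x, v x = 0}.
Proof.
move=> sv hv; have mv := sv.1.
pose vp x := Num.max (v x) 0; pose vn x := Num.max (- v x) 0.
have mvp : mf vp by apply: mf_max.
have mvn : mf vn by apply: mf_max => //; exact: mfN.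
have vp0 x : 0 <= vp x by rewrite /vp le_max lexx orbT.
have vn0 x : 0 <= vn x by rewrite /vn le_max lexx orbT.
have vE x : v x = vp x - vn x.
  rewrite /vp /vn; case: (leP (v x) 0) => h; case: (leP (- v x) 0) => h'; lra.
have svp : sqi leb vp.
  by apply: (sqi_le sv) => // x; rewrite ger0_norm// /vp ge_max ler_norm normr_ge0.
have svn : sqi leb vn.
  by apply: (sqi_le sv) => // x; rewrite ger0_norm// /vn ge_max -normrN ler_norm normr_ge0.
have key a b : ip leb v (\1_(orect a b)) = 0.
  have s1 : sqi leb (\1_(orect a b) : E -> R) by apply: sqi_indic; [exact: morect|exact: orect_fin].
  have [] := @It_dom _ _ _ leb (fun k => v * tbump a b k) (v * \1_(orect a b))
     ((fun x => `|v x|) * \1_(orect a b)).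
  - by move=> k; apply: mfM => //; case: (test_sqi (test_tbump a b k)).
  - by apply: mfM => //; case: s1.
  - apply: aeW => x; rewrite fctE /=; apply: cvgM; first exact: cvg_cst.
    rewrite indicE; have [h|h] := pselect (orect a b x).
      by rewrite mem_set//; exact: tbump_cvg.
    rewrite memNset//; under eq_fun do rewrite tbump_out//; exact: cvg_cst.
  - by apply: sqiM => //; exact: sqi_abs.
  - move=> k x; rewrite !fctE normrM; apply: ler_wpM2l => //.
    rewrite indicE; have [h|h] := pselect (orect a b x).
      by rewrite mem_set//=; have /andP[h1 h2] := tbump_01 a b k x; rewrite ger0_norm.
    by rewrite memNset// tbump_out// normr0.
  move=> _ H; apply/esym; rewrite /ip.
  have E0 k : It leb (v * tbump a b k) = 0 by apply: hv; exact: test_tbump.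
  have : (fun k => It leb (v * tbump a b k)) @ \oo --> (0 : R).
    by under eq_fun do rewrite E0; exact: cvg_cst.
  by move=> H0; exact: (cvg_unique _ H0 H).
have dE (w : E -> R) (w0 : forall x, 0 <= w x) (mw : mf w) a b : sqi leb w ->
    dens_measure leb w0 mw (orect a b) = (ip leb w (\1_(orect a b)))%:E.
  move=> sw; have s1 : sqi leb (\1_(orect a b) : E -> R).
    by apply: sqi_indic; [exact: morect|exact: orect_fin].
  rewrite /ip ItE; last exact: sqiM.
  rewrite /= /dens integral_mkcond; apply: eq_integral => x _.
  rewrite patchE /= /GRing.mul/= indicE; case: ifPn => _; by rewrite ?mulr1 ?mulr0.
have mE A : measurable A -> dens_measure leb vp0 mvp A = dens_measure leb vn0 mvn A.
  apply: measure_rV_unique => a b; rewrite !dE// ?ltry//.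
  congr (_%:E); apply/eqP; rewrite -subr_eq0 -(psdBl (psd_ip leb))//.
    by rewrite -(key a b); apply/eqP; congr ip; apply/funext => x; rewrite vE.
  by apply: sqi_indic; [exact: morect|exact: orect_fin].
have zero (w : E -> R) (A : set E) : (forall x, 0 <= w x) -> mf w -> measurable A ->
    (\int[leb]_(x in A) (w x)%:E = 0)%E -> {ae leb, forall x, A x -> w x = 0}.
  move=> w0 mw mA h; have := (@ae_eq_integral_abs _ _ _ leb A mA (EFin \o w) _).1.
  move=> /(_ (measurable_funTS (proj2 (measurable_EFinP _ _) mw))).
  under eq_integral do rewrite /= ger0_norm//.
  by move=> /(_ h); apply: filterS => x hx Ax; case: (hx Ax).
have mpos : measurable [set x | 0 < v x] by apply: mset_lt.
have mneg : measurable [set x | v x < 0] by apply: mset_lt.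
have Z1 : (\int[leb]_(x in [set x | (0 < v x)%R]) (vp x)%:E = 0)%E.
  have := mE _ mpos; rewrite /= /dens => ->.
  apply: integral0_eq => x /= vx; rewrite /vn max_r// oppr_le0 ltW//.
have Z2 : (\int[leb]_(x in [set x | (v x < 0)%R]) (vn x)%:E = 0)%E.
  have := mE _ mneg; rewrite /= /dens => <-.
  apply: integral0_eq => x /= vx; rewrite /vp max_r// ltW//.
have {Z1}z1 := zero _ _ vp0 mvp mpos Z1; have {Z2}z2 := zero _ _ vn0 mvn mneg Z2.
apply: filterS2 z1 z2 => x h1 h2; have [h|h|//] := ltgtP (v x) 0.
  by have := h2 h; rewrite /vn max_l ?oppr_ge0 ?(ltW h)// => /eqP; rewrite oppr_eq0 => /eqP.
by have := h1 h; rewrite /vp max_l ?(ltW h).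
Qed.

Lemma psd_test : psd (@test_function R n) (ip leb).
Proof.
have B := psd_ip leb; apply: (psd_sub B) => [u /test_sqi//||a u v tu tv].
  have -> : (0 : E -> R) = 0 *: tbump 0 0 0 by rewrite scale0r.
  by apply: test_functionZ; exact: test_tbump.
by apply: test_functionD => //; exact: test_functionZ.
Qed.

(* The minimising sequence of |phi|^2/2 - L(phi) converges in L^2. *)
Lemma test_riesz (L : (E -> R) -> R) (C : R) :
  (forall (a : R) u v, test_function u -> test_function v -> L (a *: u + v) = a * L u + L v) ->
  (forall phi, test_function phi -> L phi <= Num.sqrt C * Num.sqrt (ip leb phi phi)) ->
  exists2 g, sqi leb g & (forall phi, test_function phi -> ip leb g phi = L phi) /\
   (forall e : R, 0 < e -> exists2 phi, test_function phi & ip leb (phi - g) (phi - g) <= e).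
Proof.
move=> Llin LC; have B := psd_test; have BL := psd_ip leb.
pose F phi := 2^-1 * ip leb phi phi - L phi.
have Flb phi : test_function phi -> - (Num.sqrt C ^+ 2) / 2 <= F phi.
  move=> tphi; have := LC _ tphi; rewrite /F.
  have p0 := psd_ge0 B tphi.
  rewrite -[X in 2^-1 * X](sqr_sqrtr p0); set s := Num.sqrt (ip _ _ _) => h.
  have := sqr_ge0 (s - Num.sqrt C); rewrite sqrrB -mulr_natr; lra.
pose S := [set F phi | phi in @test_function R n].
have hS : has_inf S.
  split; first by exists (F 0), 0 => //; exact: psd_dom0 B.
  by exists (- (Num.sqrt C ^+ 2) / 2) => _ [phi tphi <-]; exact: Flb.
have infS phi : test_function phi -> inf S <= F phi.
  by move=> t; apply: ge_inf; [case: hS|exists phi].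
have /choice[p hp] k : exists phi, test_function phi /\ F phi <= inf S + 2^-1 ^+ k.
  have [_ [phi tphi <-] h] := inf_adherent (half_pow_gt0 R k) hS.
  by exists phi; split => //; exact: ltW.
have cau e : 0 < e -> exists N, forall k m, (N <= k)%N -> (N <= m)%N ->
    ip leb (p k - p m) (p k - p m) <= e.
  move=> e0; have [N hN] := half_pow_small (divr_gt0 e0 (ltr0n R 8)).
  exists N => k m Nk Nm; have [[tk fk] [tm fm]] := (hp k, hp m).
  have := quad_parallelogram B Llin tk tm (infS _ (psd_domZ B 2^-1 (psd_domD B tk tm))).
  have := hN _ Nk; have := hN _ Nm; rewrite -/(F _) -/(F _); lra.
have [g [s [sg hs _ cg]]] := L2_complete (fun k => test_sqi (hp k).1) cau.
exists g => //; split; last first.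
  move=> e e0; have [N hN] := (cvg_epsP _ _).1 cg _ e0; exists (p N); first exact: (hp N).1.
  by have := hN _ (leqnn N); rewrite subr0; apply: le_trans; exact: ler_norm.
move=> phi tphi; have sphi := test_sqi tphi.
have c1 : ip leb (p k) phi @[k --> \oo] --> ip leb g phi.
  apply/cvg_epsP => e e0.
  have e1 : 0 < e ^+ 2 / (ip leb phi phi + 1).
    by rewrite divr_gt0 ?exprn_gt0// ltr_wpDl// (psd_ge0 B).
  have [N hN] := (cvg_epsP _ _).1 cg _ e1; exists N => k /hN; rewrite subr0 => h.
  have sk := test_sqi (hp k).1.
  rewrite -(psdBl BL)// -ler_sqr ?nnegrE ?(ltW e0)// real_normK ?num_real//.
  apply: (le_trans (psd_CS BL (psd_domB BL sk sg) sphi)).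
  have := le_trans (ler_norm _) h; rewrite ler_pdivlMr ?ltr_wpDl ?(psd_ge0 B)//; apply: le_trans.
  by apply: ler_wpM2l; rewrite ?lerDl// (psd_ge0 BL)//; exact: (psd_domB BL).
have c2 : ip leb (p k) phi @[k --> \oo] --> L phi.
  apply/cvg_epsP => e e0.
  have e1 : 0 < e ^+ 2 / (2 * (ip leb phi phi + 1)).
    by rewrite divr_gt0 ?exprn_gt0// mulr_gt0// ltr_wpDl// (psd_ge0 B).
  have [N hN] := half_pow_small e1; exists N => k /hN h.
  have [tk fk] := hp k.
  have := quad_approx_euler B Llin tk tphi (fun t => psd_domD B tk (psd_domZ B t tphi)) infS fk.
  move: h; rewrite ler_pdivlMr; last by rewrite mulr_gt0// ltr_wpDl// (psd_ge0 B).
  move=> h h'; rewrite -ler_sqr ?nnegrE ?(ltW e0)// real_normK ?num_real//.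
  apply: (le_trans h'); have := half_pow_gt0 R k; have := psd_ge0 B tphi; lra.
by have := cvg_unique _ c1 c2; apply.
Qed.

(** Represent the pairing with g by [test_riesz]: the representer is an L^2 limit of test functions,
    and its difference with g is orthogonal to all test functions, hence 0 almost everywhere. *)
Lemma test_dense g (e : R) : sqi leb g -> 0 < e ->
  exists2 phi, test_function phi & ip leb (phi - g) (phi - g) <= e.
Proof.
move=> sg e0; have BL := psd_ip leb.
have [||g' sg' [gE dg]] := @test_riesz (ip leb g) (ip leb g g).
- by move=> a u v /test_sqi su /test_sqi sv; rewrite (psdDr BL) ?(psdZr BL)//; exact: (psd_domZ BL).
- move=> phi /test_sqi sphi; apply: le_trans (ler_norm _) (psd_CS_sqrt BL sg sphi).
have [phi tphi h] := dg _ e0; exists phi => //; have sphi := test_sqi tphi.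
have ae0 : {ae leb, forall x, (g' - g) x = 0}.
  apply: test_ortho_eq0; first exact: (psd_domB BL).
  by move=> psi' tp; rewrite (psdBl BL) ?gE ?subrr//; exact: test_sqi.
have mm : mf (phi - g) by case: (psd_domB BL sphi sg).
have mm' : mf (phi - g') by case: (psd_domB BL sphi sg').
have ae1 : {ae leb, forall x, (phi - g) x = (phi - g') x}.
  by apply: filterS ae0 => x; rewrite !fctE => /eqP; rewrite subr_eq0 => /eqP ->.
by rewrite (ip_ae mm mm mm' mm' ae1 ae1).
Qed.

End L2_rV.

(** * Weak derivatives as limits of difference quotients *)

Section difference_quotients.
Variables (R : realType) (n : nat).
Local Notation E := 'rV[R]_n.
Local Notation leb := (lebesgue_rV R n).
Implicit Types (u v g phi : E -> R) (a b c x : E) (i : 'I_n) (h : R).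
Let BL := psd_ip leb.

Definition ei i : E := delta_mx ord0 i.

Definition dq i h u : E -> R := h^-1 *: (sh (h *: ei i) u - u).

Lemma dqE i h u x : dq i h u x = h^-1 * (u (x + h *: ei i) - u x).
Proof. by []. Qed.

Lemma dq_lin i h (a : R) u v : dq i h (a *: u + v) = a *: dq i h u + dq i h v.
Proof. by apply/funext => x; rewrite /dq /sh !fctE /GRing.scale/=; ring. Qed.

Lemma mf_dq i h u : mf u -> mf (dq i h u).
Proof. by move=> mu; apply: mfZ; apply: mfB => //; exact: mf_sh. Qed.

Lemma sqi_dq i h u : sqi leb u -> sqi leb (dq i h u).
Proof.
by move=> su; apply: (psd_domZ BL); apply: (psd_domB BL) => //; exact: sqi_sh.
Qed.

Lemma dq_sh i h c u : dq i h (sh c u) = sh c (dq i h u).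
Proof.
apply/funext => x; rewrite /sh !dqE.
by rewrite (_ : x + h *: ei i + c = x + c + h *: ei i)// addrAC.
Qed.

Lemma ip_dq i h u v : sqi leb u -> sqi leb v ->
  ip leb (dq i h u) v = - ip leb u (dq i (- h) v).
Proof.
move=> su sv; have [su' sv'] := (sqi_sh (h *: ei i) su, sqi_sh (- h *: ei i) sv).
rewrite /dq (psdZl BL) ?(psdBl BL)//; last exact: (psd_domB BL).
rewrite (psdZr BL) ?(psdBr BL)//; last exact: (psd_domB BL).
rewrite (ip_sh_adj (h *: ei i))// -scaleNr invrN; ring.
Qed.

Let sh_quot c u x (v : E) : (fun h : R => h^-1 *: ((sh c u \o shift x) (h *: v) - sh c u x)) =
  (fun h : R => h^-1 *: ((u \o shift (x + c)) (h *: v) - u (x + c))).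
Proof. by apply/funext => h; rewrite /sh /= addrA. Qed.

Lemma partial_sh i c u : partial i (sh c u) = sh c (partial i u).
Proof. by apply/funext => x; rewrite /partial /derive sh_quot. Qed.

Lemma test_sh c phi : test_function phi -> test_function (sh c phi).
Proof.
have dsh i u x : derivable u (x + c) (ei i) -> derivable (sh c u) x (ei i).
  by move=> du; rewrite /derivable sh_quot.
have psh := partial_sh.
have csh k u : Ck k u -> Ck k (sh c u).
  elim: k u => [|k IH] u [cu Hu]; split => //.
  - move=> x; apply: (@continuous_comp _ _ _ (fun y : E => y + c) u); last exact: cu.
    by apply: (@continuousD _ _ _ id (cst c)); [exact: cvg_id|exact: cst_continuous].
  - move=> x; apply: (@continuous_comp _ _ _ (fun y : E => y + c) u); last exact: cu.
    by apply: (@continuousD _ _ _ id (cst c)); [exact: cvg_id|exact: cst_continuous].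
  - move=> i; have [d C] := Hu i; split; last by rewrite psh; exact: IH.
    by move=> x; apply: dsh; exact: d.
move=> [C cc]; split; first by move=> k; exact: csh.
have [M [Mr hM]] := compact_bounded cc.
apply: (@compact_supp _ _ _ [set x | `|x| <= M + 1 + `|c|]).
  exists (M + 1 + `|c|); split; first by rewrite num_real.
  by move=> M' h x /= hx; exact: le_trans hx (ltW h).
move=> x; rewrite /sh /= => h.
have xc : `|x + c| <= M + 1 by apply: (hM (M + 1)); [rewrite ltrDl|exact: subset_closure].
by rewrite -[x](addrK c); apply: (le_trans (ler_normB _ _)); rewrite lerD2r.
Qed.

Lemma test_partial i phi : test_function phi -> test_function (partial i phi).
Proof.
move=> [C cc]; split; first by move=> k; have [_ /(_ i)[]] := C k.+1.
have pz x : ~ closure [set x | phi x != 0] x -> partial i phi x = 0.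
  move=> ncx; have : \forall y \near x, phi y = cst 0 y.
    have : open (~` closure [set x | phi x != 0]) by apply: closed_openC; exact: closed_closure.
    rewrite openE => /(_ x ncx); apply: filterS => y /= yc; apply/eqP/negPn/negP => py.
    by apply: yc; exact: subset_closure.
  by move=> /near_eq_derive; rewrite /partial => ->; rewrite derive_cst.
have [M [Mr hM]] := compact_bounded cc.
apply: (@compact_supp _ _ _ [set x | `|x| <= M + 1]).
  exists (M + 1); split; first by rewrite num_real.
  by move=> M' h x /= hx; exact: le_trans hx (ltW h).
move=> x h; apply: (hM (M + 1)); first by rewrite ltrDl.
by apply: contrapT => /pz e; rewrite e eqxx in h.
Qed.

Lemma test_lip phi i : test_function phi -> exists2 M, 0 <= M &
  forall x h, `|phi (x + h *: ei i) - phi x| <= M * `|h|.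
Proof.
move=> tphi; have [M [a [b [M0 mp hM]]]] := test_bound (test_partial i tphi).
have {}hM x : `|partial i phi x| <= M.
  by apply: (le_trans (hM x)); rewrite indicE; case: (x \in _); rewrite ?mulr1 ?mulr0.
exists M => // x h.
have [C _] := tphi; have [_ /(_ i)[dphi _]] := C 1%N.
pose g (t : R) := phi (x + t *: ei i).
have dg (t : R) : is_derive t 1 g (partial i phi (x + t *: ei i)).
  have H : s^-1 *: (g (s *: 1 + t) - g t) @[s --> 0^'] --> partial i phi (x + t *: ei i).
    have := dphi (x + t *: ei i); rewrite /derivable.
    move=> /cvg_ex[l hl]; have := hl; rewrite /partial /derive => H0.
    have -> : lim (h0^-1 *: (phi (h0 *: delta_mx ord0 i + (x + t *: ei i)) - phi (x + t *: ei i)) @[h0 --> 0^']) = l.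
      exact/cvg_lim.
    rewrite (_ : (fun s => _) = (fun s : R => s^-1 *: (phi (s *: ei i + (x + t *: ei i)) - phi (x + t *: ei i))))//.
      apply/funext => s; rewrite /g; congr (_ *: (phi _ - _)).
    by rewrite [s *: 1]mulr1 scalerDl addrCA.
  by apply: DeriveDef; [apply/cvg_ex; eexists; exact: H|apply/cvg_lim].
have cg (t : R) : {for t, continuous g}.
  by apply: differentiable_continuous; apply/derivable1_diffP; exact: ex_derive.
have g0 : g 0 = phi x by rewrite /g scale0r addr0.
rewrite -/(g h) -g0; have [h0|h0|->] := ltgtP h 0; last by rewrite subrr normr0 mulr_ge0.
- have [|c _ e] := @MVT R g (fun t => partial i phi (x + t *: ei i)) h 0 h0 (fun t _ => dg t).
    by apply: continuous_in_subspaceT => t _; exact: cg.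
  by rewrite distrC e sub0r normrM normrN; apply: ler_wpM2r.
- have [|c _ ->] := @MVT R g (fun t => partial i phi (x + t *: ei i)) 0 h h0 (fun t _ => dg t).
    by apply: continuous_in_subspaceT => t _; exact: cg.
  by rewrite subr0 normrM; apply: ler_wpM2r.
Qed.

(** Steps of size at most 1 keep the quotients supported in a fixed enlarged rectangle, where the
    Lipschitz bound dominates them. *)
Lemma test_dq_cvg phi i (t : nat -> R) : test_function phi ->
  (forall k, t k != 0) -> (forall k, `|t k| <= 1) -> t k @[k --> \oo] --> 0 ->
  ip leb (dq i (t k) phi - partial i phi) (dq i (t k) phi - partial i phi)
    @[k --> \oo] --> 0.
Proof.
move=> tphi t0 t1 tcv.
have [M1 [a [b [M10 mphi hM1]]]] := test_bound tphi.
have [M M0 hM] := test_lip i tphi.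
have [_ mpp] := (mphi, test_sqi (test_partial i tphi)).
pose A := orect (a - const_mx 1) (b + const_mx 1).
have mA : measurable A by exact: morect.
have ptw x : dq i (t k) phi x @[k --> \oo] --> partial i phi x.
  have [C _] := tphi; have [_ /(_ i)[dphi _]] := C 1%N.
  have tD : t @ \oo --> (0 : R)^'.
    move=> B h; have := tcv _ h; rewrite /fmap /nbhs/=.
    by apply: filterS => k /= Bk; apply: Bk.
  have := cvg_comp _ _ tD (dphi x).
  rewrite -/(partial i phi x) /=.
  rewrite (_ : _ \o t = fun k => dq i (t k) phi x)//.
  by apply/funext => k; rewrite dqE /= [_ + x]addrC.
have zo y : ~ orect a b y -> phi y = 0.
  move=> ny; have := hM1 y; rewrite indicE memNset// mulr0 normr_le0 => /eqP//.
have bd k x : `|dq i (t k) phi x| <= M * \1_A x.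
  rewrite indicE; have [xA|xA] := pselect (A x).
    rewrite mem_set// mulr1 dqE normrM normfV ler_pdivrMl ?normr_gt0//.
    by rewrite mulrC; exact: hM.
  rewrite memNset// mulr0 dqE !zo ?subrr ?mulr0 ?normr0// => h; apply: xA => j.
    by have := h j; rewrite !mxE => /andP[h1 h2]; apply/andP; split; lra.
  have := h j; rewrite !mxE; have := t1 k; rewrite ler_norml => /andP[h3 h4].
  by rewrite eqxx; case: (j == i) => /=; rewrite ?mulr1 ?mulr0 => /andP[h1 h2]; apply/andP; split; lra.
have bp x : `|partial i phi x| <= M * \1_A x.
  have h : `|dq i (t k) phi x| @[k --> \oo] --> `|partial i phi x| by apply: cvg_norm.
  rewrite -(cvg_lim _ h)//; apply: limr_le; first by apply/cvg_ex; eexists; exact: h.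
  by apply: nearW => k; exact: bd.
have [] := @It_dom _ _ _ leb
  (fun k => (dq i (t k) phi - partial i phi) * (dq i (t k) phi - partial i phi)) 0
  ((2 * M) ^+ 2 *: \1_A).
- by move=> k; apply: mfM; apply: mfB; [exact: mf_dq|case: mpp|exact: mf_dq|case: mpp].
- exact: mf_cst.
- apply: aeW => x; rewrite !fctE.
  have e : dq i (t k) phi x - partial i phi x @[k --> \oo] --> (0 : R).
    by rewrite -(subrr (partial i phi x)); apply: cvgB => //; exact: cvg_cst.
  by have := cvgM e e; rewrite mulr0; exact.
- by apply: integZ; apply: integ_indic => //; exact: orect_fin.
- move=> k x; rewrite !fctE /GRing.scale/= normrM.
  have : `|dq i (t k) phi x - partial i phi x| <= (2 * M) * \1_A x.
    by apply: (le_trans (ler_normB _ _)); have := bd k x; have := bp x; lra.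
  rewrite indicE; case: (x \in A) => /=; rewrite ?mulr1 ?mulr0 => h.
    by rewrite expr2; apply: ler_pM.
  by move: h; rewrite normr_le0 => /eqP ->; rewrite normr0 mulr0.
by move=> _; rewrite It0.
Qed.

Definition hk k : R := 2^-1 ^+ k.

Lemma hk_gt0 k : 0 < hk k. Proof. exact: half_pow_gt0. Qed.

Lemma hk_cvg (s : R) : s * hk k @[k --> \oo] --> 0.
Proof.
rewrite -(mulr0 s); apply: cvgM; first exact: cvg_cst.
by apply/cvg_epsP => e /half_pow_small[N hN]; exists N => k /hN; rewrite subr0 ger0_norm// ltW// hk_gt0.
Qed.

Lemma hk_le1 k : hk k <= 1.
Proof. by rewrite /hk exprn_ile1// ?invr_ge0// invf_le1// ler1n. Qed.

Definition nr u := Num.sqrt (ip leb u u).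

Lemma nr_ge0 u : 0 <= nr u. Proof. exact: sqrtr_ge0. Qed.

Lemma nr_sq u : sqi leb u -> nr u ^+ 2 = ip leb u u.
Proof. by move=> su; rewrite sqr_sqrtr// (psd_ge0 BL). Qed.

Lemma nr_CS u v : sqi leb u -> sqi leb v -> `|ip leb u v| <= nr u * nr v.
Proof. by move=> su sv; exact: (psd_CS_sqrt BL). Qed.

Lemma nrD u v : sqi leb u -> sqi leb v -> nr (u + v) <= nr u + nr v.
Proof. exact: (psd_sqrt_triangle BL). Qed.

Lemma nr_sh c u : sqi leb u -> nr (sh c u) = nr u.
Proof. by move=> su; rewrite /nr ip_sh. Qed.

Lemma nr_small u (e : R) : 0 <= e -> ip leb u u <= e ^+ 2 -> nr u <= e.
Proof. by move=> e0 h; rewrite -[leRHS]ger0_norm// -sqrtr_sqr ler_wsqrtr. Qed.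

Lemma dense_bound v (b : R) : 0 <= b -> sqi leb v ->
  (forall phi, test_function phi -> ip leb v phi <= b * nr phi) -> nr v <= b.
Proof.
move=> b0 sv hv; rewrite leNgt; apply/negP => ab; set a := nr v in ab.
have a0 : 0 < a by exact: le_lt_trans ab.
(* A test function within s of v would give a (a - b) <= s (a + b); this s makes the right side half
   of the left one. *)
pose s := a * (a - b) / (2 * (a + b)).

have ab0 : 0 < a + b by rewrite ltr_wpDr.
have {}s0 : 0 < s by rewrite divr_gt0 ?mulr_gt0 ?subr_gt0//.
have [phi tphi hphi] := test_dense sv (exprn_gt0 2 s0).
have sphi := test_sqi tphi; have sd := psd_domB BL sphi sv.
have h1 : nr (phi - v) <= s by apply: nr_small => //; exact: ltW.
have h2 : nr phi <= a + s.
  have -> : phi = v + (phi - v) by rewrite addrC subrK.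
  by apply: (le_trans (nrD sv sd)); rewrite lerD2l.
have h3 : a ^+ 2 = ip leb v phi - ip leb v (phi - v).
  by rewrite nr_sq// (psdBr BL)//; ring.
have h4 := hv _ tphi; have h5 := nr_CS sv sd.
have h6 : - ip leb v (phi - v) <= a * s.
  apply: (le_trans (ler_norm _)); rewrite normrN; apply: (le_trans h5).
  by apply: ler_wpM2l; first exact: ltW.
have h7 : a ^+ 2 <= b * (a + s) + a * s.
  rewrite h3; apply: lerD => //; apply: (le_trans h4); exact: ler_wpM2l.
have : a * (a - b) <= s * (a + b) by move: h7; rewrite expr2; lra.
have -> : s * (a + b) = a * (a - b) / 2 by rewrite /s; field; rewrite gt_eqF.
have : 0 < a * (a - b) by rewrite mulr_gt0// subr_gt0.
by lra.
Qed.

Definition wpd i u g := sqi leb g /\ forall phi, test_function phi -> ip leb u (partial i phi) = - ip leb g phi.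

Lemma dq_double i h u : h != 0 ->
  dq i (2 * h) u = 2^-1 *: (dq i h u + sh (h *: ei i) (dq i h u)).
Proof.
move=> h0; apply/funext => x; rewrite /dq /sh !fctE /GRing.scale/=.
have -> : x + (2 * h) *: ei i = x + h *: ei i + h *: ei i by rewrite -addrA -scalerDl mulr2n mulrDl mul1r.
by field.
Qed.

(** At a tiny step h 2^-N, the quotient paired with any translate of [phi] is the weak derivative
    paired with it, up to e. Doubling the step averages two translates of the quotient
    ([dq_double]), so the bound, uniform in the translate, climbs back to the step h. *)
Lemma dq_pair_bound i u g h phi : sqi leb u -> wpd i u g -> h != 0 -> `|h| <= 1 ->
  test_function phi -> `|ip leb (dq i h u) phi| <= nr g * nr phi.
Proof.
move=> su [sg hg] h0 h1 tphi; apply/ler_addgt0Pr => e e0.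
have sphi := test_sqi tphi.
pose t k := - h * hk k.
have tn k : t k != 0 by rewrite mulf_neq0 ?oppr_eq0// gt_eqF// hk_gt0.
have t1 k : `|t k| <= 1.
  rewrite normrM normrN (ger0_norm (ltW (hk_gt0 k))) -[leRHS]mulr1.
  by apply: ler_pM => //; [exact: ltW (hk_gt0 k)|exact: hk_le1].
have cv := test_dq_cvg i tphi tn t1 (hk_cvg _).
have e1 : 0 < (e / (nr u + 1)) ^+ 2 by rewrite exprn_gt0// divr_gt0// ltr_wpDl// nr_ge0.
have [N hN] := (cvg_epsP _ _).1 cv _ e1; have := hN _ (leqnn N); rewrite subr0 => {}hN.
have base c : `|ip leb (dq i (h * hk N) u) (sh c phi)| <= nr g * nr phi + e.
  have tsh := test_sh c tphi; have ssh := test_sqi tsh.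
  rewrite ip_dq// dq_sh normrN -mulNr -/(t N).
  have sd := sqi_dq i (t N) sphi; have sp := test_sqi (test_partial i tphi).
  have -> : sh c (dq i (t N) phi) = partial i (sh c phi) + sh c (dq i (t N) phi - partial i phi).
    by rewrite partial_sh; apply/funext => x; rewrite /sh !fctE; ring.
  have sdp := psd_domB BL sd sp.
  rewrite (psdDr BL)//; [|by rewrite partial_sh; exact: sqi_sh|exact: sqi_sh].
  apply: (le_trans (ler_normD _ _)); apply: lerD.
    by rewrite hg// normrN; apply: (le_trans (nr_CS sg ssh)); rewrite nr_sh.
  apply: (le_trans (nr_CS su (sqi_sh c sdp))); rewrite nr_sh//.
  have : nr (dq i (t N) phi - partial i phi) <= e / (nr u + 1).
    apply: nr_small; first by rewrite divr_ge0 ?(ltW e0)// addr_ge0// nr_ge0.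
    by apply: le_trans hN; exact: ler_norm.
  move=> hh; apply: (le_trans (ler_wpM2l (nr_ge0 u) hh)).
  rewrite mulrA ler_pdivrMr ?ltr_wpDl ?nr_ge0// mulrDr mulr1 mulrC lerDl; exact: ltW.
have step k : (k <= N)%N -> forall c, `|ip leb (dq i (h * hk (N - k)) u) (sh c phi)| <= nr g * nr phi + e.
  elim: k => [|k IH] kN c; first by rewrite subn0.
  have e2 : h * hk (N - k.+1) = 2 * (h * hk (N - k)).
    by rewrite -(subnSK kN) /hk exprS; field.
  have h0' : h * hk (N - k) != 0 by rewrite mulf_neq0// gt_eqF// hk_gt0.
  have sd := sqi_dq i (h * hk (N - k)) su; have ssh := sqi_sh c sphi.
  rewrite e2 dq_double// (psdZl BL)//; last by apply: (psd_domD BL) => //; exact: sqi_sh.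
  rewrite (psdDl BL)//; last exact: sqi_sh.
  rewrite (ip_sh_adj (_ *: _))// shD normrM ger0_norm ?invr_ge0//.
  have := IH (ltnW kN) c; have := IH (ltnW kN) (- ((h * hk (N - k)) *: ei i) + c).
  move=> H1 H2; rewrite ler_pdivrMl//; apply: (le_trans (ler_normD _ _)); lra.
by have := step N (leqnn N) 0; rewrite subnn /hk expr0 mulr1 sh0.
Qed.

Lemma dq_le i u g h : sqi leb u -> wpd i u g -> h != 0 -> `|h| <= 1 -> nr (dq i h u) <= nr g.
Proof.
move=> su wg h0 h1; apply: dense_bound; [exact: nr_ge0|exact: sqi_dq|].
by move=> phi tphi; apply: (le_trans (ler_norm _)); exact: dq_pair_bound.
Qed.

(** Since |D| <= |g| by [dq_le], expanding gives |D - g|^2 <= - 2 <D - g, g>; the right side tends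
    to 0 by weak convergence, tested on a [phi] close to g. *)
Lemma dq_cvg i u g : sqi leb u -> wpd i u g ->
  nr (dq i (hk k) u - g) @[k --> \oo] --> 0.
Proof.
move=> su wg; have [sg hg] := wg; apply/cvg_epsP => e e0.
pose d := e ^+ 2 / (8 * (nr g + 1)).
have g1 : 0 < nr g + 1 by rewrite ltr_wpDl// nr_ge0.
have d0 : 0 < d by rewrite divr_gt0 ?exprn_gt0// mulr_gt0.
have [phi tphi hphi] := test_dense sg (exprn_gt0 2 d0).
have sphi := test_sqi tphi; have sp := test_sqi (test_partial i tphi).
have tn k : - 1 * hk k != 0 by rewrite mulf_neq0 ?oppr_eq0 ?oner_eq0// gt_eqF// hk_gt0.
have t1 k : `|- 1 * hk k| <= 1.
  by rewrite mulN1r normrN (ger0_norm (ltW (hk_gt0 k))) hk_le1.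
have cv := test_dq_cvg i tphi tn t1 (hk_cvg _).
have e1 : 0 < (e ^+ 2 / (4 * (nr u + 1))) ^+ 2.
  by rewrite exprn_gt0// divr_gt0 ?exprn_gt0// mulr_gt0// ltr_wpDl// nr_ge0.
have [N hN] := (cvg_epsP _ _).1 cv _ e1; exists N => k /hN; rewrite subr0 => hk1.
rewrite subr0 ger0_norm ?nr_ge0//; apply: nr_small; first exact: ltW.
set D := dq i (hk k) u; have sD : sqi leb D by exact: sqi_dq.
have sDg := psd_domB BL sD sg; have spg := psd_domB BL sphi sg.
have DDg : ip leb D D <= ip leb g g.
  have := dq_le su wg (lt0r_neq0 (hk_gt0 k)); rewrite (ger0_norm (ltW (hk_gt0 k))) => /(_ (hk_le1 k)).
  move=> h; rewrite -!nr_sq//; apply: lerXn2r => //; rewrite ?nnegrE ?nr_ge0//.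
have nDg : nr (D - g) <= 2 * nr g.
  apply: (le_trans (nrD sD (psd_domN BL sg))).
  have -> : nr (- g) = nr g by rewrite /nr (psdNl BL) ?(psdNr BL) ?opprK//; exact: (psd_domN BL).
  have : nr D <= nr g by apply: ler_wsqrtr.
  lra.
have E1 : ip leb (D - g) (D - g) <= - 2 * ip leb (D - g) phi + 2 * ip leb (D - g) (phi - g).
  by rewrite (psd_sqB BL)// (psdBr BL)//  !(psdBl BL)//; lra.
have E2 : 2 * ip leb (D - g) (phi - g) <= e ^+ 2 / 2.
  have : nr (phi - g) <= d by apply: nr_small => //; exact: ltW.
  move=> h; have := le_trans (ler_norm _) (nr_CS sDg spg) => h2.
  have h3 : nr (D - g) * nr (phi - g) <= (2 * nr g) * d.
    by apply: ler_pM => //; exact: nr_ge0.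
  have h4 : (2 * nr g) * d <= e ^+ 2 / 4.
    rewrite /d (_ : e ^+ 2 / 4 = (2 * (nr g + 1)) * (e ^+ 2 / (8 * (nr g + 1)))); last first.
      by field; rewrite gt_eqF.
    by apply: ler_wpM2r; [rewrite ltW|rewrite ler_pM2l// lerDl].
  lra.
have E3 : - 2 * ip leb (D - g) phi <= e ^+ 2 / 2.
  have -> : ip leb (D - g) phi = - ip leb u (dq i (- 1 * hk k) phi - partial i phi).
    rewrite (psdBl BL)// /D ip_dq// mulN1r (psdBr BL)//; last exact: sqi_dq.
    by rewrite hg//; ring.
  have sd := psd_domB BL (sqi_dq i (- 1 * hk k) sphi) sp.
  have h1 := le_trans (ler_norm _) (nr_CS su sd).
  have h2 : nr (dq i (-1 * hk k) phi - partial i phi) <= e ^+ 2 / (4 * (nr u + 1)).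
    apply: nr_small; last by apply: le_trans hk1; exact: ler_norm.
    by rewrite divr_ge0 ?exprn_ge0 ?(ltW e0)// mulr_ge0// addr_ge0// nr_ge0.
  have h3 := ler_wpM2l (nr_ge0 u) h2.
  have h4 : nr u * (e ^+ 2 / (4 * (nr u + 1))) <= e ^+ 2 / 4.
    have u1 : 0 < nr u + 1 by rewrite ltr_wpDl// nr_ge0.
    rewrite (_ : e ^+ 2 / 4 = (nr u + 1) * (e ^+ 2 / (4 * (nr u + 1)))); last first.
      by field; rewrite gt_eqF.
    apply: ler_wpM2r; last by rewrite lerDl.
    by rewrite divr_ge0 ?exprn_ge0 ?(ltW e0)// mulr_ge0// ltW.
  lra.
lra.
Qed.

(** Pairing u with the quotients of [phi] amounts to pairing the quotients of u with [phi]; the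
    functional - <u, d_i phi> is therefore bounded in L^2 and [test_riesz] represents it. *)
Lemma wpd_exists i u (C : R) : sqi leb u ->
  (forall k, ip leb (dq i (hk k) u) (dq i (hk k) u) <= C) -> exists g, wpd i u g.
Proof.
move=> su hC.
have [||g sg [gE _]] := @test_riesz R n (fun phi => - ip leb u (partial i phi)) C.
- move=> a v w tv tw.
  have -> : partial i (a *: v + w) = a *: partial i v + partial i w.
    have [[Cv _] [Cw _]] := (tv, tw).
    have [_ /(_ i)[dv _]] := Cv 1%N; have [_ /(_ i)[dw _]] := Cw 1%N.
    apply/funext => x; rewrite /partial deriveD ?deriveZ//; exact: derivableZ.
  have [sv sw] := (test_sqi (test_partial i tv), test_sqi (test_partial i tw)).
  by rewrite (psdDr BL) ?(psdZr BL)// ?opprD ?mulrN//; exact: (psd_domZ BL).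
- move=> phi tphi; apply/ler_addgt0Pr => e e0.
  have sphi := test_sqi tphi; have sp := test_sqi (test_partial i tphi).
  have tn k : - 1 * hk k != 0 by rewrite mulf_neq0 ?oppr_eq0 ?oner_eq0// gt_eqF// hk_gt0.
  have t1 k : `|- 1 * hk k| <= 1.
    by rewrite mulN1r normrN (ger0_norm (ltW (hk_gt0 k))) hk_le1.
  have cv := test_dq_cvg i tphi tn t1 (hk_cvg _).
  have u1 : 0 < nr u + 1 by rewrite ltr_wpDl// nr_ge0.
  have e1 : 0 < (e / (nr u + 1)) ^+ 2 by rewrite exprn_gt0// divr_gt0.
  have [N hN] := (cvg_epsP _ _).1 cv _ e1; have := hN _ (leqnn N); rewrite subr0 => {}hN.
  have sd := psd_domB BL (sqi_dq i (- 1 * hk N) sphi) sp.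
  have -> : - ip leb u (partial i phi) = ip leb (dq i (hk N) u) phi +
      ip leb u (dq i (- 1 * hk N) phi - partial i phi).
    by rewrite ip_dq// mulN1r (psdBr BL)//; [ring|exact: sqi_dq].
  apply: lerD.
    apply: (le_trans (ler_norm _)); apply: (le_trans (nr_CS (sqi_dq _ _ su) sphi)).
    by apply: ler_wpM2r; [exact: nr_ge0|apply: ler_wsqrtr].
  apply: (le_trans (ler_norm _)); apply: (le_trans (nr_CS su sd)).
  have : nr (dq i (-1 * hk N) phi - partial i phi) <= e / (nr u + 1).
    apply: nr_small; last by apply: le_trans hN; exact: ler_norm.
    by rewrite divr_ge0 ?(ltW e0)// ltW.
  move=> hh; apply: (le_trans (ler_wpM2l (nr_ge0 u) hh)).
  by rewrite mulrA ler_pdivrMr// mulrDr mulr1 mulrC lerDl; exact: ltW.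
by exists g; split => // phi tphi; rewrite gE// opprK.
Qed.

End difference_quotients.

(** * The Sobolev space and the Dirichlet form *)

Section dirichlet_form.
Variables (R : realType) (n : nat).
Local Notation E := 'rV[R]_n.
Local Notation leb := (lebesgue_rV R n).
Implicit Types (u v w f g phi : E -> R) (x y : E) (i : 'I_n).
Let BL := psd_ip leb.

Lemma weak_gradientP u (G : 'I_n -> E -> R) : sqi leb u ->
  weak_gradient u G <-> forall i, wpd i u (G i).
Proof.
move=> su; split=> h i; have := h i.
- move=> [/sqi_Lfun sg hg]; split=> // phi tphi; apply: EFin_inj.
  have sphi := test_sqi tphi; have sp := test_sqi (test_partial i tphi).
  by rewrite EFinN /ip !ItE; [exact: hg|exact: sqiM|exact: sqiM].
- move=> [sg hg]; split; first exact/sqi_Lfun.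
  move=> phi tphi; have sphi := test_sqi tphi; have sp := test_sqi (test_partial i tphi).
  have := congr1 EFin (hg _ tphi); rewrite EFinN /ip !ItE; [exact|exact: sqiM|exact: sqiM].
Qed.

Lemma H1P u : H1 u <-> sqi leb u /\ exists G, forall i, wpd i u (G i).
Proof.
split=> [[/sqi_Lfun su [G hG]]|[su [G hG]]].
  by split=> //; exists G; exact/weak_gradientP.
by split; [exact/sqi_Lfun|exists G; exact/weak_gradientP].
Qed.

Lemma H1_sqi u : H1 u -> sqi leb u. Proof. by move/H1P => []. Qed.

Lemma H1_mf u : H1 u -> mf u. Proof. by move/H1_sqi => []. Qed.

Lemma gradP u i : H1 u -> wpd i u (gradient u i).
Proof.
move=> hu; have su := H1_sqi hu; apply: (weak_gradientP (gradient u) su).1.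
by apply: getPex; have [_ [G hG]] := hu; exists G.
Qed.

Lemma grad_sqi u i : H1 u -> sqi leb (gradient u i).
Proof. by move=> hu; case: (gradP i hu). Qed.

Definition Da u v := \sum_(i < n) ip leb (gradient u i) (gradient v i).
Definition Dr u := Da u u.
(* On H1, ah k u u increases to Dr u, and H1 consists of the u in L2 on which it is bounded. *)
Definition ah k u v := \sum_(i < n) ip leb (dq i (hk R k) u) (dq i (hk R k) v).

Lemma dirichletE u : H1 u -> dirichlet u = (Dr u)%:E.
Proof.
move=> hu; rewrite /dirichlet /Dr /Da /ip.
rewrite -(It_sum _ (F := fun i => gradient u i * gradient u i)); last first.
  by move=> i; apply: sqiM; exact: grad_sqi.
rewrite ItE; last by apply: integ_sum => i; apply: sqiM; exact: grad_sqi.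
apply: eq_integral => x _; congr (_%:E); rewrite fct_sumE.
by apply: eq_bigr => i _; rewrite expr2.
Qed.

Lemma psd_ah k : psd (sqi leb) (ah k).
Proof.
split.
- exact: psd_dom0 BL.
- by move=> a u v; exact: (psd_domP BL).
- by move=> u v su sv; apply: eq_bigr => i _; apply: (psd_sym BL); exact: sqi_dq.
- move=> a u v w su sv sw; rewrite /ah mulr_sumr -big_split/=; apply: eq_bigr => i _.
  by rewrite dq_lin (psd_lin BL)//; exact: sqi_dq.
- by move=> u su; apply: sumr_ge0 => i _; apply: (psd_ge0 BL); exact: sqi_dq.
Qed.

Lemma H1_dom (a : R) u v : H1 u -> H1 v -> H1 (a *: u + v).
Proof.
move=> /H1P[su [G hG]] /H1P[sv [G' hG']]; apply/H1P; split.
  exact: (psd_domP BL).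
exists (fun i => a *: G i + G' i) => i; have [sg hg] := hG i; have [sg' hg'] := hG' i.
split; first exact: (psd_domP BL).
move=> phi tphi; have sphi := test_sqi tphi; have sp := test_sqi (test_partial i tphi).
by rewrite !(psd_lin BL)// hg// hg'// mulrN -opprD.
Qed.

Lemma H10 : H1 (0 : E -> R).
Proof.
apply/H1P; split; first exact: psd_dom0 BL.
exists (fun=> 0) => i; split; first exact: psd_dom0 BL.
move=> phi tphi; have sphi := test_sqi tphi; have sp := test_sqi (test_partial i tphi).
by rewrite !(psd0l BL)// oppr0.
Qed.

Lemma ip_cvg (U V : nat -> E -> R) u v : (forall k, sqi leb (U k)) -> (forall k, sqi leb (V k)) ->
  sqi leb u -> sqi leb v -> nr (U k - u) @[k --> \oo] --> 0 -> nr (V k - v) @[k --> \oo] --> 0 ->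
  ip leb (U k) (V k) @[k --> \oo] --> ip leb u v.
Proof.
move=> sU sV su sv cu cv.
have H k : `|ip leb (U k) (V k) - ip leb u v| <=
    nr (U k - u) * (nr (V k - v) + nr v) + nr u * nr (V k - v).
  have [sUu sVv] := (psd_domB BL (sU k) su, psd_domB BL (sV k) sv).
  have -> : ip leb (U k) (V k) - ip leb u v = ip leb (U k - u) (V k) + ip leb u (V k - v).
    by rewrite (psdBl BL)// (psdBr BL)//; lra.
  apply: (le_trans (ler_normD _ _)); apply: lerD; last exact: nr_CS.
  apply: (le_trans (nr_CS sUu (sV k))); apply: ler_wpM2l; first exact: nr_ge0.
  by rewrite -{1}[V k](subrK v); exact: nrD.
apply/cvg_epsP => e e0.
have : nr (U k - u) * (nr (V k - v) + nr v) + nr u * nr (V k - v) @[k --> \oo] -->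
    0 * (0 + nr v) + nr u * 0.
  apply: cvgD; apply: cvgM => //; first by apply: cvgD => //; exact: cvg_cst.
  exact: cvg_cst.
rewrite mul0r mulr0 addr0 => /cvg_epsP/(_ _ e0)[N hN]; exists N => k /hN.
rewrite subr0 => h; apply: (le_trans (H k)); exact: le_trans (ler_norm _) h.
Qed.

Lemma ah_cvg u v : H1 u -> H1 v -> ah k u v @[k --> \oo] --> Da u v.
Proof.
move=> hu hv; rewrite /ah /Da.
elim: (index_enum _) => [|i r IH].
  by under eq_fun do rewrite big_nil; rewrite big_nil; exact: cvg_cst.
rewrite big_cons (_ : (fun k => _) = (fun k => ip leb (dq i (hk R k) u) (dq i (hk R k) v) +
   \sum_(j <- r) ip leb (dq j (hk R k) u) (dq j (hk R k) v))); last first.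
  by apply/funext => k; rewrite big_cons.
have [su sv] := (H1_sqi hu, H1_sqi hv).
apply: cvgD => //; apply: ip_cvg.
- by move=> k; exact: sqi_dq.
- by move=> k; exact: sqi_dq.
- exact: grad_sqi.
- exact: grad_sqi.
- by apply: dq_cvg => //; exact: gradP.
- by apply: dq_cvg => //; exact: gradP.
Qed.

Lemma psd_Da : psd (@H1 R n) Da.
Proof.
split.
- exact: H10.
- by move=> a u v; exact: H1_dom.
- move=> u v hu hv; apply: eq_bigr => i _; apply: (psd_sym BL); exact: grad_sqi.
- move=> a u v w hu hv hw.
  have c1 := ah_cvg (H1_dom a hu hv) hw.
  have c2 : ah k (a *: u + v) w @[k --> \oo] --> a * Da u w + Da v w.
    under eq_fun do rewrite (psd_lin (psd_ah _) _ (H1_sqi hu) (H1_sqi hv) (H1_sqi hw)).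
    apply: cvgD; last exact: ah_cvg.
    by apply: cvgM; [exact: cvg_cst|exact: ah_cvg].
  exact: (cvg_unique _ c1 c2).
- by move=> u hu; apply: sumr_ge0 => i _; apply: (psd_ge0 BL); exact: grad_sqi.
Qed.

Lemma Dr_ge0 u : H1 u -> 0 <= Dr u. Proof. exact: (psd_ge0 psd_Da). Qed.

Lemma nr_dq_le u i (h : R) : H1 u -> h != 0 -> `|h| <= 1 -> nr (dq i h u) ^+ 2 <= Dr u.
Proof.
move=> hu h0 h1; apply: (@le_trans _ _ (ip leb (gradient u i) (gradient u i))).
  rewrite -nr_sq; last exact: grad_sqi.
  apply: lerXn2r; rewrite ?nnegrE ?nr_ge0//.
  by apply: dq_le => //; [exact: H1_sqi|exact: gradP].
rewrite /Dr /Da (bigD1 i)//= lerDl; apply: sumr_ge0 => j _.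
by apply: (psd_ge0 BL); exact: grad_sqi.
Qed.

Lemma ah_le u k : H1 u -> ah k u u <= Dr u.
Proof.
move=> hu; apply: ler_sum => i _.
have := dq_le (H1_sqi hu) (gradP i hu) (lt0r_neq0 (hk_gt0 R k)).
rewrite (ger0_norm (ltW (hk_gt0 R k))) hk_le1 => /(_ isT) h.
rewrite -!nr_sq; [|exact: grad_sqi|apply: sqi_dq; exact: H1_sqi].
by apply: lerXn2r => //; rewrite ?nnegrE ?nr_ge0.
Qed.

Lemma H1_ah u (C : R) : sqi leb u -> (forall k, ah k u u <= C) -> H1 u /\ Dr u <= C.
Proof.
move=> su hC; have hu : H1 u.
  apply/H1P; split=> //.
  have /choice[G hG] i : exists g, wpd i u g; last by exists G.
  apply: (wpd_exists (C := C)) => // k; apply: le_trans (hC k).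
  rewrite /ah (bigD1 i)//= lerDl; apply: sumr_ge0 => j _.
  by apply: (psd_ge0 BL); exact: sqi_dq.
split=> //; have c := ah_cvg hu hu.
rewrite /Dr -(cvg_lim _ c)//; apply: limr_le; first by apply/cvg_ex; eexists; exact: c.
exact: nearW.
Qed.

Lemma ah_lsc (U : nat -> E -> R) u k (C : R) : (forall m, sqi leb (U m)) -> sqi leb u ->
  nr (U m - u) @[m --> \oo] --> 0 -> (forall m, ah k (U m) (U m) <= C) -> ah k u u <= C.
Proof.
move=> sU su cU hC.
have dU : forall i, nr (dq i (hk R k) (U m) - dq i (hk R k) u) @[m --> \oo] --> 0.
  move=> i; have e m : nr (dq i (hk R k) (U m) - dq i (hk R k) u) <= 2 / hk R k * nr (U m - u).
    have sd := psd_domB BL (sU m) su.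
    have -> : dq i (hk R k) (U m) - dq i (hk R k) u =
        (hk R k)^-1 *: (sh (hk R k *: ei R i) (U m - u) - (U m - u)).
      by apply/funext => x; rewrite /dq /sh !fctE /GRing.scale/=; ring.
    have ss := sqi_sh (hk R k *: ei R i) sd.
    apply: nr_small.
      by rewrite mulr_ge0 ?nr_ge0// divr_ge0// ltW// hk_gt0.
    rewrite (psd_sqZ BL); last exact: (psd_domB BL).
    rewrite exprMn nr_sq// exprMn [2 ^+ 2 * _]mulrC -[leRHS]mulrA.
    apply: ler_wpM2l; first by rewrite exprn_ge0// invr_ge0 ltW// hk_gt0.
    by apply: (le_trans (psd_sqB_le BL ss sd)); rewrite ip_sh// expr2; lra.
  apply/cvg_epsP => e0 e0p.
  have e1 : 0 < e0 / (2 / hk R k) by rewrite divr_gt0// divr_gt0// hk_gt0.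
  have [N hN] := (cvg_epsP _ _).1 cU _ e1; exists N => m /hN; rewrite !subr0.
  rewrite !ger0_norm ?nr_ge0// => h; apply: (le_trans (e m)).
  by rewrite mulrC -ler_pdivlMr// divr_gt0// hk_gt0.
have c : ah k (U m) (U m) @[m --> \oo] --> ah k u u.
  rewrite /ah; elim: (index_enum _) => [|i r IH].
    by under eq_fun do rewrite big_nil; rewrite big_nil; exact: cvg_cst.
  rewrite big_cons (_ : (fun m => _) = (fun m => ip leb (dq i (hk R k) (U m)) (dq i (hk R k) (U m)) +
    \sum_(j <- r) ip leb (dq j (hk R k) (U m)) (dq j (hk R k) (U m)))); last first.
    by apply/funext => m; rewrite big_cons.
  apply: cvgD => //; apply: ip_cvg => //; try by move=> m; exact: sqi_dq.
  - exact: sqi_dq.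
  - exact: sqi_dq.
rewrite -(cvg_lim _ c)//; apply: limr_le; first by apply/cvg_ex; eexists; exact: c.
exact: nearW.
Qed.

(** At a fixed step the difference form is continuous in L^2, and the Dirichlet integral is
    recovered as a limit of forms that it bounds. *)
Lemma Dr_lsc (U : nat -> E -> R) u (C : R) : (forall m, H1 (U m)) -> sqi leb u ->
  nr (U m - u) @[m --> \oo] --> 0 -> (forall m, Dr (U m) <= C) -> H1 u /\ Dr u <= C.
Proof.
move=> hU su cU hC; apply: H1_ah => // k; apply: (@ah_lsc U) => //.
  by move=> m; exact: H1_sqi.
by move=> m; apply: le_trans (hC m); exact: ah_le.
Qed.

(* Every inequality for the Dirichlet form is reduced to a pointwise one for finite differences. *)
Lemma ah_list_ge0 k (s : seq ((E -> R) * (E -> R))) w :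
  (forall p, List.In p s -> sqi leb p.1 /\ sqi leb p.2) -> integ leb w ->
  (forall i (h : R) x, 0 < h -> 0 <= \sum_(p <- s)
     (p.1 (x + h *: ei R i) - p.1 x) * (p.2 (x + h *: ei R i) - p.2 x) +
     h ^+ 2 * (w x + w (x + h *: ei R i))) ->
  0 <= \sum_(p <- s) ah k p.1 p.2 + 2 * n%:R * It leb w.
Proof.
move=> ss iw H; rewrite /ah exchange_big/=.
(* Each of the n directions contributes w and a translate of w, which have the same integral. *)
have -> : 2 * n%:R * It leb w = \sum_(i < n) 2 * It leb w.
  by rewrite sumr_const card_ord -[RHS]mulr_natl -!mulrA mulrCA.
rewrite -big_split/=; apply: sumr_ge0 => i _.
set h := hk R k; have h0 : 0 < h by exact: hk_gt0.
have isum : integ leb (\sum_(p <- s) dq i h p.1 * dq i h p.2) /\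
   It leb (\sum_(p <- s) dq i h p.1 * dq i h p.2) = \sum_(p <- s) ip leb (dq i h p.1) (dq i h p.2).
  elim: {H} s ss => [|p s IH] ss; first by rewrite !big_nil It0; split => //; exact: integ0.
  have [i1 i2] := IH (fun q hq => ss q (or_intror hq)).
  have [s1 s2] := ss p (or_introl erefl).
  have ip1 : integ leb (dq i h p.1 * dq i h p.2) by apply: sqiM; exact: sqi_dq.
  by rewrite !big_cons; split; [exact: integD|rewrite ItD// i2].
have [i1 <-] := isum.
have iw2 := integD iw (integ_sh (h *: ei R i) iw).
have -> : 2 * It leb w = It leb (w + sh (h *: ei R i) w).
  by rewrite ItD// ?It_sh//; [lra|exact: integ_sh].
rewrite -ItD//; apply: It_ge0 => x.
have := H i h x h0; rewrite !fctE fct_sumE => H0.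
have -> : \sum_(p <- s) (dq i h p.1 * dq i h p.2) x + (w x + sh (h *: ei R i) w x) =
    h^-1 ^+ 2 * (\sum_(p <- s)
     (p.1 (x + h *: ei R i) - p.1 x) * (p.2 (x + h *: ei R i) - p.2 x) +
     h ^+ 2 * (w x + w (x + h *: ei R i))).
  rewrite mulrDr mulrA -exprMn mulVf ?gt_eqF// expr1n mul1r; congr (_ + _).
  rewrite mulr_sumr; apply: eq_bigr => p _.
  by rewrite fctE !dqE expr2; ring.
by rewrite mulr_ge0// exprn_ge0// invr_ge0 ltW.
Qed.

Lemma Da_list_ge0 (s : seq ((E -> R) * (E -> R))) w :
  (forall p, List.In p s -> H1 p.1 /\ H1 p.2) -> integ leb w ->
  (forall i (h : R) x, 0 < h -> 0 <= \sum_(p <- s)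
     (p.1 (x + h *: ei R i) - p.1 x) * (p.2 (x + h *: ei R i) - p.2 x) +
     h ^+ 2 * (w x + w (x + h *: ei R i))) ->
  0 <= \sum_(p <- s) Da p.1 p.2 + 2 * n%:R * It leb w.
Proof.
move=> hs iw H.
have c : \sum_(p <- s) ah k p.1 p.2 + 2 * n%:R * It leb w @[k --> \oo] -->
    \sum_(p <- s) Da p.1 p.2 + 2 * n%:R * It leb w.
  apply: cvgD; last exact: cvg_cst.
  elim: {H} s hs => [|p s IH] hs.
    by under eq_fun do rewrite big_nil; rewrite big_nil; exact: cvg_cst.
  rewrite big_cons (_ : (fun k => _) = (fun k => ah k p.1 p.2 + \sum_(q <- s) ah k q.1 q.2)).
    have [h1 h2] := hs p (or_introl erefl).
    by apply: cvgD; [exact: ah_cvg|apply: IH => q hq; apply: hs; right].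
  by apply/funext => k; rewrite big_cons.
rewrite -(cvg_lim _ c)//; apply: limr_ge; first by apply/cvg_ex; eexists; exact: c.
apply: nearW => k; apply: ah_list_ge0 => // p hp.
by have [h1 h2] := hs p hp; split; exact: H1_sqi.
Qed.

Lemma H1_contraction u v : H1 u -> sqi leb v ->
  (forall x y, `|v x - v y| <= `|u x - u y|) -> H1 v /\ Dr v <= Dr u.
Proof.
move=> hu sv huv; apply: H1_ah => // k; apply: le_trans (ah_le k hu).
apply: ler_sum => i _; apply: ip_le; try by apply: sqi_dq => //; exact: H1_sqi.
by move=> x; rewrite !dqE !normrM; apply: ler_wpM2l.
Qed.

Lemma ah_ae k u u' v : sqi leb u -> sqi leb u' -> sqi leb v ->
  {ae leb, forall x, u x = u' x} -> ah k u v = ah k u' v.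
Proof.
move=> su su' sv e; apply: eq_bigr => i _.
have md f : sqi leb f -> mf (dq i (hk R k) f) by move=> [mf_ _]; exact: mf_dq.
apply: ip_ae; try exact: md; last exact: aeW.
by apply: filterS2 e (ae_sh (hk R k *: ei R i) e) => x h1 h2; rewrite !dqE h1 h2.
Qed.

Lemma H1_ae u u' : H1 u -> mf u' -> {ae leb, forall x, u x = u' x} -> H1 u'.
Proof.
move=> hu mu' e; have su := H1_sqi hu; have su' := sqi_ae su mu' e.
suff /(H1_ah su')[//] : forall k, ah k u' u' <= Dr u.
move=> k; have e' : {ae leb, forall x, u' x = u x} by apply: filterS e.
rewrite (ah_ae k su' su su' e') (psd_sym (psd_ah k))// (ah_ae k su' su su e').
exact: ah_le.
Qed.

Lemma Da_ae u u' v : H1 u -> H1 u' -> H1 v -> {ae leb, forall x, u x = u' x} -> Da u v = Da u' v.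
Proof.
move=> hu hu' hv e; have c1 := ah_cvg hu hv; have c2 := ah_cvg hu' hv.
have E k : ah k u v = ah k u' v by apply: ah_ae => //; exact: H1_sqi.
rewrite (_ : (fun k => ah k u v) = (fun k => ah k u' v)) in c1; last exact/funext.
exact: (cvg_unique _ c1 c2).
Qed.

Lemma Dr_ae u u' : H1 u -> H1 u' -> {ae leb, forall x, u x = u' x} -> Dr u = Dr u'.
Proof.
move=> hu hu' e.
by rewrite /Dr (Da_ae hu hu' hu e) (psd_sym psd_Da hu' hu) (Da_ae hu hu' hu' e).
Qed.

(** The gradients are bounded in L^2, so it is enough to pair them with a test function [psi] near
    the gradient of [phi]; there the derivative moves onto [psi] and L^2 convergence applies. *)
Lemma Da_weak_cvg (U : nat -> E -> R) u phi (C : R) : (forall m, H1 (U m)) -> H1 u -> H1 phi ->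
  nr (U m - u) @[m --> \oo] --> 0 -> (forall m, Dr (U m) <= C) ->
  Da (U m) phi @[m --> \oo] --> Da u phi.
Proof.
move=> hU hu hphi cU hC.
have su := H1_sqi hu.
rewrite /Da; elim: (index_enum _) => [|i r IH].
  by under eq_fun do rewrite big_nil; rewrite big_nil; exact: cvg_cst.
rewrite big_cons (_ : (fun m => _) = (fun m => ip leb (gradient (U m) i) (gradient phi i) +
   \sum_(j <- r) ip leb (gradient (U m) j) (gradient phi j))); last first.
  by apply/funext => m; rewrite big_cons.
apply: cvgD => //; apply/cvg_epsP => e e0.
pose K := Num.sqrt C + nr (gradient u i) + 1.
have K0 : 0 < K by rewrite ltr_wpDl// addr_ge0 ?sqrtr_ge0 ?nr_ge0.
have d0 : 0 < e / (2 * K) by rewrite divr_gt0// mulr_gt0.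
have sg := grad_sqi i hphi.
have [psi tpsi hpsi] := test_dense sg (exprn_gt0 2 d0).
have spsi := test_sqi tpsi; have sp := test_sqi (test_partial i tpsi).
have p1 : 0 < nr (partial i psi) + 1 by rewrite ltr_wpDl// nr_ge0.
have d1 : 0 < e / (2 * (nr (partial i psi) + 1)) by rewrite divr_gt0// mulr_gt0.
have [N hN] := (cvg_epsP _ _).1 cU _ d1; exists N => m /hN; rewrite subr0 ger0_norm ?nr_ge0// => hm.
have sm := H1_sqi (hU m); have sgm := grad_sqi i (hU m); have sgu := grad_sqi i hu.
set G := gradient (U m) i; set g := gradient u i.
have sGg : sqi leb (G - g) by exact: (psd_domB BL).
have sd := psd_domB BL spsi sg.
have -> : ip leb G (gradient phi i) - ip leb g (gradient phi i) =
    ip leb (G - g) psi - ip leb (G - g) (psi - gradient phi i).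
  by rewrite (psdBr BL)// [X in _ = X](_ : _ = ip leb (G - g) (gradient phi i)) ?(psdBl BL)//; lra.
have e1 : `|ip leb (G - g) psi| <= e / 2.
  have -> : ip leb (G - g) psi = - ip leb (U m - u) (partial i psi).
    rewrite !(psdBl BL)//; have [_ h1] := gradP i (hU m); have [_ h2] := gradP i hu.
    by rewrite h1// h2// /G /g; lra.
  rewrite normrN; apply: (le_trans (nr_CS (psd_domB BL sm su) sp)).
  apply: (le_trans (ler_wpM2r (nr_ge0 _) hm)).
  have -> : e / 2 = e / (2 * (nr (partial i psi) + 1)) * (nr (partial i psi) + 1).
    by field; rewrite gt_eqF.
  by apply: ler_wpM2l; [exact: ltW|rewrite lerDl].
have e2 : `|ip leb (G - g) (psi - gradient phi i)| <= e / 2.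
  apply: (le_trans (nr_CS sGg sd)).
  have h1 : nr (psi - gradient phi i) <= e / (2 * K) by apply: nr_small => //; exact: ltW.
  have h2 : nr (G - g) <= K.
    apply: (le_trans (nrD sgm (psd_domN BL sgu))).
    have -> : nr (- g) = nr g by rewrite /nr (psdNl BL) ?(psdNr BL) ?opprK//; exact: (psd_domN BL).
    rewrite /K -addrA; apply: lerD; last by rewrite lerDl.
    apply: ler_wsqrtr; apply: le_trans (hC m).
    rewrite /Dr /Da (bigD1 i)//= lerDl; apply: sumr_ge0 => j _.
    by apply: (psd_ge0 BL); exact: grad_sqi.
  have -> : e / 2 = K * (e / (2 * K)) by field; rewrite gt_eqF.
  by apply: ler_pM => //; exact: nr_ge0.
by apply: (le_trans (ler_normB _ _)); rewrite (splitr e); exact: lerD.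
Qed.

End dirichlet_form.

(** * Lattice operations and cutoffs in the Sobolev space *)

Section calculus.
Variables (R : realType) (n : nat).
Local Notation E := 'rV[R]_n.
Local Notation leb := (lebesgue_rV R n).
Implicit Types (u v w f g phi : E -> R) (x y : E) (i : 'I_n).
Let BL := psd_ip leb.
Let BD := @psd_Da R n.

Lemma H1Z (a : R) u : H1 u -> H1 (a *: u). Proof. exact: (psd_domZ BD). Qed.
Lemma H1D u v : H1 u -> H1 v -> H1 (u + v). Proof. exact: (psd_domD BD). Qed.
Lemma H1B u v : H1 u -> H1 v -> H1 (u - v). Proof. exact: (psd_domB BD). Qed.

Lemma H1_abs u : H1 u -> H1 (fun x => `|u x|) /\ Dr (fun x => `|u x|) <= Dr u.
Proof.
move=> hu; apply: H1_contraction => //; first by apply: sqi_abs; exact: H1_sqi.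
by move=> x y; exact: ler_dist_dist.
Qed.

Lemma minE u v : u \min v = 2^-1 *: (u + v - (fun x => `|u x - v x|)).
Proof.
apply/funext => x; rewrite !fctE /GRing.scale/=.
case: (leP (u x) (v x)) => h.
  by rewrite ler0_norm ?subr_le0//; field.
by rewrite ger0_norm ?subr_ge0 ?(ltW h)//; field.
Qed.

Lemma H1_min u v : H1 u -> H1 v -> H1 (u \min v).
Proof.
move=> hu hv; rewrite minE; apply: H1Z; apply: H1B; first exact: H1D.
by case: (H1_abs (H1B hu hv)).
Qed.

Lemma maxE u v : u \max v = u + v - (u \min v).
Proof. by apply/funext => x; rewrite !fctE /=; case: (leP (u x) (v x)) => h; ring. Qed.

Lemma H1_max u v : H1 u -> H1 v -> H1 (u \max v).
Proof. by move=> hu hv; rewrite maxE; apply: H1B; [exact: H1D|exact: H1_min]. Qed.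

Lemma Da_mono u v : H1 u -> H1 v ->
  (forall x y, 0 <= (u y - u x) * (v y - v x)) -> 0 <= Da u v.
Proof.
move=> hu hv huv.
have := @Da_list_ge0 R n [:: (u, v)] 0 _ (integ0 leb).
rewrite big_seq1 It0 mulr0 addr0; apply.
  by move=> p /= [<-|//].
by move=> i h x h0; rewrite big_seq1 addr0 mulr0 addr0; exact: huv.
Qed.

Lemma Dr_add_mono u v : H1 u -> H1 v ->
  (forall x y, 0 <= (u y - u x) * (v y - v x)) -> Dr u + Dr v <= Dr (u + v).
Proof.
move=> hu hv huv; rewrite /Dr (psd_sqD BD)//.
by have := Da_mono hu hv huv; lra.
Qed.

(** Submodularity. For finite differences it is a rearrangement inequality between the pairs (u x, v
    x) and (u y, v y), decided by cases on their order. *)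
Lemma Dr_lattice u v : H1 u -> H1 v -> Dr (u \min v) + Dr (u \max v) <= Dr u + Dr v.
Proof.
move=> hu hv; have hm := H1_min hu hv; have hM := H1_max hu hv.
have := @Da_list_ge0 R n [:: (u, u); (v, v); (- (u \min v), u \min v); (- (u \max v), u \max v)] 0 _ (integ0 leb).
rewrite !big_cons big_nil It0 /= mulr0 !addr0 !(psdNl BD)// => H.
rewrite -subr_ge0; apply: le_trans (H _ _) _; last by rewrite /Dr; lra.
  by move=> p /= [<-|[<-|[<-|[<-|//]]]]; split => //; exact: (psd_domN BD).
move=> i h x h0; rewrite !big_cons big_nil /= !fctE /= !addr0 mulr0 addr0.
set a := u x; set b := v x; set c := u _; set d := v _.
by case: (leP a b) => h1; case: (leP c d) => h2; nra.
Qed.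

Lemma H1_minc u (k : R) : 0 <= k -> H1 u -> H1 (fun x => Num.min (u x) k).
Proof.
move=> k0 hu; have su := H1_sqi hu.
apply: (H1_contraction hu _ _).1.
  apply: (sqi_le su); first by apply: mf_min => //; case: su.
  move=> x; case: (leP (u x) k) => h //; rewrite !ger0_norm//; first exact: ltW.
  exact: le_trans (ltW h).
move=> x y; case: (leP (u x) k) => h; case: (leP (u y) k) => h'; rewrite ?subrr ?normr0//.
  by rewrite ler0_norm ?subr_le0// ler0_norm; lra.
by rewrite ger0_norm ?subr_ge0// ger0_norm; lra.
Qed.

Lemma Dr_minc u (k : R) : 0 <= k -> H1 u ->
  Dr (fun x => Num.min (u x) k) + Dr (u - (fun x => Num.min (u x) k)) <= Dr u.
Proof.
move=> k0 hu; have h1 := H1_minc k0 hu; have h2 := H1B hu h1.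
have e : (fun x => Num.min (u x) k) + (u - (fun x => Num.min (u x) k)) = u by rewrite addrC subrK.
have := Dr_add_mono h1 h2; rewrite e; apply => x y; rewrite !fctE.
case: (leP (u x) k) => h; case: (leP (u y) k) => h'; nra.
Qed.

(** The Lipschitz bound is asked only along positive steps in the axis directions, which are the
    ones that the difference forms see. *)
Definition cutoff (L : R) (eta : E -> R) := [/\ mf eta, forall x, 0 <= eta x <= 1, 0 <= L &
  forall i (h : R) x, 0 < h -> `|eta (x + h *: ei R i) - eta x| <= L * h].

Lemma sqi_cut L eta u : cutoff L eta -> sqi leb u -> sqi leb (eta * u).
Proof.
move=> [me e01 _ _] su; apply: (sqi_le su); first by apply: mfM => //; case: su.
move=> x; rewrite fctE normrM; have /andP[h1 h2] := e01 x.
by rewrite ger0_norm// ler_piMl.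
Qed.

(** Split eta' u' - eta u as eta' (u' - u) + (eta' - eta) u. The second part has square at most (L
    h)^2 u^2, whence the weight 2 L^2 u^2 and, summed over directions, the constant 4 n L^2. *)
Lemma H1_cut L eta u : cutoff L eta -> H1 u ->
  H1 (eta * u) /\ Dr (eta * u) <= 2 * Dr u + 4 * n%:R * L ^+ 2 * ip leb u u.
Proof.
move=> ce hu; have su := H1_sqi hu; have sc := sqi_cut ce su; have [me e01 L0 eL] := ce.
have BA k := @psd_ah R n k.
apply: H1_ah => // k.
have := @ah_list_ge0 R n k [:: (2 *: u, u); (- (eta * u), eta * u)] ((2 * L ^+ 2) *: (u * u)) _
  (integZ _ (sqiM su su)).
rewrite !big_cons big_nil /= addr0 (psdZl (BA k))// (psdNl (BA k))// ItZ; last exact: sqiM.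
rewrite -/(ip leb u u) => H.
have {H} := H _ _; have a1 := ah_le k hu.
set I0 := ip leb u u; set A1 := ah k u u in a1 *; set A2 := ah k (eta * u) (eta * u).
move=> H; suff : 0 <= 2 * A1 + (- A2 + 0) + 2 * n%:R * (2 * L ^+ 2 * I0).
  by move: a1; rewrite addr0; nra.
rewrite addr0; apply: H.
  by move=> p /= [<-|[<-|//]] /=; split => //; [exact: (psd_domZ BL)|exact: (psd_domN BL)].
move=> i h x h0; rewrite !big_cons big_nil /= !fctE /GRing.scale/= addr0.
set y := x + _; have e1 := eL i h x h0; rewrite -/y in e1.
have /andP[c1 c2] := e01 y; set a := u x; set b := u y; set p := eta x; set q := eta y.
have -> : q * b - p * a = q * (b - a) + (q - p) * a by ring.
have h1 : (q - p) ^+ 2 <= (L * h) ^+ 2.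
  by rewrite -[leLHS]real_normK ?num_real//; apply: lerXn2r; rewrite ?nnegrE ?mulr_ge0// ltW.
have h2 : q ^+ 2 <= 1 by rewrite expr_le1.
have h3 : 0 <= (q * (b - a) - (q - p) * a) ^+ 2 by exact: sqr_ge0.
have h4 : (q * (b - a)) ^+ 2 <= (b - a) ^+ 2 by rewrite exprMn ler_piMl ?sqr_ge0.
have h5 : ((q - p) * a) ^+ 2 <= (L * h) ^+ 2 * a ^+ 2 by rewrite exprMn ler_wpM2r ?sqr_ge0.
have h6 : 0 <= h ^+ 2 * (2 * L ^+ 2 * (b * b)).
  apply: mulr_ge0; first exact: sqr_ge0.
  by apply: mulr_ge0; [rewrite mulr_ge0// sqr_ge0|rewrite -expr2 sqr_ge0].
have -> : - (q * b) - - (p * a) = - (q * (b - a) + (q - p) * a) by ring.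
move: h3 h4 h5 h6; move: (q * (b - a)) => X; move: ((q - p) * a) => Y.
rewrite !exprMn !expr2 => h3 h4 h5 h6.
have : 0 <= (h * (L * a)) ^+ 2 by exact: sqr_ge0.
by rewrite !exprMn !expr2; nra.
Qed.

(* (eta' u' - eta u)^2 = (u' - u)(eta'^2 u' - eta^2 u) + u u' (eta' - eta)^2 *)
Lemma Dr_cut L eta u : cutoff L eta -> H1 u ->
  Dr (eta * u) <= Da u (eta * (eta * u)) + n%:R * L ^+ 2 * ip leb u u.
Proof.
move=> ce hu; have [hc _] := H1_cut ce hu; have [hcc _] := H1_cut ce hc.
have su := H1_sqi hu; have [me e01 L0 eL] := ce.
have := @Da_list_ge0 R n [:: (u, eta * (eta * u)); (- (eta * u), eta * u)] ((L ^+ 2 / 2) *: (u * u)) _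
  (integZ _ (sqiM su su)).
rewrite !big_cons big_nil /= addr0 (psdNl BD)// ItZ; last exact: sqiM.
rewrite -/(ip leb u u) -/(Dr (eta * u)).
set I0 := ip leb u u; set A1 := Dr _; set A2 := Da _ _.
move=> H; suff : 0 <= A2 + (- A1 + 0) + 2 * n%:R * (L ^+ 2 / 2 * I0) by lra.
rewrite addr0; apply: H.
  by move=> p /= [<-|[<-|//]] /=; split => //; exact: (psd_domN BD).
move=> i h x h0; rewrite !big_cons big_nil /= !fctE /GRing.scale/= addr0.
set y := x + _; have e1 := eL i h x h0; rewrite -/y in e1.
set a := u x; set b := u y; set p := eta x; set q := eta y.
have -> : (b - a) * (q * (q * b) - p * (p * a)) + (- (q * b) - - (p * a)) * (q * b - p * a) =
   - (a * b * (q - p) ^+ 2) by ring.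
have h1 : (q - p) ^+ 2 <= (L * h) ^+ 2.
  by rewrite -[leLHS]real_normK ?num_real//; apply: lerXn2r; rewrite ?nnegrE ?mulr_ge0// ltW.
have h2 : 2 * (a * b) <= a * a + b * b by have := sqr_ge0 (a - b); rewrite expr2; lra.
have h3 : 0 <= (q - p) ^+ 2 by exact: sqr_ge0.
have h4 : 0 <= a * a + b * b by rewrite addr_ge0// -expr2 sqr_ge0.
rewrite addrC subr_ge0; apply: (@le_trans _ _ ((a * a + b * b) / 2 * (q - p) ^+ 2)).
  by apply: ler_wpM2r => //; lra.
apply: (@le_trans _ _ ((a * a + b * b) / 2 * (L * h) ^+ 2)).
  by apply: ler_wpM2l => //; lra.
by rewrite exprMn le_eqVlt; apply/orP; left; apply/eqP; field.
Qed.

End calculus.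

(** * The Poincare inequality on a grid of cells *)

Section cells.
Variables (R : realType) (n : nat).
Local Notation E := 'rV[R]_n.
Local Notation leb := (lebesgue_rV R n).
Implicit Types (u v w f g phi : E -> R) (x y : E) (i : 'I_n).
Let BL := psd_ip leb.

Lemma mf_indic_comp d (T : measurableType d) (g : T -> E) (A : set E) :
  measurable_fun setT g -> measurable A -> measurable_fun setT (fun t : T => \1_A (g t) : R).
Proof.
move=> mg mA; have -> : (fun t : T => \1_A (g t) : R) = \1_(g @^-1` A) by [].
by apply: mf_indic; rewrite -[X in measurable X]setTI; exact: mg.
Qed.

Lemma measurable_addv : measurable_fun setT (fun p : E * E => p.1 + p.2).
Proof.
apply: (measurability [set orect p.1 p.2 | p in [set: E * E]]).
  by rewrite rect_sigma.
move=> _ [_ [p _ <-] <-]; rewrite setTI.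
have -> : (fun p0 : E * E => p0.1 + p0.2) @^-1` orect p.1 p.2 = \bigcap_(i in [set: 'I_n])
   ([set q : E * E | p.1 ord0 i < q.1 ord0 i + q.2 ord0 i] `&`
    [set q : E * E | q.1 ord0 i + q.2 ord0 i < p.2 ord0 i]).
  apply/seteqP; split=> q h i; first by move=> _; have := h i; rewrite mxE => /andP[].
  by rewrite mxE; apply/andP; exact: h.
have mc i : measurable_fun setT (fun q : E * E => q.1 ord0 i + q.2 ord0 i).
  apply: measurable_funD.
    exact: (measurableT_comp (measurable_coord i)).
  exact: (measurableT_comp (measurable_coord i)).
apply: fin_bigcap_measurable => [|i _]; first exact: finite_finset.
by apply: measurableI; apply: mset_lt.
Qed.

(** Only axis quotients are controlled, so the translation is made one coordinate at a time; this is
    the origin of the factor n in [nr_shift]. *)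
Lemma nr_shift_le v (l : seq 'I_n) (z : 'I_n -> R) (r : R) : H1 v -> 0 <= r <= 1 ->
  (forall i, `|z i| <= r) ->
  nr (sh (\sum_(i <- l) z i *: ei R i) v - v) <= (size l)%:R * r * Num.sqrt (Dr v).
Proof.
move=> hv /andP[r0 r1] hz; have sv := H1_sqi hv.
elim: l => [|i l IH].
  by rewrite big_nil sh0 subrr /nr (psd0l BL) ?sqrtr0 ?mul0r//; exact: psd_dom0 BL.
rewrite big_cons -shD; set c := \sum_(j <- l) _ in IH *.
have -> : sh (z i *: ei R i) (sh c v) - v =
   sh (z i *: ei R i) (sh c v - v) + (sh (z i *: ei R i) v - v).
  by apply/funext => x; rewrite /sh !fctE; ring.
have s1 : sqi leb (sh c v - v) by apply: (psd_domB BL) => //; exact: sqi_sh.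
have s2 : sqi leb (sh (z i *: ei R i) v - v) by apply: (psd_domB BL) => //; exact: sqi_sh.
apply: (le_trans (nrD (sqi_sh _ s1) s2)); rewrite nr_sh//.
have : nr (sh (z i *: ei R i) v - v) <= r * Num.sqrt (Dr v).
  have [z0|z0] := eqVneq (z i) 0.
    rewrite z0 scale0r sh0 subrr /nr (psd0l BL) ?sqrtr0 ?mulr_ge0 ?sqrtr_ge0//.
    exact: psd_dom0 BL.
  have -> : sh (z i *: ei R i) v - v = z i *: dq i (z i) v.
    by rewrite /dq scalerA mulfV// scale1r.
  have sd := sqi_dq i (z i) sv.
  have := nr_dq_le i hv z0 (le_trans (hz i) r1) => h.
  rewrite /nr (psd_sqZ BL)// sqrtrM ?sqr_ge0// sqrtr_sqr; apply: ler_pM => //.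
  by apply: ler_wsqrtr; rewrite -nr_sq.
by rewrite /= -natr1; move: IH; lra.
Qed.

Lemma sum_ei (z : E) : z = \sum_(i < n) z ord0 i *: ei R i.
Proof.
apply/rowP => j; rewrite summxE (bigD1 j)//= !mxE !eqxx mulr1 big1 ?addr0// => i ij.
by rewrite !mxE eqxx (eq_sym j) (negbTE ij) mulr0.
Qed.

Lemma nr_shift v (z : E) (r : R) : H1 v -> 0 <= r <= 1 -> (forall i, `|z ord0 i| <= r) ->
  ip leb (sh z v - v) (sh z v - v) <= n%:R ^+ 2 * r ^+ 2 * Dr v.
Proof.
move=> hv r01 hz; have sv := H1_sqi hv.
have := nr_shift_le (enum 'I_n) hv r01 hz.
rewrite big_enum /= -sum_ei size_enum_ord.
have s1 : sqi leb (sh z v - v) by apply: (psd_domB BL) => //; exact: sqi_sh.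
move=> h; rewrite -nr_sq//; apply: (@le_trans _ _ ((n%:R * r * Num.sqrt (Dr v)) ^+ 2)).
  have /andP[r0 _] := r01.
  by apply: lerXn2r => //; rewrite nnegrE ?nr_ge0// ?mulr_ge0 ?sqrtr_ge0.
by rewrite exprMn exprMn sqr_sqrtr ?Dr_ge0.
Qed.

(** Tonelli in the variables x and y - x, then [nr_shift] for each displacement in the cube. *)
Lemma double_shift_bound v (r : R) : H1 v -> 0 < r <= 1 ->
  (\int[leb]_x \int[leb]_y (\1_(cube (const_mx (- r)) (2 * r)) (y - x) * (v y - v x) ^+ 2)%:E
   <= ((2 * r) ^+ n * (n%:R ^+ 2 * r ^+ 2 * Dr v))%:E)%E.
Proof.
move=> hv /andP[r0 r1]; set Q := cube _ _.
have mQ : measurable Q by exact: measurable_cube.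
have mv : mf v by exact: H1_mf.
pose F (p : E * E) : \bar R := (\1_Q p.2 * (v (p.1 + p.2) - v p.1) ^+ 2)%:E.
have mF : measurable_fun setT F.
  apply/measurable_EFinP; apply: measurable_funM.
    by apply: (@mf_indic_comp _ _ snd) => //; exact: measurable_snd.
  apply: measurable_funX; apply: measurable_funB.
    exact: (measurableT_comp mv measurable_addv).
  by apply: (measurableT_comp mv); exact: measurable_fst.
have F0 p : (0 <= F p)%E by rewrite lee_fin mulr_ge0 ?sqr_ge0// indicE.
have -> : (\int[leb]_x \int[leb]_y (\1_Q (y - x) * (v y - v x) ^+ 2)%:E =
   \int[leb]_x \int[leb]_z F (x, z))%E.
  apply: eq_integral => x _.
  have m1 : measurable_fun setT (fun y : E => (\1_Q (y - x) * (v y - v x) ^+ 2)%:E).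
    apply/measurable_EFinP; apply: measurable_funM.
      by apply: (@mf_indic_comp _ _ (fun y : E => y - x)) => //; exact: measurable_shiftv.
    by apply: measurable_funX; apply: measurable_funB.
  rewrite -(ge0_integral_sh x m1); last first.
    by move=> y; rewrite lee_fin mulr_ge0 ?sqr_ge0// indicE.
  by apply: eq_integral => z _; rewrite /F /= addrK [z + x]addrC.
have -> : (\int[leb]_x \int[leb]_z F (x, z) = \int[leb]_z \int[leb]_x F (x, z))%E.
  exact: (@fubini_tonelli _ _ _ _ R leb leb F mF F0).
have HI z : (\int[leb]_x F (x, z) <= (\1_Q z * (n%:R ^+ 2 * r ^+ 2 * Dr v))%:E)%E.
  rewrite /F /= indicE; have [zQ|zQ] := boolP (z \in Q); last first.
    by rewrite mul0r integral0_eq// => x _; rewrite mul0r.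
  have sv := H1_sqi hv.
  have s1 : sqi leb (sh z v - v) by apply: (psd_domB BL) => //; exact: sqi_sh.
  rewrite mul1r; apply: (@le_trans _ _ (ip leb (sh z v - v) (sh z v - v))%:E).
    rewrite /ip ItE; last exact: sqiM.
    rewrite le_eqVlt; apply/orP; left; apply/eqP; apply: eq_integral => x _.
    by rewrite mul1r expr2 /sh.
  rewrite lee_fin; apply: nr_shift => //; first by rewrite ltW.
  move=> i; move/set_mem: zQ => /(_ i); rewrite mxE ler_norml => /andP[-> h2] /=.
  by move: h2; lra.
apply: (@le_trans _ _ (\int[leb]_z (\1_Q z * (n%:R ^+ 2 * r ^+ 2 * Dr v))%:E)%E).
  apply: ge0_le_integral => //.
  - by move=> z _; apply: integral_ge0 => x _; exact: F0.
  - exact: measurable_fun_fubini_tonelli_G.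
  - by apply/measurable_EFinP; apply: measurable_funM => //; exact: mf_indic.
have c0 : 0 <= n%:R ^+ 2 * r ^+ 2 * Dr v by rewrite mulr_ge0 ?Dr_ge0// mulr_ge0 ?sqr_ge0.
under eq_integral do rewrite mulrC EFinM.
rewrite ge0_integralZl_EFin//; last by apply/measurable_EFinP; exact: mf_indic.
rewrite integral_indic// setIT.
rewrite [leRHS]EFinM [leRHS]muleC le_eqVlt; apply/orP; left; apply/eqP.
by congr (_ * _)%E; apply: lebesgue_cube; lra.
Qed.

Definition gcell (a : E) (r : R) N (z : {ffun 'I_n -> 'I_N}) : set E :=
  cube (a + \row_i (r * (z i)%:R)) r.

Lemma gcell_disj a (r : R) N (z z' : {ffun 'I_n -> 'I_N}) x : 0 < r ->
  gcell a r z x -> gcell a r z' x -> z = z'.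
Proof.
move=> r0 h h'; apply/ffunP => i; apply/val_inj.
have := h i; have := h' i; rewrite !mxE => /andP[h1 h2] /andP[h3 h4].
have l1 : r * (z i)%:R < r * (z' i).+1%:R by rewrite -natr1; lra.
have l2 : r * (z' i)%:R < r * (z i).+1%:R by rewrite -natr1; lra.
move: l1 l2; rewrite !ltr_pM2l// !ltr_nat !ltnS => l1 l2.
by apply/eqP; rewrite eqn_leq l1 l2.
Qed.

Lemma gcell_cover a (r : R) N x : 0 < r -> cube a (r * N%:R) x ->
  exists z : {ffun 'I_n -> 'I_N}, gcell a r z x.
Proof.
move=> r0 hx; have N0 i : (Num.trunc ((x ord0 i - a ord0 i) / r) < N)%N.
  have /andP[h1 h2] := hx i.
  rewrite -(ltr_nat R); apply: le_lt_trans (_ : (x ord0 i - a ord0 i) / r < _).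
    have t0 : 0 <= (x ord0 i - a ord0 i) / r by rewrite divr_ge0 ?subr_ge0// ltW.
    by have /andP[] := truncn_itv t0.
  by rewrite ltr_pdivrMr// mulrC ltrBlDl.
exists [ffun i => Ordinal (N0 i)] => i; rewrite !mxE ffunE /=.
have /andP[h1 h2] := hx i.
have t0 : 0 <= (x ord0 i - a ord0 i) / r by rewrite divr_ge0 ?subr_ge0// ltW.
have /andP[h3 h4] := truncn_itv t0.
move: h3 h4; rewrite ler_pdivlMr// ltr_pdivrMr// -natr1; set T := (Num.trunc _)%:R => h3 h4.
by apply/andP; split; lra.
Qed.

Lemma gcell_sub a (r : R) N (z : {ffun 'I_n -> 'I_N}) : 0 < r -> gcell a r z `<=` cube a (r * N%:R).
Proof.
move=> r0 x hx i; have := hx i; rewrite !mxE => /andP[h1 h2].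
have h3 : 0 <= r * (z i)%:R by rewrite mulr_ge0// ltW.
have h4 : r * (z i).+1%:R <= r * N%:R by rewrite ler_pM2l// ler_nat.
by move: h4; rewrite -natr1 => h4; apply/andP; split; lra.
Qed.

(** Over a cell, the double integral of (v y - v x)^2 is 2 r^n times the integral of v^2 minus twice
    the squared integral of v. Two points of a cell differ by at most r in each coordinate, so a
    single use of [double_shift_bound] pays for all the cells together. *)
Lemma cell_poincare v (r : R) a N : H1 v -> 0 < r <= 1 ->
  It leb (v * v * \1_(cube a (r * N%:R))) <=
  (r ^+ n)^-1 * \sum_(z : {ffun 'I_n -> 'I_N}) It leb (v * \1_(gcell a r z)) ^+ 2 +
  2 ^+ n * n%:R ^+ 2 * r ^+ 2 * Dr v.
Proof.
move=> hv r01; have /andP[r0 r1] := r01; have sv := H1_sqi hv; have mv := sv.1.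
pose C (z : {ffun 'I_n -> 'I_N}) := gcell a r z.
have mC z : measurable (C z) by exact: measurable_cube.
have lC z : leb (C z) = (r ^+ n)%:E by apply: lebesgue_cube; exact: ltW.
have fC z : (leb (C z) < +oo)%E by rewrite lC ltry.
have sC z : sqi leb (\1_(C z) : E -> R) by exact: sqi_indic.
have iC z : integ leb (\1_(C z) : E -> R) by exact: integ_indic.
have ICz z : It leb (\1_(C z) : E -> R) = r ^+ n by rewrite It_indic// lC.
pose m z := It leb (v * \1_(C z)); pose q z := It leb (v * v * \1_(C z)).
have im z : integ leb (v * \1_(C z)) by exact: sqiM.
have svC z : sqi leb (v * \1_(C z)).
  apply: (sqi_le sv); first by apply: mfM => //; exact: mf_indic.
  by move=> x; rewrite fctE normrM indicE; case: (_ \in _); rewrite ?normr1 ?mulr1 ?normr0 ?mulr0.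
have iq z : integ leb (v * v * \1_(C z)) by rewrite -mulrA; exact: sqiM.
(* At a point of a cell, [f] is the inner integral of (v y - v x)^2 over that cell, expanded so that
   its own integral follows by linearity. *)
pose f : E -> R := \sum_z ((r ^+ n) *: (v * v * \1_(C z)) - (2 * m z) *: (v * \1_(C z)) + q z *: \1_(C z)).
have if1 z : integ leb ((r ^+ n) *: (v * v * \1_(C z)) - (2 * m z) *: (v * \1_(C z)) + q z *: \1_(C z)).
  by apply: integD; [apply: integB|]; apply: integZ.
have intf : integ leb f by exact: integ_sum.
have Itf : It leb f = \sum_z (2 * r ^+ n * q z - 2 * m z ^+ 2).
  rewrite /f It_sum//; apply: eq_bigr => z _.
  rewrite ItD; [|by apply: integB; apply: integZ|exact: integZ].
  rewrite ItB; [|exact: integZ|exact: integZ].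
  rewrite !ItZ// ICz -/(q z) -/(m z); ring.
have key : ((It leb f)%:E <= ((2 * r) ^+ n * (n%:R ^+ 2 * r ^+ 2 * Dr v))%:E)%E.
  apply: le_trans (double_shift_bound hv r01); rewrite ItE//.
  apply: (@le_trans _ _ (\int[leb]_x (`|f x|)%:E)%E).
    apply: le_integral => //; first exact: integ_abs.
    by move=> x _; rewrite lee_fin ler_norm.
  have fE x : f x = \sum_z \1_(C z) x * (r ^+ n * v x ^+ 2 - 2 * m z * v x + q z).
    rewrite /f fct_sumE; apply: eq_bigr => z _; rewrite !fctE /GRing.scale/=; ring.
  have inner x z : It leb (fun y => \1_(C z) y * (v y - v x) ^+ 2) = r ^+ n * v x ^+ 2 - 2 * m z * v x + q z.
    have -> : (fun y => \1_(C z) y * (v y - v x) ^+ 2) =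
       v * v * \1_(C z) - (2 * v x) *: (v * \1_(C z)) + (v x ^+ 2) *: \1_(C z).
      by apply/funext => y; rewrite !fctE /GRing.scale/=; ring.
    rewrite ItD; [|by apply: integB => //; apply: integZ|exact: integZ].
    rewrite ItB; [|by []|exact: integZ].
    rewrite !ItZ// ICz -/(q z) -/(m z); ring.
  have innert x z : integ leb (fun y => \1_(C z) y * (v y - v x) ^+ 2).
    have -> : (fun y => \1_(C z) y * (v y - v x) ^+ 2) =
       v * v * \1_(C z) - (2 * v x) *: (v * \1_(C z)) + (v x ^+ 2) *: \1_(C z).
      by apply/funext => y; rewrite !fctE /GRing.scale/=; ring.
    by apply: integD; [apply: integB => //; apply: integZ|exact: integZ].
  have mG : measurable_fun setT (fun x : E =>
      (\int[leb]_y (\1_(cube (const_mx (- r)) (2 * r)) (y - x) * (v y - v x) ^+ 2)%:E)%E).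
    apply: (@measurable_fun_fubini_tonelli_F _ _ _ _ R leb
       (fun p : E * E => (\1_(cube (const_mx (- r)) (2 * r)) (p.2 - p.1) * (v p.2 - v p.1) ^+ 2)%:E)).
      apply/measurable_EFinP; apply: measurable_funM.
        apply: (@mf_indic_comp _ _ (fun p : E * E => p.2 - p.1)); last exact: measurable_cube.
        have h : measurable_fun setT (fun p : E * E => (p.2, - p.1)).
          apply/measurable_fun_pairP; split; first exact: measurable_snd.
          apply: (measurableT_comp (f := fun x : E => - x)); last exact: measurable_fst.
          by apply: continuous_measurable_rV; exact: opp_continuous.
        exact: (measurableT_comp measurable_addv h).
      apply: measurable_funX; apply: measurable_funB.
        by apply: (measurableT_comp mv); exact: measurable_snd.
      by apply: (measurableT_comp mv); exact: measurable_fst.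
    by move=> p; rewrite lee_fin mulr_ge0 ?sqr_ge0// indicE.
  apply: ge0_le_integral => //.
  - by apply/measurable_EFinP; apply: mf_norm; exact: integ_mf intf.
  move=> x _; rewrite fE.
  have [xB|xB] := pselect (exists z, C z x); last first.
    rewrite big1 ?normr0; last first.
      by move=> z _; rewrite indicE memNset ?mul0r// => h; apply: xB; exists z.
    by apply: integral_ge0 => y _; rewrite lee_fin mulr_ge0 ?sqr_ge0// indicE.
  have [z Cz] := xB.
  rewrite (bigD1 z)//= indicE mem_set// mul1r big1 ?addr0; last first.
    move=> z' zz'; rewrite indicE memNset ?mul0r// => h.
    by move: zz'; rewrite (gcell_disj r0 h Cz) eqxx.
  rewrite -inner ger0_norm; last first.
    by apply: It_ge0 => y; rewrite mulr_ge0 ?sqr_ge0// indicE.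
  rewrite ItE//; apply: ge0_le_integral => //.
  - by move=> y _; rewrite lee_fin mulr_ge0 ?sqr_ge0// indicE.
  - by apply/measurable_EFinP; exact: integ_mf (innert x z).
  - apply/measurable_EFinP; apply: measurable_funM.
      apply: (@mf_indic_comp _ _ (fun y : E => y - x)); last exact: measurable_cube.
      exact: measurable_shiftv.
    by apply: measurable_funX; apply: measurable_funB.
  move=> y _; rewrite lee_fin; apply: ler_wpM2r; first exact: sqr_ge0.
  rewrite !indicE; have [yC|//] := boolP (y \in C z).
  rewrite mem_set// => i; have := Cz i; move/set_mem: yC => /(_ i).
  by rewrite !mxE => /andP[h1 h2] /andP[h3 h4]; apply/andP; split; lra.
have Eq : It leb (v * v * \1_(cube a (r * N%:R))) = \sum_z q z.
  rewrite /q -It_sum//; apply: It_ext => x; rewrite fct_sumE fctE.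
  have [xB|xB] := pselect (cube a (r * N%:R) x).
    have [z Cz] := gcell_cover r0 xB.
    rewrite (bigD1 z)//= big1 ?addr0; last first.
      move=> z' zz'; rewrite fctE indicE memNset ?mulr0// => h.
      by move: zz'; rewrite (gcell_disj r0 h Cz) eqxx.
    by rewrite !mulrfctE !indicE !mem_set.
  rewrite big1; first by rewrite indicE memNset ?mulr0.
  move=> z _; rewrite fctE indicE memNset ?mulr0// => h; apply: xB.
  exact: gcell_sub h.
move: key; rewrite Itf lee_fin Eq -/m => key.
have rn : 0 < r ^+ n by exact: exprn_gt0.
have e1 : \sum_z (2 * r ^+ n * q z - 2 * m z ^+ 2) = 2 * r ^+ n * \sum_z q z - 2 * \sum_z m z ^+ 2.
  by rewrite big_split/= !mulr_sumr; congr (_ + _); rewrite -sumrN; apply: eq_bigr => z _.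
rewrite e1 in key.
rewrite -[X in _ <= _ * X + _]/(\sum_z m z ^+ 2).
set Sq := \sum_z q z in key *; set Sm := \sum_z _ in key *; set D := Dr v in key *.
have D0 : 0 <= D by exact: Dr_ge0.
rewrite -(ler_pM2l rn) mulrDr mulrA mulfV ?gt_eqF// mul1r.
move: key; rewrite exprMn; set K := n%:R ^+ 2 * r ^+ 2 * D => key.
have K0 : 0 <= K by rewrite mulr_ge0// mulr_ge0 ?sqr_ge0.
have -> : r ^+ n * (2 ^+ n * n%:R ^+ 2 * r ^+ 2 * D) = 2 ^+ n * r ^+ n * K by rewrite /K; ring.
have : 0 <= 2 ^+ n * r ^+ n * K by rewrite mulr_ge0// mulr_ge0 ?exprn_ge0// ltW.
lra.
Qed.

End cells.

Lemma lim_le (R : realType) (v : nat -> R) (l C : R) : v m @[m --> \oo] --> l ->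
  (forall m, v m <= C) -> l <= C.
Proof. by move=> vl vC; apply: (ler_cvg_to vl (cvg_cst C)); exact: nearW. Qed.

Lemma lim_ge (R : realType) (v : nat -> R) (l C : R) : v m @[m --> \oo] --> l ->
  (forall m, C <= v m) -> C <= l.
Proof. by move=> vl vC; apply: (ler_cvg_to (cvg_cst C) vl); exact: nearW. Qed.

Lemma cvg_sumr (R : realType) I (r : seq I) (f : I -> nat -> R) (l : I -> R) :
  (forall i, f i m @[m --> \oo] --> l i) ->
  \sum_(i <- r) f i m @[m --> \oo] --> \sum_(i <- r) l i.
Proof.
move=> h; elim: r => [|i r IH].
  by rewrite big_nil; under eq_fun do rewrite big_nil; exact: cvg_cst.
rewrite big_cons; under eq_fun do rewrite big_cons; exact: cvgD.
Qed.

(** * Nash and Faber-Krahn inequalities *)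

Section nash.
Variables (R : realType) (n : nat).
Local Notation E := 'rV[R]_n.
Local Notation leb := (lebesgue_rV R n).
Implicit Types (u v w f g : E -> R).
Let BL := psd_ip leb.

Lemma coord_le_norm (x : E) i : `|x ord0 i| <= `|x|.
Proof.
rewrite [leRHS]mx_normrE.
exact: (@le_bigmax _ _ _ 0 (fun i : 'I_1 * 'I_n => `|x i.1 i.2|) (ord0, i)).
Qed.

Lemma norm_le_coord (x : E) (r : R) : 0 <= r -> (forall i, `|x ord0 i| <= r) -> `|x| <= r.
Proof.
move=> r0 h; rewrite [leLHS]mx_normrE; apply: bigmax_le => // -[i j] _ /=.
by rewrite ord1.
Qed.

(** Centred cube of half-side r N, made of [N.*2] grid cells per side. *)
Definition cubeC (r : R) N : set E := cube (const_mx (- (r * N%:R))) (r * N.*2%:R).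

Lemma cubeC_in (r : R) N x : `|x| < r * N%:R -> cubeC r N x.
Proof.
move=> h i; rewrite mxE; have := le_lt_trans (coord_le_norm x i) h.
by rewrite -addnn natrD mulrDr ltr_norml => /andP[h1 h2]; apply/andP; split; lra.
Qed.

Lemma integM_indic d (T : measurableType d) (mu : {measure set T -> \bar R}) (u : T -> R) A :
  measurable A -> integ mu u -> integ mu (u * \1_A).
Proof.
move=> mA iu; apply: (@integ_le _ _ _ _ _ (fun x => `|u x|)); last exact: integ_abs.
  by apply: mfM; [exact: integ_mf iu|exact: mf_indic].
move=> x; rewrite mulrfctE indicE normrM; case: (x \in A); last by rewrite normr0 mulr0.
by rewrite normr1 mulr1.
Qed.

Lemma norm_mul_indic T (u : T -> R) A x : `|(u * \1_A) x| = ((fun x => `|u x|) * \1_A) x.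
Proof. by rewrite !mulrfctE normrM; congr (_ * _); rewrite ger0_norm// indicE. Qed.

Lemma It_cubeC_cvg u (r : R) : 0 < r -> integ leb u ->
  It leb (u * \1_(cubeC r N)) @[N --> \oo] --> It leb u.
Proof.
move=> r0 iu; have mC N : measurable (cubeC r N) by exact: measurable_cube.
have [] := @It_dom _ _ _ leb (fun N => u * \1_(cubeC r N)) u (fun x => `|u x|) _ _ _ _ _ => //.
- by move=> N; apply: (@integ_mf _ _ _ leb); exact: integM_indic.
- exact: integ_mf iu.
- apply: aeW => x; apply/cvg_epsP => e e0; exists (Num.trunc (r^-1 * `|x|)).+1 => N hN.
  rewrite mulrfctE indicE mem_set ?mulr1 ?subrr ?normr0 ?ltW//; apply: cubeC_in.
  rewrite -(ltr_pM2l (x := r^-1)) ?invr_gt0// mulrA mulVf ?gt_eqF// mul1r.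
  apply: lt_le_trans (truncnS_gt _) _; by rewrite ler_nat.
- exact: integ_abs.
- move=> N x; rewrite mulrfctE indicE normrM; case: (x \in _); last by rewrite normr0 mulr0.
  by rewrite normr1 mulr1.
Qed.

Lemma It_gcell_le u a (r : R) N : 0 < r -> integ leb u -> (forall x, 0 <= u x) ->
  \sum_(z : {ffun 'I_n -> 'I_N}) It leb (u * \1_(gcell a r z)) <= It leb u.
Proof.
move=> r0 iu u0; have mC z : measurable (gcell a r z : set E) by exact: measurable_cube.
rewrite -It_sum; last by move=> z; exact: integM_indic.
apply: It_le => //; first by apply: integ_sum => z; exact: integM_indic.
move=> x; rewrite fct_sumE.
have [[z Cz]|xB] := pselect (exists z : {ffun 'I_n -> 'I_N}, gcell a r z x); last first.
  rewrite big1// => z _; rewrite mulrfctE indicE memNset ?mulr0// => h; apply: xB.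
  by exists z.
rewrite (bigD1 z)//= big1 ?addr0; last first.
  move=> z' zz'; rewrite mulrfctE indicE memNset ?mulr0// => h.
  by move: zz'; rewrite (gcell_disj r0 h Cz) eqxx.
by rewrite mulrfctE indicE mem_set// mulr1.
Qed.

(** A localised Nash inequality: the square of a cell integral is at most S times the cell integral
    of |v|. The factor S, which only sees the mass of single cubes, is what detects vanishing. *)
Lemma nash v (r S : R) : H1 v -> integ leb v -> 0 < r <= 1 ->
  (forall a, It leb ((fun x => `|v x|) * \1_(cube a r)) <= S) ->
  ip leb v v <= (r ^+ n)^-1 * S * It leb (fun x => `|v x|) + 2 ^+ n * n%:R ^+ 2 * r ^+ 2 * Dr v.
Proof.
move=> hv iv r01 hS; have /andP[r0 r1] := r01; have sv := H1_sqi hv.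
have iav := integ_abs iv.
have rn : 0 < (r ^+ n)^-1 by rewrite invr_gt0 exprn_gt0.
have ivv : integ leb (v * v) by exact: sqiM.
have C := It_cubeC_cvg r0 ivv.
have S0 : 0 <= S.
  by apply: le_trans (hS 0); apply: It_ge0 => x; rewrite mulrfctE mulr_ge0// indicE.
have le1 N : It leb (v * v * \1_(cubeC r N)) <=
    (r ^+ n)^-1 * S * It leb (fun x => `|v x|) + 2 ^+ n * n%:R ^+ 2 * r ^+ 2 * Dr v.
  apply: le_trans (cell_poincare _ _ hv r01) _; rewrite lerD2r -mulrA ler_pM2l//.
  have mC z : measurable (gcell (const_mx (- (r * N%:R))) r z : set E) by exact: measurable_cube.
  apply: le_trans (_ : _ <= \sum_z S * It leb ((fun x => `|v x|) * \1_(gcell (const_mx (- (r * N%:R))) r z))) _.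
    apply: ler_sum => z _; rewrite -real_normK ?num_real// expr2.
    have h : `|It leb (v * \1_(gcell (const_mx (- (r * N%:R))) r z))| <=
        It leb ((fun x => `|v x|) * \1_(gcell (const_mx (- (r * N%:R))) r z)).
      apply: le_trans (It_abs _) _; first exact: integM_indic.
      rewrite le_eqVlt; apply/orP; left; apply/eqP; apply: It_ext => x.
      exact: norm_mul_indic.
    by apply: ler_pM => //; apply: le_trans h _; exact: hS.
  by rewrite -mulr_sumr ler_wpM2l//; exact: It_gcell_le.
exact: (lim_le C).
Qed.

Lemma nash1 v : H1 v -> integ leb v ->
  ip leb v v <= It leb (fun x => `|v x|) ^+ 2 + 2 ^+ n * n%:R ^+ 2 * Dr v.
Proof.
move=> hv iv; have := @nash v 1 (It leb (fun x => `|v x|)) hv iv.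
rewrite !expr1n invr1 mul1r mulr1 expr2; apply; first by rewrite ltr01 lexx.
move=> a; have mC : measurable (cube a 1 : set E) by exact: measurable_cube.
apply: It_le; [by apply: integM_indic => //; exact: integ_abs|exact: integ_abs|].
move=> x; rewrite mulrfctE indicE; case: (x \in _); by rewrite ?mulr1 ?mulr0.
Qed.

Lemma integ_supp v A : measurable A -> (leb A < +oo)%E -> sqi leb v ->
  (forall x, ~ A x -> v x = 0) ->
  integ leb v /\ It leb (fun x => `|v x|) ^+ 2 <= fine (leb A) * ip leb v v.
Proof.
move=> mA fA sv vA; have sA := sqi_indic mA fA.
have vE : v = v * \1_A.
  apply/funext => x; rewrite mulrfctE indicE; have [|xA] := boolP (x \in A).
    by rewrite mulr1.
  by rewrite mulr0 vA// => /mem_set; rewrite (negbTE xA).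
have iv : integ leb v by rewrite vE; exact: sqiM.
split=> //.
have -> : It leb (fun x => `|v x|) = ip leb (fun x => `|v x|) \1_A.
  by apply: It_ext => x; rewrite {1}vE norm_mul_indic.
apply: le_trans (psd_CS BL (sqi_abs sv) sA) _; rewrite ip_abs mulrC ler_wpM2r//.
  exact: (psd_ge0 BL).
rewrite /ip (_ : \1_A * \1_A = \1_A) ?It_indic//.
by apply/funext => x; rewrite mulrfctE indicE; case: (x \in A); rewrite ?mulr1 ?mulr0.
Qed.

(** For v supported in A, the squared integral of |v| is at most |A| times the integral of v^2; with
    2 |A| <= r^n the first term of the Nash inequality is at most half of its left side. *)
Lemma faber_krahn v A (r : R) : measurable A -> (leb A < +oo)%E -> H1 v ->
  (forall x, ~ A x -> v x = 0) -> 0 < r <= 1 -> 2 * fine (leb A) <= r ^+ n ->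
  ip leb v v <= 2 * 2 ^+ n * n%:R ^+ 2 * r ^+ 2 * Dr v.
Proof.
move=> mA fA hv vA r01 hr; have /andP[r0 r1] := r01; have sv := H1_sqi hv.
have [iv hI] := integ_supp mA fA sv vA.
have := @nash v r (It leb (fun x => `|v x|)) hv iv r01.
have mC a : measurable (cube a r : set E) by exact: measurable_cube.
have h1 a : It leb ((fun x => `|v x|) * \1_(cube a r)) <= It leb (fun x => `|v x|).
  apply: It_le; [by apply: integM_indic => //; exact: integ_abs|exact: integ_abs|].
  move=> x; rewrite mulrfctE indicE; case: (x \in _); by rewrite ?mulr1 ?mulr0.
move=> /(_ h1); rewrite -mulrA -expr2; set I := _ ^+ 2 in hI *; set K := 2 ^+ n * _ * _ * _.
have V0 : 0 <= ip leb v v by exact: (psd_ge0 BL).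
have rn : 0 < r ^+ n by rewrite exprn_gt0.
have -> : 2 * 2 ^+ n * n%:R ^+ 2 * r ^+ 2 * Dr v = 2 * K by rewrite /K; ring.
have : (r ^+ n)^-1 * I <= 2^-1 * ip leb v v.
  rewrite ler_pdivrMl//; apply: (le_trans hI); rewrite mulrA ler_wpM2r//; lra.
lra.
Qed.

End nash.

(** * Diagonal extraction and Rellich compactness *)

Section diagonal.
Variable R : realType.

Lemma homo_comp (s t : nat -> nat) : {homo s : m n / (m < n)%N} -> {homo t : m n / (m < n)%N} ->
  {homo (s \o t) : m n / (m < n)%N}.
Proof. by move=> hs ht m n mn; apply: hs; exact: ht. Qed.

Lemma bw_subseq (u : nat -> R) (C : R) : (forall m, `|u m| <= C) ->
  exists2 s : nat -> nat, {homo s : m n / (m < n)%N} & exists l : R, u (s m) @[m --> \oo] --> l.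
Proof.
move=> uC; have [|s hs cs] := @bolzano_weierstrass R u.
  exists C; split; first exact: num_real.
  by move=> y Cy x _; exact: le_trans (uC x) (ltW Cy).
exists s; last by move/cvg_ex: cs => [l hl]; exists l.
have hs' : {mono s : m n / (m <= n)%N} by move=> m n; rewrite -!leEnat hs.
by move=> m n mn; rewrite ltnNge hs' -ltnNge.
Qed.

Lemma diagonal_subseq (u : nat -> nat -> R) (C : nat -> R) :
  (forall j m, `|u j m| <= C j) ->
  exists2 s : nat -> nat, {homo s : m n / (m < n)%N} &
    forall j, exists l : R, u j (s m) @[m --> \oo] --> l.
Proof.
move=> uC.
have /choice[t ht] (p : nat * (nat -> nat)) : exists t : nat -> nat,
    {homo t : m n / (m < n)%N} /\ exists l : R, u p.1 (p.2 (t m)) @[m --> \oo] --> l.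
  have [|t h1 h2] := @bw_subseq (fun m => u p.1 (p.2 m)) (C p.1); first by move=> m.
  by exists t.
pose S := fix S j := if j is j'.+1 then S j' \o t (j', S j') else id : nat -> nat.
have hS j : {homo S j : m n / (m < n)%N}.
  by elim: j => [//|j IH]; apply: homo_comp => //; exact: (ht _).1.
have SS j k : exists2 tau : nat -> nat, {homo tau : m n / (m < n)%N} & S (j + k)%N = S j \o tau.
  elim: k => [|k [tau h1 h2]]; first by exists id; rewrite ?addn0.
  exists (tau \o t ((j + k)%N, S (j + k)%N)); last by rewrite addnS /= h2.
  by apply: homo_comp => //; exact: (ht _).1.
exists (fun m => S m m).
  apply: homo_ltn => [? ? ?|m]; first exact: ltn_trans.
  rewrite /=; apply: leq_trans (_ : S m m < S m m.+1)%N _; first exact: hS.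
  by apply: (leq_homo_ltn (hS m)); apply: homo_ltn_ge; exact: (ht _).1.
move=> j; have [l hl] := (ht (j, S j)).2; exists l; apply/cvg_epsP => e e0.
have [N hN] := (cvg_epsP _ _).1 hl _ e0; exists (maxn N j.+1) => m; rewrite geq_max => /andP[Nm jm].
have [tau htau e1] := SS j.+1 (m - j.+1)%N; rewrite subnKC// in e1.
rewrite e1 /=; apply: hN; exact: leq_trans Nm (homo_ltn_ge htau m).
Qed.

End diagonal.

Section rellich.
Variables (R : realType) (n : nat).
Local Notation E := 'rV[R]_n.
Local Notation leb := (lebesgue_rV R n).
Implicit Types (u v w f g : E -> R).
Let BL := psd_ip leb.
Let BD := @psd_Da R n.

(** The weight turns convergence on every bounded set into one convergence in L^2, to which
    completeness applies. *)
Definition wt (x : E) : R := (1 + `|x|)^-1.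

Lemma wt_gt0 x : 0 < wt x.
Proof. by rewrite invr_gt0 ltr_wpDr. Qed.

Lemma wt_le1 x : wt x <= 1.
Proof. by rewrite invf_le1 ?ltr_wpDr// lerDl. Qed.

Lemma continuous_norm1 : continuous (fun x : E => 1 + `|x|).
Proof.
move=> x; have h : (fun y : E => `|y|) @ x --> `|x| by exact: (@norm_continuous R E).
by apply: continuousD; [exact: cst_continuous|exact: h].
Qed.

Lemma mf_wt : mf wt.
Proof.
apply: continuous_measurable_rVR => x.
have h : (fun y : E => 1 + `|y|) @ x --> 1 + `|x| by exact: continuous_norm1.
by apply: (cvgV _ h); rewrite gt_eqF// ltr_wpDr.
Qed.

Lemma sqi_wt u : sqi leb u -> sqi leb (wt * u).
Proof.
move=> su; apply: (sqi_le su); first by apply: mfM; [exact: mf_wt|exact: su.1].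
move=> x; rewrite mulrfctE normrM [`|wt x|]ger0_norm; last exact: ltW (wt_gt0 x).
have := wt_gt0 x; have := wt_le1 x; have := normr_ge0 (u x); nra.
Qed.

Lemma wt_le_cubeC u (r : R) N : 0 <= r -> sqi leb u ->
  ip leb (wt * u) (wt * u) <= It leb (u * u * \1_(cubeC r N)) + (1 + r * N%:R) ^- 2 * ip leb u u.
Proof.
move=> r0 su; have mC : measurable (cubeC r N : set E) by exact: measurable_cube.
have su2 : integ leb (u * u) by exact: sqiM.
have rN : 0 <= r * N%:R by rewrite mulr_ge0.
rewrite /ip -ItZ// -ItD; [|exact: integM_indic|exact: integZ].
apply: It_le; [by apply: sqiM; exact: sqi_wt|apply: integD; [exact: integM_indic|exact: integZ]|].
move=> x; rewrite !fctE /GRing.scale/= indicE.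
have -> : wt x * u x * (wt x * u x) = wt x ^+ 2 * (u x * u x) by ring.
have u0 : 0 <= u x * u x by rewrite -expr2 sqr_ge0.
have [xC|xC] := boolP (x \in _).
  rewrite mulr1; apply: ler_wpDr; first by rewrite mulr_ge0// invr_ge0 exprn_ge0// addr_ge0.
  by rewrite ler_piMl// expr_le1// ?wt_le1// ltW ?wt_gt0.
rewrite mulr0 add0r ler_wpM2r// -exprVn ler_pXn2r// ?nnegrE ?invr_ge0 ?addr_ge0//.
rewrite lef_pV2 ?posrE ?ltr_wpDr// lerD2l leNgt; apply/negP => h.
by move/negP: xC; apply; apply/mem_set; exact: cubeC_in.
Qed.

(** By [cell_poincare], closeness on a large cube is decided by finitely many cell integrals, up to
    an error of order r^2. There are countably many cells of dyadic side, so one diagonal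
    subsequence makes all their integrals converge. *)
Lemma rellich_cauchy (U : nat -> E -> R) (C : R) : (forall m, H1 (U m)) ->
  (forall m, ip leb (U m) (U m) <= C) -> (forall m, Dr (U m) <= C) ->
  exists2 s : nat -> nat, {homo s : m n / (m < n)%N} &
    forall e, 0 < e -> exists M, forall m l, (M <= m)%N -> (M <= l)%N ->
      ip leb (wt * U (s m) - wt * U (s l)) (wt * U (s m) - wt * U (s l)) <= e.
Proof.
move=> hU UC DC; have sU m := H1_sqi (hU m).
have C0 : 0 <= C := le_trans (psd_ge0 BL (sU 0%N)) (UC 0%N).
(* A grid is given by the exponent of its mesh and its size; [pickle] numbers the cells of all
   grids. *)
pose T := {p : nat * nat & {ffun 'I_n -> 'I_(p.2.*2)}}.
pose cell (t : T) : set E :=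
  gcell (const_mx (- (hk R (tag t).1 * (tag t).2%:R))) (hk R (tag t).1) (tagged t).
have mcell t : measurable (cell t) by exact: measurable_cube.
pose ci (t : T) m := It leb (U m * \1_(cell t)).
pose u j m := if unpickle j is Some t then ci t m else 0.
pose B j := if unpickle j is Some t then 1 + C * (hk R (tag (t : T)).1) ^+ n else 0.
have uB j m : `|u j m| <= B j.
  rewrite /u /B; case: unpickle => [t|]; last by rewrite normr0.
  have r0 := hk_gt0 R (tag t).1.
  have lC : leb (cell t) = (hk R (tag t).1 ^+ n)%:E by apply: lebesgue_cube; exact: ltW.
  have sC : sqi leb (\1_(cell t)) by apply: sqi_indic => //; rewrite lC ltry.
  have h1 : ci t m ^+ 2 <= C * hk R (tag t).1 ^+ n.
    apply: le_trans (psd_CS BL (sU m) sC) _; rewrite /(ip leb (\1_ _) _).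
    have -> : \1_(cell t) * \1_(cell t) = \1_(cell t) :> (E -> R).
      by apply/funext => x; rewrite mulrfctE indicE; case: (x \in _); rewrite ?mulr1 ?mulr0.
    rewrite It_indic// lC /= ler_wpM2r ?exprn_ge0//; exact: ltW.
  have : `|ci t m| <= 1 + ci t m ^+ 2.
    by rewrite -[ci t m ^+ 2]real_normK ?num_real//; have := normr_ge0 (ci t m); nra.
  by move=> h2; apply: le_trans h2 _; rewrite lerD2l.
have [s hs hl] := diagonal_subseq uB; exists s => // e e0.
have hc t : exists l : R, ci t (s m) @[m --> \oo] --> l.
  by have [l] := hl (pickle t); rewrite /u pickleK; exists l.
pose K := 2 ^+ n * n%:R ^+ 2 * (4 * C) : R.
have K0 : 0 <= K by rewrite !mulr_ge0// ?exprn_ge0.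
have e3 : 0 < e / 3 by rewrite divr_gt0.
have DB m l : Dr (U m - U l) <= 4 * C.
  apply: le_trans (psd_sqB_le BD (hU m) (hU l)) _.
  by have := DC m; have := DC l; rewrite /Dr; lra.
have IB m l : ip leb (U m - U l) (U m - U l) <= 4 * C.
  apply: le_trans (psd_sqB_le BL (sU m) (sU l)) _.
  by have := UC m; have := UC l; lra.
have [k hkk] : exists k, K * hk R k ^+ 2 <= e / 3.
  have [k] := (cvg_epsP _ _).1 (hk_cvg K) _ e3; move=> /(_ k (leqnn k)).
  have := hk_gt0 R k; have := hk_le1 R k; rewrite subr0 => h1 h2.
  rewrite ger0_norm ?mulr_ge0 ?(ltW h2)// => h3; exists k.
  by apply: le_trans h3; rewrite ler_wpM2l// expr2 ler_piMl// ltW.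
set r := hk R k in hkk; have r0 : 0 < r := hk_gt0 R k.
have [N hN] : exists N, (1 + r * N%:R) ^- 2 * (4 * C) <= e / 3.
  pose N := (Num.trunc (r^-1 * (4 * C / (e / 3)))).+1; exists N.
  have h1 : 4 * C / (e / 3) <= r * N%:R.
    by rewrite -ler_pdivrMl//; apply: ltW; exact: truncnS_gt.
  have rN : 0 <= r * N%:R by rewrite mulr_ge0// ltW.
  have p0 : 0 < (1 + r * N%:R) ^+ 2 by rewrite exprn_gt0// ltr_wpDr.
  rewrite ler_pdivrMl//; move: h1; rewrite ler_pdivrMr// => h1; apply: le_trans h1 _.
  by rewrite ler_wpM2r ?(ltW e3)// expr2; nra.
pose cz (z : {ffun 'I_n -> 'I_N.*2}) : T := existT _ (k, N) z.
have /choice[lz hlz] z := hc (cz z).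
have hsum : \sum_z (ci (cz z) (s m) - lz z) ^+ 2 @[m --> \oo] --> (0 : R).
  rewrite [X in _ --> X](_ : 0 = \sum_(z : {ffun 'I_n -> 'I_N.*2}) (lz z - lz z) ^+ 2); last first.
    by rewrite big1// => z _; rewrite subrr expr0n.
  by apply: cvg_sumr => z; apply: cvgM; apply: cvgB => //; exact: cvg_cst.
have rn : 0 < r ^+ n by rewrite exprn_gt0.
have e4 : 0 < r ^+ n * (e / 3) / 4 by rewrite divr_gt0// mulr_gt0.
have [M hM] := (cvg_epsP _ _).1 hsum _ e4; exists M => m l Mm Ml.
rewrite -mulrBr; have hD := H1B (hU (s m)) (hU (s l)).
apply: le_trans (wt_le_cubeC N (ltW r0) (H1_sqi hD)) _.
rewrite (_ : e = e / 3 + e / 3 + e / 3); last by field.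
apply: lerD; last first.
  by apply: le_trans hN; rewrite ler_wpM2l ?IB// invr_ge0 exprn_ge0// addr_ge0// mulr_ge0// ltW.
apply: le_trans (cell_poincare _ _ hD _) _; first by rewrite r0 hk_le1.
apply: lerD; last first.
  apply: le_trans hkk; rewrite /K [leRHS](_ : _ = 2 ^+ n * n%:R ^+ 2 * r ^+ 2 * (4 * C)); last by ring.
  by rewrite ler_wpM2l ?DB// !mulr_ge0// ?exprn_ge0// ltW.
rewrite ler_pdivrMl//.
have S1 := hM _ Mm; have S2 := hM _ Ml; rewrite !subr0 !ger0_norm in S1 S2; last 2 first.
- by apply: sumr_ge0 => z _; exact: sqr_ge0.
- by apply: sumr_ge0 => z _; exact: sqr_ge0.
apply: le_trans (_ : _ <= 2 * \sum_z (ci (cz z) (s m) - lz z) ^+ 2 + 2 * \sum_z (ci (cz z) (s l) - lz z) ^+ 2) _; last first.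
  by move: S1 S2; set a := \sum_z _; set b := \sum_z _; lra.
rewrite !mulr_sumr -big_split/=; apply: ler_sum => z _.
have -> : It leb ((U (s m) - U (s l)) * \1_(gcell (const_mx (- (r * N%:R))) r z)) =
    ci (cz z) (s m) - ci (cz z) (s l).
  rewrite mulrBl ItB//; apply: sqiM => //; apply: sqi_indic; try exact: (mcell (cz z)).
    by rewrite lebesgue_cube ?ltry// ltW.
  by rewrite lebesgue_cube ?ltry// ltW.
move: (ci _ _) (ci _ _) (lz z) => a b c; rewrite -subr_ge0.
by rewrite [leRHS](_ : _ = (a + b - 2 * c) ^+ 2) ?sqr_ge0//; ring.
Qed.

Lemma nr_cvg0 (F : nat -> E -> R) : ip leb (F m) (F m) @[m --> \oo] --> 0 ->
  nr (F m) @[m --> \oo] --> 0.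
Proof.
move=> /cvg_epsP h; apply/cvg_epsP => e e0.
have [N hN] := h _ (exprn_gt0 2 e0); exists N => m /hN; rewrite !subr0 => hm.
by rewrite ger0_norm ?nr_ge0//; apply: nr_small; [exact: ltW|exact: le_trans (ler_norm _) hm].
Qed.

(** Dividing the L^2 limit of [wt * U] by [wt] gives the pointwise limit; the integral over a
    bounded A is the pairing of [wt * U] with the square-integrable function 1_A / wt. *)
Lemma rellich (U : nat -> E -> R) (C : R) : (forall m, H1 (U m)) ->
  (forall m, ip leb (U m) (U m) <= C) -> (forall m, Dr (U m) <= C) ->
  exists s : nat -> nat, exists v, [/\ {homo s : m n / (m < n)%N}, sqi leb v,
    {ae leb, forall x, U (s m) x @[m --> \oo] --> v x} &
    forall (A : set E) (K : R), measurable A -> (forall x, A x -> `|x| <= K) -> (leb A < +oo)%E ->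
      It leb (U (s m) * \1_A) @[m --> \oo] --> It leb (v * \1_A)].
Proof.
move=> hU UC DC; have [s hs sC] := rellich_cauchy hU UC DC.
have sU m := H1_sqi (hU m).
have [V [t [sV ht aeV lV]]] := L2_complete (fun m => sqi_wt (sU (s m))) sC.
pose v x := V x / wt x.
have aev : {ae leb, forall x, U (s (t m)) x @[m --> \oo] --> v x}.
  apply: filterS aeV => x hx.
  rewrite (_ : (fun m => _) = (fun m => (wt * U (s (t m))) x / wt x)).
    by apply: cvgM => //; exact: cvg_cst.
  apply/funext => m; rewrite mulrfctE mulrC mulKf//; by rewrite gt_eqF// wt_gt0.
have mv : mf v.
  rewrite (_ : v = V * (fun x => 1 + `|x|)).
    by apply: mfM; [exact: sV.1|exact: continuous_measurable_rVR continuous_norm1].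
  by apply/funext => x; rewrite /v /wt invrK.
have sv : sqi leb v.
  split=> //; have [] := @It_fatou _ _ _ leb (fun m => U (s (t m)) * U (s (t m))) (v * v) C.
  - by move=> m; exact: sqiM.
  - by move=> m x; rewrite mulrfctE -expr2 sqr_ge0.
  - exact: mfM.
  - by move=> m; exact: UC.
  - by apply: filterS aev => x hx; apply: cvgM.
  move=> h _; rewrite (_ : v * v = (fun x => `|(v * v) x|))//.
  by apply/funext => x; rewrite ger0_norm// mulrfctE -expr2 sqr_ge0.
exists (s \o t), v; split => //; first exact: homo_comp.
move=> A K mA AK fA; have sA := sqi_indic mA fA.
pose W := (fun x => (wt x)^-1) * \1_A : E -> R.
have mW : mf W.
  apply: mfM; last exact: mf_indic.
  apply: continuous_measurable_rVR; rewrite /wt => x.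
  rewrite (_ : (fun x => _) = (fun x : E => 1 + `|x|)); last by apply/funext => y; rewrite invrK.
  exact: continuous_norm1.
have sW : sqi leb W.
  apply: (sqi_le (v := (1 + K) *: \1_A)) => //; first exact: (psd_domZ BL).
  move=> x; rewrite /W mulrfctE !fctE /GRing.scale/= indicE; have [xA|xA] := boolP (x \in A).
    rewrite !mulr1 /wt invrK !ger0_norm ?addr_ge0//; last by exact: le_trans (AK x (set_mem xA)).
    by rewrite lerD2l; apply: AK; exact: set_mem.
  by rewrite !mulr0 normr0.
have iE u : It leb (u * \1_A) = ip leb (wt * u) W.
  apply: It_ext => x; rewrite !mulrfctE /W mulrACA mulrC -!mulrA.
  by rewrite mulrA mulfV ?mul1r// gt_eqF// wt_gt0.
have VE : wt * v = V.
  by apply/funext => x; rewrite mulrfctE /v mulrC mulfVK// gt_eqF// wt_gt0.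
rewrite iE VE.
rewrite (_ : (fun m => _) = (fun m => ip leb (wt * U (s (t m))) W)); last by apply/funext => m; rewrite iE.
apply: ip_cvg => //; first by move=> m; exact: sqi_wt.
- by apply: nr_cvg0; exact: (cvg_subseq ht lV).
- by rewrite subrr /nr (psd0l BL) ?sqrtr0; [exact: cvg_cst|exact: psd_dom0 BL].
Qed.

End rellich.

(** * Capacity *)

Section capacity.
Variables (R : realType) (n : nat).
Local Notation E := 'rV[R]_n.
Local Notation leb := (lebesgue_rV R n).
Implicit Types (u v w f g : E -> R) (A B U : set E).
Let BL := psd_ip leb.
Let BD := @psd_Da R n.

Definition h1f u v := ip leb u v + Da u v.

Lemma psd_h1 : psd (@H1 R n) h1f.
Proof.
apply: psd_sub (psdD BL BD) _ _ _.
- by move=> u hu; split; [exact: H1_sqi|].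
- exact: H10.
- exact: H1_dom.
Qed.
Let BH := psd_h1.

Lemma h1E u : H1 u -> (\int[leb]_x (u x ^+ 2)%:E + dirichlet u)%E = (h1f u u)%:E.
Proof.
move=> hu; rewrite dirichletE// /h1f EFinD /ip ItE; last by apply: sqiM; exact: H1_sqi.
by congr (_ + _)%E; apply: eq_integral => x _; rewrite expr2.
Qed.

Lemma ip_le_h1 u : H1 u -> ip leb u u <= h1f u u.
Proof. by move=> hu; rewrite lerDl Dr_ge0. Qed.

Lemma Dr_le_h1 u : H1 u -> Dr u <= h1f u u.
Proof. by move=> hu; rewrite lerDr (psd_ge0 BL)//; exact: H1_sqi. Qed.

(** Truncation at 1 lowers the norm, so functions that are at least 1 near the set may serve as
    competitors. *)
Lemma cap_le_h1 A U u : H1 u -> open U -> A `<=` U ->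
  {ae leb, forall x, U x -> 1 <= u x} -> (cap A <= (h1f u u)%:E)%E.
Proof.
move=> hu oU AU uU; pose v x := Num.min (u x) 1; have hv : H1 v by exact: H1_minc.
apply: (@le_trans _ _ (h1f v v)%:E).
  apply: ereal_inf_lbound; exists v; last by rewrite h1E.
  split=> //; exists U; split => //; apply: filterS uU => x h Ux.
  by rewrite /v min_r// h.
rewrite lee_fin; apply: lerD.
  apply: ip_le; [exact: H1_sqi|exact: H1_sqi|move=> x; rewrite /v].
  by case: (leP (u x) 1) => h //; rewrite normr1; apply: le_trans (ltW h) (ler_norm _).
have := Dr_minc ler01 hu; have := Dr_ge0 (H1B hu hv); rewrite /v /Dr; lra.
Qed.

Lemma cap_lt A (c : R) : (cap A < c%:E)%E -> exists u U, [/\ H1 u, open U, A `<=` U,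
  {ae leb, forall x, U x -> u x = 1} & h1f u u < c].
Proof.
move=> /ereal_inf_lt[_ [u [hu [U [oU AU uU]]] <-]]; rewrite h1E// lte_fin => h.
by exists u, U.
Qed.

Lemma cap_ge0 A : (0 <= cap A)%E.
Proof.
apply: le_ereal_inf_tmp => _ [u [hu _] <-]; rewrite h1E// lee_fin; exact: (psd_ge0 BH).
Qed.

Lemma cap_mono A B : A `<=` B -> (cap A <= cap B)%E.
Proof.
move=> AB; apply: le_ereal_inf_tmp => _ [u [hu [U [oU BU uU]]] <-].
apply: ereal_inf_lbound; exists u => //; split=> //; exists U; split=> //; exact: subset_trans AB BU.
Qed.

Lemma cap_open_lt A (c : R) : (cap A < c%:E)%E ->
  exists U, [/\ open U, A `<=` U & (cap U < c%:E)%E].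
Proof.
move=> /cap_lt[u [U [hu oU AU uU uc]]]; exists U; split => //.
apply: le_lt_trans (cap_le_h1 hu oU (@subset_refl _ U) _) _; last by rewrite lte_fin.
by apply: filterS uU => x h /h->.
Qed.

Lemma cap_small A : (forall e : R, 0 < e -> (cap A <= e%:E)%E) -> cap A = 0%E.
Proof.
move=> h; apply/eqP; rewrite eq_le cap_ge0 andbT.
by apply/lee_addgt0Pr => e e0; rewrite add0e; exact: h.
Qed.

Lemma cap0_sub A B : A `<=` B -> cap B = 0%E -> cap A = 0%E.
Proof. by move=> AB B0; apply/eqP; rewrite eq_le cap_ge0 andbT -B0 cap_mono. Qed.

(** The competitor is |u| + |v|; the crude factor 2 is harmless because only smallness matters in
    the sequel. *)
Lemma cap_setU A B (a b : R) : (cap A < a%:E)%E -> (cap B < b%:E)%E ->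
  (cap (A `|` B) < (2 * a + 2 * b)%:E)%E.
Proof.
move=> /cap_lt[u [U [hu oU AU uU ua]]] /cap_lt[v [V [hv oV BV vV vb]]].
have [hau _] := H1_abs hu; have [hav _] := H1_abs hv.
have le_abs w : H1 w -> h1f (fun x => `|w x|) (fun x => `|w x|) <= h1f w w.
  by move=> hw; rewrite /h1f ip_abs lerD2l; exact: (H1_abs hw).2.
apply: (@le_lt_trans _ _ (h1f ((fun x => `|u x|) + (fun x => `|v x|)) ((fun x => `|u x|) + (fun x => `|v x|)))%:E).
  apply: (cap_le_h1 (H1D hau hav) (openU oU oV)); first exact: setUSS.
  apply: filterS2 uU vV => x hux hvx [/hux|/hvx] /=; rewrite fctE => ->; rewrite normr1.
    by rewrite lerDl.
  by rewrite lerDr.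
rewrite lte_fin; apply: le_lt_trans (psd_sqD_le BH hau hav) _.
have := le_abs _ hu; have := le_abs _ hv; lra.
Qed.

(** By submodularity the partial maxima [v m] of competitors have squared norms at most the partial
    sums of [e], so their increasing limit is a competitor. Its L^2 part and its Dirichlet part are
    bounded by C separately, whence 2 C. *)
Lemma cap_bigcup (A : nat -> set E) (e : nat -> R) (C : R) :
  (forall k, (cap (A k) < (e k)%:E)%E) -> (forall m, \sum_(k < m) e k <= C) ->
  (cap (\bigcup_k A k) <= (2 * C)%:E)%E.
Proof.
move=> Ae eC.
have /choice[u hu] k : exists u, [/\ H1 u, forall x, 0 <= u x <= 1, h1f u u <= e k &
    exists U, [/\ open U, A k `<=` U & {ae leb, forall x, U x -> u x = 1}]].
  have [u [U [hu oU AU uU ue]]] := cap_lt (Ae k).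
  have [hau Dau] := H1_abs hu; exists (fun x => Num.min `|u x| 1); split.
  - exact: H1_minc.
  - by move=> x; rewrite le_min normr_ge0 ler01 /= ge_min lexx orbT.
  - apply: le_trans (ltW ue); apply: lerD.
      have s1 := H1_sqi (H1_minc ler01 hau).
      apply: ip_le => //; first exact: H1_sqi.
      move=> x; rewrite ger0_norm; first by rewrite ge_min lexx.
      by rewrite le_min normr_ge0 ler01.
    have := Dr_minc ler01 hau; have := Dr_ge0 (H1B hau (H1_minc ler01 hau)).
    by move: Dau; rewrite /Dr; lra.
  exists U; split=> //; apply: filterS uU => x h /h ->.
  by rewrite normr1 minxx.
have u01 k x : 0 <= u k x <= 1 by have [_ + _ _] := hu k; exact.
pose v := fix v m : E -> R := if m is m'.+1 then v m' \max u m' else 0.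
have hv m : H1 (v m).
  by elim: m => [|m IH] /=; [exact: H10|apply: H1_max => //; have [] := hu m].
have v01 m x : 0 <= v m x <= 1.
  elim: m => [|m /andP[IH1 IH2]] /=; first by rewrite lexx ler01.
  by have /andP[h1 h2] := u01 m x; rewrite le_max ge_max IH1 IH2 h2.
have vS m x : v m x <= v m.+1 x by rewrite /= le_max lexx.
have vle m : h1f (v m) (v m) <= \sum_(k < m) e k.
  elim: m => [|m IH]; first by rewrite big_ord0 (psd0l BH)//; exact: H10.
  have [hum _ ume _] := hu m; rewrite big_ord_recr/=.
  have L := Dr_lattice (hv m) hum.
  have L2 : ip leb (v m \min u m) (v m \min u m) + ip leb (v m \max u m) (v m \max u m) =
      ip leb (v m) (v m) + ip leb (u m) (u m).
    have [s1 s2] := (H1_sqi (H1_min (hv m) hum), H1_sqi (H1_max (hv m) hum)).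
    have [s3 s4] := (H1_sqi (hv m), H1_sqi hum).
    rewrite /ip -!ItD; try exact: sqiM.
    apply: It_ext => x; rewrite !fctE /=; case: (leP (v m x) (u m x)) => _ //; exact: addrC.
  have hm := H1_min (hv m) hum.
  have g1 := psd_ge0 BL (H1_sqi hm); have g2 := psd_ge0 BD hm.
  by move: L L2 IH ume; rewrite /h1f /Dr /= in g1 g2 *; lra.
pose w x := limn (fun m => v m x).
have vw x : v m x @[m --> \oo] --> w x.
  apply: nondecreasing_is_cvgn; first by apply: homo_leq => //; exact: le_trans.
  by exists 1 => _ [m _ <-]; have /andP[] := v01 m x.
have vlew m x : v m x <= w x.
  apply: (lim_ge (cvg_subseq (s := fun k => (m + k)%N) _ (vw x))).
    by move=> i j ij; rewrite ltn_add2l.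
  by move=> k; elim: k => [|k IH]; rewrite ?addn0// addnS; apply: le_trans IH (vS _ _).
have mw : mf w by apply: (measurable_fun_cvg (h := v)) => [m|x _]; [exact: H1_mf|exact: vw].
have sw : sqi leb w.
  split=> //; have [] := @It_fatou _ _ _ leb (fun m => v m * v m) (w * w) C.
  - by move=> m; apply: sqiM; exact: H1_sqi.
  - by move=> m x; rewrite mulrfctE -expr2 sqr_ge0.
  - exact: mfM.
  - by move=> m; apply: le_trans (eC m); apply: le_trans (vle m); exact: ip_le_h1.
  - by apply: aeW => x; apply: cvgM.
  move=> h _; rewrite (_ : w * w = (fun x => `|(w * w) x|))//.
  by apply/funext => x; rewrite ger0_norm// mulrfctE -expr2 sqr_ge0.
have w01 x : 0 <= w x <= 1.
  have v0 m : 0 <= v m x by have /andP[] := v01 m x.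
  have v1 m : v m x <= 1 by have /andP[] := v01 m x.
  by apply/andP; split; [exact: lim_ge (vw x) v0|exact: lim_le (vw x) v1].
have vwc : nr (v m - w) @[m --> \oo] --> 0.
  apply: nr_cvg0; rewrite -(It0 leb).
  apply: (@It_dom _ _ _ leb (fun m => (v m - w) * (v m - w)) 0 (w * w) _ _ _ _ _).2.
  - by move=> m; apply: mfM; apply: mfB => //; exact: H1_mf.
  - exact: mf_cst.
  - apply: aeW => x; rewrite (_ : 0 x = (w x - w x) * (w x - w x)); last by rewrite subrr mul0r.
    by apply: cvgM; apply: cvgB => //; exact: cvg_cst.
  - exact: sqiM.
  - move=> m x; have := vlew m x; have /andP[h1 h2] := v01 m x; have /andP[h3 h4] := w01 x.
    by rewrite !fctE => h5; rewrite ger0_norm -?expr2 ?sqr_ge0//; nra.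
have DC m : Dr (v m) <= C.
  by apply: le_trans (eC m); apply: le_trans (vle m); exact: Dr_le_h1.
have [hw Dw] := Dr_lsc hv sw vwc DC.
have Iw : ip leb w w <= C.
  have c := ip_cvg (fun m => H1_sqi (hv m)) (fun m => H1_sqi (hv m)) sw sw vwc vwc.
  apply: (lim_le c) => m; apply: le_trans (eC m); apply: le_trans (vle m); exact: ip_le_h1.
have /choice[U hU] k : exists U, [/\ open U, A k `<=` U & {ae leb, forall x, U x -> u k x = 1}].
  by have [_ _ _] := hu k.
apply: (@le_trans _ _ (h1f w w)%:E); last by rewrite lee_fin /h1f; move: Dw Iw; rewrite /Dr; lra.
apply: (cap_le_h1 hw (U := \bigcup_k U k)).
- by apply: bigcup_open => k _; have [] := hU k.
- by move=> x [k _ Akx]; exists k => //; have [_ + _] := hU k; apply.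
have : {ae leb, forall x, forall k, U k x -> u k x = 1}.
  by apply: ae_foralln => k; have [] := hU k.
apply: filterS => x h [k _ Ukx]; rewrite -(h k Ukx); apply: le_trans (vlew k.+1 x).
by rewrite /= le_max lexx orbT.
Qed.

Lemma geom_sum (c : R) m : 0 <= c -> \sum_(k < m) c * hk R k.+1 <= c.
Proof.
move=> c0; suff : \sum_(k < m) c * hk R k.+1 <= c - c * hk R m.
  have := hk_gt0 R m; nra.
elim: m => [|m IH]; first by rewrite big_ord0 /hk expr0 mulr1 subrr.
by rewrite big_ord_recr/=; move: IH; rewrite /hk exprS; lra.
Qed.

Lemma cap0_bigcup (A : nat -> set E) : (forall k, cap (A k) = 0%E) -> cap (\bigcup_k A k) = 0%E.
Proof.
move=> A0; apply: cap_small => e e0.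
have e2 : 0 < e / 2 by rewrite divr_gt0.
have := @cap_bigcup A (fun k => e / 2 * hk R k.+1) (e / 2).
rewrite mulrCA mulfV// mulr1; apply; last by move=> m; apply: geom_sum; exact: ltW.
by move=> k; rewrite A0 lte_fin mulr_gt0// hk_gt0.
Qed.

Lemma cap0U A B : cap A = 0%E -> cap B = 0%E -> cap (A `|` B) = 0%E.
Proof.
move=> A0 B0; apply: (cap0_sub (B := \bigcup_k (if k is 0 then A else B))).
  by move=> x [Ax|Bx]; [exists 0%N|exists 1%N].
by apply: cap0_bigcup => -[|k].
Qed.

Lemma cap_set0 : cap (set0 : set E) = 0%E.
Proof.
apply/eqP; rewrite eq_le cap_ge0 andbT.
apply: le_trans (cap_le_h1 (@H10 R n) open0 (@subset_refl _ set0) _) _; first exact: aeW.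
by rewrite (psd0l BH)//; exact: H10.
Qed.

Lemma cap0_borel A : cap A = 0%E -> exists N, [/\ measurable N, A `<=` N & cap N = 0%E].
Proof.
move=> A0; have /choice[U hU] k : exists U, [/\ open U, A `<=` U & (cap U < (hk R k)%:E)%E].
  by apply: cap_open_lt; rewrite A0 lte_fin hk_gt0.
exists (\bigcap_k U k); split.
- by apply: bigcap_measurable => // k _; apply: open_measurable_rV; have [] := hU k.
- by move=> x Ax k _; have [_ + _] := hU k; apply.
- apply: cap_small => e /half_pow_small[N hN].
  apply: (@le_trans _ _ (cap (U N))); first by apply: cap_mono => x; apply.
  have [_ _ /ltW h] := hU N; apply: le_trans h _; rewrite lee_fin; exact: hN.
Qed.

Lemma cap0_leb A : cap A = 0%E -> leb.-negligible A.
Proof.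
move=> /cap0_borel[N [mN AN N0]]; apply: negligibleS AN _; apply/negligibleP => //.
apply/eqP; rewrite eq_le measure_ge0 andbT; apply/lee_addgt0Pr => e e0; rewrite add0e.
have : (cap N < e%:E)%E by rewrite N0 lte_fin.
move=> /cap_lt[u [U [hu oU NU uU ue]]]; have su := H1_sqi hu.
apply: (@le_trans _ _ (ip leb u u)%:E); last first.
  by rewrite lee_fin; apply: le_trans (ltW ue); exact: ip_le_h1.
have mU := open_measurable_rV oU.
apply: (@le_trans _ _ (leb U)); first by apply: le_measure => //; rewrite inE.
apply: (@le_trans _ _ (\int[leb]_x (\1_U x)%:E)%E); first by rewrite integral_indic// setIT.
rewrite /ip ItE; last exact: sqiM.
apply: ae_ge0_le_integral => //.
- by apply/measurable_EFinP; exact: mf_indic.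
- by move=> x _; rewrite lee_fin mulrfctE -expr2 sqr_ge0.
- by apply/measurable_EFinP; apply: mfM; exact: su.1.
apply: filterS uU => x h _; rewrite lee_fin indicE; have [/set_mem/h|] := boolP (x \in U).
  by rewrite mulrfctE => ->; rewrite mulr1.
by rewrite mulrfctE -expr2 sqr_ge0.
Qed.

End capacity.

(** * Quasi-continuous functions and quasi-everywhere convergence *)

Section quasi_continuity.
Variables (R : realType) (n : nat).
Local Notation E := 'rV[R]_n.
Local Notation leb := (lebesgue_rV R n).
Implicit Types (u v w f g : E -> R) (A B U : set E).
Let BL := psd_ip leb.
Let BH := @psd_h1 R n.

Lemma qc_comp2 (F : R -> R -> R) u v : (forall a b : R, F z.1 z.2 @[z --> (a, b)] --> F a b) ->
  quasi_continuous u -> quasi_continuous v -> quasi_continuous (fun x => F (u x) (v x)).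
Proof.
move=> cF qu qv e e0; have e4 : 0 < e / 4 by rewrite divr_gt0.
have [U [oU Ue cu]] := qu _ e4; have [V [oV Ve cv]] := qv _ e4.
exists (U `|` V); split; first exact: openU.
  have := cap_setU Ue Ve; rewrite (_ : 2 * (e / 4) + 2 * (e / 4) = e)//; by field.
have sU : ~` (U `|` V) `<=` ~` U by apply: subsetC; exact: subsetUl.
have sV : ~` (U `|` V) `<=` ~` V by apply: subsetC; exact: subsetUr.
apply/subspace_continuousP => x hx.
have h1 := (subspace_continuousP _ _).1 (continuous_subspaceW sU cu) x hx.
have h2 := (subspace_continuousP _ _).1 (continuous_subspaceW sV cv) x hx.
exact: (@continuous2_cvg _ _ _ _ _ _ u v F).
Qed.

Lemma qc_comp (F : R -> R) u : continuous F -> quasi_continuous u ->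
  quasi_continuous (fun x => F (u x)).
Proof.
move=> cF qu; apply: (@qc_comp2 (fun a _ => F a) u u) => // a b.
by apply: (@cvg_comp _ _ _ fst F); [exact: cvg_fst|exact: cF].
Qed.

Lemma qcD u v : quasi_continuous u -> quasi_continuous v -> quasi_continuous (u + v).
Proof.
by apply: (@qc_comp2 (fun a b => a + b)) => a b; apply: cvgD; [exact: cvg_fst|exact: cvg_snd].
Qed.

Lemma qcM u v : quasi_continuous u -> quasi_continuous v -> quasi_continuous (u * v).
Proof.
by apply: (@qc_comp2 (fun a b => a * b)) => a b; apply: cvgM; [exact: cvg_fst|exact: cvg_snd].
Qed.

Lemma qcZ (a : R) u : quasi_continuous u -> quasi_continuous (a *: u).
Proof. by apply: (@qc_comp (fun b => a * b)) => b; apply: cvgM; [exact: cvg_cst|exact: cvg_id]. Qed.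

Lemma qc_abs u : quasi_continuous u -> quasi_continuous (fun x => `|u x|).
Proof. by apply: qc_comp => b; exact: (@norm_continuous R R). Qed.

Lemma qc_continuous u : continuous u -> quasi_continuous u.
Proof.
move=> cu e e0; exists set0; split; [exact: open0|by rewrite cap_set0 lte_fin|].
exact: continuous_subspaceT.
Qed.

Lemma qc_cst (k : R) : quasi_continuous (cst k : E -> R).
Proof. by apply: qc_continuous; exact: cst_continuous. Qed.

Lemma qcN u : quasi_continuous u -> quasi_continuous (- u).
Proof. by move=> qu; rewrite -scaleN1r; exact: qcZ. Qed.

Lemma qc_min u v : quasi_continuous u -> quasi_continuous v -> quasi_continuous (u \min v).
Proof.
move=> qu qv; rewrite minE; apply: qcZ; apply: qcD; first exact: qcD.
by apply: qcN; apply: (@qc_abs (u - v)); apply: qcD => //; exact: qcN.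
Qed.

Lemma qc_max u v : quasi_continuous u -> quasi_continuous v -> quasi_continuous (u \max v).
Proof.
by move=> qu qv; rewrite maxE; apply: qcD; [exact: qcD|apply: qcN; exact: qc_min].
Qed.

Lemma qc_mod u v : quasi_continuous u -> cap [set x | u x != v x] = 0%E -> quasi_continuous v.
Proof.
move=> qu uv e e0; have e4 : 0 < e / 4 by rewrite divr_gt0.
have [U [oU Ue cu]] := qu _ e4.
have [V [oV UV Ve]] : exists V, [/\ open V, [set x | u x != v x] `<=` V & (cap V < (e / 4)%:E)%E].
  by apply: cap_open_lt; rewrite uv lte_fin.
exists (U `|` V); split; first exact: openU.
  have := cap_setU Ue Ve; rewrite (_ : 2 * (e / 4) + 2 * (e / 4) = e)//; by field.
have sU : ~` (U `|` V) `<=` ~` U by apply: subsetC; exact: subsetUl.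
have uvE x : (~` (U `|` V)) x -> u x = v x.
  by move=> h; apply/eqP; apply: contrapT => /negP h2; apply: h; right; apply: UV.
apply/subspace_continuousP => x hx.
have h1 := (subspace_continuousP _ _).1 (continuous_subspaceW sU cu) x hx.
rewrite /from_subspace -(uvE x hx); apply: cvg_trans h1; apply: near_eq_cvg.
by apply: filterS (withinT _ _) => // y hy; exact: uvE.
Qed.

(** Off the exceptional open set the preimage is relatively open; joined to that set it becomes open
    and can be used in the definition of capacity. *)
Lemma qc_open U u (O : set R) : open U -> {within ~` U, continuous u} -> open O ->
  open (U `|` u @^-1` O).
Proof.
move=> oU cu oO; rewrite openE => x /= Ux.
have [xU|xU] := pselect (U x).
  apply: (@filterS _ _ _ U); first exact: subsetUl.
  exact: open_nbhs_nbhs.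
have Ox : O (u x) by case: Ux.
have h1 := (subspace_continuousP _ _).1 cu x xU.
have : nbhs (u x) O by exact: open_nbhs_nbhs.
move=> /h1 h2; apply: (@filterS _ (nbhs x) _ _ _ _ h2) => y hy.
by have [Uy|Uy] := pselect (U y); [left|right; exact: hy].
Qed.

(* The union W of {u <> v} with an exceptional set U of small capacity is open and differs
   from U by a Lebesgue-null set, so every competitor for cap U is one for cap W. *)
Lemma qc_ae_eq u v : quasi_continuous u -> quasi_continuous v ->
  {ae leb, forall x, u x = v x} -> cap [set x | u x != v x] = 0%E.
Proof.
move=> qu qv uv; have qw : quasi_continuous (u - v) by apply: qcD => //; exact: qcN.
apply: cap_small => e e0; have [U [oU Ue cu]] := qw _ e0.
have [phi [V [hphi oV UV phiV phie]]] := cap_lt Ue.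
have oW := qc_open oU cu (@open_neq R 0).
apply: (@le_trans _ _ (h1f phi phi)%:E); last by rewrite lee_fin ltW.
apply: (cap_le_h1 hphi oW).
  by move=> x /= h; right; rewrite /= fctE subr_eq0.
apply: filterS2 uv phiV => x h1 h2 [/UV/h2 ->//|/=].
by rewrite fctE h1 subrr eqxx.
Qed.

Lemma H1q_dom (a : R) u v : H1q u -> H1q v -> H1q (a *: u + v).
Proof. by move=> [h1 q1] [h2 q2]; split; [exact: H1_dom|apply: qcD => //; exact: qcZ]. Qed.

Lemma H1q0 : H1q (0 : E -> R).
Proof. by split; [exact: H10|exact: qc_cst]. Qed.

Lemma psd_h1q : psd (@H1q R n) (@h1f R n).
Proof. by apply: psd_sub BH _ H1q0 H1q_dom => u []. Qed.

Lemma H1q_abs u : H1q u -> H1q (fun x => `|u x|).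
Proof. by move=> [hu qu]; split; [exact: (H1_abs hu).1|exact: qc_abs]. Qed.

Lemma H1q_min u v : H1q u -> H1q v -> H1q (u \min v).
Proof. by move=> [hu qu] [hv qv]; split; [exact: H1_min|exact: qc_min]. Qed.

Lemma H1q_minc u (k : R) : 0 <= k -> H1q u -> H1q (fun x => Num.min (u x) k).
Proof.
by move=> k0 [hu qu]; split; [exact: H1_minc|apply: (qc_min qu (qc_cst k))].
Qed.

Lemma H1q_cut L eta u : cutoff L eta -> continuous eta -> H1q u -> H1q (eta * u).
Proof.
move=> ce ceta [hu qu]; split; first exact: (H1_cut ce hu).1.
by apply: qcM => //; exact: qc_continuous.
Qed.

Lemma H1q_mod u v : H1q u -> mf v -> cap [set x | u x != v x] = 0%E -> H1q v.
Proof.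
move=> [hu qu] mv uv; split; last exact: qc_mod uv.
apply: (H1_ae hu mv); have := cap0_leb uv; apply: negligibleS => x /= h.
by apply/negP => /eqP.
Qed.

(** A Chebyshev inequality: |u| / t + |phi| is a competitor on the open set made of {|u| > t} and of
    the exceptional set, [phi] being a competitor of small norm for the latter. *)
Lemma cap_gt u (t : R) : 0 < t -> H1q u ->
  (cap [set x : E | (t < `|u x|)%R] <= (2 * t ^- 2 * h1f u u)%:E)%E.
Proof.
move=> t0 [hu qu]; apply/lee_addgt0Pr => e e0.
have e4 : 0 < e / 2 by rewrite divr_gt0.
have [U [oU Ue cu]] := qc_abs qu e4.
have [phi [V [hphi oV UV phiV phie]]] := cap_lt Ue.
have oW := qc_open oU cu (@open_gt R t).
have [hau Dau] := H1_abs hu; have [hap Dap] := H1_abs hphi.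
have hat := H1Z t^-1 hau.
apply: (@le_trans _ _ (h1f (t^-1 *: (fun x => `|u x|) + (fun x => `|phi x|))
  (t^-1 *: (fun x => `|u x|) + (fun x => `|phi x|)))%:E).
  apply: (cap_le_h1 (H1D hat hap) oW).
    by move=> x /= h; right.
  apply: filterS phiV => x h [/UV/h /= h1|/= h1]; rewrite !fctE /GRing.scale/=.
    by rewrite h1 normr1 lerDr mulr_ge0// invr_ge0 ltW.
  by apply: ler_wpDr => //; rewrite ler_pdivlMl// mulr1 ltW.
rewrite -EFinD lee_fin; apply: le_trans (psd_sqD_le BH hat hap) _.
rewrite (psd_sqZ BH)// exprVn -mulrA lerD//.
  rewrite ler_wpM2l// ler_wpM2l ?invr_ge0 ?exprn_ge0 ?(ltW t0)//.
  by rewrite /h1f ip_abs lerD2l.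
have : h1f (fun x => `|phi x|) (fun x => `|phi x|) <= h1f phi phi.
  by rewrite /h1f ip_abs lerD2l.
lra.
Qed.

Lemma H1_complete (U : nat -> E -> R) : (forall k, H1 (U k)) ->
  (forall e, 0 < e -> exists N, forall m l, (N <= m)%N -> (N <= l)%N ->
     h1f (U m - U l) (U m - U l) <= e) ->
  exists2 u, H1 u & h1f (U m - u) (U m - u) @[m --> \oo] --> 0.
Proof.
move=> hU UC; have sU m := H1_sqi (hU m).
have [|u [s [su hs aeu Lu]]] := L2_complete sU.
  move=> e /UC[N hN]; exists N => m l Nm Nl; apply: le_trans (hN m l Nm Nl).
  exact: ip_le_h1 (H1B (hU m) (hU l)).
have nu := nr_cvg0 Lu.
have D1 e : 0 < e -> exists N, forall m, (N <= m)%N -> H1 (U m - u) /\ Dr (U m - u) <= e.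
  move=> /UC[N hN]; exists N => m Nm.
  apply: (@Dr_lsc _ _ (fun l => U m - U (N + l)%N)).
  - by move=> l; exact: H1B.
  - exact: (psd_domB BL).
  - rewrite (_ : (fun l => _) = (fun l => nr (U (N + l)%N - u))).
      by apply: (@cvg_subseq _ (fun l => nr (U l - u)) 0 (fun l => (N + l)%N)) => // i j; rewrite ltn_add2l.
    apply/funext => l; rewrite -[RHS]/(Num.sqrt _) /nr; congr (Num.sqrt _).
    by apply: It_ext => x; rewrite !fctE; ring.
  - move=> l; apply: le_trans (hN m (N + l)%N Nm (leq_addr _ _)).
    exact: Dr_le_h1 (H1B (hU m) (hU _)).
have hu : H1 u.
  have [N /(_ N (leqnn N))[h _]] := D1 1 ltr01.
  by rewrite -[u](subKr (U N)); exact: H1B.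
exists u => //; apply/cvg_epsP => e e0; have e2 : 0 < e / 2 by rewrite divr_gt0.
have [N1 h1] := D1 _ e2; have [N2 h2] := (cvg_epsP _ _).1 Lu _ e2.
exists (maxn N1 N2) => m; rewrite geq_max => /andP[/h1[hd Dd] /h2]; rewrite !subr0.
move=> /(le_trans (ler_norm _)) => h3; rewrite ger0_norm ?(psd_ge0 BH)//.
by move: Dd h3; rewrite /h1f /Dr; lra.
Qed.

(** The exponent 3 gives the sets {|U_(k+1) - U_k| > 2^-k} capacities of order 2^-k. Off the open
    set [V p], which contains them from rank p on, convergence is geometric and uniform, so the
    limit is continuous there apart from the exceptional sets of the [U k]. *)
Lemma H1q_fast (U : nat -> E -> R) : (forall k, H1q (U k)) ->
  (forall k, h1f (U k.+1 - U k) (U k.+1 - U k) <= hk R k ^+ 3) ->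
  exists u Z, [/\ mf u, quasi_continuous u, measurable Z, cap Z = 0%E &
    forall x, ~ Z x -> U k x @[k --> \oo] --> u x].
Proof.
move=> hU hUk; have mU k : mf (U k) by apply: H1_mf; exact: (hU k).1.
have dU k := psd_domB psd_h1q (hU k.+1) (hU k).
pose A k := [set x : E | hk R k < `|(U k.+1 - U k) x|].
have capA k : (cap (A k) < (3 * hk R k)%:E)%E.
  apply: le_lt_trans (cap_gt (hk_gt0 R k) (dU k)) _; rewrite lte_fin.
  have k0 := hk_gt0 R k.
  apply: (@le_lt_trans _ _ (2 * (hk R k) ^- 2 * hk R k ^+ 3)).
    by rewrite ler_wpM2l// mulr_ge0// invr_ge0 exprn_ge0// ltW.
  by rewrite [ltLHS](_ : _ = 2 * hk R k); [lra|field; rewrite gt_eqF].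
have /choice[V hV] p : exists V, [/\ open V, \bigcup_k A (p + k)%N `<=` V &
    (cap V < (16 * hk R p)%:E)%E].
  apply: cap_open_lt; have p0 := hk_gt0 R p.
  apply: (@le_lt_trans _ _ (2 * (6 * hk R p))%:E); last by rewrite lte_fin; lra.
  apply: (@cap_bigcup _ _ _ (fun k => 6 * hk R p * hk R k.+1)).
    move=> k; have := capA (p + k)%N; rewrite /hk exprD exprS.
    by rewrite (_ : 6 * _ * _ = 3 * (2^-1 ^+ p * 2^-1 ^+ k))//; field.
  by move=> m; apply: geom_sum; rewrite mulr_ge0// ltW.
pose Z := \bigcap_p V p.
have mZ : measurable Z.
  by apply: bigcap_measurable => // p _; apply: open_measurable_rV; have [] := hV p.
have cZ : cap Z = 0%E.
  apply: cap_small => e e0; have e16 : 0 < e / 16 by rewrite divr_gt0.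
  have [N hN] := half_pow_small e16.
  apply: (@le_trans _ _ (cap (V N))); first by apply: cap_mono => x; apply.
  have [_ _ /ltW h] := hV N; apply: le_trans h _; rewrite lee_fin.
  by have := hN N (leqnn _); rewrite -/(hk R N) ler_pdivlMr// mulrC.
have geo p x : ~ V p x -> exists2 l : R, U (p + k)%N x @[k --> \oo] --> l &
    forall k, `|U (p + k)%N x - l| <= 2 * hk R p * 2^-1 ^+ k.
  move=> Vx; apply: geom_cvg => k; rewrite addnS -exprD leNgt; apply/negP => h.
  by apply: Vx; have [_ + _] := hV p; apply; exists k.
have cvgU p x : ~ V p x -> cvgn (fun k => U k x).
  move=> /geo[l hl _]; apply/cvg_ex; exists l; apply/cvg_epsP => e e0.
  have [N hN] := (cvg_epsP _ _).1 hl _ e0; exists (p + N)%N => k pk.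
  by have := hN (k - p)%N; rewrite subnKC ?(leq_trans (leq_addr N p))//; apply; rewrite leq_subRL// (leq_trans (leq_addr N p)).
pose u x : R := limn (fun k => (U k * \1_(~` Z)) x).
have cU x : (U k * \1_(~` Z)) x @[k --> \oo] --> u x.
  rewrite /u; apply/cvg_ex; have [xZ|xZ] := pselect (Z x).
    exists 0; rewrite (_ : (fun k => _) = (fun=> 0)); first exact: cvg_cst.
    by apply/funext => k; rewrite mulrfctE indicE memNset ?mulr0// => h; exact: h.
  have [p Vp] : exists p, ~ V p x.
    by apply: contrapT => h; apply: xZ => p _; apply: contrapT => h'; apply: h; exists p.
  have /cvg_ex[l hl] := cvgU _ _ Vp; exists l.
  by under eq_fun do rewrite mulrfctE indicE mem_set// mulr1.
have Uu x : ~ Z x -> U k x @[k --> \oo] --> u x.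
  by move=> xZ; have := cU x; under eq_fun do rewrite mulrfctE indicE mem_set// mulr1.
have mu : mf u.
  apply: (measurable_fun_cvg (h := fun k => U k * \1_(~` Z))) => [k|x _]; last exact: cU.
  by apply: mfM => //; apply: mf_indic; exact: measurableC.
exists u, Z; split => // e e0.
have /choice[W hW] k : exists W, [/\ open W, (cap W < (e / 8 * hk R k.+1)%:E)%E &
    {within ~` W, continuous (U k)}].
  by apply: (hU k).2; rewrite mulr_gt0 ?divr_gt0// hk_gt0.
have [p hp] : exists p, 16 * hk R p < e / 8.
  have e1 : 0 < e / 8 / 17 by rewrite !divr_gt0.
  have [N hN] := half_pow_small e1; exists N; have := hN N (leqnn _); rewrite -/(hk R N).
  by have := hk_gt0 R N; lra.
have oVp : open (V p) by have [] := hV p.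
have oW : open (\bigcup_k W k) by apply: bigcup_open => k _; have [] := hW k.
have e8 : 0 <= e / 8 by rewrite divr_ge0// ltW.
exists (\bigcup_k W k `|` V p); split; first exact: openU.
  have c1 : (cap (\bigcup_k W k) < (2 * (e / 8) + e / 64)%:E)%E.
    apply: (@le_lt_trans _ _ (2 * (e / 8))%:E); last by rewrite lte_fin; lra.
    apply: (@cap_bigcup _ _ _ (fun k => e / 8 * hk R k.+1)); first by move=> k; have [] := hW k.
    by move=> m; apply: geom_sum.
  have [_ _ c2] := hV p; apply: lt_le_trans (cap_setU c1 c2) _; rewrite lee_fin.
  by move: hp; lra.
apply/subspace_continuousP => x hx.
have hxV : ~ V p x by move=> h; apply: hx; right.
apply/cvgrPdist_le => d d0.
have d3 : 0 < d / 3 by rewrite divr_gt0.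
have [k hk3] : exists k, 2 * hk R p * 2^-1 ^+ k <= d / 3.
  have p0 := hk_gt0 R p; have d4 : 0 < d / 3 / (2 * hk R p) by rewrite divr_gt0// mulr_gt0.
  have [N hN] := half_pow_small d4; exists N; rewrite mulrC -ler_pdivlMr ?mulr_gt0//.
  exact: hN.
have Uclose y : ~ V p y -> `|U (p + k)%N y - u y| <= d / 3.
  move=> yV; have [l hl h] := geo _ _ yV.
  have yZ : ~ Z y by move=> h'; apply: yV; exact: h'.
  have -> : u y = l.
    apply: (cvg_unique _ _ hl) => //.
    by apply: (cvg_subseq (s := fun k => (p + k)%N) _ (Uu y yZ)) => i j; rewrite ltn_add2l.
  exact: le_trans (h k) hk3.
have sW : ~` (\bigcup_k W k `|` V p) `<=` ~` W (p + k)%N.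
  by apply: subsetC => y Wy; left; exists (p + k)%N.
have [_ _ cW] := hW (p + k)%N.
have h1 := (subspace_continuousP _ _).1 (continuous_subspaceW sW cW) x hx.
have h2 := (cvgrPdist_le _ _).1 h1 _ d3.
have h3 : nbhs x (fun y => (~` (\bigcup_k W k `|` V p)) y ->
   `|U (p + k)%N x - U (p + k)%N y| <= d / 3) by exact: h2.
suff : nbhs x (fun y => (~` (\bigcup_k W k `|` V p)) y -> `|u x - u y| <= d) by [].
apply: filterS h3 => y hy1 hy2; have {}hy1 := hy1 hy2.
have hyV : ~ V p y by move=> h; apply: hy2; right.
have A1 := Uclose x hxV; have A2 := Uclose y hyV.
have -> : u x - u y = - (U (p + k)%N x - u x) + (U (p + k)%N x - U (p + k)%N y) + (U (p + k)%N y - u y) by ring.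
apply: le_trans (ler_normD _ _) _.
have := ler_normD (- (U (p + k)%N x - u x)) (U (p + k)%N x - U (p + k)%N y).
rewrite normrN; lra.
Qed.

(** The quasi-everywhere limit of a fast subsequence agrees almost everywhere with the H^1 limit;
    the sequence itself thus produces a quasi-continuous version of its limit. *)
Lemma H1q_complete (U : nat -> E -> R) : (forall k, H1q (U k)) ->
  (forall e, 0 < e -> exists N, forall m l, (N <= m)%N -> (N <= l)%N ->
     h1f (U m - U l) (U m - U l) <= e) ->
  exists u (s : nat -> nat) Z, [/\ H1q u, {homo s : m n / (m < n)%N}, cap Z = 0%E,
    forall x, ~ Z x -> U (s k) x @[k --> \oo] --> u x &
    h1f (U m - u) (U m - u) @[m --> \oo] --> 0].
Proof.
move=> hU UC; have hU1 k := (hU k).1.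
have [v hv Lv] := H1_complete hU1 UC.
have [s hs sC] := @fast_subseq _ (fun m l => h1f (U m - U l) (U m - U l)) (fun k => hk R k ^+ 3)
   (fun k => exprn_gt0 3 (hk_gt0 R k)) UC.
have [|k|u [Z [mu qu mZ cZ Uu]]] := @H1q_fast (U \o s); first by move=> k; exact: hU.
  by apply: sC => //; apply: (leq_homo_ltn hs).
have Lsv : ip leb (U (s k) - v) (U (s k) - v) @[k --> \oo] --> 0.
  have := cvg_subseq hs Lv => /cvg_epsP h; apply/cvg_epsP => e /h[N hN]; exists N => k /hN.
  have hd := H1B (hU1 (s k)) hv; rewrite !subr0 => h1.
  rewrite ger0_norm ?(psd_ge0 BL (H1_sqi hd))//.
  exact: le_trans (ip_le_h1 hd) (le_trans (ler_norm _) h1).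
have ev : {ae leb, forall x, v x = u x}.
  have sUs k := H1_sqi (hU1 (s k)).
  have [|w [t [sw ht aew Lw]]] := @L2_complete _ _ _ leb (fun k => U (s k)) sUs.
    move=> e /UC[N hN]; exists N => m l Nm Nl.
    apply: le_trans (ip_le_h1 (H1B (hU1 _) (hU1 _))) _; apply: hN.
      exact: leq_trans Nm (homo_ltn_ge hs m).
    exact: leq_trans Nl (homo_ltn_ge hs l).
  have sv := H1_sqi hv.
  have vw : ip leb (v - w) (v - w) <= 0.
    have c : 2 * ip leb (U (s k) - v) (U (s k) - v) + 2 * ip leb (U (s k) - w) (U (s k) - w) @[k --> \oo] --> (2 * 0 + 2 * 0 : R).
      by apply: cvgD; apply: cvgM => //; exact: cvg_cst.
    rewrite mulr0 addr0 in c; apply: (lim_ge c) => k.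
    have -> : v - w = (U (s k) - w) - (U (s k) - v) by apply/funext => x; rewrite !fctE; ring.
    rewrite [leRHS]addrC; apply: (psd_sqB_le BL); exact: (psd_domB BL).
  have {}vw0 : {ae leb, forall x, (v - w) x = 0}.
    apply: ip_eq0_ae; first exact: (psd_domB BL).
    by apply/eqP; rewrite eq_le vw (psd_ge0 BL)//; exact: (psd_domB BL).
  have aeZ : {ae leb, forall x, ~ Z x}.
    by have := cap0_leb cZ; apply: negligibleS => x /= /contrapT.
  move: vw0; apply: filterS3 aeZ aew => x h1 h2 /eqP; rewrite fctE subr_eq0 => /eqP ->.
  by apply: (cvg_unique _ h2) => //; exact: (cvg_subseq ht (Uu x h1)).
have hu : H1 u by exact: H1_ae ev.
exists u, s, Z; split => //.
rewrite (_ : (fun m => _) = (fun m => h1f (U m - v) (U m - v)))//.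
apply/funext => m; have e1 : {ae leb, forall x, (U m - u) x = (U m - v) x}.
  by apply: filterS ev => x h; rewrite !fctE h.
rewrite /h1f -/(Dr _) -/(Dr _) (Dr_ae (H1B (hU1 m) hu) (H1B (hU1 m) hv) e1).
by congr (_ + _); apply: ip_ae => //; exact: H1_mf (H1B _ _).
Qed.

End quasi_continuity.

(** * The energy space of a capacitary measure *)

Section abstract_minimum.
Variables (R : realType) (V : lmodType R) (S : set V) (b : V -> V -> R) (l : V -> R).
Hypothesis B : psd S b.
Hypothesis ll : forall a u v, S u -> S v -> l (a *: u + v) = a * l u + l v.
Let F u := 2^-1 * b u u - l u.

Lemma quad_lower (C : R) u : 0 <= C -> l u ^+ 2 <= C * b u u -> S u -> - (C / 2) <= F u.
Proof.
move=> C0 h Su; have b0 := psd_ge0 B Su; rewrite /F.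
have : `|l u| <= (C + b u u) / 2.
  rewrite -ler_sqr ?nnegrE ?divr_ge0 ?addr_ge0// real_normK ?num_real//.
  by apply: le_trans h _; have := sqr_ge0 (C - b u u); nra.
by rewrite ler_norml => /andP[_]; lra.
Qed.

(** Riesz representation for a semidefinite form: minimising sequences are Cauchy for b,
    completeness gives a limit, and the approximate Euler equation passes to it by
    Cauchy-Schwarz. *)
Lemma quad_solution (C : R) : 0 <= C -> (forall v, S v -> l v ^+ 2 <= C * b v v) ->
  (forall U : nat -> V, (forall k, S (U k)) ->
    (forall e, 0 < e -> exists N, forall m p, (N <= m)%N -> (N <= p)%N ->
       b (U m - U p) (U m - U p) <= e) ->
    exists2 u, S u & b (U m - u) (U m - u) @[m --> \oo] --> 0) ->
  exists2 u, S u & forall v, S v -> b u v = l v.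
Proof.
move=> C0 lC Scomp.
have FC u : S u -> - (C / 2) <= F u by move=> Su; apply: quad_lower => //; exact: lC.
pose I := [set F u | u in S]; have hI : has_inf I.
  split; first by exists (F 0), 0 => //; exact: (psd_dom0 B).
  by exists (- (C / 2)) => _ [u Su <-]; exact: FC.
set m := inf I.
have mF u : S u -> m <= F u by move=> Su; apply: (inf_lbound hI.2); exists u.
have /choice[U hU] k : exists u, S u /\ F u < m + 2^-1 ^+ k.
  have [_ [u Su <-] h] := inf_adherent (half_pow_gt0 R k) hI.
  by exists u.
have SU k : S (U k) := (hU k).1.
have PU p q : b (U p - U q) (U p - U q) <= 4 * (F (U p) - m) + 4 * (F (U q) - m).
  apply: (quad_parallelogram B ll) => //; apply: mF.
  by apply: (psd_domZ B); exact: (psd_domD B).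
have [|u Su Lu] := Scomp U SU.
  move=> e e0; have e8 : 0 < e / 8 by rewrite divr_gt0.
  have [N hN] := half_pow_small e8; exists N => p q /hN hp /hN hq; apply: le_trans (PU p q) _.
  by have := (hU p).2; have := (hU q).2; lra.
exists u => // v Sv; apply/eqP; rewrite -subr_eq0 -sqrf_eq0; apply/eqP.
apply/le_anti; rewrite sqr_ge0 andbT.
have b0 := psd_ge0 B Sv.
apply: (lim_ge (v := fun k => (4 * 2^-1 ^+ k + 2 * b (U k - u) (U k - u)) * b v v)).
  rewrite -(mul0r (b v v)); apply: cvgM; last exact: cvg_cst.
  rewrite -[X in _ --> X]addr0 -[X in _ --> _ + X](mulr0 2).
  by apply: cvgD; [exact: hk_cvg|apply: cvgM => //; exact: cvg_cst].
move=> k; have St (t : R) : S (U k + t *: v).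
  by apply: (psd_domD B) => //; exact: (psd_domZ B).
have h2 := quad_approx_euler B ll (SU k) Sv St mF (ltW (hU k).2).
have Sd := psd_domB B (SU k) Su.
have := psd_CS B Sd Sv; rewrite (psdBl B)//.
set x := b (U k) v in h2 *; set y := b u v; set z := l v in h2 * => h1.
have : (y - z) ^+ 2 <= 2 * (x - z) ^+ 2 + 2 * (x - y) ^+ 2 by have := sqr_ge0 (2 * x - y - z); nra.
by rewrite mulrDl; lra.
Qed.

End abstract_minimum.

Section energy_form.
Variables (R : realType) (n : nat) (mu : {measure set 'rV[R]_n -> \bar R}).
Local Notation E := 'rV[R]_n.
Local Notation leb := (lebesgue_rV R n).
Implicit Types (u v w f g : E -> R) (A B U : set E).
Let BL := psd_ip leb.
Let BM := psd_ip mu.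
Let BD := @psd_Da R n.

Lemma sqintE u : sqi mu u -> sqint mu u = (ip mu u u)%:E.
Proof.
by move=> su; rewrite /ip ItE; [apply: eq_integral => x _; rewrite expr2|exact: sqiM].
Qed.

Lemma H1muP u : H1mu mu u <-> H1q u /\ sqi mu u.
Proof.
split=> -[hu h]; split => //; last by rewrite sqintE// ltry.
have mu_ := H1_mf hu.1; split; first exact: mu_.
apply/integ_ge0P; first by apply: mfM; exact: mu_.
  by move=> x; rewrite mulrfctE -expr2 sqr_ge0.
by move: h; congr (_ < _)%E; apply: eq_integral => x _; rewrite expr2.
Qed.

Lemma H1mu_H1 u : H1mu mu u -> H1 u. Proof. by case=> -[]. Qed.
Lemma H1mu_sqi u : H1mu mu u -> sqi leb u. Proof. by move/H1mu_H1/H1_sqi. Qed.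
Lemma H1mu_smu u : H1mu mu u -> sqi mu u. Proof. by case/H1muP. Qed.

Definition Ef u v := Da u v + ip mu u v.

Lemma psd_E : psd (H1mu mu) Ef.
Proof.
apply: psd_sub (psdD BD BM) _ _ _.
- by move=> u hu; split; [exact: H1mu_H1|exact: H1mu_smu].
- by apply/H1muP; split; [exact: H1q0|exact: (psd_dom0 BM)].
- move=> a u v /H1muP[h1 h2] /H1muP[h3 h4]; apply/H1muP; split; first exact: H1q_dom.
  exact: (psd_domP BM).
Qed.
Let BE := psd_E.

Lemma Dr_le_E u : H1mu mu u -> Dr u <= Ef u u.
Proof. by move=> hu; rewrite lerDl (psd_ge0 BM)//; exact: H1mu_smu. Qed.

Lemma ip_le_E u : H1mu mu u -> ip mu u u <= Ef u u.
Proof. by move=> hu; rewrite lerDr; apply: Dr_ge0; exact: H1mu_H1. Qed.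

Lemma H1mu_le u v : H1q v -> H1mu mu u -> (forall x, `|v x| <= `|u x|) -> H1mu mu v.
Proof.
move=> qv hu vu; apply/H1muP; split => //.
by apply: sqi_le vu; [exact: H1mu_smu|exact: H1_mf qv.1].
Qed.

Lemma H1mu_abs u : H1mu mu u -> H1mu mu (fun x => `|u x|) /\
  Ef (fun x => `|u x|) (fun x => `|u x|) <= Ef u u.
Proof.
move=> hu; have [qu su] := (H1muP u).1 hu; split.
  by apply: (H1mu_le _ hu); [exact: H1q_abs|move=> x; rewrite normr_id].
by rewrite /Ef ip_abs lerD2r; exact: (H1_abs qu.1).2.
Qed.

Lemma energyE f u : H1mu mu u -> integ leb (f * u) ->
  energy mu f u = (2^-1 * Ef u u - It leb (f * u))%:E.
Proof.
move=> hu ifu; rewrite /energy dirichletE ?sqintE; [|exact: H1mu_smu|exact: H1mu_H1].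
have -> : (\int[leb]_x (f x * u x)%:E = (It leb (f * u))%:E)%E by rewrite ItE.
by rewrite [RHS]EFinB /Ef /Dr mulrDr EFinD !EFinM.
Qed.

Lemma H1mu_L1P u : H1mu_L1 mu u <-> H1mu mu u /\ integ leb u.
Proof. by split=> -[h1 h2]; split => //; apply/Lfun1_integrable. Qed.

Lemma cap0_ae A : capacitary mu -> cap A = 0%E -> {ae mu, forall x, ~ A x}.
Proof. by move=> cmu /cmu; apply: negligibleS => x /= /contrapT. Qed.

(** A set of zero capacity is negligible for mu, so quasi-everywhere convergence allows Fatou's
    lemma with respect to mu. Convergence almost everywhere for the Lebesgue measure would say
    nothing about the mu-part. The L^2 Cauchy condition is separate because the energy alone does
    not bound the L^2 norm. *)
Lemma E_complete (U : nat -> E -> R) : capacitary mu -> (forall k, H1mu mu (U k)) ->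
  (forall e, 0 < e -> exists N, forall m l, (N <= m)%N -> (N <= l)%N ->
     Ef (U m - U l) (U m - U l) <= e) ->
  (forall e, 0 < e -> exists N, forall m l, (N <= m)%N -> (N <= l)%N ->
     ip leb (U m - U l) (U m - U l) <= e) ->
  exists u (s : nat -> nat) Z, [/\ H1mu mu u, cap Z = 0%E, {homo s : m n / (m < n)%N},
    forall x, ~ Z x -> U (s k) x @[k --> \oo] --> u x &
    Ef (U m - u) (U m - u) @[m --> \oo] --> 0 /\ ip leb (U m - u) (U m - u) @[m --> \oo] --> 0].
Proof.
move=> cmu hU EC LC; have qU k := ((H1muP _).1 (hU k)).1.
have hd m l := psd_domB BE (hU m) (hU l).
have [|u [s [Z [qu hs cZ Uu Lu]]]] := H1q_complete qU.
  move=> e e0; have e2 : 0 < e / 2 by rewrite divr_gt0.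
  have [N1 h1] := EC _ e2; have [N2 h2] := LC _ e2; exists (maxn N1 N2) => m l.
  rewrite !geq_max => /andP[a1 a2] /andP[b1 b2]; have := h1 m l a1 b1; have := h2 m l a2 b2.
  by have := Dr_le_E (hd m l); rewrite /h1f /Dr; lra.
have aeU : {ae mu, forall x, U (s k) x @[k --> \oo] --> u x}.
  by have := cap0_ae cmu cZ; apply: filterS => x; exact: Uu.
have mu_ := H1_mf qu.1.
have key e : 0 < e -> exists N, forall m, (N <= m)%N -> sqi mu (U m - u) /\ ip mu (U m - u) (U m - u) <= e.
  move=> /EC[N hN]; exists N => m Nm.
  have msq : mf ((U m - u) * (U m - u)) by apply: mfM; apply: mfB => //; exact: H1_mf (qU m).1.
  have [] := @It_fatou _ _ _ mu (fun k => (U m - U (s (N + k)%N)) * (U m - U (s (N + k)%N))) ((U m - u) * (U m - u)) e.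
  - by move=> k; apply: sqiM; apply: H1mu_smu.
  - by move=> k x; rewrite mulrfctE -expr2 sqr_ge0.
  - exact: msq.
  - move=> k; apply: le_trans (hN m (s (N + k)%N) Nm _); first exact: ip_le_E.
    exact: leq_trans (leq_addr _ _) (homo_ltn_ge hs _).
  - apply: filterS aeU => x hx; have hx' : U (s (N + k)%N) x @[k --> \oo] --> u x.
      by apply: (cvg_subseq (v := fun k => U (s k) x) (s := fun k => (N + k)%N) _ hx) => i j; rewrite ltn_add2l.
    by apply: cvgM; apply: cvgB => //; exact: cvg_cst.
  have eq : (fun x => `|((U m - u) * (U m - u)) x|) = (U m - u) * (U m - u).
    by apply/funext => x; rewrite ger0_norm// mulrfctE -expr2 sqr_ge0.
  rewrite eq => h1 h2; split => //; split => //.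
  by apply: mfB => //; exact: H1_mf (qU m).1.
have hu : H1mu mu u.
  apply/H1muP; split => //; have [N /(_ N (leqnn N))[h _]] := key 1 ltr01.
  by rewrite -[u](subKr (U N)); apply: (psd_domB BM) => //; exact: H1mu_smu.
have hdu m := psd_domB BE (hU m) hu.
exists u, s, Z; split => //; split; apply/cvg_epsP => e e0.
  have e2 : 0 < e / 2 by rewrite divr_gt0.
  have [N1 h1] := key _ e2; have [N2 h2] := (cvg_epsP _ _).1 Lu _ e2.
  exists (maxn N1 N2) => m; rewrite geq_max => /andP[/h1[_ a1] /h2]; rewrite !subr0.
  move=> /(le_trans (ler_norm _)) => a2; rewrite ger0_norm ?(psd_ge0 BE)//.
  by have := Dr_le_h1 (H1mu_H1 (hdu m)); move: a1 a2; rewrite /Ef /Dr; lra.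
have [N h] := (cvg_epsP _ _).1 Lu _ e0; exists N => m /h; rewrite !subr0.
rewrite [`|ip leb _ _|]ger0_norm ?(psd_ge0 BL (H1mu_sqi (hdu m)))// => h2.
exact: le_trans (ip_le_h1 (H1mu_H1 (hdu m))) (le_trans (ler_norm _) h2).
Qed.

End energy_form.

(** * Measures made infinite outside a set *)

Section saturation.
Variables (R : realType) (n : nat) (mu : {measure set 'rV[R]_n -> \bar R}) (S : set 'rV[R]_n).
Local Notation E := 'rV[R]_n.
Local Notation leb := (lebesgue_rV R n).
Implicit Types (u v w f g : E -> R) (A B U : set E).
Local Open Scope ereal_scope.

(** mu made infinite off S, up to sets of zero capacity. The same construction confines mu to a ball
    or an annulus, saturates it on its finiteness set, and imposes the set {w > 0} on the limit
    measure. *)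
Definition satf A : \bar R := if `[< cap (A `\` S) = 0 >] then mu A else +oo.

Lemma satf_in A : cap (A `\` S) = 0 -> satf A = mu A.
Proof. by move=> h; rewrite /satf; case: asboolP. Qed.

Lemma satf_out A : cap (A `\` S) <> 0 -> satf A = +oo.
Proof. by move=> h; rewrite /satf; case: asboolP. Qed.

Lemma satf0 : satf set0 = 0.
Proof. by rewrite satf_in ?measure0// set0D cap_set0. Qed.

Lemma satf_ge0 A : 0 <= satf A.
Proof. by rewrite /satf; case: ifP. Qed.

Lemma satf_semi : semi_sigma_additive satf.
Proof.
move=> F mF tF mUF; have [h|h] := pselect (forall i, cap (F i `\` S) = 0).
  rewrite satf_in; last first.
    rewrite (_ : _ `\` S = \bigcup_k (F k `\` S)); first exact: cap0_bigcup.
    by rewrite setD_bigcupl.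
  rewrite (_ : (fun n => _) = (fun n => \sum_(0 <= i < n) mu (F i))).
    exact: measure_semi_sigma_additive.
  by apply/funext => k; apply: eq_bigr => i _; rewrite satf_in.
have [i0 hi0] : exists i, cap (F i `\` S) <> 0.
  by apply: contrapT => h'; apply: h => i; apply: contrapT => h2; apply: h'; exists i.
rewrite satf_out; last first.
  by apply: contra_not hi0; apply: cap0_sub; apply: setSD => x Fx; exists i0.
apply: cvg_near_cst; exists i0.+1 => // k /= ik.
rewrite big_mkord (bigD1 (Ordinal ik))//= satf_out// addye// gt_eqF//.
by apply: (@lt_le_trans _ _ 0%E) => //; apply: sume_ge0 => i _; exact: satf_ge0.
Qed.

Definition sat : {measure set E -> \bar R} :=
  HB.pack satf (isMeasure.Build _ _ _ satf satf0 satf_ge0 satf_semi).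

Lemma sat_ge A : mu A <= sat A.
Proof. by rewrite /sat /= /satf; case: ifP => // _; rewrite leey. Qed.

Lemma capacitary_sat : capacitary mu -> capacitary sat.
Proof.
move=> cmu A A0; have [N [mN AN N0]] := cap0_borel A0.
apply: (negligibleS AN); apply/negligibleP => //.
transitivity (mu N); last exact/negligibleP/cmu.
by apply: satf_in; exact: cap0_sub (@subDsetl _ _ _) N0.
Qed.

Hypothesis mS : measurable S.

Lemma sat_int f : mf f -> (forall x, 0 <= f x)%R -> cap ([set x | f x != 0%R] `\` S) = 0 ->
  \int[sat]_x (f x)%:E = \int[mu]_x (f x)%:E.
Proof.
move=> mf_ f0 fS; pose G := S `|` [set x | f x != 0%R].
have mG : measurable G.
  apply: measurableU => //; rewrite (_ : [set x | _] = ~` [set x | f x = 0%R]).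
    by apply: measurableC; apply: mset_eq => //; exact: mf_cst.
  by apply/seteqP; split => x /= /eqP.
have GE (m : {measure set E -> \bar R}) : \int[m]_x (f x)%:E = \int[m]_(x in G) (f x)%:E.
  rewrite [RHS]integral_mkcond; apply: eq_integral => x _; rewrite patchE.
  case: ifPn => // xG; congr (_%:E); apply/eqP; apply: contraNT xG => fx.
  by apply/mem_set; right.
rewrite !GE; apply: eq_measure_integral => A mA AG; apply: satf_in.
apply: cap0_sub fS => x [Ax nSx]; split => //; by have [] := AG _ Ax.
Qed.

Lemma sat_int_infty f : mf f -> (forall x, 0 <= f x)%R -> cap ([set x | f x != 0%R] `\` S) <> 0 ->
  \int[sat]_x (f x)%:E = +oo.
Proof.
move=> mf_ f0 fS.
have [k hk_] : exists k, cap ([set x | hk R k < f x]%R `\` S) <> 0.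
  apply: contrapT => h; apply: fS.
  apply: (cap0_sub (B := \bigcup_k ([set x | hk R k < f x]%R `\` S))).
    move=> x [/= fx nS]; have fx0 : (0 < f x)%R by rewrite lt_neqAle eq_sym fx f0.
    have fx2 : (0 < f x / 2)%R by rewrite divr_gt0.
    have [N hN] := half_pow_small fx2; exists N => //; split => //=.
    by apply: le_lt_trans (hN N (leqnn _)) _; rewrite ltr_pdivrMr// ltr_pMr// ltr1n.
  by apply: cap0_bigcup => k; apply: contrapT => h2; apply: h; exists k.
have mA : measurable [set x | hk R k < f x]%R by apply: mset_lt => //; exact: mf_cst.
apply/eqP; rewrite -leye_eq -(gt0_muley (x := (hk R k)%:E)) ?lte_fin ?hk_gt0//.
have <- : sat [set x | hk R k < f x]%R = +oo := satf_out hk_.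
rewrite -[X in _ * sat X]setIT -integral_indic//.
rewrite -ge0_integralZl_EFin//; last 2 first.
- by apply/measurable_EFinP; exact: mf_indic.
- by rewrite ltW// hk_gt0.
apply: ge0_le_integral => //.
- by move=> x _; rewrite mule_ge0// ?lee_fin ?ltW ?hk_gt0.
- by apply: measurable_funeM; apply/measurable_EFinP; exact: mf_indic.
- exact/measurable_EFinP.
move=> x _; rewrite -EFinM lee_fin indicE; have [|_] := boolP (x \in _); last by rewrite mulr0.
by move=> /set_mem /ltW; rewrite mulr1.
Qed.

End saturation.

(** * The torsion function *)

Section torsion_function.
Variables (R : realType) (n : nat) (mu : {measure set 'rV[R]_n -> \bar R}).
Local Notation E := 'rV[R]_n.
Local Notation leb := (lebesgue_rV R n).
Implicit Types (u v w f g : E -> R) (A B U : set E).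
Let BD := @psd_Da R n.
Let BE := psd_E mu.

Definition V1 := [set u | H1mu mu u /\ integ leb u].
(* poinc C holds for C = 2 P(mu), and tors is the weak equation - Delta w + mu w = 1. *)
Definition poinc (C : R) := 0 <= C /\ forall v, V1 v -> It leb v ^+ 2 <= C * Ef mu v v.
Definition tors w := V1 w /\ forall v, V1 v -> Ef mu w v = It leb v.

Lemma psd_V1 : psd V1 (Ef mu).
Proof.
apply: psd_sub BE _ _ _; first by move=> u [].
  by split; [exact: (psd_dom0 BE)|exact: integ0].
by move=> a u v [h1 h2] [h3 h4]; split; [exact: (psd_domP BE)|apply: integD => //; exact: integZ].
Qed.
Let B1 := psd_V1.

Lemma It_lin (a : R) u v : V1 u -> V1 v -> It leb (a *: u + v) = a * It leb u + It leb v.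
Proof. by move=> [_ iu] [_ iv]; rewrite ItD ?ItZ//; exact: integZ. Qed.

Lemma V1_abs u : V1 u -> V1 (fun x => `|u x|).
Proof. by move=> [hu iu]; split; [exact: (H1mu_abs hu).1|exact: integ_abs]. Qed.

Lemma V1_le u v : H1q v -> V1 u -> (forall x, `|v x| <= `|u x|) -> V1 v.
Proof.
move=> qv [hu iu] vu; split; first exact: H1mu_le vu.
by apply: integ_le vu _; [exact: H1_mf qv.1|exact: integ_abs].
Qed.

Lemma poinc_abs C v : poinc C -> V1 v -> It leb (fun x => `|v x|) ^+ 2 <= C * Ef mu v v.
Proof.
move=> [C0 hC] hv; apply: le_trans (hC _ (V1_abs hv)) _.
by rewrite ler_wpM2l//; exact: (H1mu_abs hv.1).2.
Qed.

Definition nashK : R := 2 ^+ n * n%:R ^+ 2.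

Lemma nashK_ge0 : 0 <= nashK. Proof. by rewrite mulr_ge0// exprn_ge0. Qed.

Lemma V1_L2 C v : poinc C -> V1 v -> ip leb v v <= (C + nashK) * Ef mu v v.
Proof.
move=> hC hv; have h1 := poinc_abs hC hv; have h2 := nash1 (H1mu_H1 hv.1) hv.2.
have := ler_wpM2l nashK_ge0 (Dr_le_E hv.1); rewrite mulrDl; move: h1 h2; rewrite /nashK; lra.
Qed.

Lemma V1_complete C (U : nat -> E -> R) : capacitary mu -> poinc C -> (forall k, V1 (U k)) ->
  (forall e, 0 < e -> exists N, forall m l, (N <= m)%N -> (N <= l)%N ->
     Ef mu (U m - U l) (U m - U l) <= e) ->
  exists2 u, V1 u & Ef mu (U m - u) (U m - u) @[m --> \oo] --> 0.
Proof.
move=> cmu hC hU EC; have hd m l := psd_domB B1 (hU m) (hU l).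
have C0 := hC.1; have K0 := nashK_ge0; have CK : 0 <= C + nashK by rewrite addr_ge0.
have LC e : 0 < e -> exists N, forall m l, (N <= m)%N -> (N <= l)%N ->
     (1 + C + nashK) * Ef mu (U m - U l) (U m - U l) <= e.
  move=> e0; have p : 0 < 1 + C + nashK by rewrite -addrA ltr_pwDl.
  have e1 : 0 < e / (1 + C + nashK) by rewrite divr_gt0.
  have [N hN] := EC _ e1; exists N => m l Nm Nl; rewrite mulrC -ler_pdivlMr//; exact: hN.
have [|u [s [Z [hu cZ hs Uu [Lu _]]]]] := E_complete cmu (fun k => (hU k).1) EC.
  move=> e e0; have [N hN] := LC _ e0; exists N => m l Nm Nl; apply: le_trans (V1_L2 hC (hd m l)) _.
  apply: le_trans (hN m l Nm Nl); rewrite ler_wpM2r ?(psd_ge0 B1)//; lra.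
exists u => //; split => //.
have aeU : {ae leb, forall x, U (s k) x @[k --> \oo] --> u x}.
  by have := cap0_leb cZ; apply: negligibleS => x /= h; apply: contrapT => /Uu.
have [N hN] := LC 1 ltr01; have iN := (hU (s N)).2.
have mu_ := H1_mf (H1mu_H1 hu).
have [] := @It_fatou _ _ _ leb (fun k => (fun x => `|(U (s (N + k)%N) - U (s N)) x|)) (fun x => `|(u - U (s N)) x|) 1.
- by move=> k; apply: integ_abs; exact: (hd _ _).2.
- by [].
- by apply: mf_norm; apply: mfB => //; exact: integ_mf iN.
- move=> k; rewrite -[leRHS]ger0_norm// -ler_sqr ?nnegrE ?It_ge0// normr1 expr1n.
  apply: le_trans (poinc_abs hC (hd _ _)) _.
  apply: le_trans (hN (s (N + k)%N) (s N) _ _).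
  + rewrite ler_wpM2r ?(psd_ge0 B1)//; lra.
  + exact: leq_trans (leq_addr _ _) (homo_ltn_ge hs _).
  + exact: homo_ltn_ge hs _.
- apply: filterS aeU => x hx; apply: cvg_norm; apply: cvgB; last exact: cvg_cst.
  by apply: (cvg_subseq (v := fun k => U (s k) x) (s := fun k => (N + k)%N) _ hx) => i j; rewrite ltn_add2l.
move=> h _; have i1 : integ leb (u - U (s N)).
  apply: integ_le h => [|x]; last by rewrite normr_id.
  by apply: mfB => //; exact: integ_mf iN.
by rewrite -[u](subrK (U (s N))); exact: integD.
Qed.

Lemma energy1E v : V1 v -> energy mu (cst 1) v = (2^-1 * Ef mu v v - It leb v)%:E.
Proof.
move=> [hv iv]; have e : cst 1 * v = v by apply/funext => x; rewrite mulrfctE mul1r.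
by rewrite energyE// e.
Qed.

Lemma torsion_poinc (P : R) : (torsion mu <= P%:E)%E -> poinc (2 * P).
Proof.
move=> hP.
have key v : V1 v -> - P <= 2^-1 * Ef mu v v - It leb v.
  move=> hv; rewrite -lee_fin EFinN leeNl; apply: le_trans hP.
  rewrite /torsion leeN2; apply: ereal_inf_lbound; exists v; first exact/H1mu_L1P.
  exact: energy1E.
have P0 : 0 <= P.
  by have := key 0 (psd_dom0 B1); rewrite (psd0l B1) ?It0; [lra|exact: (psd_dom0 B1)].
split=> [|v hv]; first by rewrite mulr_ge0.
have Ev := psd_ge0 B1 hv; set e := Ef mu v v in Ev *; set l := It leb v.
have {}key t : - P <= 2^-1 * (t ^+ 2 * e) - t * l.
  have := key _ (psd_domZ B1 t hv); rewrite (psd_sqZ B1)// ItZ//; exact: hv.2.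
have [e0|e0] := eqVneq e 0.
  have [->|l0] := eqVneq l 0; first by rewrite expr0n /= mulr_ge0// mulr_ge0.
  by have := key ((P + 1) / l); rewrite e0 mulr0 mulr0 mulfVK//; lra.
have ep : 0 < e by rewrite lt_neqAle eq_sym e0.
(* This t minimises the energy of t v, with value - l^2 / (2 e). *)
have := key (l / e).
have -> : 2^-1 * ((l / e) ^+ 2 * e) - l / e * l = - (l ^+ 2 / (2 * e)) by field.
by rewrite lerN2 ler_pdivrMr ?mulr_gt0//; lra.
Qed.

Lemma poinc_finite C : capacitary mu -> poinc C -> finite_torsion mu.
Proof.
move=> cmu [C0 hC]; split=> //; rewrite /torsion.
apply: (@le_lt_trans _ _ (C / 2)%:E); last by rewrite ltry.
rewrite leeNl -EFinN; apply: le_ereal_inf_tmp => _ [v /H1mu_L1P hv <-].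
rewrite energy1E// lee_fin; apply: (quad_lower B1) => //; exact: hC.
Qed.

Lemma tors_exists C : capacitary mu -> poinc C -> exists w, tors w.
Proof.
move=> cmu hC; have [w hw Ew] := quad_solution B1 It_lin hC.1 hC.2 (fun X hX => V1_complete cmu hC hX).
by exists w.
Qed.

Lemma torsP w : is_torsion_function mu w <-> tors w.
Proof.
split=> [[/H1mu_L1P hw Jw]|[hw Ew]].
  have hw1 : V1 w by []; split=> // v hv.
  have hK (t : R) : V1 (w + t *: v) by apply: (psd_domD B1) => //; exact: (psd_domZ B1).
  apply: (quad_euler B1 It_lin hw1 hv hK) => u hu.
  by rewrite -lee_fin -!energy1E//; apply: Jw; exact/H1mu_L1P.
split=> [|v /H1mu_L1P hv]; first exact/H1mu_L1P.
rewrite !energy1E// lee_fin -subr_ge0.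
rewrite (quad_diff (l := It leb) B1 hw hv); first by rewrite mulr_ge0// (psd_ge0 B1)//; exact: (psd_domB B1).
by rewrite Ew ?ItB//; [exact: hv.2|exact: hw.2|exact: (psd_domB B1)].
Qed.

Lemma V1_E0_ae C v : poinc C -> V1 v -> Ef mu v v = 0 -> {ae leb, forall x, v x = 0}.
Proof.
move=> hC hv e0; have := poinc_abs hC hv; rewrite e0 mulr0 => h.
have I0 : It leb (fun x => `|v x|) = 0.
  by apply/eqP; rewrite -sqrf_eq0 eq_le h sqr_ge0.
have := It_eq0_ae (integ_abs hv.2) (fun x => normr_ge0 (v x)) I0.
by apply: filterS => x /normr0_eq0.
Qed.

Lemma tors_uniq C w w' : poinc C -> tors w -> tors w' -> {ae leb, forall x, w x = w' x}.
Proof.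
move=> hC [hw Ew] [hw' Ew']; have hd := psd_domB B1 hw hw'.
have : {ae leb, forall x, (w - w') x = 0}.
  by apply: (V1_E0_ae hC hd); rewrite (psdBl B1)// Ew// Ew'// subrr.
by apply: filterS => x /eqP; rewrite fctE subr_eq0 => /eqP.
Qed.

Lemma tors_abs w : tors w -> tors (fun x => `|w x|).
Proof.
move=> hw; apply/torsP; have /torsP[_ hmin] := hw; split; first by apply/H1mu_L1P/V1_abs; case: hw.
move=> v hv; apply: le_trans (hmin v hv).
have hw1 := hw.1; rewrite !energy1E//; last exact: V1_abs.
rewrite lee_fin lerB//; first by rewrite ler_wpM2l//; exact: (H1mu_abs hw1.1).2.
by apply: It_le; [exact: hw1.2|exact: (V1_abs hw1).2|move=> x; exact: ler_norm].
Qed.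

Lemma tors_E w : tors w -> Ef mu w w = It leb w.
Proof. by move=> [hw ->]. Qed.

Lemma tors_It C w : poinc C -> tors w -> 0 <= It leb w <= C.
Proof.
move=> hC hw; have h1 := psd_ge0 B1 hw.1; rewrite tors_E// in h1; rewrite h1 /=.
have := hC.2 _ hw.1; rewrite tors_E//.
have [->|h0] := eqVneq (It leb w) 0; first by rewrite hC.1.
by rewrite expr2 ler_pM2r// lt_neqAle eq_sym h0.
Qed.

Lemma tors_Dr C w : poinc C -> tors w -> Dr w <= C.
Proof.
move=> hC hw; apply: le_trans (Dr_le_E hw.1.1) _; rewrite tors_E//.
by have /andP[] := tors_It hC hw.
Qed.

Lemma tors_ip C w : poinc C -> tors w -> ip leb w w <= (C + nashK) * C.
Proof.
move=> hC hw; apply: le_trans (V1_L2 hC hw.1) _; rewrite tors_E// ler_wpM2l//.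
  by rewrite addr_ge0 ?nashK_ge0// hC.1.
by have /andP[] := tors_It hC hw.
Qed.

Lemma H1_max0 u : H1 u -> H1 (u \max 0) /\ Dr (u \max 0) <= Dr u.
Proof.
move=> hu; apply: (H1_contraction hu); first exact: H1_sqi (H1_max hu (@H10 R n)).
by move=> x y /=; case: (leP (u x) 0) => h1; case: (leP (u y) 0) => h2;
  rewrite ?subrr ?normr0// ?subr0 ?sub0r; rewrite ?normrN; do ?[rewrite ler_norml; apply/andP; split];
  have := ler_norm (u x - u y); have := ler_norm (- (u x - u y)); rewrite normrN; lra.
Qed.

(* Truncating w - t phi from below only decreases the energy, to first order in t. *)
Lemma tors_subsol w phi : tors w -> (forall x, 0 <= w x) -> H1q phi -> integ leb phi ->
  (forall x, 0 <= phi x) -> Da w phi <= It leb phi.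
Proof.
move=> hw w0 qphi iphi phi0; have hw1 := hw.1; have hH := H1mu_H1 hw1.1.
have qw := ((H1muP mu w).1 hw1.1).1.
apply/ler_addgt0Pr => e e0.
have Dp := Dr_ge0 qphi.1.
(* The first-order inequality carries the error t times the Dirichlet integral of [phi]; this t
   makes it at most e. *)
pose t := e / (Dr phi + 1); have t0 : 0 < t by rewrite divr_gt0// ltr_wpDl.
pose v := (w - t *: phi) \max 0.
have htp := H1Z t qphi.1; have hd := H1B hH htp.
have [hv Dv] := H1_max0 hd.
have v0 x : 0 <= v x <= w x.
  by rewrite /v /= le_max lexx orbT ge_max w0 !fctE /GRing.scale/= andbT gerBl mulr_ge0// ltW.
have Vv : V1 v.
  apply: (V1_le _ hw1).
    split=> //; apply: qc_max; last exact: qc_cst.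
    by apply: qcD; [exact: qw.2|apply: qcN; apply: qcZ; exact: qphi.2].
  by move=> x; have /andP[h1 h2] := v0 x; rewrite !ger0_norm.
have [_ hmin] := (torsP w).2 hw; have := hmin v ((H1mu_L1P mu v).2 Vv).
rewrite !energy1E// lee_fin /Ef => h1.
have Iv : It leb w - t * It leb phi <= It leb v.
  rewrite -ItZ// -ItB//; [|exact: hw1.2|exact: integZ].
  apply: It_le; [apply: integB; [exact: hw1.2|exact: integZ]|exact: Vv.2|].
  by move=> x; rewrite /v /= le_max lexx.
have Mv : ip mu v v <= ip mu w w.
  apply: ip_le; [exact: H1mu_smu Vv.1|exact: H1mu_smu hw1.1|].
  by move=> x; have /andP[h2 h3] := v0 x; rewrite !ger0_norm.
have Dd : Dr (w - t *: phi) = Dr w - 2 * t * Da w phi + t ^+ 2 * Dr phi.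
  by rewrite /Dr (psd_sqB BD)// (psdZr BD)// ?(psd_sqZ BD)//; [ring|exact: qphi.1|exact: qphi.1].
rewrite Dd in Dv; move: Dv h1; rewrite -/(Dr v) -/(Dr w) => Dv h1.
have : t * Da w phi <= t * (It leb phi + t * Dr phi).
  have : 0 <= t ^+ 2 * Dr phi by rewrite mulr_ge0// exprn_ge0// ltW.
  rewrite -[2 * t * _]mulrA -/v in Dv; rewrite mulrDr mulrA -expr2.
  move: (t * Da w phi) (t ^+ 2 * Dr phi) (t * It leb phi) Iv Mv Dv h1 => x y z; lra.
rewrite ler_pM2l// => h; apply: le_trans h _; rewrite lerD2l.
by rewrite /t mulrAC ler_pdivrMr ?ltr_wpDl// ler_pM2l// lerDl.
Qed.

End torsion_function.

(** * Comparison of torsion functions *)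

Section comparison.
Variables (R : realType) (n : nat) (mu : {measure set 'rV[R]_n -> \bar R}).
Local Notation E := 'rV[R]_n.
Local Notation leb := (lebesgue_rV R n).
Implicit Types (u v w f g : E -> R) (A B U S : set E).
Let BM := psd_ip mu.
Let B1 := psd_V1 mu.

Lemma H1mu_satP S u : measurable S -> H1mu (sat mu S) u <->
  H1mu mu u /\ cap ([set x | u x != 0] `\` S) = 0%E.
Proof.
move=> mS; have sE : [set x | u x ^+ 2 != 0] = [set x | u x != 0].
  by apply/seteqP; split=> x /=; rewrite sqrf_eq0.
split=> [[hu fu]|[[hu fu] c0]].
  have mu2 : mf (fun x => u x ^+ 2) by apply: measurable_funX; exact: H1_mf hu.1.
  have c0 : cap ([set x | u x != 0] `\` S) = 0%E.
    apply: contrapT => h; move: fu; rewrite /sqint (sat_int_infty mu mu2)//.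
      by move=> x; exact: sqr_ge0.
    by rewrite sE.
  split=> //; split=> //; move: fu; rewrite /sqint (sat_int mu mS mu2)//.
    by move=> x; exact: sqr_ge0.
  by rewrite sE.
split=> //; rewrite /sqint (sat_int mu mS)//; last by rewrite sE.
  by apply: measurable_funX; exact: H1_mf hu.1.
by move=> x; exact: sqr_ge0.
Qed.

Lemma ip_sat_sq S u : measurable S -> H1mu (sat mu S) u -> ip (sat mu S) u u = ip mu u u.
Proof.
move=> mS hu; have [hm c0] := (H1mu_satP u mS).1 hu.
apply/EFin_inj; rewrite -!sqintE; [|exact: H1mu_smu|exact: H1mu_smu].
rewrite /sqint (sat_int mu mS)//; [by apply: measurable_funX; exact: H1_mf hm.1.1|by move=> x; exact: sqr_ge0|].
by rewrite (_ : [set x | u x ^+ 2 != 0] = [set x | u x != 0])//; apply/seteqP; split=> x /=; rewrite sqrf_eq0.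
Qed.

(** Integrals against [sat] are computed for nonnegative integrands, so the mixed term is obtained
    by polarisation. *)
Lemma Ef_sat S u v : measurable S -> H1mu (sat mu S) u -> H1mu (sat mu S) v ->
  Ef (sat mu S) u v = Ef mu u v.
Proof.
move=> mS hu hv; have hd := psd_domD (psd_E (sat mu S)) hu hv.
have [hu' _] := (H1mu_satP u mS).1 hu; have [hv' _] := (H1mu_satP v mS).1 hv.
congr (_ + _); have := ip_sat_sq mS hd.
rewrite (psd_sqD (psd_ip (sat mu S)))//; try exact: H1mu_smu.
rewrite (psd_sqD BM)//; try exact: H1mu_smu.
by rewrite !ip_sat_sq//; lra.
Qed.

Lemma V1_sat S u : measurable S -> V1 (sat mu S) u <-> V1 mu u /\ cap ([set x | u x != 0] `\` S) = 0%E.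
Proof.
move=> mS; split=> [[/(H1mu_satP _ mS)[h1 h2] h3]|[[h1 h2] h3]]; split => //.
exact/H1mu_satP.
Qed.

Lemma poinc_sat C S : measurable S -> poinc mu C -> poinc (sat mu S) C.
Proof.
move=> mS [C0 hC]; split=> // v hv; rewrite Ef_sat//; try exact: hv.1.
by apply: hC; have [] := (V1_sat v mS).1 hv.
Qed.

(** Subtract the two equations and test with (w' - w)+. It is admissible for both because it is
    dominated by |w'|, w being nonnegative, and its own energy is at most its mixed energy with w' -
    w, which is 0. *)
Lemma tors_compare C S w w' : measurable S -> poinc mu C -> tors mu w -> (forall x, 0 <= w x) ->
  tors (sat mu S) w' -> {ae leb, forall x, w' x <= w x}.
Proof.
move=> mS hC hw w0 hw'; have hw1 := hw.1; have [hm' c'] := (V1_sat w' mS).1 hw'.1.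
have BS := psd_V1 (sat mu S).
pose v := w' - (w' \min w); have hw'1 := hw'.1.
have q1 := ((H1muP _ _).1 hw1.1).1; have q2 := ((H1muP _ _).1 hm'.1).1.
have vE x : v x = if w x < w' x then w' x - w x else 0.
  by rewrite /v !fctE /=; case: (leP (w' x) (w x)) => h; rewrite ?subrr.
have qv : H1q v by apply: (psd_domB (@psd_h1q R n)) => //; exact: H1q_min.
have Vv : V1 (sat mu S) v.
  apply: (V1_le qv hw'1) => x; rewrite vE; case: ifP => h; last by rewrite normr0.
  by have wx := w0 x; rewrite !ger0_norm; lra.
have [Vm _] := (V1_sat v mS).1 Vv.
have hd := psd_domB B1 hm' hw1.
have e0 : Ef mu (w' - w) v = 0.
  by rewrite (psdBl B1)// hw.2// -(Ef_sat mS hw'1.1 Vv.1) hw'.2// subrr.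
have hd2 := psd_domB B1 hd Vm.
have e1 : Ef mu v v <= Ef mu (w' - w) v.
  have wE : w' - w = v + (w' - w - v) by rewrite [RHS]addrC subrK.
  rewrite [X in _ <= Ef mu X v]wE (psdDl B1 Vm hd2 Vm) lerDl /Ef addr_ge0//.
    apply: Da_mono; [exact: H1mu_H1 hd2.1|exact: H1mu_H1 Vm.1|move=> x y].
    rewrite !fctE !vE; case: ifP => h1; case: ifP => h2; nra.
  apply: It_ge0 => x; rewrite !fctE vE; case: ifP => h; [rewrite subrr mul0r//|by rewrite mulr0].
have Ev0 : Ef mu v v = 0 by apply/eqP; rewrite eq_le (psd_ge0 B1 Vm) andbT -e0.
have := V1_E0_ae hC Vm Ev0; apply: filterS => x; rewrite vE; case: ltP => // h.
by move=> /eqP; rewrite subr_eq0 gt_eqF.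
Qed.

End comparison.

(** * Sup bound of the torsion function by De Giorgi iteration *)

Section torsion_bound.
Variables (R : realType) (n : nat) (mu : {measure set 'rV[R]_n -> \bar R}).
Local Notation E := 'rV[R]_n.
Local Notation leb := (lebesgue_rV R n).
Implicit Types (u v w f g : E -> R) (A B U S : set E).
Let BL := psd_ip leb.
Let BD := @psd_Da R n.

Lemma tors_trunc w (k : R) : tors mu w -> (forall x, 0 <= w x) -> 0 <= k ->
  let phi := w - (fun x => Num.min (w x) k) in
  [/\ H1 phi, integ leb phi & Dr phi <= It leb phi].
Proof.
move=> hw w0 k0 phi; have hw1 := hw.1; have q1 := ((H1muP _ _).1 hw1.1).1.
have phiE x : phi x = if k < w x then w x - k else 0.
  by rewrite /phi !fctE /=; case: (leP (w x) k) => h; rewrite ?subrr.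
have qp : H1q phi by apply: (psd_domB (@psd_h1q R n)) => //; exact: H1q_minc.
have Vp : V1 mu phi.
  apply: (V1_le qp hw1) => x; rewrite phiE; case: ifP => h; last by rewrite normr0.
  by rewrite !ger0_norm; lra.
split; [exact: qp.1|exact: Vp.2|rewrite -hw.2//].
have hm := H1_minc k0 q1.1.
have wE : w = phi + (fun x => Num.min (w x) k) by rewrite /phi subrK.
have h1 : Da w phi = Dr phi + Da (fun x => Num.min (w x) k) phi.
  by rewrite {1}wE (psdDl BD)//; exact: qp.1.
rewrite /Ef h1 -addrA lerDl addr_ge0//.
  apply: Da_mono => //; first exact: qp.1.
  move=> x y; rewrite !phiE.
  case: (leP (w x) k) => h2; case: (leP (w y) k) => h3; nra.
apply: It_ge0 => x; rewrite mulrfctE phiE; case: ifP => h; last by rewrite mulr0.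
by rewrite mulr_ge0// subr_ge0 ltW.
Qed.

Lemma chebyshev_leb u (k : R) : 0 < k -> sqi leb u ->
  (leb [set x : E | (k < u x)%R] <= (k ^- 2 * ip leb u u)%:E)%E.
Proof.
move=> k0 su; have mA : measurable [set x | k < u x] by apply: mset_lt; [exact: mf_cst|exact: su.1].
have k2 : 0 < k ^- 2 by rewrite invr_gt0 exprn_gt0.
have su2 : sqi leb (k^-1 *: u) by exact: (psd_domZ BL).
rewrite -exprVn -(psd_sqZ BL)// -[X in leb X]setIT -integral_indic// /ip ItE; last exact: sqiM.
apply: ge0_le_integral => //.
- by apply/measurable_EFinP; exact: mf_indic.
- by apply/measurable_EFinP; apply: mfM; exact: su2.1.
move=> x _; rewrite lee_fin !fctE /GRing.scale/= indicE; have [/set_mem/= h|_] := boolP (x \in _).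
  have h1 : 1 <= k^-1 * u x by rewrite ler_pdivlMl// mulr1 ltW.
  nra.
by rewrite -expr2 sqr_ge0.
Qed.

Definition degK : R := 2 * nashK R n.

(** The excess (w - k)+ has Dirichlet integral at most its integral I. Cauchy-Schwarz and
    Faber-Krahn on {w > k} give I^2 <= |{w > k}| degK r^2 I. *)
Lemma tors_level w (k r : R) : tors mu w -> (forall x, 0 <= w x) -> 0 < k -> 0 < r <= 1 ->
  2 * fine (leb [set x | k < w x]) <= r ^+ n ->
  It leb (w - (fun x => Num.min (w x) k)) <= degK * r ^+ 2 * fine (leb [set x | k < w x]).
Proof.
move=> hw w0 k0 r01 hr; have [hp ip_ Dp] := tors_trunc hw w0 (ltW k0).
set phi := w - _ in hp ip_ Dp *.
have sw := H1mu_sqi hw.1.1.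
pose A := [set x | k < w x].
have mA : measurable A by apply: mset_lt; [exact: mf_cst|exact: sw.1].
have fA : (leb A < +oo)%E by apply: le_lt_trans (chebyshev_leb k0 sw) _; rewrite ltry.
have pA x : ~ A x -> phi x = 0.
  by rewrite /A /phi /= !fctE => /negP; rewrite -leNgt => h; rewrite min_l// subrr.
have p0 x : 0 <= phi x by rewrite /phi !fctE subr_ge0 ge_min lexx.
have FK := faber_krahn mA fA hp pA r01 hr.
have [_ CS] := integ_supp mA fA (H1_sqi hp) pA.
have eI : It leb (fun x => `|phi x|) = It leb phi by apply: It_ext => x; rewrite ger0_norm.
rewrite eI in CS; set I := It leb phi in Dp CS *; set a := fine (leb A) in CS hr *.
have I0 : 0 <= I by exact: It_ge0.
have a0 : 0 <= a by rewrite fine_ge0.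
have K0 : 0 <= degK * r ^+ 2 by rewrite mulr_ge0 ?sqr_ge0// mulr_ge0// nashK_ge0.
have FK' : ip leb phi phi <= degK * r ^+ 2 * I.
  apply: le_trans FK _; rewrite /degK /nashK; apply: le_trans (ler_wpM2l _ Dp).
    by rewrite !mulrA.
  by move: K0; rewrite /degK /nashK !mulrA.
have [->|In0] := eqVneq I 0; first by rewrite mulr_ge0.
have Ip : 0 < I by rewrite lt_neqAle eq_sym In0.
rewrite -(ler_pM2r Ip) -expr2; apply: le_trans CS _.
by apply: le_trans (ler_wpM2l a0 FK') _; rewrite mulrCA mulrA.
Qed.

(** De Giorgi iteration with levels k0 + H (1 - 2^-j). The invariant, twice the measure of the j-th
    superlevel set at most (2^-j r0)^n, is exactly what [tors_level] asks at radius 2^-j r0. The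
    constant H is such that each step divides the measure by at least 2^n; its summand 1 keeps H
    positive. *)
Lemma tors_bound w (k0 r0 : R) : (0 < n)%N -> tors mu w -> (forall x, 0 <= w x) ->
  0 < k0 -> 0 < r0 <= 1 -> 2 * fine (leb [set x | k0 < w x]) <= r0 ^+ n ->
  {ae leb, forall x, w x <= k0 + (2 ^+ n * degK * 2 + 1) * r0 ^+ 2}.
Proof.
move=> n0 hw w0 k00 r01 hr; have /andP[r0p r1] := r01.
set H := (2 ^+ n * degK * 2 + 1) * r0 ^+ 2.
have deg0 : 0 <= degK by rewrite mulr_ge0// nashK_ge0.
have Hp : 0 < H by rewrite mulr_gt0 ?exprn_gt0// ltr_wpDl// !mulr_ge0// exprn_ge0.
have sw := H1mu_sqi hw.1.1.
pose k j := k0 + H * (1 - hk R j).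
have kp j : 0 < k j.
  by rewrite ltr_pwDl// mulr_ge0 ?(ltW Hp)// subr_ge0 hk_le1.
pose a j := fine (leb [set x | k j < w x]).
have mA j : measurable [set x | k j < w x] by apply: mset_lt; [exact: mf_cst|exact: sw.1].
have fA j : (leb [set x : E | (k j < w x)%R] < +oo)%E.
  by apply: le_lt_trans (chebyshev_leb (kp j) sw) _; rewrite ltry.
have a0 j : 0 <= a j by rewrite fine_ge0.
have step j : 2 * a j <= (hk R j * r0) ^+ n -> 2 * a j.+1 <= (hk R j.+1 * r0) ^+ n.
  move=> hj; have hp := hk_gt0 R j; have h1 := hk_le1 R j.
  have r01' : 0 < hk R j * r0 <= 1 by rewrite mulr_gt0//= mulr_ile1// ltW.
  have L := tors_level hw w0 (kp j) r01' hj; rewrite -/(a j) in L.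
  have [_ ip_ _] := tors_trunc hw w0 (ltW (kp j)).
  have dk : k j.+1 - k j = H * (hk R j / 2) by rewrite /k /hk exprS; field.
  have A1 : H * (hk R j / 2) * a j.+1 <= It leb (w - (fun x => Num.min (w x) (k j))).
    rewrite -dk /a -It_indic// -ItZ; last exact: integ_indic.
    apply: It_le => //; first by apply: integZ; exact: integ_indic.
    move=> x; rewrite !fctE /GRing.scale/= indicE; have [/set_mem/= h|_] := boolP (x \in _).
      have kk : k j <= k j.+1 by rewrite -subr_ge0 dk mulr_ge0 ?divr_ge0// ltW.
      by rewrite mulr1 min_r; [rewrite lerB// ltW|exact: le_trans kk (ltW h)].
    by rewrite mulr0 subr_ge0 ge_min lexx.
  have A2 := le_trans A1 L.
  have hh : hk R j ^+ 2 <= hk R j by rewrite expr2 ler_piMl// ltW.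
  have A3 : 2 ^+ n * a j.+1 <= a j.
    have p2 : (0 : R) < 2 ^+ n by rewrite exprn_gt0.
    rewrite mulrC -ler_pdivlMr//.
    have A4 : H * (hk R j / 2) * a j.+1 <= degK * (r0 ^+ 2 * hk R j) * a j.
      apply: le_trans A2 _; rewrite ler_wpM2r// ler_wpM2l// exprMn mulrC ler_wpM2l// exprn_ge0// ltW//.
    have A5 : H * (hk R j / 2) = (2 ^+ n * degK + 2^-1) * (r0 ^+ 2 * hk R j) by rewrite /H; field.
    rewrite A5 in A4; have q0 : 0 < r0 ^+ 2 * hk R j by rewrite mulr_gt0 ?exprn_gt0//.
    have A6 : (2 ^+ n * degK + 2^-1) * a j.+1 <= degK * a j.
      by rewrite -(ler_pM2r q0); move: A4; congr (_ <= _); ring.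
    rewrite ler_pdivlMr//.
    have [d0|dn0] := eqVneq degK 0.
      have : a j.+1 <= 0 by move: A6; rewrite d0; lra.
      by have := a0 j; have := a0 j.+1; nra.
    have dp : 0 < degK by rewrite lt_neqAle eq_sym dn0.
    rewrite -(ler_pM2l dp); apply: le_trans A6; have := a0 j.+1; nra.
  rewrite /hk exprS -mulrA exprMn [2^-1 ^+ n]exprVn ler_pdivlMl ?exprn_gt0//.
  by move: hj A3; rewrite /hk; lra.
have all j : 2 * a j <= (hk R j * r0) ^+ n.
  elim: j => [|j IH]; last exact: step.
  by rewrite /a /k /hk expr0 subrr mulr0 addr0 mul1r.
have aa j : a j <= hk R j.
  have := all j; have h0 := hk_gt0 R j; have h1 := hk_le1 R j.
  have : (hk R j * r0) ^+ n <= hk R j.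
    rewrite -(prednK n0) exprS; have : hk R j * r0 * (hk R j * r0) ^+ n.-1 <= hk R j * 1 * 1.
      apply: ler_pM; rewrite ?exprn_ge0// ?mulr_ge0 ?(ltW h0) ?(ltW r0p)//.
        by rewrite ler_wpM2l// ltW.
      by rewrite exprn_ile1// ?mulr_ile1// ?mulr_ge0// ltW.
    by rewrite !mulr1.
  by have := a0 j; lra.
have mB : measurable [set x | k0 + H < w x] by apply: mset_lt; [exact: mf_cst|exact: sw.1].
have B0 : leb [set x | k0 + H < w x] = 0%E.
  apply/eqP; rewrite eq_le measure_ge0 andbT; apply/lee_addgt0Pr => e /half_pow_small[N hN].
  rewrite add0e; apply: (@le_trans _ _ (leb [set x : E | (k N < w x)%R])).
    apply: le_measure; rewrite ?inE// => x /=; apply: le_lt_trans.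
    by rewrite /k lerD2l ler_piMr ?(ltW Hp)// gerBl ltW// hk_gt0.
  have fin : leb [set x | k N < w x] \is a fin_num by rewrite ge0_fin_numE// measure_ge0.
  rewrite -[leb _]fineK// lee_fin; apply: le_trans (aa N) _; exact: hN.
apply: negligibleS ((negligibleP _ mB).2 B0) => x /= /negP; by rewrite -ltNge.
Qed.

End torsion_bound.

(** * Radial cutoffs *)

Section cutoffs.
Variables (R : realType) (n : nat).
Local Notation E := 'rV[R]_n.
Local Notation leb := (lebesgue_rV R n).
Implicit Types (u v w f g : E -> R).

Lemma norm_ei i : `|ei R i : E| <= 1.
Proof.
apply: norm_le_coord => // j; rewrite mxE eqxx /=; case: (_ == _); by rewrite ?normr1 ?normr0.
Qed.

Lemma lip_continuous (f : E -> R) (L : R) : (forall x y, `|f y - f x| <= L * `|y - x|) -> continuous f.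
Proof.
move=> fL x; apply/(@cvgrPdist_le R R E (nbhs x) _ f (f x)) => e e0.
have L0 : 0 < `|L| + 1 by rewrite ltr_wpDl.
apply/nbhs_ballP; exists (e / (`|L| + 1)) => /=; first by rewrite divr_gt0.
move=> y; rewrite -ball_normE /= => h; rewrite distrC.
apply: le_trans (fL x y) _; rewrite distrC.
move: h; rewrite ltr_pdivlMr// => h; apply: le_trans (ltW h); rewrite mulrC ler_wpM2l//.
by apply: le_trans (ler_norm _) _; rewrite lerDl.
Qed.

Lemma cutoff_norm (z : R -> R) (L : R) : 0 <= L -> (forall t, 0 <= z t <= 1) ->
  (forall s t, `|z s - z t| <= L * `|s - t|) ->
  cutoff L (fun x : E => z `|x|) /\ continuous (fun x : E => z `|x|).
Proof.
move=> L0 z01 zL.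
have lip (x y : E) : `|z `|y| - z `|x| | <= L * `|y - x|.
  by apply: le_trans (zL _ _) _; rewrite ler_wpM2l// ler_dist_dist.
have cz := lip_continuous lip; split => //; split => //.
  exact: continuous_measurable_rVR.
move=> i h x h0; apply: le_trans (lip _ _) _; rewrite ler_wpM2l// addrC addKr normrZ ger0_norm ?(ltW h0)//.
by rewrite ler_piMr ?(ltW h0)// norm_ei.
Qed.

Definition ramp (a b t : R) : R := Num.max 0 (Num.min 1 ((b - t) / (b - a))).

Lemma ramp01 a b t : 0 <= ramp a b t <= 1.
Proof. by rewrite /ramp le_max lexx ge_max ler01 ge_min lexx. Qed.

Lemma ramp_in a b t : a < b -> t <= a -> ramp a b t = 1.
Proof.
move=> ab ta; have p : 0 < b - a by rewrite subr_gt0.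
rewrite /ramp min_l ?max_r//; rewrite ler_pdivlMr//; lra.
Qed.

Lemma ramp_out a b t : a < b -> b <= t -> ramp a b t = 0.
Proof.
move=> ab ta; have p : 0 < b - a by rewrite subr_gt0.
have h : (b - t) / (b - a) <= 0 by rewrite ler_pdivrMr//; lra.
by rewrite /ramp min_r ?max_l//; lra.
Qed.

Lemma ramp_lip a b s t : a < b -> `|ramp a b s - ramp a b t| <= (b - a)^-1 * `|s - t|.
Proof.
move=> ab; have p : 0 < b - a by rewrite subr_gt0.
have e : (b - a)^-1 * `|s - t| = `|(b - s) / (b - a) - (b - t) / (b - a)|.
  rewrite -mulrBl normrM [`|_^-1|]ger0_norm ?invr_ge0 ?ltW// mulrC; congr (_ * _).
  by rewrite distrC; congr (`|_|); ring.
rewrite e /ramp; move: ((b - s) / _) ((b - t) / _) => x y.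
have h (c : R) (x' y' : R) : `|Num.min c x' - Num.min c y'| <= `|x' - y'|.
  have h1 := ler_norm (x' - y'); have h2 := ler_norm (y' - x'); rewrite distrC in h2.
  by case: (leP c x') => a1; case: (leP c y') => a2; rewrite ?subrr ?normr0// ler_norml; apply/andP; split; lra.
have h' (c : R) (x' y' : R) : `|Num.max c x' - Num.max c y'| <= `|x' - y'|.
  have h1 := ler_norm (x' - y'); have h2 := ler_norm (y' - x'); rewrite distrC in h2.
  by case: (leP c x') => a1; case: (leP c y') => a2; rewrite ?subrr ?normr0// ler_norml; apply/andP; split; lra.
exact: le_trans (h' _ _ _) (h _ _ _).
Qed.

Lemma measurable_normlt (K : R) : measurable [set x : E | `|x| < K].
Proof.
apply: mset_lt; last exact: mf_cst.
by apply: continuous_measurable_rVR => x; exact: norm_continuous.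
Qed.

Lemma normlt_fin (K : R) : (leb [set x : E | (`|x| < K)%R] < +oo)%E.
Proof.
pose N := (Num.trunc K).+1.
apply: (@le_lt_trans _ _ (leb (cubeC 1 N))); last first.
  by rewrite /cubeC lebesgue_cube ?ltry// mul1r.
apply: le_measure; rewrite ?inE; [exact: measurable_normlt|exact: measurable_cube|].
move=> x /= h; apply: cubeC_in; rewrite mul1r; apply: lt_trans h _; exact: truncnS_gt.
Qed.

Lemma integ_supp_norm (K : R) u : sqi leb u -> (forall x, K <= `|x| -> u x = 0) -> integ leb u.
Proof.
move=> su h; apply: (integ_supp (measurable_normlt K) (normlt_fin K) su _).1.
by move=> x /= /negP; rewrite -leNgt; exact: h.
Qed.

End cutoffs.

(** * Picone and Barta inequalities; the resolvent *)

Section barta.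
Variables (R : realType) (n : nat).
Local Notation E := 'rV[R]_n.
Local Notation leb := (lebesgue_rV R n).
Implicit Types (u v w f g : E -> R).
Let BL := psd_ip leb.
Let BD := @psd_Da R n.

Lemma sq_triangle (a b x y : R) : 0 <= a -> 0 <= b -> `|x| <= a -> `|y| <= b -> (x + y) ^+ 2 <= 2 * a ^+ 2 + 2 * b ^+ 2.
Proof.
move=> a0 b0 xa yb; have : `|x + y| ^+ 2 <= (a + b) ^+ 2.
  by rewrite ler_pXn2r ?nnegrE ?addr_ge0//; apply: le_trans (ler_normD _ _) _; exact: lerD.
by rewrite real_normK ?num_real// => h; apply: le_trans h _; have := sqr_ge0 (a - b); nra.
Qed.

(** Picone's identity for differences: the defect is (u' (w + e) - u (w' + e))^2 / ((w + e) (w' +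
    e)). The shift e and the bound on u make the quotient a Lipschitz function of u and w, which
    puts it in H^1. *)
Lemma picone u w (M e : R) : H1 u -> H1 w -> 0 < e -> 0 <= M -> (forall x, `|u x| <= M) ->
  (forall x, 0 <= w x) -> quasi_continuous u -> quasi_continuous w ->
  let q x := u x ^+ 2 / (w x + e) in H1q q /\ Da w q <= Dr u.
Proof.
move=> hu hw e0 M0 uM w0 qu qw q.
have we x : 0 < w x + e by rewrite ltr_wpDl.
have su := H1_sqi hu.
(* The absolute value makes the reciprocal continuous on the whole line, without changing it on the
   values of w. *)
pose zz (t : R) := (`|t| + e)^-1.
have czz : continuous zz.
  move=> t; have h : (fun t : R => `|t| + e) @ t --> `|t| + e.
    by apply: cvgD; [exact: (@norm_continuous R R)|exact: cvg_cst].
  by apply: (cvgV _ h); rewrite gt_eqF// ltr_wpDl.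
have qE : q = u * (u * (fun x => zz (w x))).
  by apply/funext => x; rewrite !mulrfctE /zz ger0_norm// mulrA -expr2.
have qq : quasi_continuous q.
  by rewrite qE; apply: qcM => //; apply: qcM => //; exact: qc_comp.
have mq : mf q.
  rewrite qE; apply: mfM; first exact: su.1; apply: mfM; first exact: su.1.
  have mz : measurable_fun setT zz by exact: continuous_measurable_fun.
  exact: (measurableT_comp mz (H1_mf hw)).
have e1 : 0 < e^-1 by rewrite invr_gt0.
have iwe x : (w x + e)^-1 <= e^-1 by rewrite lef_pV2 ?posrE// lerDr.
have iw0 x : 0 < (w x + e)^-1 by rewrite invr_gt0.
have sq : sqi leb q.
  have sM : sqi leb ((M * e^-1) *: u) by exact: (psd_domZ BL).
  apply: (sqi_le sM mq) => x.
  have -> : `|q x| = `|u x| * (`|u x| * (w x + e)^-1).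
    by rewrite /q expr2 -mulrA normrM normrM (ger0_norm (ltW (iw0 x))).
  have -> : `|((M / e) *: u) x| = `|u x| * (M * e^-1).
    by rewrite fctE /GRing.scale/= normrM mulrC [`|M / e|]ger0_norm// divr_ge0// ltW.
  by rewrite ler_wpM2l// ler_pM// ltW.
have hq : H1 q.
  pose a := 2 * M / e; pose b := M ^+ 2 / e ^+ 2.
  have a0 : 0 <= a by rewrite divr_ge0 ?mulr_ge0// ltW.
  have b0 : 0 <= b by rewrite divr_ge0 ?exprn_ge0// ltW.
  apply: (proj1 (H1_ah (C := 2 * a ^+ 2 * Dr u + 2 * b ^+ 2 * Dr w) sq _)) => k.
  have BA := @psd_ah R n k; have sw := H1_sqi hw.
  have := @ah_list_ge0 R n k [:: ((2 * a ^+ 2) *: u, u); ((2 * b ^+ 2) *: w, w); (- q, q)] 0 _ (integ0 leb).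
  rewrite !big_cons big_nil It0 /= mulr0 !addr0 !(psdZl BA)// (psdNl BA)// => H.
  have h1 : 2 * a ^+ 2 * ah k u u <= 2 * a ^+ 2 * Dr u.
    by rewrite ler_wpM2l ?ah_le// mulr_ge0// exprn_ge0.
  have h2 : 2 * b ^+ 2 * ah k w w <= 2 * b ^+ 2 * Dr w.
    by rewrite ler_wpM2l ?ah_le// mulr_ge0// exprn_ge0.
  apply: le_trans (lerD h1 h2); rewrite -subr_ge0; move: H; rewrite addrA; apply.
    by move=> p /= [<-|[<-|[<-|//]]]; split => //=; [exact: (psd_domZ BL)|exact: (psd_domZ BL)|exact: (psd_domN BL)].
  move=> i h x h0; rewrite !big_cons big_nil /= !fctE /GRing.scale/= !addr0 mulr0 addr0.
  set y := x + _; have -> : q y - q x = (u y - u x) * ((u y + u x) / (w y + e)) +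
      (w y - w x) * (- u x ^+ 2 / (w y + e) / (w x + e)).
    by rewrite /q; field; rewrite !gt_eqF.
  set X := (u y - u x) * _; set Y := (w y - w x) * _.
  have hX : `|X| <= a * `|u y - u x|.
    rewrite normrM mulrC ler_wpM2r// normrM (ger0_norm (ltW (iw0 y))).
    apply: ler_pM => //; first exact: ltW.
    by apply: le_trans (ler_normD _ _) _; have := uM x; have := uM y; lra.
  have hY : `|Y| <= b * `|w y - w x|.
    rewrite normrM mulrC ler_wpM2r// -mulrA normrM -invfM normrN normrX.
    rewrite ler_pM ?exprn_ge0// ?ler_pXn2r ?nnegrE//.
    have wp : 0 < (w y + e) * (w x + e) by rewrite mulr_gt0.
    rewrite ger0_norm; last by rewrite invr_ge0 (ltW wp).
    rewrite lef_pV2 ?posrE ?exprn_gt0//.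
    by rewrite expr2 ler_pM ?(ltW e0)// lerDr.
  have := sq_triangle (mulr_ge0 a0 (normr_ge0 _)) (mulr_ge0 b0 (normr_ge0 _)) hX hY.
  rewrite [(a * _) ^+ 2]exprMn [(b * _) ^+ 2]exprMn !real_normK ?num_real//.
  have -> : - q y - - q x = - (X + Y) by rewrite /X /Y /q; field; rewrite !gt_eqF.
  move=> H; have := subr_ge0 ((X + Y) ^+ 2) (2 * (a ^+ 2 * (u y - u x) ^+ 2) + 2 * (b ^+ 2 * (w y - w x) ^+ 2)).
  rewrite H => {}H; apply: le_trans H _.
  by rewrite le_eqVlt; apply/orP; left; apply/eqP; move: (X + Y) (a) (b) => c1 c2 c3; ring.
split; first by split.
have := @Da_list_ge0 R n [:: (u, u); (- w, q)] 0 _ (integ0 leb).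
rewrite !big_cons big_nil It0 /= mulr0 !addr0 (psdNl BD)// -/(Dr u) subr_ge0; apply.
  by move=> p /= [<-|[<-|//]]; split => //=; exact: (psd_domN BD).
move=> i h x h0; rewrite !big_cons big_nil /= !fctE !addr0 mulr0 addr0.
set y := x + _; rewrite /q.
have -> : (u y - u x) * (u y - u x) + (- w y - - w x) * (u y ^+ 2 / (w y + e) - u x ^+ 2 / (w x + e)) =
   (u y * (w x + e) - u x * (w y + e)) ^+ 2 * ((w x + e)^-1 * (w y + e)^-1).
  by field; rewrite !gt_eqF.
by rewrite mulr_ge0 ?sqr_ge0// mulr_ge0// ltW.
Qed.

Variable mu : {measure set E -> \bar R}.
Let BE := psd_E mu.

Lemma H1mu_trunc u (k : R) : 0 <= k -> H1mu mu u ->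
  let v x := Num.min `|u x| k in H1mu mu v /\ Ef mu v v <= Ef mu u u.
Proof.
move=> k0 hu v; have [ha Ea] := H1mu_abs hu; have [[qa _] _] := (H1muP mu u).1 hu.
have qv : H1q v by apply: H1q_minc => //; exact: ((H1muP _ _).1 ha).1.
have le x : `|v x| <= `|u x|.
  by rewrite /v ger0_norm ?le_min ?normr_ge0// ge_min lexx.
split; first exact: H1mu_le hu le.
apply: le_trans Ea; rewrite /Ef lerD//.
  have hh := H1mu_H1 ha; have := Dr_minc k0 hh; rewrite -/v.
  by have := Dr_ge0 (H1B hh qv.1); rewrite /Dr; lra.
apply: ip_le; [exact: H1mu_smu (H1mu_le qv hu le)|exact: H1mu_smu|].
by move=> x; rewrite normr_id.
Qed.

Lemma trunc_cvg u (k0 : nat) : sqi leb u ->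
  ip leb (fun x => Num.min `|u x| k%:R) (fun x => Num.min `|u x| k%:R) @[k --> \oo] --> ip leb u u.
Proof.
move=> su; rewrite -(ip_abs leb u).
have mm k : mf (fun x => Num.min `|u x| k%:R) by apply: mf_min => //; apply: mf_norm; exact: su.1.
apply: (@It_dom _ _ _ leb _ _ ((fun x => `|u x|) * (fun x => `|u x|)) _ _ _ _ _).2.
- by move=> k; apply: mfM.
- by apply: mfM; apply: mf_norm; exact: su.1.
- apply: aeW => x; apply/cvg_epsP => e e1; exists (Num.trunc `|u x|).+1 => k hk.
  rewrite !mulrfctE min_l ?subrr ?normr0 ?ltW//.
  by apply: lt_le_trans (truncnS_gt _) _; rewrite ler_nat.
- by apply: sqiM; exact: sqi_abs.
- move=> k x; rewrite !mulrfctE.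
  have m0 : 0 <= Num.min `|u x| k%:R by rewrite le_min normr_ge0 ler0n.
  rewrite ger0_norm ?mulr_ge0//; apply: ler_pM => //; by rewrite ge_min lexx.
Qed.

(* Test the equation of the torsion function w with u^2 / (w + e). *)
Lemma barta w u (M : R) : tors mu w -> (forall x, 0 <= w x) -> 0 <= M ->
  {ae leb, forall x, w x <= M} -> H1mu mu u -> ip leb u u <= M * Ef mu u u.
Proof.
move=> hw w0 M0 wM hu.
(* The test function asks for a bounded u; truncating |u| at height k lowers the energy, and the L^2
   norms converge. *)
suff bounded v (K : R) : H1mu mu v -> 0 <= K -> (forall x, `|v x| <= K) -> ip leb v v <= M * Ef mu v v.
  apply: (lim_le (trunc_cvg 0 (H1mu_sqi hu))) => k.
  have [hv Ev] := H1mu_trunc (ler0n R k) hu; apply: le_trans (bounded _ k%:R hv _ _) _ => //.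
    by move=> x; rewrite ger0_norm ?le_min ?normr_ge0 ?ler0n// ge_min lexx orbT.
  by rewrite ler_wpM2l.
move=> hv K0 vK; apply/ler_addgt0Pr => d d0.
have [qv sv] := (H1muP mu v).1 hv; have [qw sw] := (H1muP mu w).1 hw.1.1.
have E0 := psd_ge0 BE hv.
pose e := d / (Ef mu v v + 1); have e0 : 0 < e by rewrite divr_gt0// ltr_wpDl.
have [qq Dq] := picone qv.1 qw.1 e0 K0 vK w0 qv.2 qw.2.
set q := (fun x => _) in qq Dq.
have we x : 0 < w x + e by rewrite ltr_wpDl.
have q0 x : 0 <= q x by rewrite /q divr_ge0 ?sqr_ge0// ltW.
have sv2 := H1mu_sqi hv.
have qe x : q x <= e^-1 * (v x * v x).
  by rewrite /q expr2 mulrC ler_wpM2r -?expr2 ?sqr_ge0// lef_pV2 ?posrE// lerDr.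
have e1 : 0 < e^-1 by rewrite invr_gt0.
have Vq : V1 mu q.
  split.
    apply/H1muP; split => //; have sK : sqi mu ((e^-1 * K) *: v) by exact: (psd_domZ (psd_ip mu)).
    apply: (sqi_le sK); first exact: H1_mf qq.1.
    move=> x; rewrite fctE /GRing.scale/= (ger0_norm (q0 x)) !normrM (ger0_norm (ltW e1)) (ger0_norm K0).
    apply: le_trans (qe x) _; rewrite -mulrA ler_wpM2l ?(ltW e1)// -expr2 -real_normK ?num_real// expr2.
    by rewrite ler_wpM2r.
  apply: (@integ_le _ _ _ _ _ (e^-1 *: (v * v))); first exact: H1_mf qq.1.
    by move=> x; rewrite ger0_norm//; exact: qe.
  by apply: integZ; exact: sqiM.
have Ew : It leb q <= Ef mu v v.
  rewrite -(hw.2 _ Vq) /Ef lerD// /ip; apply: It_le.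
  - by apply: sqiM => //; exact: H1mu_smu Vq.1.
  - exact: sqiM.
  move=> x; rewrite !mulrfctE /q -expr2 mulrCA ler_piMr ?sqr_ge0//.
  by rewrite ler_pdivrMr// mul1r lerDl ltW.
apply: le_trans (_ : _ <= (M + e) * It leb q) _.
  rewrite -ItZ; last exact: Vq.2.
  apply: It_le_ae; [exact: sqiM|by apply: integZ; exact: Vq.2|].
  apply: filterS wM => x hx; rewrite !fctE /GRing.scale/= /q.
  by rewrite mulrA ler_pdivlMr// mulrC -expr2 ler_wpM2r ?sqr_ge0// lerD2r.
apply: le_trans (_ : _ <= (M + e) * Ef mu v v) _.
  by rewrite ler_wpM2l// addr_ge0// ltW.
rewrite mulrDl lerD2l /e mulrAC ler_pdivrMr ?ltr_wpDl// ler_pM2l// lerDl //.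
Qed.

Definition res f u := H1mu mu u /\ forall v, H1mu mu v -> Ef mu u v = ip leb f v.

Lemma resP f u : sqi leb f -> is_minimizer (energy mu f) (H1mu mu) u <-> res f u.
Proof.
move=> sf; have ll (a : R) v v' : H1mu mu v -> H1mu mu v' ->
    ip leb f (a *: v + v') = a * ip leb f v + ip leb f v'.
  move=> hv hv'; have s1 := H1mu_sqi hv; have s2 := H1mu_sqi hv'.
  by rewrite (psdDr BL)//; [rewrite (psdZr BL)|exact: (psd_domZ BL)].
have en v : H1mu mu v -> energy mu f v = (2^-1 * Ef mu v v - ip leb f v)%:E.
  by move=> hv; apply: energyE => //; apply: sqiM => //; exact: (H1mu_sqi hv).
split=> [[hu Ju]|[hu Eu]].
  split=> // v hv; have hK (t : R) : H1mu mu (u + t *: v).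
    by apply: (psd_domD BE) => //; exact: (psd_domZ BE).
  apply: (quad_euler BE ll hu hv hK) => v' hv'.
  by rewrite -lee_fin -!en//; exact: Ju.
split=> // v hv; rewrite !en// lee_fin -subr_ge0.
rewrite (quad_diff (l := ip leb f) BE hu hv); first by rewrite mulr_ge0// (psd_ge0 BE)//; exact: (psd_domB BE).
by rewrite Eu ?(psdBr BL)//; [exact: (H1mu_sqi hv)|exact: (H1mu_sqi hu)|exact: (psd_domB BE)].
Qed.

(** By [barta] it holds with M any bound of the torsion function. The same M bounds the norm of the
    resolvent, and its inverse bounds the first eigenvalue from below. *)
Definition coercive (M : R) := 0 <= M /\ forall u, H1mu mu u -> ip leb u u <= M * Ef mu u u.

Lemma res_exists f M : capacitary mu -> coercive M -> sqi leb f -> exists u, res f u.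
Proof.
move=> cmu [M0 hM] sf.
have ll (a : R) v v' : H1mu mu v -> H1mu mu v' ->
    ip leb f (a *: v + v') = a * ip leb f v + ip leb f v'.
  move=> hv hv'; have s1 := H1mu_sqi hv; have s2 := H1mu_sqi hv'.
  by rewrite (psdDr BL)//; [rewrite (psdZr BL)|exact: (psd_domZ BL)].
have f0 := psd_ge0 BL sf.
have [|||u hu Eu] := quad_solution BE ll (C := ip leb f f * M); first by rewrite mulr_ge0.
- move=> v hv; apply: le_trans (psd_CS BL sf (H1mu_sqi hv)) _.
  by rewrite -mulrA ler_wpM2l//; exact: hM.
- move=> X hX EX; have [|u [s [Z [hu _ _ _ [Lu _]]]]] := E_complete cmu hX EX; last by exists u.
  move=> e e0; have p : 0 < M + 1 by rewrite ltr_wpDl.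
  have e1 : 0 < e / (M + 1) by rewrite divr_gt0.
  have [N hN] := EX _ e1; exists N => m l Nm Nl; have hd := psd_domB BE (hX m) (hX l).
  apply: le_trans (hM _ hd) _; have := hN m l Nm Nl; rewrite ler_pdivlMr// => h.
  by apply: le_trans h; rewrite mulrC ler_wpM2l ?(psd_ge0 BE hd)// lerDl.
by exists u.
Qed.

Lemma res_bound f M u : coercive M -> sqi leb f -> res f u ->
  Ef mu u u <= M * ip leb f f /\ ip leb u u <= M ^+ 2 * ip leb f f.
Proof.
move=> [M0 hM] sf [hu Eu]; have E0 := psd_ge0 BE hu; have f0 := psd_ge0 BL sf.
have su := H1mu_sqi hu.
have h1 : Ef mu u u <= M * ip leb f f.
  have : Ef mu u u ^+ 2 <= M * ip leb f f * Ef mu u u.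
    rewrite {1}Eu//; apply: le_trans (psd_CS BL sf su) _.
    by rewrite [leLHS]mulrC -[leRHS]mulrA [_ * Ef _ _ _]mulrC mulrA ler_wpM2r//; exact: hM.
  have [->|h0] := eqVneq (Ef mu u u) 0; first by rewrite mulr_ge0.
  by rewrite expr2 ler_pM2r// lt_neqAle eq_sym h0.
split => //; apply: le_trans (hM _ hu) _; rewrite expr2 -mulrA ler_wpM2l//.
Qed.

End barta.

(** * Finite-energy functions vanish where the torsion function does *)

Section quasi_support.
Variables (R : realType) (n : nat) (mu : {measure set 'rV[R]_n -> \bar R}).
Local Notation E := 'rV[R]_n.
Local Notation leb := (lebesgue_rV R n).
Implicit Types (u v w f g : E -> R).
Let B1 := psd_V1 mu.

Lemma H1mu_cut L eta u : cutoff L eta -> continuous eta -> H1mu mu u -> H1mu mu (eta * u).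
Proof.
move=> ce ceta hu; have [qu su] := (H1muP mu u).1 hu.
apply: (H1mu_le (H1q_cut ce ceta qu) hu) => x; have [_ e01 _ _] := ce.
have /andP[h1 h2] := e01 x; rewrite mulrfctE normrM ger0_norm// ler_piMl//.
Qed.

(** The cut costs only an L^2 term; what remains is the form tested with eta^2 u, which a weak
    equation for u evaluates. *)
Lemma E_cut L eta u : cutoff L eta -> continuous eta -> H1mu mu u ->
  Ef mu (eta * u) (eta * u) <= Ef mu u (eta * (eta * u)) + n%:R * L ^+ 2 * ip leb u u.
Proof.
move=> ce ceta hu; have := Dr_cut ce (H1mu_H1 hu); rewrite /Ef /Dr.
have -> : ip mu (eta * u) (eta * u) = ip mu u (eta * (eta * u)).
  by apply: It_ext => x; rewrite !mulrfctE; ring.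
lra.
Qed.

(** The multiple c w solves the equation with right side c. The excess v - m lives where m = c w, so
    the mixed energy of m and v - m is at least c times the integral of v - m. *)
Lemma tors_min_energy w v (c : R) : tors mu w -> (forall x, 0 <= w x) -> V1 mu v -> (forall x, 0 <= v x) ->
  0 <= c -> let m := v \min (c *: w) in
  V1 mu m /\ Ef mu m m + Ef mu (v - m) (v - m) + 2 * c * It leb (v - m) <= Ef mu v v.
Proof.
move=> hw w0 hv v0 c0 m; have hw1 := hw.1.
have qv := ((H1muP mu v).1 hv.1).1; have qw := ((H1muP mu w).1 hw1.1).1.
have qcw := psd_domZ (@psd_h1q R n) c qw.
have Vcw := psd_domZ B1 c hw1.
have mx x : m x = if v x <= c * w x then v x else c * w x.
  by rewrite /m /= fctE; case: leP.
have hm : V1 mu m.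
  apply: (V1_le (H1q_min qv qcw) hv) => x; rewrite -/(m x) mx; have := v0 x; have := w0 x.
  by move=> wx vx; have [h|/ltW h] := leP (v x) (c * w x); rewrite !ger0_norm ?mulr_ge0.
split=> //; have hp := psd_domB B1 hv hm; set phi := v - m in hp *.
have hd := psd_domB B1 Vcw hm; set psi := c *: w - m in hd.
have pE x : phi x = if v x <= c * w x then 0 else v x - c * w x.
  by rewrite -[phi x]/(v x - m x) mx; case: ifP; rewrite ?subrr.
have sE x : psi x = if v x <= c * w x then c * w x - v x else 0.
  by rewrite -[psi x]/(c * w x - m x) mx; case: ifP; rewrite ?subrr.
have n1 : Ef mu (- psi) phi >= 0.
  have hN := psd_domN B1 hd.
  rewrite /Ef addr_ge0//.
    apply: Da_mono; [exact: H1mu_H1 hN.1|exact: H1mu_H1 hp.1|move=> x y].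
    rewrite -[(- psi) y]/(- psi y) -[(- psi) x]/(- psi x) !sE !pE.
    by have [h1|h1] := leP (v y) (c * w y); have [h2|h2] := leP (v x) (c * w x); nra.
  apply: It_ge0 => x; rewrite mulrfctE -[(- psi) x]/(- psi x) sE pE.
  by case: ifP; rewrite ?oppr0 ?mul0r ?mulr0.
have e1 : Ef mu m phi = c * It leb phi + Ef mu (- psi) phi.
  have {1}-> : m = c *: w + - psi by rewrite /psi opprB addrC subrK.
  rewrite (psdDl B1)//; last exact: (psd_domN B1).
  by rewrite (psdZl B1)// hw.2.
have vE : v = m + phi by rewrite /phi addrC subrK.
by have h2 := psd_sqD B1 hm hp; rewrite -vE e1 in h2; lra.
Qed.

Lemma ndbounded_cauchy (e : nat -> R) (C : R) : (forall j k, (j <= k)%N -> e j <= e k) ->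
  (forall k, e k <= C) -> forall d, 0 < d -> exists N, forall j k, (N <= j)%N -> (N <= k)%N -> `|e k - e j| <= d.
Proof.
move=> nd eC d d0.
have c : cvgn e by apply: nondecreasing_is_cvgn => //; exists C => _ [k _ <-].
have d2 : 0 < d / 2 by rewrite divr_gt0.
move/cvg_ex: c => [l /cvg_epsP/(_ _ d2)[N hN]]; exists N => j k /hN hj /hN hk_.
have -> : e k - e j = (e k - l) - (e j - l) by ring.
by apply: le_trans (ler_normB _ _) _; lra.
Qed.

(* The truncations of v by multiples of the torsion function w increase to v off {w = 0} and
   form a Cauchy sequence of the energy space, since w is a supersolution. *)
Lemma tors_qe_zero_V1 C w v : capacitary mu -> poinc mu C -> tors mu w -> (forall x, 0 <= w x) ->
  V1 mu v -> (forall x, 0 <= v x) -> cap [set x | v x != 0 /\ w x = 0] = 0%E.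
Proof.
move=> cmu hC hw w0 hv v0.
pose m (k : nat) := v \min (k%:R *: w).
have hm k := tors_min_energy hw w0 hv v0 (ler0n R k).
have Vm k : V1 mu (m k) := (hm k).1.
have m0 k x : 0 <= m k x by rewrite /m /= le_min v0 /= fctE mulr_ge0.
have mS j k : (j <= k)%N -> m j = m k \min (j%:R *: w).
  move=> jk; apply/funext => x; rewrite /m /= -minA; congr (Num.min _ _).
  rewrite min_r// !fctE /GRing.scale/= ler_wpM2r// ler_nat//.
have step j k : (j <= k)%N -> Ef mu (m j) (m j) + Ef mu (m k - m j) (m k - m j) <= Ef mu (m k) (m k).
  move=> jk; have := (tors_min_energy hw w0 (Vm k) (m0 k) (ler0n R j)).2; rewrite -mS//.
  have : 0 <= 2 * j%:R * It leb (m k - m j).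
    rewrite !mulr_ge0// It_ge0// => x; rewrite (mS j k jk) fctE subr_ge0 /=.
    by rewrite ge_min lexx.
  lra.
have nd j k : (j <= k)%N -> Ef mu (m j) (m j) <= Ef mu (m k) (m k).
  by move=> jk; have := step j k jk; have := psd_ge0 B1 (psd_domB B1 (Vm k) (Vm j)); lra.
have E0 := psd_ge0 B1 hv.
have vmk k : Ef mu (m k) (m k) + 2 * k%:R * It leb (v - m k) <= Ef mu v v.
  have := (hm k).2; have := psd_ge0 B1 (psd_domB B1 hv (Vm k)); rewrite -/(m k); lra.
have Iv k : 0 <= It leb (v - m k).
  by apply: It_ge0 => x; rewrite fctE subr_ge0 /m /= ge_min lexx.
have eC k : Ef mu (m k) (m k) <= Ef mu v v.
  by have := vmk k; have : 0 <= 2 * k%:R * It leb (v - m k); [rewrite !mulr_ge0|lra].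
have EC : forall d, 0 < d -> exists N, forall i j, (N <= i)%N -> (N <= j)%N ->
     Ef mu (m i - m j) (m i - m j) <= d.
  move=> d d0; have [N hN] := ndbounded_cauchy nd eC d0; exists N => i j Ni Nj.
  have [ij|/ltnW ji] := leqP i j.
    rewrite -opprB (psdNl B1) ?(psdNr B1) ?opprK; try exact: (psd_domB B1); last exact: (psd_domN B1 (psd_domB B1 _ _)).
    have := step _ _ ij; have := hN i j Ni Nj; have := ler_norm (Ef mu (m j) (m j) - Ef mu (m i) (m i)); lra.
  have := step _ _ ji; have := hN j i Nj Ni; have := ler_norm (Ef mu (m i) (m i) - Ef mu (m j) (m j)); lra.
have [|u [s [Z [hu cZ hs Zu _]]]] := E_complete cmu (fun k => (Vm k).1) EC.
  have p : 0 < C + nashK R n + 1 by rewrite ltr_wpDl// addr_ge0 ?nashK_ge0// hC.1.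
  move=> e e0; have [N hN] := EC _ (divr_gt0 e0 p); exists N => i j Ni Nj.
  have hd := psd_domB B1 (Vm i) (Vm j).
  apply: le_trans (V1_L2 hC hd) _; have := hN i j Ni Nj; rewrite ler_pdivlMr// mulrC => h.
  by apply: le_trans h; rewrite ler_wpM2r ?(psd_ge0 B1)// lerDl.
have lim x : ~ Z x -> u x = if w x == 0 then 0 else v x.
  move=> /Zu h; apply: (cvg_unique _ h) => //; apply/cvg_epsP => e e0.
  have [wx|wx] := eqVneq (w x) 0.
    exists 0%N => k _; rewrite /m /= fctE wx scaler0 min_r// subrr normr0 ltW//.
  have wp : 0 < w x by rewrite lt_neqAle eq_sym wx w0.
  exists (Num.trunc (v x / w x)).+1 => k hk_; rewrite /m /= fctE min_l ?subrr ?normr0 ?ltW//.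
  rewrite -[_ *: _]/(_ * _) -ltr_pdivrMr//; apply: lt_le_trans (truncnS_gt _) _.
  by rewrite ler_nat (leq_trans hk_)// homo_ltn_ge.
have mw := H1_mf (H1mu_H1 hw.1.1).
have mW : measurable [set x | w x = 0] by apply: mset_eq => //; exact: mf_cst.
(* By [vmk], 2 k times the integral of v - m k stays below the energy of v, while m k = 0 wherever w
   = 0; letting k grow, v = 0 almost everywhere there. *)
have vae : {ae leb, forall x, (v * \1_[set x | w x = 0]) x = 0}.
  have iW := integM_indic mW hv.2.
  apply: It_le0_ae => //; first by move=> x; rewrite mulrfctE mulr_ge0// indicE.
  apply/ler_addgt0Pr => e e0; rewrite add0r.
  pose k := (Num.trunc (Ef mu v v / e)).+1.
  have kp : 0 < k%:R :> R by rewrite ltr0n.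
  apply: le_trans (_ : _ <= It leb (v - m k)) _.
    apply: It_le => //; first by apply: integB; [exact: hv.2|exact: (Vm k).2].
    move=> x; rewrite !fctE indicE /m /=; have [/set_mem/= wx|_] := boolP (x \in _).
      by rewrite mulr1 fctE wx scaler0 min_r// subr0.
    by rewrite mulr0 subr_ge0 ge_min lexx.
  have h1 : Ef mu v v / e < k%:R by exact: truncnS_gt.
  move: h1; rewrite ltr_pdivrMr// => h1; have := vmk k; have := psd_ge0 B1 (Vm k) => h2 h3.
  rewrite -(ler_pM2l kp); have := mulr_ge0 (ltW kp) (Iv k); rewrite -mulrA in h3; lra.
have qu := ((H1muP mu u).1 hu).1; have qv := ((H1muP mu v).1 hv.1).1.
(* Both functions are quasi-continuous, so this improves to equality quasi-everywhere; as u = 0 on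
   {w = 0} off [Z], the same follows for v. *)
have aeq : {ae leb, forall x, u x = v x}.
  have aZ : {ae leb, forall x, ~ Z x} by have := cap0_leb cZ; apply: negligibleS => x /= /contrapT.
  apply: filterS2 vae aZ => x h /lim ->; case: eqP => // wx; move: h.
  by rewrite mulrfctE indicE mem_set// mulr1.
apply: (cap0_sub _ (cap0U (qc_ae_eq qu.2 qv.2 aeq) cZ)) => x [vx wx].
have [Zx|/lim ux] := pselect (Z x); [by right|left].
by rewrite /= ux wx eqxx eq_sym.
Qed.

(** A cutoff of bounded support makes u integrable, hence an element of [V1]; cutoffs of radius k
    exhaust the space, and countable unions keep zero capacity. *)
Lemma tors_qe_zero C w u : capacitary mu -> poinc mu C -> tors mu w -> (forall x, 0 <= w x) ->
  H1mu mu u -> cap [set x | u x != 0 /\ w x = 0] = 0%E.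
Proof.
move=> cmu hC hw w0 hu.
pose eta k (x : E) := ramp k%:R k.+1%:R `|x|.
have lt k : (k%:R : R) < k.+1%:R by rewrite ltr_nat.
have ce k : cutoff 1 (eta k) /\ continuous (eta k).
  apply: cutoff_norm => //; first by move=> t; exact: ramp01.
  move=> s t; apply: le_trans (ramp_lip _ _ (lt k)) _.
  by rewrite -natrB// subSnn invr1.
pose v k x := `|(eta k * u) x|.
have hv k : V1 mu (v k).
  have hc := H1mu_cut (ce k).1 (ce k).2 hu; apply: V1_abs; split => //.
  apply: (@integ_supp_norm _ _ k.+1%:R); first exact: (H1mu_sqi hc).
  by move=> x hx; rewrite mulrfctE /eta ramp_out// mul0r.
apply: (cap0_sub (B := \bigcup_k [set x | v k x != 0 /\ w x = 0])).
  move=> x [ux wx]; exists (Num.trunc `|x|).+1 => //; split => //.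
  by rewrite /v normr_eq0 mulrfctE /eta ramp_in ?mul1r// ltW// truncnS_gt.
apply: cap0_bigcup => k; exact: (tors_qe_zero_V1 cmu hC hw w0 (hv k) (fun x => normr_ge0 _)).
Qed.

Lemma H1mu_mod u v : capacitary mu -> mf v -> cap [set x | u x != v x] = 0%E -> H1mu mu u -> H1mu mu v.
Proof.
move=> cmu mv uv /H1muP[qu su]; apply/H1muP; split; first exact: H1q_mod uv.
apply: (sqi_ae su mv); have := cap0_ae cmu uv; apply: filterS => x /= /negP.
by rewrite negbK => /eqP.
Qed.

Lemma Ef_mod u v z : capacitary mu -> H1mu mu u -> H1mu mu v -> H1mu mu z ->
  cap [set x | u x != v x] = 0%E -> Ef mu u z = Ef mu v z.
Proof.
move=> cmu hu hv hz uv.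
have ae_of (m : {measure set E -> \bar R}) : m.-negligible [set x | u x != v x] -> {ae m, forall x, u x = v x}.
  by apply: negligibleS => x /= h; apply/negP => /eqP.
congr (_ + _).
  by apply: Da_ae; [exact: H1mu_H1 hu|exact: H1mu_H1 hv|exact: H1mu_H1 hz|apply: ae_of; exact: cap0_leb].
apply: ip_ae; try by apply: H1_mf; apply: H1mu_H1; eassumption.
  by apply: ae_of; exact: cmu.
exact: aeW.
Qed.

Lemma tors_mod w w' : capacitary mu -> tors mu w -> mf w' -> cap [set x | w x != w' x] = 0%E -> tors mu w'.
Proof.
move=> cmu [hw Ew] mw' ww'; have hw' := H1mu_mod cmu mw' ww' hw.1.
split; last by move=> v hv; rewrite -(Ef_mod cmu hw.1 hw' hv.1 ww'); exact: Ew.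
split=> //; apply: (integ_ae hw.2 mw'); have := cap0_leb ww'; apply: negligibleS => x /= h.
by apply/negP => /eqP.
Qed.

End quasi_support.

(** A change on a set of zero capacity makes the torsion function vanish everywhere off S, so that
    {w > 0} is a version of the finiteness set truly contained in S. *)
Lemma tors_version (R : realType) (n : nat) (mu : {measure set 'rV[R]_n -> \bar R}) C S : capacitary mu -> poinc mu C -> measurable S ->
  exists w, [/\ tors (sat mu S) w, forall x, 0 <= w x & forall x, ~ S x -> w x = 0].
Proof.
move=> cmu hC mS; have cs : capacitary (sat mu S) by exact: capacitary_sat.
have [w hw] := tors_exists cs (poinc_sat mS hC).
have ha := tors_abs hw; have [[hm _] c0] := (V1_sat mu _ mS).1 ha.1.
pose w' : 'rV[R]_n -> R := (fun x => `|w x|) * \1_S.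
have mw' : mf w' by apply: mfM; [exact: H1_mf (H1mu_H1 hm)|exact: mf_indic].
exists w'; split.
- have E0 : cap [set x | `|w x| != w' x] = 0%E.
    apply: cap0_sub c0 => x /=; rewrite /w' mulrfctE indicE; have [/set_mem Sx|] := boolP (x \in S).
      by rewrite mulr1 eqxx.
    by rewrite mulr0 => h1 h2; split => // Sx; move: h1; rewrite mem_set.
  exact: tors_mod cs ha mw' E0.
- by move=> x; rewrite /w' mulrfctE mulr_ge0// indicE.
- by move=> x Sx; rewrite /w' mulrfctE indicE memNset ?mulr0.
Qed.

(** * Averages over cubes *)

Section averages.
Variables (R : realType) (n : nat).
Local Notation E := 'rV[R]_n.
Local Notation leb := (lebesgue_rV R n).
Implicit Types (u v w f g phi : E -> R).
Let BL := psd_ip leb.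
Let BD := @psd_Da R n.
Let BH := @psd_h1 R n.

Lemma H1_sh c u : H1 u -> H1 (sh c u) /\ Dr (sh c u) <= Dr u.
Proof.
move=> hu; have su := H1_sqi hu; apply: H1_ah; first exact: sqi_sh.
move=> k; apply: le_trans (ah_le k hu); apply: ler_sum => i _.
by rewrite dq_sh ip_sh//; exact: sqi_dq.
Qed.

(** Averages over cubes serve as mollifiers: they are continuous by the L^2 modulus of translations
    ([nr_shift]) and increase neither the L^2 norm nor the Dirichlet integral. *)
Definition avg (h : R) f (x : E) : R := (h ^+ n)^-1 * It leb (f * \1_(cube x h)).

Let mC x (h : R) : measurable (cube x h : set E). Proof. exact: measurable_cube. Qed.

Let sC x (h : R) : 0 < h -> sqi leb (\1_(cube x h) : E -> R).
Proof. by move=> h0; apply: sqi_indic => //; rewrite lebesgue_cube ?ltry// ltW. Qed.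

Lemma It_cube_sq f x (h : R) : 0 < h -> sqi leb (f * \1_(cube x h)) ->
  It leb (f * \1_(cube x h)) ^+ 2 <= h ^+ n * It leb (f * f * \1_(cube x h)).
Proof.
move=> h0 sf.
have i2 : (\1_(cube x h) * \1_(cube x h) : E -> R) = \1_(cube x h).
  by apply/funext => y; rewrite mulrfctE indicE; case: (y \in _); rewrite ?mulr1 ?mulr0.
have e2 : f * \1_(cube x h) * (f * \1_(cube x h)) = f * f * \1_(cube x h) by rewrite mulrACA i2.
have e3 : f * \1_(cube x h) * \1_(cube x h) = f * \1_(cube x h) by rewrite -mulrA i2.
have := psd_CS BL sf (sC x h0); rewrite /ip e2 e3 i2 It_indic// lebesgue_cube ?(ltW h0)//=.
by move=> H; apply: le_trans H _; rewrite mulrC.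
Qed.

Lemma mul_indic_le g (A : set E) t : 0 <= g t -> (g * \1_A) t <= g t.
Proof. by move=> g0; rewrite mulrfctE indicE; case: (t \in A); rewrite ?mulr1 ?mulr0. Qed.

Lemma sqi_mul_indic f (A : set E) : measurable A -> sqi leb f -> sqi leb (f * \1_A).
Proof.
move=> mA sf; apply: (sqi_le sf); first by apply: mfM; [exact: sf.1|exact: mf_indic].
move=> x; rewrite mulrfctE indicE; case: (x \in A); first by rewrite mulr1.
by rewrite mulr0 normr0.
Qed.

Lemma avg_sq f x (h : R) : 0 < h -> sqi leb f ->
  avg h f x ^+ 2 <= (h ^+ n)^-1 * It leb (f * f * \1_(cube x h)).
Proof.
move=> h0 sf; have hn : 0 < h ^+ n by rewrite exprn_gt0.
rewrite /avg; set J := It _ _.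
rewrite (_ : ((h ^+ n)^-1 * J) ^+ 2 = (h ^+ n)^-1 * ((h ^+ n)^-1 * J ^+ 2)); last by ring.
rewrite ler_wpM2l ?invr_ge0 ?(ltW hn)// ler_pdivrMl//.
by apply: It_cube_sq => //; exact: sqi_mul_indic.
Qed.

Lemma avg_sh f c x (h : R) : sqi leb f -> 0 < h -> avg h (sh c f) x = avg h f (x + c).
Proof.
move=> sf h0; rewrite /avg; congr (_ * _).
have i1 : integ leb (f * \1_(cube (x + c) h)) by apply: sqiM => //; exact: sC.
rewrite -(It_sh c i1); apply: It_ext => y; rewrite /sh !mulrfctE !indicE; congr (_ * _).
have e : cube x h y <-> cube (x + c) h (y + c).
  by split=> H i; have := H i; rewrite !mxE; lra.
by congr (_%:R); congr nat_of_bool; apply/idP/idP => /set_mem/e/mem_set.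
Qed.

Lemma avg_lin (a h : R) f g : 0 < h -> sqi leb f -> sqi leb g ->
  avg h (a *: f + g) = a *: avg h f + avg h g.
Proof.
move=> h0 sf sg; apply/funext => x; rewrite !fctE /GRing.scale/= /avg.
have i1 : integ leb (f * \1_(cube x h)) by apply: sqiM => //; exact: sC.
have i2 : integ leb (g * \1_(cube x h)) by apply: sqiM => //; exact: sC.
rewrite (_ : (a *: f + g) * \1_(cube x h) = a *: (f * \1_(cube x h)) + g * \1_(cube x h)).
  by rewrite ItD ?ItZ//; [ring|exact: integZ].
by apply/funext => y; rewrite !fctE /GRing.scale/=; ring.
Qed.

Lemma avg_continuous f (h : R) : 0 < h -> H1 f -> continuous (avg h f).
Proof.
move=> h0 hf x; have sf := H1_sqi hf.
have hn : 0 < h ^+ n by rewrite exprn_gt0.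
apply/(@cvgrPdist_le R R E (nbhs x) _ (avg h f) (avg h f x)) => e e0.
pose C := (h ^+ n)^-1 * (n%:R ^+ 2 * Dr f); have C0 : 0 <= C.
  by rewrite mulr_ge0 ?invr_ge0 ?(ltW hn)// mulr_ge0 ?exprn_ge0// Dr_ge0.
pose r := Num.min 1 (e / (C + 1)).
have r0 : 0 < r by rewrite lt_min ltr01 divr_gt0// ltr_wpDl.
have r1 : r <= 1 by rewrite ge_min lexx.
pose r2 := Num.min 1 (e ^+ 2 / (C + 1)).
have r20 : 0 < r2 by rewrite lt_min ltr01 divr_gt0 ?exprn_gt0// ltr_wpDl.
apply/nbhs_ballP; exists r2 => //= y; rewrite -ball_normE /= => hxy.
pose z := y - x; have zr i : `|z ord0 i| <= r2.
  by apply: le_trans (coord_le_norm _ _) _; rewrite distrC ltW.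
have r21 : 0 <= r2 <= 1 by rewrite (ltW r20) ge_min lexx.
have S1 := nr_shift hf r21 zr.
have ss := sqi_sh z sf; have sd := psd_domB BL ss sf.
have e1 : avg h f x - avg h f y = - avg h (sh z f - f) x.
  have -> : sh z f - f = (-1) *: f + sh z f by rewrite scaleN1r addrC.
  have zE : x + z = y by rewrite /z addrC subrK.
  by rewrite avg_lin// !fctE /GRing.scale/= avg_sh// zE; ring.
rewrite e1 normrN -ler_sqr ?nnegrE ?(ltW e0)// real_normK ?num_real//.
apply: le_trans (avg_sq x h0 sd) _.
have i1 : It leb ((sh z f - f) * (sh z f - f) * \1_(cube x h)) <= ip leb (sh z f - f) (sh z f - f).
  apply: It_le; [apply: integM_indic => //; exact: sqiM|exact: sqiM|].
  by move=> t; apply: mul_indic_le; rewrite mulrfctE -expr2 sqr_ge0.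
apply: le_trans (_ : _ <= C * r2) _.
  rewrite /C -[leRHS]mulrA ler_wpM2l ?invr_ge0 ?(ltW hn)//; apply: le_trans i1 _; apply: le_trans S1 _.
  rewrite mulrAC ler_wpM2l ?mulr_ge0 ?exprn_ge0 ?Dr_ge0//.
  by rewrite expr2 ler_piMl// ?(ltW r20)//; case/andP: r21.
have : r2 <= e ^+ 2 / (C + 1) by rewrite /r2 ge_min lexx orbT.
rewrite ler_pdivlMr ?ltr_wpDl// => h2; apply: le_trans h2; rewrite mulrC ler_wpM2l ?(ltW r20)// lerDl//.
Qed.

Lemma tonelli_cube f (h : R) : 0 < h -> sqi leb f ->
  measurable_fun setT (fun x => (It leb (f * f * \1_(cube x h)))%:E) /\
  (\int[leb]_x (It leb (f * f * \1_(cube x h)))%:E = (h ^+ n * ip leb f f)%:E)%E.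
Proof.
move=> h0 sf; have mf_ := sf.1; set Q := cube 0 h : set E.
pose F (p : E * E) : \bar R := (\1_Q p.2 * f (p.1 + p.2) ^+ 2)%:E.
have mF : measurable_fun setT F.
  apply/measurable_EFinP; apply: measurable_funM.
    exact: (mf_indic_comp measurable_snd (mC 0 h)).
  have h2 : measurable_fun setT (fun p : E * E => f (p.1 + p.2)).
    exact: (measurableT_comp mf_ (@measurable_addv R n)).
  exact: measurable_funX.
have F0 p : (0 <= F p)%E by rewrite lee_fin mulr_ge0 ?sqr_ge0// indicE.
have FE x : (It leb (f * f * \1_(cube x h)))%:E = (\int[leb]_z F (x, z))%E.
  have i1 : integ leb (f * f * \1_(cube x h)) by apply: integM_indic => //; exact: sqiM.
  rewrite -(It_sh x i1) ItE; last exact: integ_sh.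
  apply: eq_integral => z _; rewrite /F /sh /= !mulrfctE mulrC expr2 [z + x]addrC !indicE.
  congr ((_%:R * _)%:E); congr nat_of_bool.
  by apply/idP/idP => /set_mem H; apply/mem_set => i; have := H i; rewrite !mxE; lra.
split.
  rewrite (_ : (fun x => _) = (fun x => \int[leb]_z F (x, z))%E); last by apply/funext.
  exact: (@measurable_fun_fubini_tonelli_F _ _ _ _ R leb F).
transitivity (\int[leb]_x \int[leb]_z F (x, z))%E; first by apply: eq_integral => x _.
transitivity (\int[leb]_z \int[leb]_x F (x, z))%E.
  exact: (@fubini_tonelli _ _ _ _ R leb leb F mF F0).
transitivity (\int[leb]_z ((ip leb f f)%:E * (\1_Q z)%:E))%E.
  apply: eq_integral => z _; rewrite /F /= indicE; have [zQ|zQ] := boolP (z \in Q); last first.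
    by rewrite mule0 integral0_eq// => x _; rewrite mul0r.
  rewrite mule1 -(ip_sh z sf sf) /ip ItE; last by apply: sqiM; exact: sqi_sh.
  by apply: eq_integral => x _; rewrite mul1r expr2 /sh.
rewrite ge0_integralZl_EFin//; last 2 first.
- by apply/measurable_EFinP; exact: mf_indic (mC 0 h).
- exact: (psd_ge0 BL).
rewrite (integral_indic leb measurableT (mC 0 h)) setIT mulrC EFinM.
by congr (_ * _)%E; apply: lebesgue_cube; exact: ltW.
Qed.

Lemma avg_nr f (h : R) : 0 < h -> H1 f -> sqi leb (avg h f) /\ ip leb (avg h f) (avg h f) <= ip leb f f.
Proof.
move=> h0 hf; have sf := H1_sqi hf; have hn : 0 < h ^+ n by rewrite exprn_gt0.
have ma : mf (avg h f) by apply: continuous_measurable_rVR; exact: avg_continuous.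
have [mI tI] := tonelli_cube h0 sf.
have key : (\int[leb]_x ((avg h f * avg h f) x)%:E <= (ip leb f f)%:E)%E.
  apply: (@le_trans _ _ (\int[leb]_x (((h ^+ n)^-1)%:E * (It leb (f * f * \1_(cube x h)))%:E))%E).
    apply: ge0_le_integral => //.
    - by move=> x _; rewrite lee_fin mulrfctE -expr2 sqr_ge0.
    - by apply/measurable_EFinP; exact: mfM.
    - exact: measurable_funeM.
    - by move=> x _; rewrite -EFinM lee_fin mulrfctE -expr2; exact: avg_sq.
  rewrite ge0_integralZl_EFin//; last 2 first.
  - by move=> x _; rewrite lee_fin It_ge0// => y; rewrite !mulrfctE mulr_ge0// ?indicE// -expr2 sqr_ge0.
  - by rewrite invr_ge0 ltW.
  by rewrite tI -EFinM mulrA mulVf ?mul1r// gt_eqF.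
have ia : integ leb (avg h f * avg h f).
  apply/integ_ge0P; [exact: mfM|by move=> x; rewrite mulrfctE -expr2 sqr_ge0|].
  by apply: le_lt_trans key _; rewrite ltry.
by split=> //; rewrite -lee_fin /ip ItE.
Qed.

Lemma H1_avg f (h : R) : 0 < h -> H1 f -> H1 (avg h f) /\ Dr (avg h f) <= Dr f.
Proof.
move=> h0 hf; have sf := H1_sqi hf; have [sa _] := avg_nr h0 hf.
apply: H1_ah => // k; apply: le_trans (ah_le k hf); apply: ler_sum => i _.
have hs := (H1_sh (hk R k *: ei R i) hf).1.
have hd : H1 (dq i (hk R k) f) by apply: (psd_domZ BD); exact: H1B.
have e : dq i (hk R k) (avg h f) = avg h (dq i (hk R k) f).
  have -> : dq i (hk R k) f = (hk R k)^-1 *: ((-1) *: f + sh (hk R k *: ei R i) f) + 0.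
    by rewrite /dq scaleN1r addr0 [in RHS]addrC.
  have s0 := psd_dom0 BL; have s1 := H1_sqi hs.
  have s2 : sqi leb ((-1) *: f + sh (hk R k *: ei R i) f) by exact: (psd_domP BL).
  rewrite !avg_lin//; apply/funext => x; rewrite dqE !fctE /GRing.scale/= avg_sh//.
  have -> : avg h 0 x = 0 by rewrite /avg mul0r It0 mulr0.
  by rewrite addr0; ring.
by rewrite e; exact: (avg_nr h0 hd).2.
Qed.

(** Cauchy-Schwarz on each cube leads to [double_shift_bound], whose volume (2 h)^n divided by h^n
    leaves the factor 2^n. *)
Lemma avg_close f (h : R) : 0 < h <= 1 -> H1 f ->
  ip leb (avg h f - f) (avg h f - f) <= 2 ^+ n * n%:R ^+ 2 * h ^+ 2 * Dr f.
Proof.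
move=> h01 hf; have /andP[h0 h1] := h01; have sf := H1_sqi hf.
have hn : 0 < h ^+ n by rewrite exprn_gt0.
have [ha _] := H1_avg h0 hf; have sd := psd_domB BL (H1_sqi ha) sf.
have K := double_shift_bound hf h01; set Q := cube _ _ in K.
have mQ : measurable Q by exact: measurable_cube.
pose F (p : E * E) : \bar R := (\1_Q (p.2 - p.1) * (f p.2 - f p.1) ^+ 2)%:E.
have msub : measurable_fun setT (fun p : E * E => p.2 - p.1).
  have h2 : measurable_fun setT (fun p : E * E => (p.2, - p.1)).
    apply/measurable_fun_pairP; split; first exact: measurable_snd.
    apply: (measurableT_comp (f := fun x : E => - x)); last exact: measurable_fst.
    by apply: continuous_measurable_rV; exact: opp_continuous.
  exact: (measurableT_comp (@measurable_addv R n) h2).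
have mF : measurable_fun setT F.
  apply/measurable_EFinP; apply: measurable_funM; first exact: (mf_indic_comp msub mQ).
  apply: measurable_funX; apply: measurable_funB.
    exact: (measurableT_comp sf.1 measurable_snd).
  exact: (measurableT_comp sf.1 measurable_fst).
have F0 p : (0 <= F p)%E by rewrite lee_fin mulr_ge0 ?sqr_ge0// indicE.
have mG := @measurable_fun_fubini_tonelli_F _ _ _ _ R leb F mF F0.
rewrite -lee_fin /ip ItE; last exact: sqiM.
apply: (@le_trans _ _ (\int[leb]_x (((h ^+ n)^-1)%:E * \int[leb]_y F (x, y)))%E); last first.
  rewrite ge0_integralZl_EFin//; last 2 first.
  - by move=> x _; exact: integral_ge0.
  - by rewrite invr_ge0 ltW.
  apply: le_trans (lee_wpmul2l _ K) _; first by rewrite lee_fin invr_ge0 ltW.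
  rewrite -EFinM lee_fin exprMn le_eqVlt; apply/orP; left; apply/eqP.
  by field; rewrite gt_eqF.
apply: ge0_le_integral => //.
- by move=> x _; rewrite lee_fin mulrfctE -expr2 sqr_ge0.
- by apply/measurable_EFinP; apply: mfM; exact: sd.1.
- exact: measurable_funeM.
move=> x _; pose g y := f y - f x.
have sC1 := sC x h0.
have sg : sqi leb (g * \1_(cube x h)).
  rewrite (_ : g * \1_(cube x h) = f * \1_(cube x h) - f x *: \1_(cube x h)).
    by apply: (psd_domB BL); [exact: sqi_mul_indic|exact: (psd_domZ BL)].
  by apply/funext => y; rewrite /g !fctE /GRing.scale/=; ring.
have e : (avg h f - f) x = (h ^+ n)^-1 * It leb (g * \1_(cube x h)).
  rewrite (_ : g * \1_(cube x h) = f * \1_(cube x h) - f x *: \1_(cube x h)); last first.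
    by apply/funext => y; rewrite /g !fctE /GRing.scale/=; ring.
  have i1 : integ leb (\1_(cube x h) : E -> R).
    by apply: integ_indic => //; rewrite lebesgue_cube ?ltry// ltW.
  rewrite ItB ?ItZ//; [|exact: sqiM|exact: integZ].
  rewrite It_indic// lebesgue_cube ?(ltW h0)//= fctE /avg.
  by rewrite -[(- f) x]/(- f x); field; rewrite gt_eqF.
have gg : integ leb (g * g * \1_(cube x h)).
  have := sqiM sg sg; congr integrable; congr (EFin \o _); apply/funext => y.
  rewrite !mulrfctE indicE; case: (y \in _); rewrite ?mulr1 ?mulr0//.
apply: (@le_trans _ _ ((h ^+ n)^-1%:E * (It leb (g * g * \1_(cube x h)))%:E)%E).
  rewrite -EFinM lee_fin mulrfctE -expr2 e; set J := It _ _.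
  rewrite (_ : ((h ^+ n)^-1 * J) ^+ 2 = (h ^+ n)^-1 * ((h ^+ n)^-1 * J ^+ 2)); last by ring.
  by rewrite ler_wpM2l ?invr_ge0 ?(ltW hn)// ler_pdivrMl//; exact: It_cube_sq.
apply: lee_wpmul2l; first by rewrite lee_fin invr_ge0 ltW.
rewrite ItE//; apply: ge0_le_integral => //.
- by move=> y _; rewrite lee_fin !mulrfctE mulr_ge0 ?indicE// -expr2 sqr_ge0.
- by apply/measurable_EFinP; exact: integ_mf gg.
- apply: (measurableT_comp mF); exact: measurable_pair1.
move=> y _; rewrite lee_fin !mulrfctE -expr2 mulrC ler_wpM2r ?sqr_ge0// !indicE.
have [/set_mem yC|//] := boolP (y \in cube x h).
rewrite mem_set// => i; have := yC i; rewrite !mxE => /andP[a1 a2]; apply/andP; split; lra.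
Qed.

(** Weak convergence plus an upper bound on the norms: in D(G - f) = D(G) - 2 D(G, f) + D(f) the
    mixed term converges by [Da_weak_cvg]. *)
Lemma h1_cvg_of_limsup (G : nat -> E -> R) f (e : nat -> R) : (forall k, H1 (G k)) -> H1 f ->
  ip leb (G k - f) (G k - f) @[k --> \oo] --> 0 -> (forall k, Dr (G k) <= Dr f + e k) ->
  e k @[k --> \oo] --> 0 -> h1f (G k - f) (G k - f) @[k --> \oo] --> 0.
Proof.
move=> hG hf cG De ce.
have [C hC] : exists C, forall k, e k <= C.
  have [M [_ hM]] := cvg_seq_bounded (cvgP _ ce); exists (M + 1) => k.
  by apply: le_trans (ler_norm _) _; apply: hM; rewrite // ltrDl.
have DC k : Dr (G k) <= Dr f + C by apply: le_trans (De k) _; rewrite lerD2l.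
have cD := Da_weak_cvg hG hf hf (nr_cvg0 cG) DC.
have c : ip leb (G k - f) (G k - f) + (2 * Dr f + e k - 2 * Da (G k) f) @[k --> \oo] --> (0 : R).
  have -> : (0 : R) = 0 + (2 * Dr f + 0 - 2 * Da f f) by rewrite /Dr addr0 subrr addr0.
  apply: cvgD => //; apply: cvgB; first by apply: cvgD => //; exact: cvg_cst.
  by apply: cvgM => //; exact: cvg_cst.
apply/cvg_epsP => d d0; have [N hN] := (cvg_epsP _ _).1 c _ d0; exists N => k /hN; rewrite !subr0.
have hd := H1B (hG k) hf.
move=> h; rewrite ger0_norm ?(psd_ge0 BH)//; apply: le_trans (le_trans (ler_norm _) h).
have := De k; rewrite /h1f lerD2l (psd_sqB BD)// /Dr; lra.
Qed.

Lemma avg_cvg f : H1 f -> h1f (avg (hk R k) f - f) (avg (hk R k) f - f) @[k --> \oo] --> 0.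
Proof.
move=> hf; have hp k := hk_gt0 R k.
apply: (@h1_cvg_of_limsup _ f (fun=> 0)) => //; try exact: cvg_cst.
- by move=> k; exact: (H1_avg (hp k) hf).1.
- apply/cvg_epsP => e e0; pose C := 2 ^+ n * n%:R ^+ 2 * Dr f.
  have [N hN] := (cvg_epsP _ _).1 (hk_cvg C) _ e0; exists N => k /hN; rewrite !subr0 => h.
  have sd := psd_domB BL (H1_sqi (H1_avg (hp k) hf).1) (H1_sqi hf).
  rewrite ger0_norm ?(psd_ge0 BL)//; apply: le_trans (le_trans (ler_norm _) h).
  apply: le_trans (avg_close _ hf) _; first by rewrite hp hk_le1.
  have C0 : 0 <= C by rewrite !mulr_ge0 ?exprn_ge0 ?Dr_ge0.
  rewrite (_ : _ * Dr f = C * hk R k ^+ 2); last by rewrite /C; ring.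
  by rewrite ler_wpM2l// expr2 ler_piMl ?hk_le1// ltW.
- by move=> k; rewrite addr0; exact: (H1_avg (hp k) hf).2.
Qed.

Lemma cvg_2D (a b : nat -> R) : a k @[k --> \oo] --> 0 -> b k @[k --> \oo] --> 0 ->
  2 * a k + 2 * b k @[k --> \oo] --> 0.
Proof.
move=> ca cb; rewrite -[X in _ --> X](mulr0 2) -[X in _ --> X]addr0 -[X in _ --> _ + X](mulr0 2).
by apply: cvgD; apply: cvgM => //; exact: cvg_cst.
Qed.

Lemma psd_tri S b u v w : psd S b -> S u -> S v -> S w ->
  b (u - v) (u - v) <= 2 * b (u - w) (u - w) + 2 * b (v - w) (v - w).
Proof.
move=> B Su Sv Sw; rewrite (_ : u - v = (u - w) - (v - w)); last first.
  by rewrite opprB addrA subrK.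
by apply: (psd_sqB_le B); exact: (psd_domB B).
Qed.

Lemma psd_tri' S b u v w : psd S b -> S u -> S v -> S w ->
  b (u - v) (u - v) <= 2 * b (w - u) (w - u) + 2 * b (w - v) (w - v).
Proof.
move=> B Su Sv Sw; rewrite (_ : u - v = (w - v) - (w - u)); last first.
  by rewrite opprB [RHS]addrC addrA subrK.
by rewrite [leRHS]addrC; apply: (psd_sqB_le B); exact: (psd_domB B).
Qed.

(** The averages are continuous and converge in H^1, so [H1q_complete] supplies a quasi-continuous
    limit. *)
Lemma H1q_rep u : H1 u -> exists2 v, H1q v & {ae leb, forall x, u x = v x}.
Proof.
move=> hu; have c := avg_cvg hu; have ha k := (H1_avg (hk_gt0 R k) hu).1.
have qa k : H1q (avg (hk R k) u).
  by split=> //; apply: qc_continuous; exact: avg_continuous (hk_gt0 R k) hu.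
have [|v [s [Z [hv _ _ _ cv]]]] := H1q_complete qa.
  move=> e e0; have e4 : 0 < e / 4 by rewrite divr_gt0.
  have [N hN] := (cvg_epsP _ _).1 c _ e4; exists N => m l /hN h1 /hN h2.
  apply: le_trans (psd_tri BH (ha m) (ha l) hu) _; move: h1 h2.
  move: (h1f _ _) (h1f _ _) => a b; rewrite !subr0 => h1 h2.
  by have := le_trans (ler_norm _) h1; have := le_trans (ler_norm _) h2; lra.
exists v => //; have hd := H1B hu hv.1.
have vw : ip leb (u - v) (u - v) <= 0.
  apply: (lim_ge (cvg_2D c cv)) => k; apply: le_trans (ip_le_h1 hd) _.
  exact: psd_tri' BH hu hv.1 (ha k).
have : {ae leb, forall x, (u - v) x = 0}.
  apply: ip_eq0_ae; first exact: H1_sqi hd.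
  by apply/eqP; rewrite eq_le vw (psd_ge0 BL (H1_sqi hd)).
by apply: filterS => x /eqP; rewrite fctE subr_eq0 => /eqP.
Qed.

Definition Lc := [set u : E -> R | [/\ H1 u, continuous u & exists K : R, forall x, K <= `|x| -> u x = 0]].

Lemma Lc_H1q u : Lc u -> H1q u.
Proof. by case=> h1 h2 _; split => //; exact: qc_continuous. Qed.

Lemma Lc_integ u : Lc u -> integ leb u.
Proof. by case=> h1 _ [K hK]; apply: (integ_supp_norm (H1_sqi h1) hK). Qed.

(** Steps are at most 1, so the difference quotients are bounded by L times the indicator of the
    ball of radius K + 1. *)
Lemma H1_lip_supp L u (K : R) : cutoff L u -> (forall x, K <= `|x| -> u x = 0) -> H1 u.
Proof.
move=> [mu u01 L0 uL] uK.
have sI (K' : R) : sqi leb (\1_[set x : E | `|x| < K'] : E -> R).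
  by apply: sqi_indic; [exact: measurable_normlt|exact: normlt_fin].
have su : sqi leb u.
  apply: (sqi_le (sI K) mu) => x; rewrite indicE; have [xK|xK] := boolP (x \in _).
    by rewrite normr1; have /andP[h1 h2] := u01 x; rewrite ger0_norm.
  rewrite normr0 uK ?normr0// leNgt; apply/negP => h; move/negP: xK; apply.
  exact/mem_set.
have sJ : sqi leb (L *: (\1_[set x : E | `|x| < K + 1] : E -> R)) by exact: (psd_domZ BL).
apply: (proj1 (H1_ah (C := \sum_(i < n) ip leb (L *: \1_[set x : E | `|x| < K + 1]) (L *: \1_[set x : E | `|x| < K + 1])) su _)).
move=> k; apply: ler_sum => i _; apply: ip_le => //; first exact: sqi_dq.
move=> x; have h0 := hk_gt0 R k; rewrite dqE normrM fctE /GRing.scale/= normrM (ger0_norm L0) [`|_^-1|]ger0_norm ?invr_ge0 ?(ltW h0)//.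
rewrite indicE; have [xK|xK] := boolP (x \in _).
  by rewrite normr1 mulr1 ler_pdivrMl// mulrC; exact: uL.
rewrite normr0 mulr0 !uK ?subrr ?normr0 ?mulr0//.
  apply: (@le_trans _ _ (K + 1)); first by rewrite lerDl.
  by rewrite leNgt; apply/negP => h; move/negP: xK; apply; exact/mem_set.
have : K + 1 <= `|x| by rewrite leNgt; apply/negP => h; move/negP: xK; apply; exact/mem_set.
have := ler_normD (x + hk R k *: ei R i) (- (hk R k *: ei R i)).
rewrite addrK normrN normrZ (ger0_norm (ltW h0)).
have : hk R k * `|ei R i : E| <= 1 by rewrite mulr_ile1 ?(ltW h0) ?hk_le1 ?norm_ei.
lra.
Qed.

Lemma Lc_chi (K : R) : exists2 chi, Lc chi & (forall x, 0 <= chi x <= 1) /\ forall x, `|x| <= K -> chi x = 1.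
Proof.
have lt : K < K + 1 by rewrite ltrDl.
have [] := @cutoff_norm R n (ramp K (K + 1)) ((K + 1 - K)^-1).
- by rewrite invr_ge0 subr_ge0 ltW.
- by move=> t; exact: ramp01.
- by move=> s t; exact: ramp_lip.
move=> c1 c2; exists (fun x => ramp K (K + 1) `|x|); last first.
  by split=> x; [exact: ramp01|exact: ramp_in].
split => //; last by exists (K + 1) => x; exact: ramp_out.
by apply: (H1_lip_supp c1 (K := K + 1)) => x; exact: ramp_out.
Qed.

End averages.

(** * Density of continuous functions of bounded support *)

Section density.
Variables (R : realType) (n : nat).
Local Notation E := 'rV[R]_n.
Local Notation leb := (lebesgue_rV R n).
Implicit Types (u v w f g phi : E -> R).
Let BL := psd_ip leb.
Let BD := @psd_Da R n.
Let BH := @psd_h1 R n.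

Lemma ramp_norm_cutoff (a b : R) : a < b ->
  cutoff (b - a)^-1 (fun x : E => ramp a b `|x|) /\ continuous (fun x : E => ramp a b `|x|).
Proof.
move=> ab; apply: cutoff_norm; first by rewrite invr_ge0 subr_ge0 ltW.
  by move=> t; exact: ramp01.
by move=> s t; exact: ramp_lip.
Qed.

Lemma It_abs_small v (K d : R) : sqi leb v -> (forall x, K <= `|x| -> v x = 0) -> 0 <= d ->
  fine (leb [set x : E | `|x| < K]) * ip leb v v <= d ^+ 2 -> It leb (fun x => `|v x|) <= d.
Proof.
move=> sv vK d0 h; have [|_ h2] := integ_supp (@measurable_normlt R n K) (@normlt_fin R n K) sv.
  by move=> x /= /negP; rewrite -leNgt => /vK.
rewrite -ler_sqr ?nnegrE//; first exact: le_trans h2 h.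
exact: It_ge0.
Qed.

Lemma avg_Lc u (K h : R) : 0 < h <= 1 -> H1 u -> (forall x, K <= `|x| -> u x = 0) ->
  Lc (avg h u) /\ forall x, K + 1 <= `|x| -> avg h u x = 0.
Proof.
move=> /andP[h0 h1] hu uK; have z x : K + 1 <= `|x| -> avg h u x = 0.
  move=> xK; rewrite /avg (_ : u * _ = 0) ?It0 ?mulr0//; apply/funext => y.
  rewrite !fctE indicE; have [/set_mem yC|_] := boolP (y \in _); last by rewrite mulr0.
  rewrite uK ?mul0r//; have : `|y - x| <= h.
    apply: norm_le_coord; first exact: ltW.
    by move=> i; rewrite !mxE; have /andP[a b] := yC i; rewrite ler_norml; apply/andP; split; lra.
  have t : `|x| <= `|y - x| + `|y| by have := ler_normD (x - y) y; rewrite subrK distrC.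
  move=> hh; have := le_trans xK (le_trans t (lerD (le_trans hh h1) (lexx _))).
  by rewrite [_ + 1]addrC lerD2l.
split=> //; split; [exact: (H1_avg h0 hu).1|exact: avg_continuous|].
by exists (K + 1).
Qed.

Lemma Lc_dense_supp u (K e : R) : H1 u -> (forall x, K <= `|x| -> u x = 0) -> 0 < e ->
  exists F, [/\ Lc F, h1f (F - u) (F - u) <= e, It leb (fun x => `|(F - u) x|) <= e &
    (forall x, 0 <= u x) -> forall x, 0 <= F x].
Proof.
move=> hu uK e0; pose A := fine (leb [set x : E | `|x| < K + 1]).
have A0 : 0 <= A by rewrite fine_ge0.
pose d := Num.min e (e ^+ 2 / (A + 1)); have d0 : 0 < d.
  by rewrite lt_min e0 divr_gt0 ?exprn_gt0// ltr_wpDl.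
have [N /(_ N (leqnn N))] := (cvg_epsP _ _).1 (avg_cvg hu) _ d0.
have hp : 0 < hk R N <= 1 by rewrite hk_gt0 hk_le1.
have hp0 := hk_gt0 R N.
have [F1 F2] := avg_Lc hp hu uK; set F := avg _ _ in F1 F2 *.
have hd := H1B (Lc_H1q F1).1 hu.
rewrite subr0 ger0_norm ?(psd_ge0 BH hd)// => h; exists F; split => //.
- by apply: le_trans h _; rewrite ge_min lexx.
- apply: (It_abs_small (H1_sqi hd) (K := K + 1) _ (ltW e0)).
    move=> x xK; rewrite !fctE F2// uK ?subrr//; apply: le_trans xK; by rewrite lerDl.
  apply: (@le_trans _ _ (A * d)).
    by rewrite -/A ler_wpM2l//; exact: le_trans (ip_le_h1 hd) h.
  apply: (@le_trans _ _ ((A + 1) * d)); first by rewrite ler_wpM2r ?(ltW d0)// lerDl.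
  by rewrite mulrC -ler_pdivlMr ?ltr_wpDl// /d ge_min lexx orbT.
- move=> u0 x; rewrite /F /avg mulr_ge0 ?invr_ge0 ?exprn_ge0 ?(ltW hp0)//.
  by apply: It_ge0 => y; rewrite !fctE mulr_ge0// indicE.
Qed.

(** [H1_cut] alone would leave a factor 2 on the Dirichlet integral. The sharp inequality [Dr_cut],
    with slopes tending to 0 and D(eta^2 phi, phi) tending to D(phi), gives the upper bound that
    strong convergence asks for. *)
Lemma H1_cut_cvg phi (e : R) : H1 phi -> integ leb phi -> 0 < e ->
  exists u K, [/\ H1 u, forall x, K <= `|x| -> u x = 0, h1f (u - phi) (u - phi) <= e,
    It leb (fun x => `|(u - phi) x|) <= e & (forall x, 0 <= phi x) -> forall x, 0 <= u x].
Proof.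
move=> hp ip_ e0; pose a k : R := k.+1%:R; pose b k : R := 2 * a k.
have a0 k : 0 < a k by rewrite ltr0n.
have ab k : a k < b k by rewrite /b; have := a0 k; lra.
pose eta k (x : E) := ramp (a k) (b k) `|x|.
have C k := ramp_norm_cutoff (ab k); have sp := H1_sqi hp.
have bE k : (b k - a k)^-1 = (a k)^-1 by congr (_^-1); rewrite /b; ring.
have e01 k x : 0 <= eta k x <= 1 by exact: ramp01.
have ec x : \forall k \near \oo, eta k x = 1.
  have [K hK] : exists K : nat, `|x| < K%:R.
    by exists (Num.truncn `|x|).+1; exact: truncnS_gt.
  near=> k; apply: ramp_in => //; apply: le_trans (ltW hK) _; rewrite ler_nat; apply: leqW.
  by near: k; exists K.
have cc (F : R -> R) x : F (eta k x) @[k --> \oo] --> F 1.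
  by apply: cvg_near_cst; apply: filterS (ec x) => k ->.
have mE k : mf (eta k) by case: (C k) => -[].
have H k := H1_cut (C k).1 hp; have H2 k := H1_cut (C k).1 (H k).1.
have le1 k (g : R -> R) x : 0 <= g (eta k x) <= 1 -> `|(g (eta k x) - 1) * phi x| <= `|phi x|.
  move=> /andP[h1 h2]; rewrite normrM ler_piMl// ler_norml; apply/andP; split; lra.
have e2 k x : 0 <= eta k x * eta k x <= 1.
  by have /andP[h1 h2] := e01 k x; rewrite mulr_ge0// mulr_ile1.
have nrc (g : R -> R) : g 1 = 1 -> (forall k, mf (fun x => g (eta k x))) ->
    (forall k x, 0 <= g (eta k x) <= 1) ->
    ip leb ((fun x => g (eta k x) * phi x) - phi) ((fun x => g (eta k x) * phi x) - phi) @[k --> \oo] --> 0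
    /\ It leb (fun x => `|g (eta k x) * phi x - phi x|) @[k --> \oo] --> 0.
  move=> g1 mg g01; have m1 k : mf ((fun x => g (eta k x) * phi x) - phi).
    by apply: mfB; [apply: mfM; [exact: mg|exact: sp.1]|exact: sp.1].
  have eq k x : g (eta k x) * phi x - phi x = (g (eta k x) - 1) * phi x by ring.
  split.
    rewrite -[X in _ --> X](@It0 _ _ _ leb) /ip.
    apply: (proj2 (It_dom (g := phi * phi) _ _ _ _ _)) => //.
    - by move=> k; exact: mfM.
    - exact: mf_cst.
    - apply: aeW => x; rewrite -[X in _ --> X](_ : (fun t => (t * phi x - phi x) * (t * phi x - phi x)) (g 1) = _); last first.
        by rewrite /= g1 mul1r subrr mul0r.
      exact: (cc (fun t => (g t * phi x - phi x) * (g t * phi x - phi x))).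
    - exact: sp.2.
    - move=> k x; rewrite !mulrfctE -[X in `|X * _|]/(g (eta k x) * phi x - phi x).
      rewrite -[X in `|_ * X|]/(g (eta k x) * phi x - phi x) eq normrM.
      have := le1 k g x (g01 k x); move: (`|_|) (normr_ge0 ((g (eta k x) - 1) * phi x)) => t t0 ht.
      by rewrite -[leRHS]ger0_norm -?expr2 ?sqr_ge0// normrX lerXn2r ?nnegrE.
  rewrite -[X in _ --> X](@It0 _ _ _ leb).
  apply: (proj2 (It_dom (g := fun x => `|phi x|) _ _ _ _ _)) => //.
  - by move=> k; apply: mf_norm; exact: m1.
  - exact: mf_cst.
  - apply: aeW => x; rewrite -[X in _ --> X](_ : (fun t => `|t * phi x - phi x|) (g 1) = _); last first.
      by rewrite /= g1 mul1r subrr normr0.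
    exact: (cc (fun t => `|g t * phi x - phi x|)).
  - exact: integ_abs.
  - by move=> k x; rewrite normr_id eq le1.
have [n1 n2] := nrc id erefl mE e01.
have [n3 _] := nrc (fun t => t * t) (mulr1 1) (fun k => mfM (mE k) (mE k)) e2.
have La k : (a k)^-1 ^+ 2 <= 1.
  by rewrite expr2 mulr_ile1 ?invr_ge0 ?(ltW (a0 k))// invf_le1// ler1n.
pose D := 2 * (2 * Dr phi + 4 * n%:R * ip leb phi phi) + 4 * n%:R * ip leb phi phi.
have bd L2 w : L2 <= 1 -> 0 <= ip leb w w -> 4 * n%:R * L2 * ip leb w w <= 4 * n%:R * ip leb w w.
  by move=> l0 w0; rewrite ler_wpM2r// ler_piMr// mulr_ge0.
have ipe k : ip leb (eta k * phi) (eta k * phi) <= ip leb phi phi.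
  apply: ip_le; [exact: sqi_cut (C k).1 sp|exact: sp|] => x.
  by rewrite fctE normrM ler_piMl// ger0_norm; case/andP: (e01 k x).
have DU k : Dr (eta k * (eta k * phi)) <= D.
  apply: le_trans (H2 k).2 _; rewrite /D lerD//.
    rewrite ler_wpM2l//; apply: le_trans (H k).2 _; rewrite lerD2l bE.
    by apply: bd => //; exact: (psd_ge0 BL).
  rewrite bE; apply: le_trans (bd _ _ (La k) (psd_ge0 BL (sqi_cut (C k).1 sp))) _.
  by rewrite ler_wpM2l//; exact: ipe.
have cD : Da (eta k * (eta k * phi)) phi @[k --> \oo] --> Dr phi.
  apply: (Da_weak_cvg (C := D)) => //; first by move=> k; exact: (H2 k).1.
  apply: nr_cvg0; apply: cvg_trans n3; apply: near_eq_cvg; near=> k.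
  by congr (ip leb _ _); apply/funext => x; rewrite !fctE /= mulrA.
have ca : (a k)^-1 @[k --> \oo] --> 0.
  by have := @cvg_harmonic R; congr (_ --> _).
have cL : n%:R * (a k)^-1 ^+ 2 * ip leb phi phi @[k --> \oo] --> 0.
  rewrite -[X in _ --> X](_ : (n%:R : R) * (0 * 0) * ip leb phi phi = 0); last by rewrite !mulr0 mul0r.
  by apply: cvgM; [apply: cvgM; [exact: cvg_cst|exact: cvgM]|exact: cvg_cst].
have ch : h1f (eta k * phi - phi) (eta k * phi - phi) @[k --> \oo] --> 0.
  apply: (h1_cvg_of_limsup (e := fun k => Da (eta k * (eta k * phi)) phi - Dr phi + n%:R * (a k)^-1 ^+ 2 * ip leb phi phi)) => //.
  - by move=> k; exact: (H k).1.
  - move=> k; apply: le_trans (Dr_cut (C k).1 hp) _; rewrite bE.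
    rewrite [leRHS]addrA [Dr phi + _]addrC subrK (psd_sym BD hp (H2 k).1).
    exact: lexx.
  - rewrite -[X in _ --> X](addr0 0); apply: cvgD => //.
    by rewrite -[X in _ --> X](subrr (Dr phi)); apply: cvgB => //; exact: cvg_cst.
have [N1 h1] := (cvg_epsP _ _).1 ch _ e0.
have [N2 h2] := (cvg_epsP _ _).1 n2 _ e0.
pose N := maxn N1 N2; have := h1 N (leq_maxl _ _); have := h2 N (leq_maxr _ _).
rewrite !subr0 => i2 i1; exists (eta N * phi), (b N); split.
- exact: (H N).1.
- by move=> x xb; rewrite fctE /eta ramp_out ?mul0r.
- exact: le_trans (ler_norm _) i1.
- exact: le_trans (ler_norm _) i2.
- by move=> p0 x; rewrite fctE mulr_ge0//; case/andP: (e01 N x).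
Unshelve. all: by end_near. Qed.

Lemma Lc_dense phi (e : R) : H1 phi -> integ leb phi -> 0 < e ->
  exists F, [/\ Lc F, h1f (F - phi) (F - phi) <= e, It leb (fun x => `|(F - phi) x|) <= e &
    (forall x, 0 <= phi x) -> forall x, 0 <= F x].
Proof.
move=> hp i0 e0; have e4 : 0 < e / 4 by rewrite divr_gt0.
have [u [K [hu uK u1 u2 u3]]] := H1_cut_cvg hp i0 e4.
have [F [F1 F2 F3 F4]] := Lc_dense_supp hu uK e4; have hF := (Lc_H1q F1).1.
have hFu := H1B hF hu; have hup := H1B hu hp.
have iF := Lc_integ F1; have iu := integ_supp_norm (H1_sqi hu) uK.
exists F; split=> //.
- have -> : F - phi = (F - u) + (u - phi) by rewrite addrA subrK.
  apply: le_trans (psd_sqD_le BH hFu hup) _.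
  by move: (h1f _ _) (h1f _ _) u1 F2 => x y; lra.
- apply: (@le_trans _ _ (It leb (fun x => `|(F - u) x|) + It leb (fun x => `|(u - phi) x|))).
    have i1 := integ_abs (integB iF iu); have i2 := integ_abs (integB iu i0).
    rewrite -ItD//; apply: It_le; [exact: integ_abs (integB iF i0)|exact: integD|].
    move=> x; rewrite !fctE; apply: le_trans (ler_normD _ _); rewrite le_eqVlt; apply/orP; left.
    by apply/eqP; congr (`|_|); ring.
  by move: (It _ _) (It _ _) u2 F3 => x y; lra.
- by move=> p0 x; apply: F4; exact: u3.
Qed.

End density.

(** * The Radon measure 1 + Delta w *)

Section riesz.
Variables (R : realType) (n : nat).
Local Notation E := 'rV[R]_n.
Local Notation leb := (lebesgue_rV R n).
Implicit Types (u v f g phi : E -> R).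
Let BL := psd_ip leb.
Let BD := @psd_Da R n.
Let BH := @psd_h1 R n.

Lemma Lc_dom (a : R) u v : Lc u -> Lc v -> Lc (a *: u + v).
Proof.
move=> [h1 c1 [K1 k1]] [h2 c2 [K2 k2]]; split; first exact: H1_dom.
  move=> x; apply: (@cvgD R R^o E (nbhs x) _ (fun t => a * u t) v); last exact: c2.
  by apply: cvgM; [exact: cvg_cst|exact: c1].
exists (Num.max K1 K2) => x; rewrite ge_max => /andP[l1 l2].
by rewrite !fctE k1// k2// scaler0 addr0.
Qed.

Lemma Lc_min u v : Lc u -> Lc v -> Lc (u \min v).
Proof.
move=> [h1 c1 [K1 k1]] [h2 c2 [K2 k2]]; split; first exact: H1_min.
  by move=> x; apply: continuous_min; [exact: c1|exact: c2].
exists (Num.max K1 K2) => x; rewrite ge_max => /andP[l1 l2].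
by rewrite /= k1// k2// minxx.
Qed.

Lemma Lc_abs u : Lc u -> Lc (fun x => `|u x|).
Proof.
move=> [h1 c1 [K1 k1]]; split; first exact: (H1_abs h1).1.
  by move=> x; apply: (@continuous_comp _ _ _ u (fun t => `|t|)); [exact: c1|exact: norm_continuous].
by exists K1 => x xK; rewrite k1// normr0.
Qed.

Lemma Lc_minc u (k : R) : 0 <= k -> Lc u -> Lc (fun x => Num.min (u x) k).
Proof.
move=> k0 [h1 c1 [K1 k1]]; split; first exact: H1_minc.
  by move=> x; apply: (@continuous_min _ _ u (cst k)); [exact: c1|exact: cst_continuous].
by exists K1 => x xK; rewrite k1// min_l.
Qed.

Lemma Lc0 : Lc (0 : E -> R).
Proof.
by split; [exact: H10|exact: cst_continuous|exists 0].
Qed.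

Lemma LcZ (a : R) u : Lc u -> Lc (a *: u).
Proof. by move=> hu; rewrite -[a *: u]addr0; apply: Lc_dom => //; exact: Lc0. Qed.
Lemma LcD u v : Lc u -> Lc v -> Lc (u + v).
Proof. by move=> hu hv; rewrite -[u]scale1r; exact: Lc_dom. Qed.
Lemma LcB u v : Lc u -> Lc v -> Lc (u - v).
Proof. by move=> hu hv; rewrite addrC -scaleN1r; exact: Lc_dom. Qed.

(** g is the distance to the complement of U; adding the value 1 to the set of distances caps it,
    and keeps the infimum meaningful when U is the whole space. *)
Lemma distance_cutoff (U : set E) : open U ->
  exists g, [/\ cutoff 1 g, continuous g & forall x, (0 < g x) <-> U x].
Proof.
move=> oU; pose S x : set R := [set `|x - y| | y in ~` U] `|` [set 1]; pose g x := inf (S x).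
have lb x : lbound (S x) 0 by move=> _ [[y _ <-]|->].
have S0 x : S x !=set0 by exists 1; right.
have g0 x : 0 <= g x by exact: lb_le_inf.
have g1 x : g x <= 1 by apply: inf_lbound; [by exists 0|right].
have gy x y : ~ U y -> g x <= `|x - y|.
  by move=> Uy; apply: inf_lbound; [by exists 0|left; exists y].
have lip x y : g y <= g x + `|y - x|.
  rewrite -lerBlDr; apply: lb_le_inf => // _ [[z Uz <-]|->].
    rewrite lerBlDr; apply: le_trans (gy _ _ Uz) _.
    by rewrite [leRHS]addrC (le_trans _ (ler_normD _ _))// addrA subrK.
  by rewrite lerBlDr; apply: le_trans (g1 y) _; rewrite lerDl.
have lip' x y : `|g y - g x| <= 1 * `|y - x|.
  have := lip x y; have := lip y x; rewrite mul1r [`|x - y|]distrC ler_norml.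
  by move: (`|y - x|) => t h1 h2; apply/andP; split; lra.
have cg : continuous g by exact: lip_continuous lip'.
exists g; split=> //.
  split=> //; [exact: continuous_measurable_rVR|by move=> x; rewrite g0 g1|].
  move=> i h x h0; apply: le_trans (lip' _ _) _; rewrite !mul1r addrC addKr normrZ.
  by rewrite (gtr0_norm h0) ler_piMr ?norm_ei// ltW.
move=> x; split=> [gx|Ux].
  by apply: contrapT => Ux; have := gy x x Ux; rewrite subrr normr0 leNgt gx.
have /nbhs_ballP[e /= e0 eU] : nbhs x U by exact: open_nbhs_nbhs.
have m0 : 0 < Num.min e 1 by rewrite lt_min e0 ltr01.
apply: lt_le_trans m0 _; apply: lb_le_inf => // _ [[z Uz <-]|->]; rewrite ge_min ?lexx ?orbT//.
apply/orP; left; rewrite leNgt; apply/negP => h; apply: Uz; apply: eU.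
by rewrite -ball_normE.
Qed.

Variable w : E -> R.
Hypotheses (hw : H1 w).
Hypothesis sub : forall phi, H1 phi -> integ leb phi -> (forall x, 0 <= phi x) -> Da w phi <= It leb phi.

Let D u := H1 u /\ integ leb u.
(* ell is the distribution 1 + Delta w; rmeas below is the Radon measure representing it. *)
Definition ell u := It leb u - Da w u.

Let LD u : Lc u -> D u. Proof. by move=> h; split; [case: h|exact: Lc_integ]. Qed.

Lemma ell_lin (a : R) u v : D u -> D v -> ell (a *: u + v) = a * ell u + ell v.
Proof.
move=> [h1 i1] [h2 i2]; rewrite /ell ItD ?ItZ//; last exact: integZ.
by rewrite (psdDr BD)// ?(psdZr BD)//; [ring|exact: (psd_domZ BD)].
Qed.

Lemma ellD u v : D u -> D v -> ell (u + v) = ell u + ell v.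
Proof. by move=> h1 h2; rewrite -[u]scale1r ell_lin// mul1r scale1r. Qed.
Lemma ell0 : ell 0 = 0.
Proof. by rewrite /ell It0 (psd_sym BD)// ?(psd0l BD)// ?subr0//; exact: H10. Qed.
Lemma ellZ (a : R) u : D u -> ell (a *: u) = a * ell u.
Proof.
have D0 : D 0 by split; [exact: H10|exact: integ0].
by move=> h1; rewrite -[a *: u]addr0 ell_lin// ell0 addr0.
Qed.
Lemma ellB u v : D u -> D v -> ell (u - v) = ell u - ell v.
Proof. by move=> h1 h2; rewrite addrC -scaleN1r ell_lin// mulN1r addrC. Qed.

Lemma ell_ge0 u : D u -> (forall x, 0 <= u x) -> 0 <= ell u.
Proof. by move=> [h1 h2] u0; rewrite /ell subr_ge0; exact: sub. Qed.

Lemma ell_le u v : D u -> D v -> (forall x, u x <= v x) -> ell u <= ell v.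
Proof.
move=> hu hv uv; rewrite -subr_ge0 -ellB//; apply: ell_ge0; last first.
  by move=> x; rewrite fctE subr_ge0.
by split; [exact: H1B hv.1 hu.1|exact: integB hv.2 hu.2].
Qed.

Lemma ell_le_ae u v : D u -> D v -> {ae leb, forall x, u x <= v x} -> ell u <= ell v.
Proof.
move=> hu hv uv; rewrite -subr_ge0 -ellB//.
have hd : H1 (v - u) by exact: H1B hv.1 hu.1.
have id_ : integ leb (v - u) by exact: integB hv.2 hu.2.
have ha := (H1_abs hd).1; have ia := integ_abs id_.
have e : {ae leb, forall x, (v - u) x = `|(v - u) x|}.
  by apply: filterS uv => x h; rewrite ger0_norm// fctE subr_ge0.
rewrite /ell (It_ae _ _ e); [|exact: H1_mf|exact: H1_mf].
rewrite (psd_sym BD hw hd) (Da_ae hd ha hw e) (psd_sym BD ha hw).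
by apply: (@ell_ge0 (fun x => `|(v - u) x|)).
Qed.

Definition Lp (psi : nat -> E -> R) := [/\ forall m, Lc (psi m), forall m x, 0 <= psi m x &
  forall m p x, (m <= p)%N -> psi m x <= psi p x].
(** A Daniell upper integral of the indicator of A: the supremum of the increasing sequence is at
    least 1 on A and has cost at most c. *)
Definition cover (A : set E) (c : R) := exists psi, [/\ Lp psi, forall m, ell (psi m) <= c &
  forall x, A x -> exists m, 1 <= psi m x].

Lemma cover_ge0 A c : cover A c -> 0 <= c.
Proof. by move=> [p [[h1 h2 _] h _]]; apply: le_trans (h 0%N); apply: ell_ge0; [exact: LD|exact: h2]. Qed.

Lemma cover_mono A A' c c' : A `<=` A' -> c <= c' -> cover A' c -> cover A c'.
Proof.
move=> AA cc [p [h1 h2 h3]]; exists p; split=> // [m|x /AA]; last exact: h3.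
exact: le_trans (h2 m) cc.
Qed.

Lemma cover0 : cover set0 0.
Proof.
exists (fun _ => 0); split=> //; last by move=> m; rewrite ell0.
by split=> // m; exact: Lc0.
Qed.

Lemma cover_one A u c : Lc u -> (forall x, 0 <= u x) -> ell u <= c -> (forall x, A x -> 1 <= u x) -> cover A c.
Proof. by move=> hu u0 uc uA; exists (fun _ => u); split=> // x Ax; exists 0%N; exact: uA. Qed.

(** A diagonal sum: the m-th function adds the m-th terms of the first m covers, hence increases in
    m, and its cost is at most a partial sum of the costs. *)
Lemma cover_bigcup (A : nat -> set E) (a : nat -> R) C : (forall k, cover (A k) (a k)) ->
  (forall m, \sum_(k < m) a k <= C) -> cover (\bigcup_k A k) C.
Proof.
move=> /choice[p hp] aC; pose q m := \sum_(k < m) p k m.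
have lq j m : Lc (\sum_(k < j) p k m).
  elim: j => [|j ih]; first by rewrite big_ord0; exact: Lc0.
  by rewrite big_ord_recr/=; apply: LcD => //; case: (hp j) => -[].
have p0 k m x : 0 <= p k m x by case: (hp k) => -[].
have pm k m l x : (m <= l)%N -> p k m x <= p k l x by case: (hp k) => -[_ _ H] _ _; exact: H.
have sE j m x : (\sum_(k < j) p k m) x = \sum_(k < j) p k m x by rewrite fct_sumE.
have qE m x : q m x = \sum_(k < m) p k m x by exact: sE.
exists q; split.
- split=> [m|m x|m l x ml]; [exact: lq|by rewrite qE; exact: sumr_ge0|].
  rewrite !qE -(subnKC ml) big_split_ord/=; apply: ler_wpDr; first exact: sumr_ge0.
  by apply: ler_sum => k _; apply: pm; exact: leq_addr.
- move=> m; suff H j : ell (\sum_(k < j) p k m) <= \sum_(k < j) a k by exact: le_trans (H m) (aC m).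
  elim: j => [|j ih]; first by rewrite !big_ord0 ell0.
  rewrite !big_ord_recr/= ellD; [|exact: LD (lq _ _)|by apply: LD; case: (hp j) => -[H _ _] _ _; exact: H].
  by apply: lerD => //; case: (hp j).
- move=> x [k _ Ax]; have [_ _ /(_ _ Ax)[m h]] := hp k; pose l := maxn m k.+1.
  exists l; rewrite qE; have kl : (k < l)%N by exact: leq_maxr.
  rewrite (bigD1 (Ordinal kl))//=; apply: ler_wpDr; first exact: sumr_ge0.
  by apply: le_trans h _; apply: pm; exact: leq_maxl.
Qed.

Definition mstar (A : set E) : \bar R := ereal_inf (EFin @` [set c | cover A c]).

Lemma mstar_le A c : cover A c -> (mstar A <= c%:E)%E.
Proof. by move=> h; apply: ereal_inf_lbound; exists c. Qed.
Lemma mstar_lt A c : (mstar A < c%:E)%E -> cover A c.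
Proof. by move=> /ereal_inf_lt[_ [c' h <-]]; rewrite lte_fin => /ltW cc; exact: cover_mono h. Qed.
Lemma mstar_ge0 A : (0 <= mstar A)%E.
Proof. by apply: le_ereal_inf_tmp => _ [c h <-]; rewrite lee_fin; exact: cover_ge0 h. Qed.
Lemma mstar_mono A A' : A `<=` A' -> (mstar A <= mstar A')%E.
Proof. by move=> AA; apply: ereal_inf_le_tmp => _ [c h <-]; exists c => //; exact: cover_mono h. Qed.
Lemma mstar0 : mstar set0 = 0%E.
Proof. by apply/eqP; rewrite eq_le mstar_ge0 andbT; apply: mstar_le; exact: cover0. Qed.

Lemma mstar_sub : sigma_subadditive mstar.
Proof.
move=> A; have s0 := fun k (_ : true) => mstar_ge0 (A k).
have [->|foo] := eqVneq (\sum_(0 <= i <oo) mstar (A i))%E +oo%E; first exact: leey.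
have sge0 : (0 <= \sum_(0 <= i <oo) mstar (A i))%E by apply: nneseries_ge0 => i _ _; exact: mstar_ge0.
have fs : (\sum_(0 <= i <oo) mstar (A i))%E \is a fin_num.
  by rewrite ge0_fin_numE// lt_neqAle foo leey.
have part m : (\sum_(i < m) mstar (A i) <= \sum_(0 <= i <oo) mstar (A i))%E.
  by rewrite -(big_mkord xpredT (mstar \o A)); apply: nneseries_lim_ge => i _ _; exact: mstar_ge0.
have fA k : mstar (A k) \is a fin_num.
  rewrite ge0_fin_numE ?mstar_ge0//.
  have : (\sum_(0 <= i <oo) mstar (A i) < +oo)%E by rewrite -ge0_fin_numE//; exact: fs.
  apply: le_lt_trans; apply: le_trans (part k.+1); rewrite big_ord_recr/= leeDr// sume_ge0// => i _.
  exact: mstar_ge0.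
apply/lee_addgt0Pr => e e0; rewrite -(fineK fs) -EFinD; apply: mstar_le.
apply: (@cover_bigcup _ (fun k => fine (mstar (A k)) + e * hk R k.+1)).
  by move=> k; apply: mstar_lt; rewrite EFinD (fineK (fA k)) lteDl// lte_fin mulr_gt0// hk_gt0.
move=> m; rewrite big_split/= lerD//; last by apply: geom_sum; exact: ltW.
rewrite -lee_fin (fineK fs); apply: le_trans (part m).
by rewrite -sumEFin; apply: lee_sum => i _; rewrite (fineK (fA i)).
Qed.

Definition mouter : {outer_measure set E -> \bar R} :=
  HB.pack mstar (isOuterMeasure.Build R E mstar mstar0 mstar_ge0 mstar_mono mstar_sub).

(** A cover p of X is split along g: min(p_m, m g) increases to a cover of X on {g > 0}, and for
    fixed j the functions p_m - min(p_m, j g) cover X off it. By additivity of [ell] the costs add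
    up to at most that of p. *)
Lemma caratheodory_pos g : Lc g -> (forall x, 0 <= g x) -> mouter.-caratheodory [set x | 0 < g x].
Proof.
move=> lg g0; set G := [set x | _]; apply: le_caratheodory_measurable => X.
change (mstar (X `&` G) + mstar (X `&` ~` G) <= mstar X)%E.
have [->|foo] := eqVneq (mstar X) +oo%E; first exact: leey.
have fX : mstar X \is a fin_num by rewrite ge0_fin_numE ?mstar_ge0// lt_neqAle foo leey.
apply/lee_addgt0Pr => e e0; rewrite -(fineK fX) -EFinD.
have /mstar_lt[p [[lp p0 pm] pc pX]] : (mstar X < (fine (mstar X) + e)%:E)%E.
  by rewrite EFinD (fineK fX) lteDl// lte_fin.
move: (fine (mstar X) + e) pc => {fX foo e e0} c pc.
pose a m x := Num.min (p m x) (m%:R * g x).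
pose q j m x := p m x - Num.min (p m x) (j%:R * g x).
have lmg (m j : nat) : Lc (fun x => Num.min (p m x) (j%:R * g x)).
  by apply: Lc_min => //; exact: LcZ.
have la m : Lc (a m) by exact: lmg.
have lq j m : Lc (q j m) by exact: LcB.
have jg (j : nat) x : 0 <= j%:R * g x by rewrite mulr_ge0.
have a0 m x : 0 <= a m x by rewrite le_min p0 jg.
have am m k x : (m <= k)%N -> a m x <= a k x.
  move=> mk; rewrite le_min !ge_min (pm _ _ _ mk)/=; apply/orP; right.
  by rewrite ler_wpM2r// ler_nat.
have q0 j m x : 0 <= q j m x by rewrite subr_ge0 ge_min lexx.
have qm j m k x : (m <= k)%N -> q j m x <= q j k x.
  move=> /(pm _ _ x); rewrite /q; move: (p m x) (p k x) (j%:R * g x) => s t z st.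
  by have [h1|h1] := leP s z; have [h2|h2] := leP t z; lra.
have aq j m : (j <= m)%N -> ell (a j) + ell (q j m) <= c.
  move=> jm; rewrite -ellD; [|exact: LD|exact: LD].
  apply: le_trans (ell_le _ _ _) (pc m); [by apply: LD; exact: LcD|exact: LD|].
  move=> x; rewrite fctE /a /q addrCA gerDl subr_le0 le_min !ge_min (pm _ _ _ jm)/=.
  by rewrite lexx orbT.
have ca b : (forall m, ell (a m) <= b) -> (mstar (X `&` G) <= b%:E)%E.
  move=> hb; apply: mstar_le; exists a; split=> // x [Xx Gx]; have [m hm] := pX _ Xx.
  pose k := (Num.truncn (g x)^-1).+1; exists (maxn m k); rewrite le_min.
  rewrite (le_trans hm (pm _ _ _ (leq_maxl _ _)))/= -ler_pdivrMr// div1r.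
  by apply: le_trans (ltW (truncnS_gt _)) _; rewrite ler_nat leq_maxr.
have cq j : (mstar (X `&` ~` G) <= (c - ell (a j))%:E)%E.
  have lpq : Lp (q j) by split; [exact: lq|exact: q0|move=> m k x; exact: qm].
  apply: mstar_le; exists (q j); split; [exact: lpq|move=> m|move=> x [Xx /negP]].
    apply: le_trans (ell_le _ _ (qm j m (maxn m j) ^~ (leq_maxl _ _))) _; try exact: LD.
    by rewrite lerBrDl; apply: aq; exact: leq_maxr.
  rewrite -leNgt => gx; have g00 : g x = 0 by apply/eqP; rewrite eq_le gx g0.
  by have [m hm] := pX _ Xx; exists m; rewrite /q g00 mulr0 min_r// subr0.
have fG : mstar (X `&` ~` G) \is a fin_num.
  rewrite ge0_fin_numE ?mstar_ge0//; exact: le_lt_trans (cq 0%N) (ltry _).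

rewrite -(fineK fG) -leeBrDr// -EFinB; apply: ca => m.
by have := cq m; rewrite -(fineK fG) lee_fin; lra.
Qed.

Lemma normlt_open (K : R) : open [set x : E | `|x| < K].
Proof.
apply: (@open_comp _ _ (fun x : E => `|x|) [set t | t < K]); last exact: open_lt.
by move=> x _; exact: norm_continuous.
Qed.

Lemma bounded_open_Lc (U : set E) (K : R) : open U -> (forall x, U x -> `|x| < K) ->
  exists g, [/\ Lc g, forall x, 0 <= g x <= 1 & forall x, (0 < g x) <-> U x].
Proof.
move=> oU UK; have [g [c1 c2 c3]] := distance_cutoff oU; have [_ g01 _ _] := c1.
exists g; split=> //; have z x : K <= `|x| -> g x = 0.
  move=> xK; apply/eqP; rewrite eq_le; case/andP: (g01 x) => -> _; rewrite andbT leNgt.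
  by apply/negP => /c3/UK; rewrite ltNge xK.
by split=> //; [exact: H1_lip_supp c1 z|exists K].
Qed.

(** A bounded open set is {g > 0} for some g in [Lc], and every open set is a countable union of
    bounded ones. *)
Lemma borel_caratheodory (A : set E) : measurable A -> mouter.-caratheodory A.
Proof.
have [s1 s2 s3] := sigma_algebra_measurable (caratheodory_type mouter).
move: A; apply: smallest_sub; first by split.
move=> U oU; have -> : U = \bigcup_k (U `&` [set x : E | `|x| < k%:R]).
  apply/seteqP; split=> [x Ux|x [k _ []]//]; exists (Num.truncn `|x|).+1 => //; split=> //.
  exact: truncnS_gt.
apply: caratheodory_measurable_bigcup => k.
have oUk : open (U `&` [set x : E | `|x| < k%:R]) by apply: openI => //; exact: normlt_open.
have [g [h1 h2 h3]] := bounded_open_Lc oUk (fun x => @proj2 _ _).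
rewrite (_ : _ `&` _ = [set x | 0 < g x]); last by apply/seteqP; split=> x /h3.
by apply: caratheodory_pos => // x; case/andP: (h2 x).
Qed.

Lemma mstar_semi : semi_sigma_additive (mstar : set E -> \bar R).
Proof.
move=> F mF tF mUF; apply: (@caratheodory_measure_sigma_additive _ _ mouter) => //.
  by move=> i; exact: borel_caratheodory.
exact: borel_caratheodory.
Qed.

Definition rmeas : {measure set E -> \bar R} :=
  HB.pack mstar (isMeasure.Build _ _ _ mstar mstar0 mstar_ge0 mstar_semi).

Lemma ball_cover (K : R) : exists c, cover [set x : E | `|x| < K] c.
Proof.
have [chi lc [c01 c1]] := @Lc_chi R n K; exists (ell chi); apply: (@cover_one _ chi) => //.
  by move=> x; case/andP: (c01 x).
by move=> x /= /ltW/c1 ->.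
Qed.

Lemma Lc_closed_ball u (d : R) : Lc u -> 0 < d -> compact [set x | d <= u x].
Proof.
move=> [_ cu [K uK]] d0; apply: bounded_closed_compact.
  exists K; split; first exact: num_real.
  move=> M KM x /= dx; apply: ltW; apply: le_lt_trans KM; rewrite leNgt; apply/negP => /ltW/uK ux.
  by move: dx; rewrite ux leNgt d0.
apply: (@preimage_closed _ _ u [set t | d <= t]); last exact: closed_ge.
by move=> x _; exact: cu.
Qed.

(* Dini's theorem on the compact set {d <= phi} *)
Lemma daniell phi (a c : R) A : Lc phi -> (forall x, 0 <= phi x <= a) ->
  (forall x, phi x != 0 -> A x) -> cover A c -> ell phi <= a * c.
Proof.
move=> lphi p0a pA [psi [[lp p0 pm] pc pcov]]; apply/ler_addgt0Pr => e e0.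
have a0 : 0 <= a by have /andP[h1 h2] := p0a 0; exact: le_trans h2.
have [_ cphi [K pK]] := lphi.
have [chi lchi [c01 c1]] := @Lc_chi R n K; have chi0 x : 0 <= chi x by case/andP: (c01 x).
(* [chi] is 1 where [phi] is not 0: adding d chi absorbs the error d of Dini's argument, at a cost
   of at most e. *)
have s0 := ell_ge0 (LD lchi) chi0; pose d := e / (ell chi + 1).
have s1 : 0 < ell chi + 1 by rewrite ltr_wpDl.
have d0 : 0 < d by rewrite divr_gt0.
have := Lc_closed_ball lphi d0 => /compact_near_coveringP.
move=> /(_ nat \oo (fun m y => phi y < a * psi m y + d)) [].
  move=> x /= dx; have px : phi x != 0 by rewrite gt_eqF// (lt_le_trans d0).
  have [m hm] := pcov _ (pA _ px).
  exists ([set y | phi y - a * psi m y < d], [set i | (m <= i)%N]) => /=.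
    split; last by exists m.
    have [_ cm _] := lp m.
    have cx : (fun y => phi y - a * psi m y) @ x --> phi x - a * psi m x.
      apply: (@cvgB R R^o E (nbhs x) _ phi (fun y => a * psi m y)); first exact: cphi.
      by apply: cvgM; [exact: cvg_cst|exact: cm].
    apply: (cvgr_lt _ cx); apply: le_lt_trans d0; rewrite subr_le0.
    by case/andP: (p0a x) => _ h; apply: le_trans h _; rewrite ler_peMr.
  move=> [y i] /= [h1 /(pm _ _ y) h2]; rewrite addrC -ltrBlDr; apply: le_lt_trans h1.
  by rewrite lerB// ler_wpM2l.
move=> N _ /(_ N (leqnn N)) hN; have la : Lc (a *: psi N) by exact: LcZ.
have ld : Lc (d *: chi) by exact: LcZ.
apply: le_trans (ell_le (LD lphi) (LD (LcD la ld)) _) _.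
  move=> x; rewrite !fctE /GRing.scale/=; have [xK|xK] := leP K `|x|.
    by rewrite pK// addr_ge0// mulr_ge0// ltW.
  rewrite (c1 _ (ltW xK)) mulr1; have [h|h] := leP d (phi x); first exact/ltW/hN.
  by apply: le_trans (ltW h) _; rewrite lerDr mulr_ge0.
rewrite ellD ?ellZ//; try exact: LD; apply: lerD; first by rewrite ler_wpM2l.
by rewrite /d mulrAC ler_pdivrMr// ler_wpM2l ?(ltW e0)// lerDl.
Qed.

Lemma ell_small (e : R) : 0 < e -> exists2 d : R, 0 < d &
  forall z, D z -> `|It leb z| <= d -> Dr z <= d -> `|ell z| <= e.
Proof.
move=> e0; have q0 := Dr_ge0 hw; pose t := e / (2 * (Dr w + 1)).
have q1 : 0 < Dr w + 1 by rewrite ltr_wpDl.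
have t0 : 0 < t by rewrite divr_gt0// mulr_gt0.
exists (Num.min (e / 2) (e / 2 * t)) => [|z hz]; first by rewrite lt_min divr_gt0//= mulr_gt0// divr_gt0.
rewrite !le_min => /andP[h1 _] /andP[_ h2]; rewrite /ell.
have key : `|Da w z| <= e / 2.
  have A1 := psd_AMGM BD t0 hw hz.1; have A2 := psd_AMGM BD t0 hw (H1Z (-1) hz.1).
  rewrite (psdZr BD _ hz.1 hw) (psd_sqZ BD _ hz.1) sqrrN expr1n mul1r mulN1r in A2.
  have : t * Da w w <= e / 2.
    rewrite /t invfM mulrA -mulrA ler_piMr ?divr_ge0 ?(ltW e0)// mulrC ler_pdivrMr// mul1r.
    by rewrite lerDl.
  have : t^-1 * Da z z <= e / 2 by rewrite ler_pdivrMl// mulrC.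
  have : 0 <= t * Da w w by rewrite mulr_ge0// ltW.
  by rewrite ler_norml; move: (Da w z) (t * _) (t^-1 * _) A1 A2 => x y y' *; apply/andP; split; lra.
by apply: le_trans (ler_normB _ _) _; rewrite [e]splitr lerD.
Qed.

(** On a ball, take u nearly optimal for the capacity of A and g positive exactly on the part of the
    open set {u = 1} inside the ball. The functions min(m g, 1) cover A there and are dominated
    almost everywhere by |u| times a cutoff, on which [ell] is small by [ell_small]. *)
Lemma mstar_cap0 A : cap A = 0%E -> mstar A = 0%E.
Proof.
move=> A0; apply/eqP; rewrite eq_le mstar_ge0 andbT.
suff H K : mstar (A `&` [set x | `|x| < K%:R]) = 0%E.
  apply: le_trans (_ : mstar (\bigcup_K (A `&` [set x | (`|x| < K%:R)%R])) <= 0)%E.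
    apply: mstar_mono => x Ax; exists (Num.truncn `|x|).+1 => //; split=> //; exact: truncnS_gt.
  by apply: le_trans (mstar_sub _) _; rewrite eseries0.
apply/eqP; rewrite eq_le mstar_ge0 andbT; apply/lee_addgt0Pr => e e0; rewrite add0e.
apply: mstar_le; have lt : K%:R < K%:R + 1 :> R by rewrite ltrDl.
have [cc kc] := @ramp_norm_cutoff R n _ _ lt; set chi := (fun x : E => _) in cc kc; set L := (_)^-1 in cc.
have schi : H1 chi by apply: (H1_lip_supp cc) => x; exact: ramp_out.
have [d d0 hd] := ell_small e0; have i0 := psd_ge0 BL (H1_sqi schi).
pose M := Num.sqrt (ip leb chi chi) + 1; have M0 : 0 < M by rewrite ltr_wpDl ?sqrtr_ge0.
pose N := 2 + 4 * n%:R * L ^+ 2; have N0 : 0 < N by rewrite ltr_wpDr// mulr_ge0 ?sqr_ge0// mulr_ge0.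
pose r := Num.min (d / N) ((d / M) ^+ 2); have r0 : 0 < r by rewrite lt_min !(divr_gt0, exprn_gt0).
have : (cap A < r%:E)%E by rewrite A0 lte_fin.
move=> /cap_lt[u [U [hu oU AU u1 ur]]].
have [ha hda] := H1_abs hu; set au := (fun x => `|u x|) in ha hda *.
have [hz hdz] := H1_cut cc ha; set z := chi * au in hz hdz *.
have iz : integ leb z by apply: sqiM; exact: H1_sqi.
have Dz : D z by [].
have ipu : ip leb au au <= r.
  by rewrite /au ip_abs; apply: le_trans (ip_le_h1 hu) (ltW ur).
have ez : `|ell z| <= e.
  apply: hd => //.
    apply: (le_trans (psd_CS_sqrt BL (H1_sqi schi) (H1_sqi ha))).
    apply: (@le_trans _ _ (M * (d / M))); last by rewrite mulrC divfK// gt_eqF.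
    apply: ler_pM; rewrite ?sqrtr_ge0//; first by rewrite lerDl.
    apply: (@le_trans _ _ (Num.sqrt ((d / M) ^+ 2))); last first.
      by rewrite sqrtr_sqr ger0_norm// divr_ge0// ltW.
    by rewrite ler_sqrt ?sqr_ge0// (le_trans ipu)// ge_min lexx orbT.
  apply: le_trans hdz _; apply: (@le_trans _ _ (N * r)); last first.
    by rewrite mulrC -ler_pdivlMr// ge_min lexx.
  have -> : N * r = 2 * r + 4 * n%:R * L ^+ 2 * r by rewrite /N mulrDl.
  apply: lerD; last by rewrite ler_wpM2l// mulr_ge0 ?sqr_ge0// mulr_ge0.
  by rewrite ler_wpM2l//; apply: le_trans hda _; apply: le_trans (Dr_le_h1 hu) (ltW ur).
have oV : open (U `&` [set x : E | `|x| < K%:R]) by apply: openI => //; exact: normlt_open.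
have [g [lg g01 gU]] := bounded_open_Lc oV (fun x => @proj2 _ _).
have g0 x : 0 <= g x by case/andP: (g01 x).
have lm (m : nat) : Lc (fun x => Num.min ((m%:R *: g) x) 1) by apply: Lc_minc => //; exact: LcZ.
exists (fun m x => Num.min ((m%:R *: g) x) 1); split.
- split=> // [m x|m p x mp]; first by rewrite le_min ler01 andbT fctE mulr_ge0.
  by rewrite le_min !ge_min lexx orbT andbT fctE ler_wpM2r// ler_nat.
- move=> m; apply: le_trans (le_trans (ler_norm _) ez).
  apply: ell_le_ae => //; first exact: LD.
  apply: filterS u1 => x ux; have [gx|gx] := ltP 0 (g x).
    have [/ux ux1 xK] := (gU x).1 gx; rewrite /z /au mulrfctE ux1 normr1 mulr1 /chi ramp_in ?ge_min ?lexx ?orbT//.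
    exact: ltW.
  rewrite fctE (_ : g x = 0); last by apply/eqP; rewrite eq_le gx g0.
  by rewrite scaler0 min_l// /z mulrfctE mulr_ge0 /au// /chi; case/andP: (ramp01 (K%:R : R) (K%:R + 1) `|x|).
- move=> x [Ax xK]; have gx : 0 < g x by apply/gU; split=> //; exact: AU.
  exists (Num.truncn (g x)^-1).+1; rewrite le_min lexx andbT fctE /GRing.scale/= -ler_pdivrMr// div1r.
  exact/ltW/truncnS_gt.
Qed.

Lemma rmeas_capacitary : capacitary rmeas.
Proof.
move=> A /cap0_borel[N [mN AN N0]]; exists N; split=> //; exact: mstar_cap0.
Qed.

Lemma integ_rind (A : set E) : measurable A -> (mstar A < +oo)%E ->
  integ rmeas (\1_A : E -> R) /\ It rmeas (\1_A : E -> R) = fine (mstar A).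
Proof.
move=> mA Af; have e : (\int[rmeas]_x (\1_A x : R)%:E = mstar A)%E.
  by rewrite integral_indic// setIT.
have i : integ rmeas (\1_A : E -> R).
  by apply/integ_ge0P; [exact: mf_indic|move=> x; rewrite indicE|rewrite e].
by split=> //; apply: EFin_inj; rewrite ItE// e fineK// ge0_fin_numE// mstar_ge0.
Qed.

Lemma ball_fin (K : R) A : A `<=` [set x : E | `|x| < K] -> (mstar A < +oo)%E.
Proof.
move=> AK; have [c hc] := ball_cover K; apply: le_lt_trans (mstar_mono AK) _.
by apply: le_lt_trans (mstar_le hc) _; rewrite ltry.
Qed.

Lemma Lc_bounded u : Lc u -> exists2 M, 0 <= M & forall x, `|u x| <= M.
Proof.
move=> /Lc_abs lu; have [_ cu _] := lu; have := Lc_closed_ball lu ltr01.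
move=> /(@continuous_compact _ _ (fun x => `|u x|)) => /(_ (continuous_subspaceT cu)).
move=> /compact_bounded[M [_ hM]]; exists (`|M| + 2) => [|x]; first by rewrite addr_ge0.
have [h|h] := leP 1 `|u x|; last by apply: le_trans (ltW h) _; rewrite ler_wpDl// ler1n.
have : M < `|M| + 2 by apply: le_lt_trans (ler_norm M) _; rewrite ltrDl.
by move=> /hM /(_ `|u x| (ex_intro2 _ _ x h erefl)) /=; rewrite normr_id.
Qed.

Lemma integ_rbounded u (K M : R) : mf u -> (forall x, 0 <= u x <= M) -> (forall x, K <= `|x| -> u x = 0) ->
  integ rmeas u.
Proof.
move=> mu_ uM uK; set B := [set x : E | `|x| < K].
have [i1 _] := integ_rind (@measurable_normlt R n K) (@ball_fin K B (fun x h => h)).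
apply: (integ_le (v := M *: (\1_B : E -> R))) => //; last exact: integZ.
move=> x; have /andP[h1 h2] := uM x; rewrite ger0_norm// fctE /GRing.scale/= indicE.
have [xB|xB] := boolP (x \in B); first by rewrite mulr1.
by rewrite mulr0 uK// leNgt; apply/negP => h; move/negP: xB; apply; exact/mem_set.
Qed.

(** The slice of [phi] between the levels t and t + h equals h on {phi > t + h} and lives in {phi >
    t}. Its value under [ell] and its integral are therefore squeezed between the same two
    numbers. *)
Lemma layer_bounds phi (K t h : R) : Lc phi -> (forall x, 0 <= phi x) -> (forall x, K <= `|x| -> phi x = 0) ->
  0 <= t -> 0 < h ->
  let G s := fine (mstar [set x | s < phi x]) in
  let f x := Num.min (phi x) (t + h) - Num.min (phi x) t in
  [/\ Lc f, h * G (t + h) <= ell f <= h * G t, integ rmeas f & h * G (t + h) <= It rmeas f <= h * G t].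
Proof.
move=> lp p0 pK t0 h0 G f; have th0 : 0 <= t + h by rewrite addr_ge0// ltW.
have [_ cp _] := lp; have mp : mf phi by exact: continuous_measurable_rVR.
have lf : Lc f by apply: LcB; exact: Lc_minc.
have f0h x : 0 <= f x <= h.
  rewrite /f; move: (phi x) => y; have [h1|h1] := leP y (t + h); have [h2|h2] := leP y t; apply/andP; split; lra.
have ft x : f x != 0 -> t < phi x.
  rewrite /f ltNge; apply: contra => h1; rewrite !min_l ?subrr//; apply: le_trans h1 _.
  by rewrite lerDl ltW.
have fth x : t + h < phi x -> f x = h.
  move=> h1; have h2 : t < phi x by apply: le_lt_trans h1; rewrite lerDl ltW.
  by rewrite /f !min_r ?ltW// addrAC subrr add0r.
have fin s : 0 <= s -> (mstar [set x : E | (s < phi x)%R] < +oo)%E.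
  move=> s0; apply: (@ball_fin K) => x /=; apply: contraTT; rewrite -!leNgt => /pK ->//.
have GE s : 0 <= s -> mstar [set x | s < phi x] = (G s)%:E.
  by move=> s0; rewrite /G fineK// ge0_fin_numE ?mstar_ge0//; exact: fin.
have mG s : measurable [set x | s < phi x].
  by apply: (@mset_lt _ _ _ (cst s) phi) => //; exact: mf_cst.
have mff : mf f by have [_ c _] := lf; exact: continuous_measurable_rVR.
have intf : integ rmeas f.
  apply: (@integ_rbounded f K h) => // x /pK fx; rewrite /f fx !min_l ?subrr//.
have ih s : 0 <= s -> integ rmeas (h *: (\1_[set x | s < phi x] : E -> R)) /\
    It rmeas (h *: (\1_[set x | s < phi x] : E -> R)) = h * G s.
  by move=> s0; have [i1 i2] := integ_rind (mG s) (fin s s0); rewrite ItZ// i2; split=> //; exact: integZ.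
split=> //.
- apply/andP; split.
    rewrite -ler_pdivlMl// -lee_fin -GE//; apply: mstar_le; apply: (@cover_one _ (h^-1 *: f)).
    + exact: LcZ.
    + by move=> x; rewrite fctE /GRing.scale/= mulr_ge0 ?invr_ge0 ?(ltW h0)//; case/andP: (f0h x).
    + by rewrite ellZ//; exact: LD.
    + by move=> x /= /fth fx; rewrite fctE /GRing.scale/= fx mulVf ?gt_eqF.
  apply/ler_addgt0Pr => e e0; have eh : 0 < e / h by rewrite divr_gt0.
  have -> : h * G t + e = h * (G t + e / h) by rewrite mulrDr mulrCA divff ?mulr1// gt_eqF.
  apply: (daniell (A := [set x | t < phi x])) => //.
  by apply: mstar_lt; rewrite GE// lte_fin ltrDl.
- have [i1 <-] := ih _ th0; have [i2 <-] := ih _ t0; apply/andP; split; apply: It_le => // x.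
    rewrite fctE /GRing.scale/= indicE; have [/set_mem/fth->|_] := boolP (_ \in _); first by rewrite mulr1.
    by rewrite mulr0; case/andP: (f0h x).
  rewrite fctE /GRing.scale/= indicE; have [_|] := boolP (_ \in _); first by rewrite mulr1; case/andP: (f0h x).
  move=> /negP H; rewrite mulr0 (_ : f x = 0)//; apply/eqP/negPn/negP => /ft hx; apply: H.
  exact/mem_set.
Qed.

(** Summing the slices of height h, the two values differ by at most h times the measure of {phi >
    0}, because the bounds telescope; then h tends to 0. *)
Lemma riesz_Lc_ge0 phi : Lc phi -> (forall x, 0 <= phi x) -> integ rmeas phi /\ It rmeas phi = ell phi.
Proof.
move=> lp p0; have [M M0 hM] := Lc_bounded lp; have [_ cp [K pK]] := lp.
have mp : mf phi by exact: continuous_measurable_rVR.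
have iphi : integ rmeas phi.
  by apply: (@integ_rbounded phi K M) => // x; rewrite p0/= (le_trans (ler_norm _) (hM x)).
split=> //; pose G s := fine (mstar [set x | s < phi x]).
suff H h : 0 < h -> `|It rmeas phi - ell phi| <= h * G 0.
  apply/eqP; rewrite -subr_eq0 -normr_le0; apply/ler_addgt0Pr => e e0; rewrite add0r.
  have G0 : 0 <= G 0 by rewrite fine_ge0// mstar_ge0.
  have g1 : 0 < G 0 + 1 by rewrite ltr_wpDl.
  apply: le_trans (H (e / (G 0 + 1)) _) _; first by rewrite divr_gt0.
  by rewrite mulrAC ler_pdivrMr// ler_wpM2l ?(ltW e0)// lerDl.
move=> h0; have hn (j : nat) : 0 <= h * j%:R by rewrite mulr_ge0// ltW.
have mc (k : R) : 0 <= k -> Lc (fun x => Num.min (phi x) k) by move=> k0; exact: Lc_minc.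
have I0 j : integ rmeas (fun x => Num.min (phi x) (h * j%:R)).
  apply: (integ_le (v := phi)) => //; first by have [_ c _] := mc _ (hn j); exact: continuous_measurable_rVR.
  by move=> x; rewrite ger0_norm ?le_min ?p0//= ge_min lexx.
have key (N : nat) : `|It rmeas (fun x => Num.min (phi x) (h * N%:R)) - ell (fun x => Num.min (phi x) (h * N%:R))| <=
    h * (G 0 - G (h * N%:R)).
  elim: N => [|N ih].
    have e : (fun x => Num.min (phi x) (h * 0%:R)) = 0 by apply/funext => x; rewrite mulr0 min_r.
    by rewrite e It0 ell0 subrr normr0 mulr0 subrr mulr0.
  have [lf L1 intf L2] := layer_bounds lp p0 pK (hn N) h0.
  have e : (fun x => Num.min (phi x) (h * N.+1%:R)) = (fun x => Num.min (phi x) (h * N%:R)) +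
      (fun x => Num.min (phi x) (h * N%:R + h) - Num.min (phi x) (h * N%:R)).
    by apply/funext => x; rewrite fctE addrC subrK mulrSr mulrDr mulr1.
  rewrite e ItD// ellD; [|exact: LD (mc _ (hn N))|exact: LD].
  have -> : h * N.+1%:R = h * N%:R + h by rewrite mulrSr mulrDr mulr1.
  move: L1 L2 ih; rewrite -!/(G _); move: (It _ _) (ell _) (It _ _) (ell _) => a b a' b'.
  move=> /andP[l1 l2] /andP[l3 l4]; rewrite !ler_norml => /andP[l5 l6]; apply/andP; split; lra.
pose N := (Num.truncn (M / h)).+1; have := key N.
have -> : (fun x => Num.min (phi x) (h * N%:R)) = phi.
  apply/funext => x; rewrite min_l//; apply: le_trans (le_trans (ler_norm _) (hM x)) _.
  by rewrite mulrC -ler_pdivrMr//; exact/ltW/truncnS_gt.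
move=> H; apply: le_trans H _; rewrite ler_wpM2l ?(ltW h0)// gerBl fine_ge0// mstar_ge0//.
Qed.

Lemma riesz_Lc phi : Lc phi -> integ rmeas phi /\ It rmeas phi = ell phi.
Proof.
move=> lp; have la := Lc_abs lp; have [i1 e1] := riesz_Lc_ge0 la (fun x => normr_ge0 _).
have lb : Lc ((fun x => `|phi x|) - phi) by exact: LcB.
have [|i2 e2] := riesz_Lc_ge0 lb; first by move=> x; rewrite fctE subr_ge0 ler_norm.
have e : phi = (fun x => `|phi x|) - ((fun x => `|phi x|) - phi) by rewrite subKr.
split; first by rewrite e; exact: integB.
by rewrite {1}e ItB// e1 e2 ellB ?subKr//; exact: LD.
Qed.

(** [ell_small] applied to |F k - F l| makes approximants from [Lc] Cauchy in L^1 of [rmeas]. They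
    converge quasi-everywhere along a subsequence, hence almost everywhere for [rmeas], which fixes
    the limit as the given quasi-continuous v. *)
Lemma riesz_H1q v : H1q v -> integ leb v -> integ rmeas v /\ It rmeas v = ell v.
Proof.
move=> hv iv; have hvH := hv.1.
have /choice[F hF] k := Lc_dense hvH iv (hk_gt0 R k).
have lF k : Lc (F k) by case: (hF k).
have hF1 k : h1f (F k - v) (F k - v) <= hk R k by case: (hF k).
have hF2 k : It leb (fun x => `|(F k - v) x|) <= hk R k by case: (hF k).
have HF k : H1 (F k) := (Lc_H1q (lF k)).1.
have IF k : integ leb (F k) := Lc_integ (lF k).
have tri k l : h1f (F k - F l) (F k - F l) <= 2 * hk R k + 2 * hk R l.
  by apply: le_trans (psd_tri BH (HF k) (HF l) hvH) _; rewrite lerD// ler_wpM2l.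
have hs e : 0 < e -> exists N, forall m, (N <= m)%N -> hk R m <= e by exact: half_pow_small.
have [|u [s [Z [hu hos Z0 cu cF]]]] := H1q_complete (fun k => Lc_H1q (lF k)).
  move=> e e0; have [|N hN] := hs (e / 4); first by rewrite divr_gt0.
  exists N => m l /hN h1 /hN h2; apply: le_trans (tri m l) _.
  by move: (hk R m) (hk R l) h1 h2 => a b; lra.
have c0 : hk R k @[k --> \oo] --> 0 by have := hk_cvg (1 : R); under eq_fun do rewrite mul1r.
have uv : {ae leb, forall x, u x = v x}.
  have hd := H1B hu.1 hvH.
  have : {ae leb, forall x, (u - v) x = 0}.
    apply: ip_eq0_ae; first exact: H1_sqi hd.
    apply/eqP; rewrite eq_le (psd_ge0 BL (H1_sqi hd)) andbT.
    apply: (lim_ge (cvg_2D cF c0)) => k; apply: le_trans (ip_le_h1 hd) _.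
    apply: le_trans (psd_tri' BH hu.1 hvH (HF k)) _.
    by rewrite lerD2l ler_wpM2l.
  by apply: filterS => x /eqP; rewrite fctE subr_eq0 => /eqP.
have Z1 := cap0U Z0 (qc_ae_eq hu.2 hv.2 uv).
have mv := H1_mf hvH.
have cae : {ae rmeas, forall x, F (s k) x @[k --> \oo] --> v x}.
  apply: filterS (cap0_ae rmeas_capacitary Z1) => x /not_orP[h1 h2].
  by have -> : v x = u x; [apply/esym/eqP/negPn/negP|exact: cu].
have mF k : mf (F k) by exact: H1_mf.
have small e : 0 < e -> exists N, forall k l, (N <= k)%N -> (N <= l)%N ->
    It rmeas (fun x => `|(F k - F l) x|) <= e /\ `|ell (F k - v)| <= e.
  move=> e0; have [d d0 hd] := ell_small e0.
  have [|N hN] := hs (d / 4); first by rewrite divr_gt0.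
  exists N => k l /hN h1 /hN h2; have lkl := LcB (lF k) (lF l); have lak := Lc_abs lkl.
  have a0 x : 0 <= `|(F k - F l) x| by [].
  split.
    rewrite (riesz_Lc_ge0 lak a0).2; apply: le_trans (ler_norm _) _; apply: hd; first exact: LD.
      rewrite ger0_norm ?It_ge0//.
      have i1 := integ_abs (integB (IF k) iv); have i2 := integ_abs (integB (IF l) iv).
      apply: (@le_trans _ _ (It leb ((fun x => `|(F k - v) x|) + (fun x => `|(F l - v) x|)))).
        apply: It_le; [exact: Lc_integ|exact: integD|move=> x; rewrite !fctE].
        have -> : F k x + (- F l) x = (F k x + (- v) x) - (F l x + (- v) x).
          by rewrite -[(- F l) x]/(- F l x) -[(- v) x]/(- v x); ring.
        exact: ler_normB.
      rewrite ItD//; have := hF2 k; have := hF2 l; move: (It _ _) (It _ _) h1 h2 => a b.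
      by move: (hk R k) (hk R l) => c c'; lra.
    apply: le_trans (H1_abs (Lc_H1q lkl).1).2 _; apply: le_trans (Dr_le_h1 (Lc_H1q lkl).1) _.
    by apply: le_trans (tri k l) _; move: (hk R k) (hk R l) h1 h2 => c c'; lra.
  have hkv := H1B (HF k) hvH; have dd : d / 4 <= d by lra.
  apply: hd; first by split=> //; exact: integB.
    apply: le_trans (It_abs (integB (IF k) iv)) _; exact: le_trans (hF2 k) (le_trans h1 dd).
  exact: le_trans (Dr_le_h1 hkv) (le_trans (hF1 k) (le_trans h1 dd)).
have lim e : 0 < e -> exists k, [/\ integ rmeas (F k - v), `|It rmeas (F k - v)| <= e & `|ell (F k - v)| <= e].
  move=> e0; have [N hN] := small e e0; pose k := N; exists k.
  have mkv : mf (F k - v) by exact: mfB.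
  have [] := @It_fatou _ _ _ rmeas (fun l x => `|(F k - F (s (l + N)%N)) x|) (fun x => `|(F k - v) x|) e.
  - by move=> l; exact: (riesz_Lc_ge0 (Lc_abs (LcB (lF k) (lF _))) (fun x => normr_ge0 _)).1.
  - by [].
  - exact: mf_norm.
  - move=> l; apply: (hN _ _ (leqnn N) _).1.
    by apply: leq_trans (leq_addl _ _) (homo_ltn_ge hos _).
  - apply: filterS cae => x hx; apply: cvg_norm; rewrite !fctE; apply: cvgB; first exact: cvg_cst.
    apply: (@cvg_subseq _ (fun l => F (s l) x) _ (fun l => l + N)%N) hx => a b ab.
    by rewrite ltn_add2r.
  move=> i1 i2; have i3 : integ rmeas (F k - v).
    by apply: (integ_le (v := fun x => `| `|(F k - v) x| |)) => // x; rewrite normr_id.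
  split=> //; last by have [] := hN k k (leqnn _) (leqnn _).
  apply: le_trans (It_abs i3) _; apply: le_trans i2; rewrite le_eqVlt; apply/orP; left; apply/eqP.
  by apply: It_ext => x; rewrite normr_id.
have vE k : v = F k - (F k - v) by rewrite subKr.
have iv' : integ rmeas v.
  by have [k [h1 _ _]] := lim 1 ltr01; rewrite (vE k); apply: integB => //; exact: (riesz_Lc (lF k)).1.
split=> //; apply/eqP; rewrite -subr_eq0 -normr_le0; apply/ler_addgt0Pr => e e0; rewrite add0r.
have [|k [h1 h2 h3]] := lim (e / 2); first by rewrite divr_gt0.
have [i4 i5] := riesz_Lc (lF k); have Dv : D v by [].
have -> : It rmeas v - ell v = ell (F k - v) - It rmeas (F k - v).
  by rewrite ItB// i5 ellB//; ring.
by apply: le_trans (ler_normB _ _) _; rewrite [e]splitr lerD.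
Qed.

End riesz.

(** * Realising a function as a torsion function *)

Section realization.
Variables (R : realType) (n : nat).
Local Notation E := 'rV[R]_n.
Local Notation leb := (lebesgue_rV R n).
Implicit Types (u v w f g phi : E -> R).

Lemma mf_inv d (T : measurableType d) (u : T -> R) : mf u -> (forall x, 0 <= u x) -> mf (fun x => (u x)^-1).
Proof.
move=> mu u0; rewrite (_ : (fun x => _) = (fun x => u x `^ (-1))).
  exact: (measurableT_comp (measurable_powR (-1)) mu).
by apply/funext => x; rewrite powR_inv1.
Qed.

Lemma It_dens (mu : {measure set E -> \bar R}) f (f0 : forall x, 0 <= f x) (mf_ : mf f) g : mf g ->
  integ (dens_measure mu f0 mf_) g <-> integ mu (g * f).
Proof.
move=> mg; have mgf : mf (g * f) by exact: mfM.
have e : (\int[dens_measure mu f0 mf_]_x `|(EFin \o g) x| = \int[mu]_x `|(EFin \o (g * f)%R) x|)%E.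
  rewrite integral_dens//; last by apply: measurableT_comp => //; exact/measurable_EFinP.
  by apply: eq_integral => x _ /=; rewrite mulrfctE normrM [`|f x|]ger0_norm.
split=> /integrableP[_ h]; apply/integrableP; split; try exact/measurable_EFinP.
  by rewrite -e.
by rewrite e.
Qed.

Lemma It_densE (mu : {measure set E -> \bar R}) f (f0 : forall x, 0 <= f x) (mf_ : mf f) g :
  integ (dens_measure mu f0 mf_) g -> It (dens_measure mu f0 mf_) g = It mu (g * f).
Proof.
move=> ig; have mg := integ_mf ig; have igf := (It_dens mu f0 mf_ mg).1 ig.
have pos u : mf u -> (forall x, 0 <= u x) -> integ (dens_measure mu f0 mf_) u ->
    It (dens_measure mu f0 mf_) u = It mu (u * f).
  move=> m0 u0 iu; apply: EFin_inj; rewrite !ItE//; last exact/(It_dens mu f0 mf_ m0).1.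
  by rewrite integral_dens//; exact/measurable_EFinP.
have ia := integ_abs ig; have ib := integB ia ig.
have e : g = (fun x => `|g x|) - ((fun x => `|g x|) - g) by rewrite subKr.
have p1 := pos _ (integ_mf ia) (fun x => normr_ge0 _) ia.
have p2 := pos _ (integ_mf ib) _ ib; rewrite {1}e ItB// p1 p2; last first.
  by move=> x; rewrite fctE subr_ge0 ler_norm.
rewrite -ItB; [congr (It mu _)| |]; last 2 first.
- exact/(It_dens mu f0 mf_ (integ_mf ia)).1.
- exact/(It_dens mu f0 mf_ (integ_mf ib)).1.
by rewrite mulrBl subKr.
Qed.

Lemma tors_poinc (mu : {measure set E -> \bar R}) w : tors mu w -> poinc mu (It leb w).
Proof.
move=> [[h1 h2] h3]; have B1 := psd_V1 mu; split.
  by rewrite -(tors_E (conj (conj h1 h2) h3)); exact: (psd_ge0 B1).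
move=> v hv; rewrite -h3//; apply: le_trans (psd_CS B1 _ hv) _ => //.
by rewrite (tors_E (conj (conj h1 h2) h3)).
Qed.

(** With m the measure 1 + Delta w and density 1 / w, the measure term of the form is the integral
    of w v / w = v against m, that is the integral of v minus D(w, v). Adding D(w, v) gives the weak
    equation. *)
Lemma tors_realize w : H1q w -> integ leb w -> (forall x, 0 <= w x) ->
  (forall phi, H1 phi -> integ leb phi -> (forall x, 0 <= phi x) -> Da w phi <= It leb phi) ->
  exists nu : {measure set E -> \bar R}, finite_torsion nu /\ tors nu w.
Proof.
move=> hq iw w0 sub; have hw := hq.1; have mw := H1_mf hw.
pose m := rmeas hw sub; have mi := mf_inv mw w0.
have i0 x : 0 <= (w x)^-1 by rewrite invr_ge0.
pose mu0 := dens_measure m i0 mi; pose S := [set x | 0 < w x].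
have mS : measurable S by apply: (@mset_lt _ _ _ (cst 0) w) => //; exact: mf_cst.
have c0 : capacitary mu0.
  move=> A /(rmeas_capacitary hw sub)[N [mN N0 AN]]; exists N; split=> //.
  apply: (null_set_integral mN _ N0).
  by apply: (measurable_funS measurableT) => //; exact/measurable_EFinP.
pose nu := sat mu0 S; have cnu : capacitary nu by exact: capacitary_sat.
have [iwm ewm] := riesz_H1q hw sub hq iw.
have ww : (w * w * (fun x => (w x)^-1)) = w.
  apply/funext => x; rewrite !mulrfctE; have [->|h] := eqVneq (w x) 0; first by rewrite !mul0r.
  by rewrite mulfK.
have hwn : H1mu nu w.
  apply/H1mu_satP => //; split.
    apply/H1muP; split=> //; split=> //; apply/(It_dens m i0 mi); first exact: mfM.
    by rewrite ww.
  rewrite (_ : _ `\` _ = set0); first exact: cap_set0.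
  by apply/seteqP; split=> // x [/= h []]; rewrite /S /= lt_neqAle eq_sym h w0.
have tw : tors nu w.
  split=> [|v [hv iv]]; first by split.
  rewrite (Ef_sat mS hwn hv) /Ef; have [hv0 vS] := (H1mu_satP _ _ mS).1 hv.
  have [hw0 _] := (H1mu_satP _ _ mS).1 hwn.
  have iwv : integ mu0 (w * v) by apply: sqiM; [exact: H1mu_smu hw0|exact: H1mu_smu hv0].
  have hvq : H1q v by case: hv0.
  have [ivm evm] := riesz_H1q hw sub hvq iv.
  have iwvf := (It_dens m i0 mi (integ_mf iwv)).1 iwv.
  rewrite /ip It_densE// (_ : It m _ = It m v).
    by rewrite evm /ell addrC subrK.
  apply: It_ae; [exact: integ_mf iwvf|exact: H1_mf hvq.1|].
  (* Where w = 0 the product w v / w takes the default value 0, and v itself vanishes there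
     quasi-everywhere by saturation, hence almost everywhere for m. *)
  apply: filterS (cap0_ae (rmeas_capacitary hw sub) vS) => x vx; rewrite !mulrfctE.
  have [wx|wx] := eqVneq (w x) 0; last by rewrite mulrAC divff// mul1r.
  rewrite wx mul0r mul0r; apply/esym/eqP/negPn/negP => h; apply: vx; split=> //.
  by rewrite /S /= wx ltxx.
exists nu; split=> //; exact: poinc_finite cnu (tors_poinc tw).
Qed.

End realization.

(** * Small norm implies small sup *)

Section smallness.
Variables (R : realType) (n : nat).
Local Notation E := 'rV[R]_n.
Local Notation leb := (lebesgue_rV R n).
Hypothesis n0 : (0 < n)%N.

(** Take k0 = delta / 2 in [tors_bound] and r0 so small that the added term is at most delta / 2;
    Chebyshev turns a small L^2 norm into the required smallness of {w > k0}. *)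
Lemma tors_small_L2 (delta : R) : 0 < delta -> exists2 theta : R, 0 < theta &
  forall (mu : {measure set E -> \bar R}) w, tors mu w -> (forall x, 0 <= w x) ->
    ip leb w w <= theta -> {ae leb, forall x, w x <= delta}.
Proof.
move=> d0; pose K : R := 2 ^+ n * degK R n * 2 + 1.
have K0 : 0 < K by rewrite ltr_wpDl// !mulr_ge0 ?exprn_ge0.
pose k0 := delta / 2; have k00 : 0 < k0 by rewrite divr_gt0.
pose r0 := Num.min 1 (delta / (2 * K)).
have r00 : 0 < r0 by rewrite lt_min ltr01/= divr_gt0// mulr_gt0.
have r01 : r0 <= 1 by rewrite ge_min lexx.
exists (k0 ^+ 2 * r0 ^+ n / 2) => [|mu w tw w0 wth]; first by rewrite divr_gt0// mulr_gt0// exprn_gt0.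
have sw : sqi leb w by apply: H1_sqi; case: tw => -[[[]]].
have ch := chebyshev_leb k00 sw.
have : {ae leb, forall x, w x <= k0 + K * r0 ^+ 2}.
  apply: (tors_bound n0 tw w0 k00); first by rewrite r00.
  have : fine (leb [set x : E | k0 < w x]) <= k0 ^- 2 * ip leb w w.
    rewrite -lee_fin fineK// ge0_fin_numE//; exact: le_lt_trans ch (ltry _).
  move=> h; have h2 : k0 ^- 2 * ip leb w w <= r0 ^+ n / 2.
    by rewrite ler_pdivrMl ?exprn_gt0// mulrA.
  have := le_trans h h2; move: (fine _) (r0 ^+ n) => a b; lra.
apply: filterS => x h; apply: le_trans h _; rewrite [leRHS]splitr -/k0 lerD2l.
apply: (@le_trans _ _ (K * r0)); first by rewrite ler_wpM2l ?(ltW K0)// expr2 ler_piMl// ltW.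
have : r0 <= delta / (2 * K) by rewrite ge_min lexx orbT.
move=> /(ler_wpM2l (ltW K0)) h2; apply: le_trans h2 _; rewrite /k0 le_eqVlt; apply/orP; left.
by apply/eqP; field; rewrite gt_eqF.
Qed.

Lemma tors_small_L1 (delta : R) : 0 < delta -> exists2 theta : R, 0 < theta &
  forall (mu : {measure set E -> \bar R}) w, tors mu w -> (forall x, 0 <= w x) ->
    It leb w <= theta -> {ae leb, forall x, w x <= delta}.
Proof.
move=> /tors_small_L2[th th0 H]; have N0 := nashK_ge0 R n.
have N1 : 0 < 1 + nashK R n by rewrite ltr_wpDr.
exists (Num.min 1 (th / (1 + nashK R n))) => [|mu w tw w0]; first by rewrite lt_min ltr01 divr_gt0.
rewrite le_min => /andP[h1 h2]; apply: (H mu w) => //; have [V _] := tw.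
have I0 : 0 <= It leb w by exact: It_ge0.
have := nash1 (H1mu_H1 V.1) V.2; have := Dr_le_E V.1; rewrite (tors_E tw) => h3 h4.
have e : It leb (fun x => `|w x|) = It leb w by apply: It_ext => x; rewrite ger0_norm.
rewrite e in h4; apply: le_trans h4 _; apply: (@le_trans _ _ ((1 + nashK R n) * It leb w)).
  rewrite mulrDl mul1r lerD//; first by rewrite expr2 ler_piMl.
  by rewrite ler_wpM2l.
by rewrite mulrC -ler_pdivlMr.
Qed.

End smallness.

(** * Cutting a measure on an annulus *)

Section dichotomy.
Variables (R : realType) (n : nat).
Local Notation E := 'rV[R]_n.
Local Notation leb := (lebesgue_rV R n).
Let BL := psd_ip leb.

(** From S to {w > 0} the form is unchanged and its domain shrinks but keeps w, so the weak equation
    is inherited. *)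
Lemma tors_sat_pos (mu : {measure set E -> \bar R}) S w : measurable S -> tors (sat mu S) w ->
  (forall x, 0 <= w x) -> (forall x, ~ S x -> w x = 0) -> tors (sat mu [set x | 0 < w x]) w.
Proof.
move=> mS [Vw ew] w0 wS; set Om := [set x | _]; have hw := (proj1 Vw).
have mO : measurable Om by apply: (@mset_lt _ _ _ (cst 0) w); [exact: mf_cst|exact: H1_mf (H1mu_H1 hw)].
have OS : Om `<=` S.
  by move=> x; rewrite /Om /= => wx; apply: contrapT => /wS w00; rewrite w00 ltxx in wx.
have Vw' : V1 (sat mu Om) w.
  apply/(V1_sat _ _ mO); split; first by case: ((V1_sat _ _ mS).1 Vw).
  rewrite (_ : _ `\` _ = set0); first exact: cap_set0.
  by apply/seteqP; split=> // x [/= h []]; rewrite /Om /= lt_neqAle eq_sym h w0.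
split=> // v Vv; have [V0 c0] := (V1_sat _ _ mO).1 Vv.
have VS : V1 (sat mu S) v.
  by apply/(V1_sat _ _ mS); split=> //; apply: cap0_sub c0 => x [h1 h2]; split=> // /OS.
by rewrite (Ef_sat mO Vw'.1 Vv.1) -(Ef_sat mS Vw.1 VS.1) ew.
Qed.

Lemma saturated_sat (mu : {measure set E -> \bar R}) S w : measurable S -> tors (sat mu S) w ->
  (forall x, 0 <= w x) -> (forall x, ~ S x -> w x = 0) ->
  finiteness_set (sat mu [set x | 0 < w x]) [set x | 0 < w x] /\ saturated (sat mu [set x | 0 < w x]).
Proof.
move=> mS tw w0 wS; have t := tors_sat_pos mS tw w0 wS; set Om := [set x | _].
have fO : finiteness_set (sat mu Om) Om by exists w => //; exact/torsP.
split=> //; exists Om => // A mA AO cA; apply: satf_out => h.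
have : (A `\` Om) = A by apply/seteqP; split=> [x []//|x Ax]; split=> //; exact: AO.
by move=> e; move: cA; rewrite -e h ltxx.
Qed.

(** A splitting of finite cost forces A into the union of [O1] and [O2] up to zero capacity, and
    costs at least mu A. The splitting along [S1], which separates [O1] from [O2], attains it. *)
Lemma sat_wedge (mu : {measure set E -> \bar R}) S1 O1 O2 A : measurable S1 -> measurable A ->
  O1 `<=` S1 -> (forall x, S1 x -> ~ O2 x) ->
  sat mu (O1 `|` O2) A = ereal_inf [set (sat mu O1 B + sat mu O2 (A `\` B))%E | B in
    [set B | measurable B /\ B `<=` A]].
Proof.
move=> mS mA OS SO; apply/eqP; rewrite eq_le; apply/andP; split.
  apply: le_ereal_inf_tmp => _ [B [mB BA] <-].
  have [c|c] := pselect (cap (A `\` (O1 `|` O2)) = 0%E).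
    rewrite -[sat mu _ A]/(satf mu _ A) satf_in//.
    apply: (@le_trans _ _ (mu B + mu (A `\` B))%E); last by apply: leeD; exact: sat_ge.
    rewrite -measureU//; [|exact: measurableD|by apply/seteqP; split=> // x [h []]].
    by rewrite setDUK.
  have [c1|c1] := pselect (cap (B `\` O1) = 0%E); last first.
    rewrite -[sat mu O1 B]/(satf mu O1 B) (satf_out _ c1) addye ?leey//.
    by rewrite gt_eqF// (lt_le_trans _ (measure_ge0 _ _)).
  have [c2|c2] := pselect (cap ((A `\` B) `\` O2) = 0%E); last first.
    rewrite -[sat mu O2 _]/(satf mu O2 _) (satf_out _ c2) addey ?leey//.
    by rewrite gt_eqF// (lt_le_trans _ (measure_ge0 _ _)).
  exfalso; apply: c; apply: cap0_sub (cap0U c1 c2) => x [Ax /not_orP[h1 h2]].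
  by have [Bx|Bx] := pselect (B x); [left|right].
have [c|c] := pselect (cap (A `\` (O1 `|` O2)) = 0%E); last first.
  by rewrite -[sat mu _ A]/(satf mu _ A) (satf_out _ c) leey.
apply: ereal_inf_lbound; exists (A `&` S1); first by split; [exact: measurableI|move=> x []].
rewrite -[sat mu _ A]/(satf mu _ A) (satf_in _ c).
have c1 : cap ((A `&` S1) `\` O1) = 0%E.
  by apply: cap0_sub c => x [[h1 h2] h3]; split=> // -[//|]; exact: SO.
have c2 : cap ((A `\` (A `&` S1)) `\` O2) = 0%E.
  apply: cap0_sub c => x [[h1 h2] h3]; split=> // -[/OS h|//]; exact: h2.
rewrite -[sat mu O1 _]/(satf mu O1 _) (satf_in _ c1) -[sat mu O2 _]/(satf mu O2 _) (satf_in _ c2).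
rewrite -measureU//; [|exact: measurableI|by apply: measurableD => //; exact: measurableI|].
  by rewrite setDUK// => x [].
by apply/seteqP; split=> // x [h []].
Qed.

Lemma cap_le_sat (mu : {measure set E -> \bar R}) S : measurable S -> cap_le mu (sat mu S).
Proof.
move=> mS u hu; have m2 : mf (fun x => u x ^+ 2) by apply: measurable_funX; exact: H1_mf hu.1.
have [c|c] := pselect (cap ([set x | u x ^+ 2 != 0] `\` S) = 0%E).
  by rewrite /sqint (sat_int mu mS m2)// => x; exact: sqr_ge0.
by rewrite [leRHS](sat_int_infty mu m2) ?leey// => x; exact: sqr_ge0.
Qed.

Lemma cutoff_shift (L : R) (g : E -> R) (c : E) : cutoff L g -> continuous g ->
  cutoff L (fun x : E => g (x - c)) /\ continuous (fun x : E => g (x - c)).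
Proof.
move=> [mg g01 L0 gL] cg; have cc : continuous (fun x : E => x - c).
  by move=> x; apply: (@continuousB _ _ _ id (cst c)); [exact: cvg_id|exact: cst_continuous].
have cgc : continuous (fun x : E => g (x - c)).
  by move=> x; apply: (@continuous_comp _ _ _ (fun x : E => x - c) g); [exact: cc|exact: cg].
split=> //; split=> // [|i h x h0]; first exact: continuous_measurable_rVR.
by rewrite addrAC; exact: gL.
Qed.

Variables (mu : {measure set E -> \bar R}) (C M rho : R) (w : E -> R) (c : E).
Hypotheses (cmu : capacitary mu) (pmu : poinc mu C) (tw : tors mu w) (w0 : forall x, 0 <= w x).
Hypotheses (M0 : 0 <= M) (wM : {ae leb, forall x, w x <= M}) (rho0 : 0 < rho).
Let BE := psd_E mu.

Let r12 : rho < 2 * rho. Proof. by move: rho0; lra. Qed.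
Let r34 : 3 * rho < 4 * rho. Proof. by move: rho0; lra. Qed.
(** eta = e1 + e2 is 1 up to radius rho and beyond radius 4 rho, and 0 between 2 rho and 3 rho. The
    gap of width rho separates the two pieces, and A contains the points where 1 - eta is not 0. *)
Let e1 (x : E) : R := ramp rho (2 * rho) `|x - c|.
Let e2 (x : E) : R := 1 - ramp (3 * rho) (4 * rho) `|x - c|.
Let eta x := e1 x + e2 x.
Let zeta x := 1 - eta x.
Let L := 2 / rho.
Let S1 : set E := [set x | `|x - c| < 2 * rho].
Let S2 : set E := [set x | 3 * rho < `|x - c|].
Let A : set E := [set x | rho < `|x - c| < 4 * rho].

Let mnorm : mf (fun x : E => `|x - c|).
Proof.
apply: continuous_measurable_rVR => x.
apply: (@continuous_comp _ _ _ (fun x : E => x - c) (fun x => `|x|)); last exact: norm_continuous.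
by apply: (@continuousB _ _ _ id (cst c)); [exact: cvg_id|exact: cst_continuous].
Qed.
Let mlt (r : R) : measurable [set x : E | `|x - c| < r].
Proof. by apply: (@mset_lt _ _ _ (fun x : E => `|x - c|) (cst r)) => //; exact: mf_cst. Qed.
Let mgt (r : R) : measurable [set x : E | r < `|x - c|].
Proof. by apply: (@mset_lt _ _ _ (cst r) (fun x : E => `|x - c|)) => //; exact: mf_cst. Qed.
Let mS1 : measurable S1. Proof. exact: mlt. Qed.
Let mS2 : measurable S2. Proof. exact: mgt. Qed.
Let mA : measurable A.
Proof.
rewrite (_ : A = [set x : E | rho < `|x - c|] `&` [set x : E | `|x - c| < 4 * rho]).
  by apply: measurableI; [exact: mgt|exact: mlt].
by apply/seteqP; split=> x; rewrite /A /=; [move=> /andP[]|move=> [-> ->]].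
Qed.

Let z t := ramp rho (2 * rho) t + (1 - ramp (3 * rho) (4 * rho) t).
Let z01 t : 0 <= z t <= 1.
Proof.
rewrite /z; have /andP[a1 a2] := ramp01 rho (2 * rho) t; have /andP[b1 b2] := ramp01 (3 * rho) (4 * rho) t.
have [h|h] := leP t (3 * rho).
  by rewrite (ramp_in r34 h) subrr addr0 a1.
have h2 : 2 * rho <= t by have := rho0; have := ltW h; lra.
by rewrite (ramp_out r12 h2) add0r subr_ge0 b2/= gerBl.
Qed.
Let L0 : 0 <= L. Proof. by rewrite divr_ge0// ltW. Qed.
Let zlip s t : `|z s - z t| <= L * `|s - t|.
Proof.
have a := ramp_lip s t r12; have b := ramp_lip s t r34.
have d1 : 2 * rho - rho = rho by ring.
have d2 : 4 * rho - 3 * rho = rho by ring.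
rewrite d1 in a; rewrite d2 in b; rewrite /z /L.
have -> : ramp rho (2 * rho) s + (1 - ramp (3 * rho) (4 * rho) s) -
   (ramp rho (2 * rho) t + (1 - ramp (3 * rho) (4 * rho) t)) =
   (ramp rho (2 * rho) s - ramp rho (2 * rho) t) - (ramp (3 * rho) (4 * rho) s - ramp (3 * rho) (4 * rho) t) by ring.
apply: le_trans (ler_normB _ _) _; have -> : 2 / rho * `|s - t| = rho^-1 * `|s - t| + rho^-1 * `|s - t| by ring.
exact: lerD.
Qed.
Let ceta : cutoff L eta /\ continuous eta. Proof. have [a b] := @cutoff_norm R n z L L0 z01 zlip; exact: (cutoff_shift c a b). Qed.
Let czeta : cutoff L zeta /\ continuous zeta.
Proof.
suff [a b] : cutoff L (fun x : E => 1 - z `|x|) /\ continuous (fun x : E => 1 - z `|x|).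
  exact: (cutoff_shift c a b).
apply: (@cutoff_norm R n (fun t => 1 - z t) L L0) => [t|s t].
  by have := z01 t; move: (z t) => y /andP[h1 h2]; apply/andP; split; lra.
have -> : 1 - z s - (1 - z t) = - (z s - z t) by ring.
by rewrite normrN.
Qed.
Let c1 : cutoff (2 * rho - rho)^-1 e1 /\ continuous e1. Proof. have [a b] := @ramp_norm_cutoff R n _ _ r12; exact: (cutoff_shift c a b). Qed.
Let c2 : cutoff (4 * rho - 3 * rho)^-1 e2 /\ continuous e2.
Proof.
have r0 : 0 <= (4 * rho - 3 * rho)^-1 by rewrite invr_ge0 subr_ge0 ltW.
suff [a b] : cutoff (4 * rho - 3 * rho)^-1 (fun x : E => 1 - ramp (3 * rho) (4 * rho) `|x|) /\
  continuous (fun x : E => 1 - ramp (3 * rho) (4 * rho) `|x|).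
  exact: (cutoff_shift c a b).
apply: (@cutoff_norm R n (fun t => 1 - ramp (3 * rho) (4 * rho) t) _ r0) => [t|s t].
  by have := ramp01 (3 * rho) (4 * rho) t; move: (ramp _ _ _) => y /andP[h1 h2]; apply/andP; split; lra.
have -> : 1 - ramp (3 * rho) (4 * rho) s - (1 - ramp (3 * rho) (4 * rho) t) =
  - (ramp (3 * rho) (4 * rho) s - ramp (3 * rho) (4 * rho) t) by ring.
by rewrite normrN; exact: ramp_lip.
Qed.

Let zetaA x : zeta x != 0 -> A x.
Proof.
move=> h; apply: contrapT => /negP; rewrite negb_and -!leNgt => /orP[h1|h1]; move/eqP: h; apply.
  have h3 : `|x - c| <= 3 * rho by apply: le_trans h1 _; have := rho0; lra.
  by rewrite /zeta /eta /e1 /e2 (ramp_in r12 h1) (ramp_in r34 h3); ring.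
have h3 : 2 * rho <= `|x - c| by apply: le_trans h1; have := rho0; lra.
by rewrite /zeta /eta /e1 /e2 (ramp_out r12 h3) (ramp_out r34 h1); ring.
Qed.

Variables (w1 w2 : E -> R).
Hypotheses (t1 : tors (sat mu S1) w1) (w10 : forall x, 0 <= w1 x).
Hypotheses (t2 : tors (sat mu S2) w2) (w20 : forall x, 0 <= w2 x).
Let O := [set x | 0 < w1 x] `|` [set x | 0 < w2 x].

Let H1mu_off S e u : measurable S -> H1mu mu (e * u) -> (forall x, e x != 0 -> S x) -> H1mu (sat mu S) (e * u).
Proof.
move=> mS he eS; apply/H1mu_satP => //; split=> //; rewrite (_ : _ `\` _ = set0); first exact: cap_set0.
apply/seteqP; split=> // x [/= h []]; apply: eS; move: h; rewrite fctE mulf_eq0 negb_or.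
by case/andP.
Qed.

Let mO : measurable O.
Proof.
apply: measurableU; apply: (@mset_lt _ _ _ (cst 0)); try exact: mf_cst.
  by case: t1 => -[[[h _] _] _] _; exact: H1_mf h.
by case: t2 => -[[[h _] _] _] _; exact: H1_mf h.
Qed.

(** eta u is the sum of e1 u, carried by [S1], and e2 u, carried by [S2]. Each vanishes
    quasi-everywhere where the torsion function of its piece does ([tors_qe_zero]), so the sum
    vanishes quasi-everywhere off [O]. *)
Lemma H1mu_cut12 u : H1mu mu u -> H1mu (sat mu O) (eta * u).
Proof.
move=> hu; have h1 := H1mu_cut c1.1 c1.2 hu; have h2 := H1mu_cut c2.1 c2.2 hu.
have s1 : H1mu (sat mu S1) (e1 * u).
  by apply: H1mu_off => // x; apply: contraR; rewrite -leNgt => h; apply/eqP; exact: ramp_out.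
have s2 : H1mu (sat mu S2) (e2 * u).
  apply: H1mu_off => // x; apply: contraR; rewrite -leNgt => h; apply/eqP.
  by rewrite /e2 ramp_in// subrr.
have z1 := tors_qe_zero (capacitary_sat S1 cmu) (poinc_sat mS1 pmu) t1 w10 s1.
have z2 := tors_qe_zero (capacitary_sat S2 cmu) (poinc_sat mS2 pmu) t2 w20 s2.
apply/(H1mu_satP _ _ mO); split; first exact: H1mu_cut ceta.1 ceta.2 hu.
apply: cap0_sub (cap0U z1 z2) => x [/= h /not_orP[n1 n2]].
have q1 : w1 x = 0 by apply/eqP; rewrite eq_le w10 andbT leNgt; exact/negP.
have q2 : w2 x = 0 by apply/eqP; rewrite eq_le w20 andbT leNgt; exact/negP.
have [g|g] := eqVneq ((e1 * u) x) 0; [right; split=> //|by left].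
have e : (eta * u) x = (e1 * u) x + (e2 * u) x by rewrite !mulrfctE /eta mulrDl.
by rewrite -(_ : (eta * u) x = (e2 * u) x)// e g add0r.
Qed.

(** Testing the equation of w12 with eta w, AM-GM bounds 2 int eta w by int w12 + E(eta w), and
    [E_cut] bounds E(eta w) by int eta^2 w + n L^2 int w^2. Hence int w - int w12 is at most int (1
    - eta)^2 w + n L^2 int w^2. *)
Lemma dichotomy_torsion w12 : tors (sat mu O) w12 ->
  It leb (fun x => `|w x - w12 x|) <= It leb (w * \1_A) + n%:R * L ^+ 2 * ip leb w w.
Proof.
move=> t12; have [[hw iw] ew] := tw; have [V12 e12] := t12.
have [V12' _] := (V1_sat _ _ mO).1 V12.
have le := tors_compare mO pmu tw w0 t12.
have [k1 k01 _ _] := ceta.1.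
have h1 := H1mu_cut12 hw; have he := H1mu_cut ceta.1 ceta.2 hw.
have hee := H1mu_cut ceta.1 ceta.2 he.
have dom u : H1mu mu u -> (forall x, `|u x| <= w x) -> integ leb u.
  by move=> hu uw; apply: (integ_le (v := w)) => //; exact: H1_mf (H1mu_H1 hu).
have i1 : integ leb (eta * w).
  by apply: dom => // x; have /andP[a b] := k01 x; rewrite fctE ger0_norm ?mulr_ge0// ler_piMl.
have i2 : integ leb (eta * (eta * w)).
  apply: dom => // x; have /andP[a b] := k01 x; rewrite !fctE ger0_norm ?mulr_ge0//.
  by rewrite mulrA ler_piMl// mulr_ile1.
have cut := E_cut ceta.1 ceta.2 hw; rewrite (ew _ (conj hee i2)) in cut.
have V1e : V1 (sat mu O) (eta * w) by split.
have am := psd_AMGM (psd_V1 (sat mu O)) ltr01 V12 V1e.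
rewrite (e12 _ V1e) (tors_E t12) invr1 !mul1r (Ef_sat mO h1 h1) in am.
have -> : It leb (fun x => `|w x - w12 x|) = It leb w - It leb w12.
  rewrite -ItB//; last by case: V12'.
  apply: It_ae; [apply: mf_norm; apply: mfB|apply: mfB|]; try exact: integ_mf iw.
  - exact: H1_mf (H1mu_H1 V12'.1).
  - exact: H1_mf (H1mu_H1 V12'.1).
  by apply: filterS le => x h; rewrite ger0_norm// subr_ge0.
have zz : It leb w - 2 * It leb (eta * w) + It leb (eta * (eta * w)) <= It leb (w * \1_A).
  rewrite -ItZ// -ItB//; last exact: integZ.
  rewrite -ItD//; last by apply: integB => //; exact: integZ.
  apply: It_le.
  - by apply: integD => //; apply: integB => //; exact: integZ.
  - exact: integM_indic.
  move=> x; rewrite !fctE /GRing.scale/=.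
  have -> : w x + - (2 * (eta x * w x)) + eta x * (eta x * w x) = zeta x ^+ 2 * w x by rewrite /zeta; ring.
  rewrite indicE; have [_|xA] := boolP (x \in A).
    by have := k01 x; rewrite mulr1 => /andP[a b]; rewrite ler_piMl// expr_le1// /zeta; move: a b; move: (eta x) => y; lra.
  have -> : zeta x = 0 by apply/eqP/negPn/negP => /zetaA h; move/negP: xA; apply; exact/mem_set.
  by rewrite expr0n/= mul0r mulr0.
move: (It leb (w * _)) (It leb w) (It leb w12) (It leb (eta * w)) (It leb (eta * (eta * w))) am cut zz.
by move: (Ef _ _ _) (n%:R * L ^+ 2 * ip leb w w) => a b c1' c2' c3' c4' c5' h1' h2' h3'; lra.
Qed.

(** u - v is orthogonal to the domain of [sat mu O], so its energy is at most that of u - eta u =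
    zeta u. This function lives in the annulus, where Barta's inequality has constant delta; its
    energy is bounded by testing the equation of u with zeta^2 u and absorbing through AM-GM. *)
Lemma dichotomy_resolvent (delta : R) wA f u v : 0 < delta -> tors (sat mu A) wA -> (forall x, 0 <= wA x) ->
  {ae leb, forall x, wA x <= delta} -> sqi leb f -> res mu f u -> res (sat mu O) f v ->
  ip leb (u - v) (u - v) <= M * (delta + 2 * n%:R * L ^+ 2 * M ^+ 2) * ip leb f f.
Proof.
move=> d0 tA wA0 wAd sf [hu eu] [hv ev].
have co : coercive mu M by split=> // u' hu'; exact: barta tw w0 M0 wM hu'.
have [_ ub] := res_bound co sf (conj hu eu).
have [hv' _] := (H1mu_satP _ _ mO).1 hv.
have hz := H1mu_cut czeta.1 czeta.2 hu; have hzz := H1mu_cut czeta.1 czeta.2 hz.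
have hev := H1mu_cut12 hu; have [hev' _] := (H1mu_satP _ _ mO).1 hev.
have ue : u - eta * u = zeta * u.
  apply/funext => x; transitivity (u x - eta x * u x); first by [].
  by rewrite -[RHS]/(zeta x * u x) /zeta mulrBl mul1r.
have hd := psd_domB BE hu hv'.
have orth phi : H1mu (sat mu O) phi -> Ef mu (u - v) phi = 0.
  move=> hp; have [hp' _] := (H1mu_satP _ _ mO).1 hp.
  by rewrite (psdBl BE)// eu// -(Ef_sat mO hv hp) ev// subrr.
set X := Ef mu (zeta * u) (zeta * u).
have X1 : Ef mu (u - v) (u - v) <= X.
  have hq : H1mu (sat mu O) (eta * u - v) by exact: (psd_domB (psd_E _)).
  have hq' := psd_domB BE hev' hv'.
  have e : zeta * u = (u - v) - (eta * u - v) by rewrite -ue opprB addrA subrK.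
  rewrite /X e (psd_sqB BE hd hq') (orth _ hq) mulr0 subr0 lerDl.
  exact: (psd_ge0 BE).
have [mz z01' _ _] := czeta.1.
have sz := H1mu_sqi hz; have szz := H1mu_sqi hzz.
have X2 : ip leb (zeta * u) (zeta * u) <= delta * X.
  have hzA : H1mu (sat mu A) (zeta * u) by exact: H1mu_off.
  by have := barta tA wA0 (ltW d0) wAd hzA; rewrite (Ef_sat mA hzA hzA).
have X3 : ip leb (zeta * (zeta * u)) (zeta * (zeta * u)) <= ip leb (zeta * u) (zeta * u).
  apply: ip_le => // x; have /andP[a b] := z01' x.
  by rewrite [leLHS](_ : _ = `|zeta x| * `|(zeta * u) x|) ?normrM// ler_piMl// ger0_norm.
have cut := E_cut czeta.1 czeta.2 hu; rewrite (eu _ hzz) -/X in cut.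
have am := psd_AMGM BL d0 sf szz.
have X4 : delta^-1 * ip leb (zeta * (zeta * u)) (zeta * (zeta * u)) <= X.
  by rewrite ler_pdivrMl//; exact: le_trans X3 X2.
have fin : X <= (delta + 2 * n%:R * L ^+ 2 * M ^+ 2) * ip leb f f.
  have ub' : 2 * (n%:R * L ^+ 2 * ip leb u u) <= 2 * n%:R * L ^+ 2 * M ^+ 2 * ip leb f f.
    have -> : 2 * n%:R * L ^+ 2 * M ^+ 2 * ip leb f f = 2 * (n%:R * L ^+ 2 * (M ^+ 2 * ip leb f f)) by ring.
    by rewrite ler_wpM2l// ler_wpM2l// mulr_ge0// sqr_ge0.
  have -> : (delta + 2 * n%:R * L ^+ 2 * M ^+ 2) * ip leb f f =
    delta * ip leb f f + 2 * n%:R * L ^+ 2 * M ^+ 2 * ip leb f f by ring.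
  move: cut am X4 ub'; move: (n%:R * L ^+ 2 * _) (_ * M ^+ 2 * _) (delta * _) (delta^-1 * _) => a b c' d.
  by move: (ip leb f _) => y; lra.
apply: le_trans (co.2 _ hd) _; rewrite -mulrA ler_wpM2l//; exact: le_trans X1 fin.
Qed.

End dichotomy.

(** * Translated measures and their torsion functions *)

Section translation.
Variables (R : realType) (n : nat) (c : 'rV[R]_n).
Local Notation E := 'rV[R]_n.
Local Notation leb := (lebesgue_rV R n).
Implicit Types (mu : {measure set E -> \bar R}) (u v w g : E -> R).

Lemma shK d u : sh (- d) (sh d u) = u.
Proof. by rewrite shD addNr sh0. Qed.
Lemma shKN d u : sh d (sh (- d) u) = u.
Proof. by rewrite shD addrN sh0. Qed.

Lemma ge0_integral_translate mu g : mf g -> (forall x, 0 <= g x) ->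
  (\int[translate c mu]_x (g x)%:E = \int[mu]_x (sh (- c) g x)%:E)%E.
Proof.
move=> mg g0; have mphi : measurable_fun setT (sub_rV c : E -> E) by exact: measurable_funPT.
have := @ge0_integral_pushforward _ _ _ _ R (sub_rV c) mphi mu setT (EFin \o g) measurableT.
move=> /(_ ((measurable_EFinP _ _).2 mg)) /(_ (fun y _ => g0 y)).
by rewrite preimage_setT => <-; apply: eq_measure_integral.
Qed.

Lemma integ_translate mu g : mf g -> integ (translate c mu) g <-> integ mu (sh (- c) g).
Proof.
move=> mg; have mg' : mf (sh (- c) g) by exact: mf_sh.
have e : (\int[translate c mu]_x `|(EFin \o g) x| = \int[mu]_x `|(EFin \o sh (- c) g) x|)%E.
  by apply: (@ge0_integral_translate mu (fun x => `|g x|)) => //; exact: mf_norm.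
split=> /integrableP[_ h]; apply/integrableP; split; try exact/measurable_EFinP.
  by rewrite -e.
by rewrite e.
Qed.

Lemma It_translate mu g : integ (translate c mu) g -> It (translate c mu) g = It mu (sh (- c) g).
Proof.
move=> ig; have mg := integ_mf ig.
have pos u : mf u -> (forall x, 0 <= u x) -> integ (translate c mu) u ->
    It (translate c mu) u = It mu (sh (- c) u).
  move=> m0 u0 iu; apply: EFin_inj; rewrite !ItE//; last exact/(integ_translate mu m0).1.
  exact: ge0_integral_translate.
have ia := integ_abs ig; have ib := integB ia ig.
have e : g = (fun x => `|g x|) - ((fun x => `|g x|) - g) by rewrite subKr.
have p1 := pos _ (integ_mf ia) (fun x => normr_ge0 _) ia.
have p2 := pos _ (integ_mf ib) _ ib; rewrite {1}e ItB// p1 p2; last first.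
  by move=> x; rewrite fctE subr_ge0 ler_norm.
rewrite -ItB; [congr (It mu _)| |]; last 2 first.
- exact/(integ_translate mu (integ_mf ia)).1.
- exact/(integ_translate mu (integ_mf ib)).1.
by rewrite [RHS](_ : _ = sh (- c) ((fun x => `|g x|) - ((fun x => `|g x|) - g))) ?subKr.
Qed.

Lemma sqi_translate mu u : sqi (translate c mu) (sh c u) <-> sqi mu u.
Proof.
have e : sh (- c) (sh c u * sh c u) = u * u by rewrite -[in RHS](shK c u).
split=> -[mu_ iu].
  have mu2 : mf u by rewrite -(shK c u); exact: mf_sh.
  by split=> //; have := (integ_translate mu (integ_mf iu)).1 iu; rewrite e.
split; first exact: mf_sh.
by apply/integ_translate; [apply: mfM; exact: mf_sh|rewrite e].
Qed.

Lemma ip_translate mu u v : sqi mu u -> sqi mu v -> ip (translate c mu) (sh c u) (sh c v) = ip mu u v.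
Proof.
move=> su sv; rewrite /ip It_translate; last by apply: sqiM; exact/sqi_translate.
by congr (It mu _); rewrite -[in RHS](shK c u) -[in RHS](shK c v).
Qed.

Lemma Da_sh d u v : H1 u -> H1 v -> Da (sh d u) (sh d v) = Da u v.
Proof.
move=> hu hv; have a1 := ah_cvg (H1_sh d hu).1 (H1_sh d hv).1; have a2 := ah_cvg hu hv.
have e : (fun k => ah k (sh d u) (sh d v)) = (fun k => ah k u v).
  apply/funext => k; apply: eq_bigr => i _; rewrite !dq_sh ip_sh//; apply: sqi_dq; exact: H1_sqi.
by rewrite e in a1; apply: (cvg_unique _ a1 a2).
Qed.

Lemma continuous_addr d : continuous (fun x : E => x + d).
Proof. by move=> x; apply: (@continuousD _ _ _ id (cst d)); [exact: cvg_id|exact: cst_continuous]. Qed.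

Lemma open_shift d (U : set E) : open U -> open [set x | U (x + d)].
Proof.
by move=> oU; apply: (@open_comp _ _ (fun x : E => x + d) U) => // x _; exact: continuous_addr.
Qed.

Lemma cap_shift (d : E) (A : set E) : (cap [set x : E | A (x + d)%R] <= cap A)%E.
Proof.
apply/lee_addgt0Pr => e e0; have [->|foo] := eqVneq (cap A) +oo%E; first exact: leey.
have fA : cap A \is a fin_num by rewrite ge0_fin_numE ?cap_ge0// lt_neqAle foo leey.
have : (cap A < (fine (cap A) + e)%:E)%E by rewrite EFinD fineK// lteDl// lte_fin.
move=> /cap_lt[u [U [hu oU AU u1 ul]]]; rewrite -(fineK fA) -EFinD.
have [h1 h2] := H1_sh d hu; have su := H1_sqi hu.
apply: (@le_trans _ _ (h1f (sh d u) (sh d u))%:E).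
  apply: (cap_le_h1 h1 (open_shift (d := d) oU)); first by move=> x; exact: AU.
  by apply: filterS (ae_sh d u1) => x h /h; rewrite /sh => ->.
by rewrite lee_fin; apply: ltW; apply: le_lt_trans ul; rewrite /h1f ip_sh// lerD2l.
Qed.

Lemma cap0_shift d (A : set E) : cap A = 0%E -> cap [set x | A (x + d)] = 0%E.
Proof. by move=> A0; apply/eqP; rewrite eq_le cap_ge0 andbT -A0 cap_shift. Qed.

Lemma qc_sh d u : quasi_continuous u -> quasi_continuous (sh d u).
Proof.
move=> qu e e0; have [U [oU Ue cu]] := qu _ e0.
exists [set x | U (x + d)]; split; [exact: open_shift|exact: le_lt_trans (cap_shift d U) Ue|].
apply/subspace_continuousP => x hx.
have h1 := (subspace_continuousP _ _).1 cu (x + d) hx.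
apply: (@cvg_comp _ _ _ (fun y : E => y + d) u); last exact: h1.
by move=> P /= hP; exact: (@continuous_addr d x _ hP).
Qed.

Lemma H1q_sh d u : H1q u -> H1q (sh d u).
Proof. by move=> [h q]; split; [exact: (H1_sh d h).1|exact: qc_sh]. Qed.

Lemma H1mu_translate mu u : H1mu mu u -> H1mu (translate c mu) (sh c u).
Proof. by move=> /H1muP[h s]; apply/H1muP; split; [exact: H1q_sh|exact/sqi_translate]. Qed.

Lemma H1mu_translateN mu u : H1mu (translate c mu) u -> H1mu mu (sh (- c) u).
Proof.
by move=> /H1muP[h s]; apply/H1muP; split; [exact: H1q_sh|apply/sqi_translate; rewrite shKN].
Qed.

Lemma tors_translate mu w : tors mu w -> tors (translate c mu) (sh c w).
Proof.
move=> [[hw iw] ew]; split=> [|v [hv iv]].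
  by split; [exact: H1mu_translate|exact: integ_sh].
have hv' := H1mu_translateN hv; have iv' := integ_sh (- c) iv.
have := ew _ (conj hv' iv'); rewrite /Ef (It_sh _ iv) => <-.
rewrite -[in LHS](shKN c v) Da_sh; [|exact: H1mu_H1 hw|exact: H1mu_H1 hv'].
by rewrite ip_translate//; exact: H1mu_smu.
Qed.

Lemma capacitary_translate mu : capacitary mu -> capacitary (translate c mu).
Proof.
move=> cmu A /cap0_borel[N [mN AN N0]]; exists N; split=> //.
have /cmu[N' [mN' N'0 NN']] := cap0_shift (- c) N0.
have h : (mu (sub_rV c @^-1` N) <= mu N')%E.
  by apply: le_measure; rewrite ?inE//; exact: (@mset_sh R n (- c) N).
by apply/eqP; rewrite -measure_le0 -N'0.
Qed.

Lemma finite_torsion_translate mu w : capacitary mu -> tors mu w -> finite_torsion (translate c mu).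
Proof.
move=> cmu tw; apply: poinc_finite (tors_poinc (tors_translate tw)).
exact: capacitary_translate.
Qed.

End translation.

(** * Norms, distances and eigenvalues in terms of weak solutions *)

Section norms.
Variables (R : realType) (n : nat).
Local Notation E := 'rV[R]_n.
Local Notation leb := (lebesgue_rV R n).
Implicit Types (mu : {measure set E -> \bar R}) (u v w f g : E -> R).
Let BL := psd_ip leb.

Lemma Lnorm2E f : sqi leb f -> ('N[leb]_2%:E[EFin \o f] = (nr f)%:E)%E.
Proof.
move=> sf; rewrite unlock /nr.
rewrite (_ : (\int[leb]_x `|(EFin \o f) x| `^ 2)%E = (ip leb f f)%:E).
  by rewrite poweR_EFin powR12_sqrt// (psd_ge0 BL).
rewrite /ip ItE; last exact: sf.2.
apply: eq_integral => x _; by rewrite -[(EFin \o f) x]/((f x)%:E) abse_EFin poweR_EFin powR_mulrn// real_normK ?num_real// mulrfctE expr2.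
Qed.

Lemma opnorm2_le (T : (E -> R) -> E -> R) (e : R) : 0 <= e ->
  (forall f, sqi leb f -> sqi leb (T f) /\ ip leb (T f) (T f) <= e ^+ 2 * ip leb f f) ->
  (0 <= opnorm2 T <= e%:E)%E.
Proof.
move=> e0 h; apply/andP; split.
  apply: (@le_trans _ _ ('N[leb]_2%:E[EFin \o T 0%R])%E); first exact: Lnorm_ge0.
  apply: ereal_sup_ubound; exists 0 => //; split; first by apply/sqi_Lfun; exact: (psd_dom0 BL).
  by rewrite Lnorm2E ?lee_fin; [rewrite /nr (psd0l BL) ?sqrtr0//|]; exact: (psd_dom0 BL).
apply: ge_ereal_sup => _ [f [/sqi_Lfun sf f1] <-]; have [sT hT] := h _ sf.
move: f1; rewrite !Lnorm2E// !lee_fin => f1; apply: nr_small => //.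
apply: le_trans hT _; rewrite -[leRHS]mulr1 ler_wpM2l ?sqr_ge0// -nr_sq// expr_le1//.
exact: nr_ge0.
Qed.

Lemma eq_tors_fun mu w : tors mu w -> tors mu (torsion_function mu).
Proof. by move=> /torsP h; apply/torsP; exact: (getPex (ex_intro _ w h)). Qed.

(** [torsion_function] is chosen by [get]; uniqueness almost everywhere lets any versions compute
    the distance. *)
Lemma d_gammaE mu nu w w' : tors mu w -> tors nu w' ->
  d_gamma mu nu = (It leb (fun x => `|w x - w' x|))%:E.
Proof.
move=> tw tw'; have t1 := eq_tors_fun tw; have t2 := eq_tors_fun tw'.
have u1 := tors_uniq (tors_poinc tw) tw t1; have u2 := tors_uniq (tors_poinc tw') tw' t2.
have i v nu0 : tors nu0 v -> integ leb v by case=> -[].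
have h := integ_abs (integB (i _ _ t1) (i _ _ t2)).
have h' := integ_abs (integB (i _ _ tw) (i _ _ tw')).
rewrite /d_gamma Lnorm1 (_ : (It leb _) = It leb (fun x => `|(torsion_function mu - torsion_function nu) x|)).
  by rewrite ItE//.
apply: It_ae; [exact: integ_mf h'|exact: integ_mf h|].
by apply: filterS2 u1 u2 => x e1 e2; rewrite !fctE -e1 -e2.
Qed.

Lemma resolventP mu M f : capacitary mu -> coercive mu M -> sqi leb f -> res mu f (resolvent mu f).
Proof.
move=> cmu co sf; have [u hu] := res_exists cmu co sf.
apply/(resP _ _ sf); apply: (getPex (ex_intro _ u _)); exact/(resP _ _ sf).
Qed.

Lemma opnorm_resolvent mu M : capacitary mu -> coercive mu M -> (0 <= opnorm2 (resolvent mu) <= M%:E)%E.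
Proof.
move=> cmu co; apply: opnorm2_le => [|f sf]; first by case: co.
have h := resolventP cmu co sf; split; first by case: h => /H1mu_sqi.
exact: (res_bound co sf h).2.
Qed.

Lemma Linfty_tors mu w (M : R) : (0 <= M) -> tors mu w -> (forall x, 0 <= w x) -> {ae leb, forall x, w x <= M} ->
  (0 <= 'N[leb]_+oo[EFin \o torsion_function mu] <= M%:E)%E.
Proof.
move=> M0 tw w0 wM; rewrite Lnorm_ge0/= unlock; case: ifP => _; last by rewrite lee_fin.
have u1 := tors_uniq (tors_poinc tw) tw (eq_tors_fun tw).
apply/ess_sup_inf.ess_supP; apply: filterS2 u1 wM => x e1 e2.
by rewrite /= -e1 lee_fin ger0_norm.
Qed.

Lemma lambda1_ge mu (M A : R) : coercive mu M -> 0 < A -> A * M <= 1 -> (A%:E <= lambda1 mu)%E.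
Proof.
move=> [M0 co] A0 AM; apply: le_ereal_inf_tmp => _ [u [hu u1] <-].
have hq := H1mu_H1 hu; have su := H1mu_smu hu.
rewrite dirichletE// sqintE// -EFinD lee_fin -/(Ef mu u u).
have e1 : ip leb u u = 1.
  apply: EFin_inj; rewrite -u1 /ip ItE; last exact: (H1mu_sqi hu).2.
  by apply: eq_integral => x _; rewrite mulrfctE expr2.
have := co _ hu; rewrite e1 => h; have E0 := psd_ge0 (psd_E mu) hu.
apply: (@le_trans _ _ (A * (M * Ef mu u u))); first by rewrite ler_peMr// ltW.
by rewrite mulrA ler_piMl.
Qed.

Lemma ereal_cvg0 (x : nat -> \bar R) :
  (forall e : R, 0 < e -> exists N, forall k, (N <= k)%N -> (0 <= x k <= e%:E)%E) -> x k @[k --> \oo] --> 0%E.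
Proof.
move=> h; have h' (e : R) : 0 < e -> \forall k \near \oo, (0 <= x k <= e%:E)%E.
  by move=> /h[N hN]; exists N.
have f1 : \forall k \near \oo, x k \is a fin_num.
  apply: filterS (h' 1 ltr01) => k /andP[a b].
  by rewrite ge0_fin_numE// (le_lt_trans b)// ltry.
apply/fine_cvgP; split=> //; apply/cvgrPdist_le => e e0; apply: filterS2 f1 (h' e e0) => k fk /andP[a b].
by rewrite /= sub0r normrN ger0_norm ?fine_ge0// -lee_fin fineK.
Qed.

End norms.

Lemma subseq_pick (Q : nat -> nat -> Prop) : (forall k N, exists2 m, (N <= m)%N & Q k m) ->
  exists2 s : nat -> nat, {homo s : m n / (m < n)%N} & forall k, Q k (s k).
Proof.
move=> H; have /choice[f hf] : forall kN : nat * nat, exists m, (kN.2 <= m)%N /\ Q kN.1 m.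
  by move=> [k N]; have [m h1 h2] := H k N; exists m.
pose fix s k := if k is j.+1 then f (k, (s j).+1) else f (0%N, 0%N).
exists s; first by apply: homo_ltn; [exact: ltn_trans|move=> k /=; case: (hf (k.+1, (s k).+1))].
by case=> [|k] /=; [case: (hf (0%N, 0%N))|case: (hf (k.+1, (s k).+1))].
Qed.

(** * Uniform estimates, vanishing, and one splitting *)

Section uniform.
Variables (R : realType) (n : nat).
Local Notation E := 'rV[R]_n.
Local Notation leb := (lebesgue_rV R n).
Implicit Types (mu nu : {measure set E -> \bar R}) (u v w f g phi : E -> R).
Let BL := psd_ip leb.
Hypothesis n0 : (0 < n)%N.

Lemma tors_nonneg mu C : capacitary mu -> poinc mu C -> exists w, tors mu w /\ forall x, 0 <= w x.
Proof. by move=> h1 h2; have [w /tors_abs tw] := tors_exists h1 h2; exists (fun x => `|w x|). Qed.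

Lemma tors_uniform_bound (C : R) : exists2 M, 0 < M & forall mu w, poinc mu C -> tors mu w ->
  (forall x, 0 <= w x) -> {ae leb, forall x, w x <= M}.
Proof.
(* [B] bounds the integral of w^2, and k0 is chosen so that Chebyshev leaves measure at most 1/2 to
   {w > k0}, the threshold of [tors_bound] at r0 = 1. *)
pose B := `|(C + nashK R n) * C|; pose k0 := 2 * B + 1.
have B0 : 0 <= B by exact: normr_ge0. have k01 : 1 <= k0 by rewrite lerDr mulr_ge0.
have k00 : 0 < k0 by apply: lt_le_trans k01.
have d0 : 0 <= degK R n by rewrite mulr_ge0// nashK_ge0.
exists (k0 + (2 ^+ n * degK R n * 2 + 1) * 1 ^+ 2) => [|mu w pm tw w0].
  by rewrite ltr_wpDr// expr1n mulr1 addr_ge0// !mulr_ge0// exprn_ge0.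
have sw : sqi leb w by apply: H1_sqi; case: tw => -[[[]]].
apply: (tors_bound n0 tw w0 k00); first by rewrite ltr01 lexx.
have ch := chebyshev_leb k00 sw; rewrite expr1n.
have h : fine (leb [set x : E | k0 < w x]) <= k0 ^- 2 * ip leb w w.
  rewrite -lee_fin fineK// ge0_fin_numE//; exact: le_lt_trans ch (ltry _).
have h2 : k0 ^- 2 * ip leb w w <= 2^-1.
  rewrite ler_pdivrMl ?exprn_gt0//; apply: (@le_trans _ _ B).
    exact: le_trans (tors_ip pm tw) (ler_norm _).
  have : k0 <= k0 ^+ 2 by rewrite expr2 ler_peMl// ltW.
  by rewrite /k0; move: (_ ^+ 2) => y; lra.
by have := le_trans h h2; lra.
Qed.

(** The Dirichlet term of the Nash inequality fixes r; the admissible mass d of a cube is then of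
    order e r^n. *)
Lemma nash_small (C e : R) : 0 < e -> exists2 d : R, 0 < d & forall mu w, poinc mu C -> tors mu w ->
  (forall x, 0 <= w x) -> (forall a, It leb (w * \1_(cube a 1)) <= d) -> ip leb w w <= e.
Proof.
move=> e0; pose D := `|C|; pose K := nashK R n; have K0 : 0 <= K by exact: nashK_ge0.
have D0 : 0 <= D by exact: normr_ge0.
have KD : 0 < K * D + 1 by rewrite ltr_wpDl// mulr_ge0.
pose r := Num.min 1 (e / (2 * (K * D + 1))).
have r0 : 0 < r by rewrite lt_min ltr01 divr_gt0// mulr_gt0.
have r1 : r <= 1 by rewrite ge_min lexx.
have rn : 0 < r ^+ n by rewrite exprn_gt0.
have D1 : 0 < D + 1 by rewrite ltr_wpDl.
exists (e * r ^+ n / (2 * (D + 1))) => [|mu w pm tw w0 hw]; first by rewrite !(divr_gt0, mulr_gt0).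
set d := _ / _ in hw; have [[hm iw] _] := tw; have hH := H1mu_H1 hm.
have wE : (fun x => `|w x|) = w by apply/funext => x; rewrite ger0_norm.
have mc a (s : R) : measurable (cube a s : set E) by exact: measurable_cube.
have := @nash R n w r d hH iw; rewrite r0 r1 => /(_ isT) H.
have Hc : forall a, It leb ((fun x => `|w x|) * \1_(cube a r)) <= d.
  move=> a; rewrite wE; apply: le_trans (hw a); apply: It_le; try exact: integM_indic.
  move=> x; rewrite !mulrfctE !indicE; have [/set_mem xC|_] := boolP (x \in _); last first.
    by rewrite mulr0 mulr_ge0.
  rewrite mem_set// => i; have /andP[h1 h2] := xC i; rewrite h1/=; apply: lt_le_trans h2 _.
  by rewrite lerD2l.
have h := H Hc; rewrite wE in h; apply: le_trans h _; rewrite [e]splitr.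
have /andP[I0 IC] := tors_It pm tw; have ID : It leb w <= D by apply: le_trans IC (ler_norm _).
have DD : Dr w <= D by apply: le_trans (tors_Dr pm tw) (ler_norm _).
have q0 := Dr_ge0 hH; apply: lerD.
  apply: (@le_trans _ _ ((r ^+ n)^-1 * d * (D + 1))).
    rewrite ler_wpM2l//; first by rewrite mulr_ge0 ?invr_ge0 ?(ltW rn)// ltW// !(divr_gt0, mulr_gt0).
    by apply: le_trans ID _; rewrite lerDl.
  rewrite le_eqVlt; apply/orP; left; apply/eqP; rewrite /d; field.
  by rewrite !gt_eqF.
rewrite -/(nashK R n) -/K; apply: (@le_trans _ _ (K * D * r)).
  apply: (@le_trans _ _ (K * r ^+ 2 * D)); first by rewrite ler_wpM2l// mulr_ge0 ?sqr_ge0.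
  by rewrite mulrAC ler_wpM2l ?mulr_ge0// expr2 ler_piMl// ltW.
apply: (@le_trans _ _ ((K * D + 1) * r)); first by rewrite ler_wpM2r ?(ltW r0)// lerDl.
have : r <= e / (2 * (K * D + 1)) by rewrite ge_min lexx orbT.
move=> /(ler_wpM2l (ltW KD)) h2; apply: le_trans h2 _; rewrite le_eqVlt; apply/orP; left.
by apply/eqP; field; rewrite gt_eqF.
Qed.

Lemma vanishing (mu : nat -> {measure set E -> \bar R}) (w : nat -> E -> R) :
  (forall k, capacitary (mu k)) -> (forall k, tors (mu k) (w k)) -> (forall k x, 0 <= w k x) ->
  (forall e : R, 0 < e -> exists N, forall k, (N <= k)%N -> {ae leb, forall x, w k x <= e}) ->
  [/\ opnorm2 (resolvent (mu k)) @[k --> \oo] --> 0%E,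
      ('N[leb]_+oo[EFin \o torsion_function (mu k)])%E @[k --> \oo] --> 0%E &
      lambda1 (mu k) @[k --> \oo] --> +oo%E].
Proof.
move=> cm tw w0 h; have co k (e : R) : 0 <= e -> {ae leb, forall x, w k x <= e} -> coercive (mu k) e.
  by move=> e0 we; split=> // u hu; exact: barta (tw k) (w0 k) e0 we hu.
split.
- apply: ereal_cvg0 => e e0; have [N hN] := h e e0; exists N => k /hN we.
  by apply: opnorm_resolvent => //; apply: co => //; exact: ltW.
- apply: ereal_cvg0 => e e0; have [N hN] := h e e0; exists N => k /hN we.
  exact: Linfty_tors (ltW e0) (tw k) (w0 k) we.
- apply/cvgeyPge => A; pose a := Num.max 1 A; have a0 : 0 < a by rewrite lt_max ltr01.
  have [|N hN] := h a^-1; first by rewrite invr_gt0.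
  exists N => // k /= /hN we; apply: (@le_trans _ _ a%:E); first by rewrite lee_fin le_max lexx orbT.
  have a1 : 0 <= a^-1 by rewrite invr_ge0 ltW.
  by apply: (lambda1_ge (co _ _ a1 we) a0); rewrite divff// gt_eqF.
Qed.

(** The dichotomy for one measure at tolerance e, so that a sequence is obtained by choosing an
    index for each tolerance. The lower bounds 0 serve to conclude convergence in the extended
    reals. *)
Definition split_data mu (e : R) := exists (mu1 mu2 mu12 : {measure set E -> \bar R}) (Om1 Om2 : set E),
  [/\ capacitary mu1, capacitary mu2, is_wedge mu1 mu2 mu12 & finite_torsion mu12] /\
  [/\ finiteness_set mu1 Om1 /\ finiteness_set mu2 Om2, e^-1 <= euclidean_dist Om1 Om2,
      cap_le mu mu12, (0 <= d_gamma mu mu12 <= e%:E)%E &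
      (0 <= opnorm2 (fun f => (resolvent mu f \- resolvent mu12 f)%R) <= e%:E)%E].

(** The balls are those of the sup norm, which is below the Euclidean norm. Both sets must be
    nonempty, since the distance is 0 by default otherwise. *)
Lemma euclidean_dist_ge (A B : set E) (c : E) (rho : R) : 0 <= rho -> A !=set0 -> B !=set0 ->
  A `<=` [set x | `|x - c| < 2 * rho] -> B `<=` [set x | 3 * rho < `|x - c|] -> rho <= euclidean_dist A B.
Proof.
move=> rho0 [a Aa] [b Bb] hA hB; apply: lb_le_inf.
  by exists (Num.sqrt (\sum_(i < n) (a ord0 i - b ord0 i) ^+ 2)); exists a => //; exists b.
move=> _ [x Ax [y By <-]]; have h1 := hA _ Ax; have h2 := hB _ By.
have h3 : rho <= `|x - y|.
  have t : `|y - c| <= `|x - y| + `|x - c|.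
    by have := ler_normD (y - x) (x - c); rewrite addrA subrK [`|y - x|]distrC.
  have : 3 * rho < `|x - y| + 2 * rho.
    by apply: lt_le_trans h2 _; apply: le_trans t _; rewrite lerD2l ltW.
  by rewrite (_ : 3 * rho = rho + 2 * rho); [rewrite ltrD2r => /ltW|ring].
apply: le_trans h3 _; apply: norm_le_coord; first exact: sqrtr_ge0.
move=> i; rewrite !mxE -sqrtr_sqr ler_sqrt; last by apply: sumr_ge0 => j _; exact: sqr_ge0.
by rewrite (bigD1 i)//= lerDl; apply: sumr_ge0 => j _; exact: sqr_ge0.
Qed.

(** g is a mass present both in the inner ball and outside the outer one. As it exceeds the L^1
    error eps + et of the cut, the torsion function of the cut measure cannot vanish on either side,
    so both finiteness sets are nonempty. *)
Lemma split_one (C M e g : R) : 0 < C -> 0 < M -> 0 < e -> 0 < g -> exists eps rho0 : R,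
  [/\ 0 < eps, 0 < rho0 & forall mu w (c : E) (rho : R), capacitary mu -> poinc mu C -> tors mu w ->
    (forall x, 0 <= w x) -> {ae leb, forall x, w x <= M} -> rho0 <= rho ->
    It leb (w * \1_[set x | rho < `|x - c| < 4 * rho]) <= eps ->
    g <= It leb (w * \1_[set x | `|x - c| < rho]) ->
    g <= It leb (w * \1_[set x | 4 * rho <= `|x - c|]) -> split_data mu e].
Proof.
(* With this value the term M delta in [dichotomy_resolvent] is e^2 / 2. *)
move=> C0 M0 e0 g0; pose delta := e ^+ 2 / (2 * M).
have d0 : 0 < delta by rewrite divr_gt0 ?exprn_gt0// mulr_gt0.
have [th th0 hth] := tors_small_L1 n0 d0.
pose B := (C + nashK R n) * C; have B0 : 0 <= B by rewrite mulr_ge0 ?(ltW C0)// addr_ge0 ?nashK_ge0// ltW.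
(* [Q] exceeds both factors that multiply n L^2, namely the integral of w^2 in the torsion estimate
   and 2 M^3 in the resolvent estimate; [rho0] makes n L^2 Q at most [et]. *)
pose Q := B + 2 * M ^+ 3; have Q0 : 0 <= Q by rewrite addr_ge0// mulr_ge0// exprn_ge0// ltW.
pose et := Num.min (Num.min (e / 2) (g / 4)) (e ^+ 2 / 2).
have et0 : 0 < et by rewrite !lt_min !divr_gt0 ?exprn_gt0.
pose eps := Num.min th (Num.min (e / 2) (g / 4)).
have eps0 : 0 < eps by rewrite !lt_min th0 !divr_gt0.
pose rho0 := Num.max (Num.max 1 e^-1) (n%:R * 4 * Q / et).
have rho01 : 1 <= rho0 by rewrite !le_max lexx.
have r00 : 0 < rho0 by apply: lt_le_trans rho01.
exists eps, rho0; split=> // mu w c rho cm pm tw w0 wM rr an m1 m2.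
have r0 : 0 < rho := lt_le_trans r00 rr; have r1 : 1 <= rho := le_trans rho01 rr.
have LQ : n%:R * (2 / rho) ^+ 2 * Q <= et.
  have h : n%:R * 4 * Q / et <= rho by apply: le_trans rr; rewrite le_max lexx orbT.
  rewrite ler_pdivrMr// in h; have -> : n%:R * (2 / rho) ^+ 2 * Q = (n%:R * 4 * Q) / rho ^+ 2.
    by field; rewrite gt_eqF.
  rewrite ler_pdivrMr ?exprn_gt0//; apply: le_trans h _; rewrite mulrC ler_wpM2l ?(ltW et0)//.
  by rewrite expr2 ler_peMl// ltW.
have L0 : 0 <= n%:R * (2 / rho) ^+ 2 by rewrite mulr_ge0 ?sqr_ge0.
have mb : mf (fun x : E => `|x - c|).
  apply: continuous_measurable_rVR => x.
  apply: (@continuous_comp _ _ _ (fun x : E => x - c) (fun x => `|x|)); last exact: norm_continuous.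
  by apply: (@continuousB _ _ _ id (cst c)); [exact: cvg_id|exact: cst_continuous].
have mlt (r : R) : measurable [set x : E | `|x - c| < r].
  by apply: (@mset_lt _ _ _ (fun x : E => `|x - c|) (cst r)) => //; exact: mf_cst.
have mgt (r : R) : measurable [set x : E | r < `|x - c|].
  by apply: (@mset_lt _ _ _ (cst r) (fun x : E => `|x - c|)) => //; exact: mf_cst.
have mge (r : R) : measurable [set x : E | r <= `|x - c|].
  by apply: (@mset_le _ _ _ (cst r) (fun x : E => `|x - c|)) => //; exact: mf_cst.
pose S1 := [set x : E | `|x - c| < 2 * rho]; pose S2 := [set x : E | 3 * rho < `|x - c|].
pose A := [set x : E | rho < `|x - c| < 4 * rho].
have mS1 : measurable S1 by exact: mlt. have mS2 : measurable S2 by exact: mgt.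
have mA : measurable A.
  rewrite (_ : A = [set x : E | rho < `|x - c|] `&` [set x : E | `|x - c| < 4 * rho]).
    by apply: measurableI; [exact: mgt|exact: mlt].
  by apply/seteqP; split=> x; rewrite /A /=; [move=> /andP[]|move=> [-> ->]].
have [w1 [t1 w10 w1S]] := tors_version cm pm mS1.
have [w2 [t2 w20 w2S]] := tors_version cm pm mS2.
have [wA [tA wA0 wAS]] := tors_version cm pm mA.
pose O1 := [set x | 0 < w1 x]; pose O2 := [set x | 0 < w2 x].
have O1S : O1 `<=` S1 by move=> x; rewrite /O1 /= => h; apply: contrapT => /w1S e1; rewrite e1 ltxx in h.
have O2S : O2 `<=` S2 by move=> x; rewrite /O2 /= => h; apply: contrapT => /w2S e1; rewrite e1 ltxx in h.
have S12 x : S1 x -> ~ O2 x.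
  move=> h1 /O2S h2; have := lt_trans h2 h1; rewrite ltr_pM2r// ltr_nat.
  by [].
pose nu := sat mu (O1 `|` O2).
have mO1 : measurable O1.
  by apply: (@mset_lt _ _ _ (cst 0)); [exact: mf_cst|case: t1 => -[[[h _] _] _] _; exact: H1_mf h].
have mO2 : measurable O2.
  by apply: (@mset_lt _ _ _ (cst 0)); [exact: mf_cst|case: t2 => -[[[h _] _] _] _; exact: H1_mf h].
have mO : measurable (O1 `|` O2) by exact: measurableU.
have cn : capacitary nu by exact: capacitary_sat.
have pn : poinc nu C by exact: poinc_sat.
have [w12 t12] := tors_exists cn pn.
have [[hw iw] _] := tw; have [[hw12 iw12] _] := t12.
have D1 := dichotomy_torsion cm pm tw w0 r0 t1 w10 t2 w20 t12.
have D1' : It leb (fun x => `|w x - w12 x|) <= eps + et.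
  apply: le_trans D1 _; apply: lerD; first exact: an.
  apply: le_trans LQ; rewrite ler_wpM2l//; apply: le_trans (tors_ip pm tw) _.
  by rewrite lerDl mulr_ge0// exprn_ge0// ltW.
have ege : eps + et <= e.
  have h1 : eps <= e / 2 by rewrite !ge_min lexx ?orbT.
  have h2 : et <= e / 2 by rewrite !ge_min lexx ?orbT.
  by move: h1 h2; lra.
have gge : eps + et < g.
  have h1 : eps <= g / 4 by rewrite !ge_min lexx ?orbT.
  have h2 : et <= g / 4 by rewrite !ge_min lexx ?orbT.
  by move: h1 h2 g0; lra.
have off : {ae leb, forall x, w12 x != 0 -> (O1 `|` O2) x}.
  have [_ c0] := (V1_sat _ _ mO).1 t12.1; have [N [mN N0 hN]] := cap0_leb c0.
  exists N; split=> // x /= h; apply: hN; split.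
    by apply/negP => h2; apply: h => h3; move: h3; rewrite h2.
  by move=> hx; apply: h.
have nonempty (T S : set E) : measurable T -> g <= It leb (w * \1_T) -> (forall x, T x -> ~ S x) ->
    ~ {ae leb, forall x, w12 x != 0 -> S x}.
  move=> mT gT TS bad; have : It leb (w * \1_T) <= It leb (fun x => `|w x - w12 x|).
    apply: It_le_ae; [exact: integM_indic|exact: integ_abs (integB iw iw12)|].
    apply: filterS bad => x hx; rewrite mulrfctE indicE; have [/set_mem xT|_] := boolP (x \in _).
      have -> : w12 x = 0 by apply/eqP/negPn/negP => /hx; exact: TS.
      by rewrite subr0 mulr1 ger0_norm.
    by rewrite mulr0.
  by move=> h; have := le_trans gT (le_trans h D1'); rewrite leNgt gge.
have ne1 : O1 !=set0.
  apply: contrapT => /set0P/negP/negPn/eqP h; apply: (nonempty _ O2 (mlt rho) m1).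
    by move=> x /= xr; apply: S12; rewrite /S1 /=; apply: lt_le_trans xr _; lra.
  by apply: filterS off => x hx /hx; rewrite h set0U.
have ne2 : O2 !=set0.
  apply: contrapT => /set0P/negP/negPn/eqP h; apply: (nonempty _ O1 (mge (4 * rho)) m2).
    move=> x /= xr /O1S; rewrite /S1 /= => h2; have := le_lt_trans xr h2; rewrite ltr_pM2r// ltr_nat.
    by [].
  by apply: filterS off => x hx /hx; rewrite h setU0.
have [f1 s1] := saturated_sat mS1 t1 w10 w1S; have [f2 s2] := saturated_sat mS2 t2 w20 w2S.
have cO X : capacitary (sat mu X) by exact: capacitary_sat.
exists (sat mu O1), (sat mu O2), nu, O1, O2; split; split=> //.
- exists (sat mu O1), (sat mu O2); split=> // D mD; exact: sat_wedge mS1 mD O1S S12.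
- exact: poinc_finite cn pn.
- apply: le_trans (euclidean_dist_ge (ltW r0) ne1 ne2 O1S O2S).
  by apply: le_trans rr; rewrite !le_max lexx orbT.
- exact: cap_le_sat.
- rewrite (d_gammaE tw t12) !lee_fin It_ge0//=; exact: le_trans D1' ege.
- have com : coercive mu M by split=> [|u hu]; [exact: ltW|exact: barta tw w0 (ltW M0) wM hu].
  have con : coercive nu M.
    split=> [|u hu]; first exact: ltW.
    by have [hu' _] := (H1mu_satP _ _ mO).1 hu; rewrite (Ef_sat mO hu hu); exact: com.2.
  apply: opnorm2_le => [|f sf]; first exact: ltW.
  have ru := resolventP cm com sf; have rv := resolventP cn con sf.
  have su : sqi leb (resolvent mu f) by case: ru => /H1mu_sqi.
  have sv : sqi leb (resolvent nu f) by case: rv => /H1mu_sqi.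
  split; first exact: (psd_domB BL su sv).
  have IA : It leb wA <= th.
    apply: (@le_trans _ _ eps); last by rewrite !ge_min lexx.
    apply: le_trans an; have [[hA iA] _] := tA.
    apply: It_le_ae => //; first exact: integM_indic.
    apply: filterS (tors_compare mA pm tw w0 tA) => x h; rewrite mulrfctE indicE.
    have [_|xA] := boolP (x \in _); first by rewrite mulr1.
    by rewrite mulr0 wAS// => h2; move/negP: xA; apply; exact/mem_set.
  have wAd := hth _ _ tA wA0 IA.
  apply: le_trans (dichotomy_resolvent cm pm tw w0 (ltW M0) wM r0 t1 w10 t2 w20 d0 tA wA0 wAd sf ru rv) _.
  rewrite ler_wpM2r ?(psd_ge0 BL)// mulrDr [leRHS]splitr; apply: lerD.
    by rewrite /delta le_eqVlt; apply/orP; left; apply/eqP; field; rewrite gt_eqF.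
  apply: (@le_trans _ _ et); last by rewrite !ge_min lexx !orbT.
  apply: le_trans LQ; rewrite (_ : M * _ = n%:R * (2 / rho) ^+ 2 * (2 * M ^+ 3)); last by ring.
  by rewrite ler_wpM2l// lerDr.
Qed.

(** Scheffe's argument: |v - w| = v - w + 2 (w - v)+, and (w - v)+ is dominated by w. *)
Lemma scheffe (v : nat -> E -> R) w : (forall k, integ leb (v k)) -> (forall k x, 0 <= v k x) ->
  integ leb w -> (forall x, 0 <= w x) -> {ae leb, forall x, v k x @[k --> \oo] --> w x} ->
  It leb (v k) @[k --> \oo] --> It leb w -> It leb (fun x => `|v k x - w x|) @[k --> \oo] --> 0.
Proof.
move=> iv v0 iw w0 cv cI; pose p k (x : E) := Num.max (w x - v k x) 0.
have mp k : mf (p k).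
  by apply: (mf_max (v := cst 0)); [apply: mfB; [exact: integ_mf iw|exact: integ_mf (iv k)]|exact: mf_cst].
have pw k x : `|p k x| <= w x.
  rewrite /p; have := v0 k x; have := w0 x; move: (w x) (v k x) => a b a0 b0.
  by have [h|h] := leP (a - b) 0; rewrite ?normr0// ger0_norm; lra.
have ip_ k : integ leb (p k) by exact: integ_le (mp k) (pw k) iw.
have c0 : It leb (p k) @[k --> \oo] --> 0.
  rewrite -[X in _ --> X](@It0 _ _ _ leb); apply: (proj2 (It_dom mp _ _ iw pw)); first exact: mf_cst.
  apply: filterS cv => x h; rewrite [X in _ --> X](_ : _ = Num.max (w x - w x) 0); last by rewrite subrr maxxx.
  apply: (@cvg_comp _ _ _ (fun k => v k x) (fun t => Num.max (w x - t) 0) _ _ _ h).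
  apply: (@continuous_max R R (fun t => w x - t) (cst 0)); last exact: cst_continuous.
  by apply: cvgB; [exact: cvg_cst|exact: cvg_id].
have e k : It leb (fun x => `|v k x - w x|) = It leb (v k) - It leb w + 2 * It leb (p k).
  rewrite -ItB// -ItZ// -ItD//; [|exact: integB|exact: integZ].
  apply: It_ext => x; rewrite !fctE /GRing.scale/= /p; move: (w x) (v k x) => a b.
  by have [h|h] := leP (a - b) 0; [rewrite ger0_norm|rewrite ler0_norm]; lra.
rewrite (_ : (fun k => _) = (fun k => It leb (v k) - It leb w + 2 * It leb (p k))); last exact/funext.
rewrite [X in _ --> X](_ : _ = It leb w - It leb w + 2 * 0); last by rewrite subrr mulr0 addr0.
apply: cvgD; first by apply: cvgB => //; exact: cvg_cst.
by apply: cvgM => //; exact: cvg_cst.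
Qed.

End uniform.

(** * Compactness or dichotomy when mass persists *)

Section nonvanishing.
Variables (R : realType) (n : nat).
Local Notation E := 'rV[R]_n.
Local Notation leb := (lebesgue_rV R n).
Hypothesis n0 : (0 < n)%N.
Let BL := psd_ip leb.
Let BD := @psd_Da R n.

Lemma It_sh_indic (c : E) (u : E -> R) (A B : set E) : measurable B -> integ leb u ->
  (forall x, A x <-> B (x + c)) -> It leb (sh c u * \1_A) = It leb (u * \1_B).
Proof.
move=> mB iu AB; rewrite -(It_sh c (integM_indic mB iu)); apply: It_ext => x.
rewrite /sh !mulrfctE !indicE; congr (_ * _%:R); congr nat_of_bool.
by apply/idP/idP => /set_mem/AB/mem_set.
Qed.

(** [tors_subsol] asks for a quasi-continuous test function; a general one is replaced by the
    absolute value of its quasi-continuous version, which changes neither side. *)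
Lemma tors_le_DaE (mu : {measure set E -> \bar R}) w phi : tors mu w -> (forall x, 0 <= w x) ->
  H1 phi -> integ leb phi -> (forall x, 0 <= phi x) -> Da w phi <= It leb phi.
Proof.
move=> tw w0 hp ip0 p0; have [psi hpsi e] := H1q_rep hp; have hw := H1mu_H1 tw.1.1.
have ha := H1q_abs hpsi; have e' : {ae leb, forall x, phi x = `|psi x|}.
  by apply: filterS e => x h; rewrite -h ger0_norm.
have mp := H1_mf hp; have ma := H1_mf ha.1.
rewrite (psd_sym BD hw hp) (Da_ae hp ha.1 hw e') (psd_sym BD ha.1 hw) (It_ae mp ma e').
by apply: tors_subsol tw w0 ha _ _ => //; exact: integ_ae ip0 ma e'.
Qed.

Variables (mu : nat -> {measure set E -> \bar R}) (w : nat -> E -> R) (C delta : R) (x : nat -> E).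
Hypotheses (C0 : 0 < C) (cm : forall k, capacitary (mu k)) (pm : forall k, poinc (mu k) C).
Hypotheses (tw : forall k, tors (mu k) (w k)) (w0 : forall k y, 0 <= w k y).
Hypotheses (delta0 : 0 < delta) (hx : forall k, delta <= It leb (w k * \1_(cube (x k) 1))).

(** Convergence of the integrals improves convergence almost everywhere to L^1, and the common bound
    M improves that to L^2. The inequality D(w, phi) <= int phi then passes to the limit, whose
    quasi-continuous version is fed to [tors_realize]. *)
Lemma compactness_limit (M : R) (s : nat -> nat) z : 0 < M ->
  (forall k, {ae leb, forall y, w k y <= M}) -> sqi leb z -> (forall y, 0 <= z y) -> integ leb z ->
  {ae leb, forall y, sh (x (s k)) (w (s k)) y @[k --> \oo] --> z y} ->
  It leb (w (s k)) @[k --> \oo] --> It leb z ->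
  exists nu : {measure set E -> \bar R}, [/\ forall k, finite_torsion (translate (x (s k)) (mu (s k))),
    finite_torsion nu & d_gamma (translate (x (s k)) (mu (s k))) nu @[k --> \oo] --> 0%E].
Proof.
move=> M0 wM sz z0 iz cz cI; pose U k := sh (x (s k)) (w (s k)).
have tU k : tors (translate (x (s k)) (mu (s k))) (U k) by exact: tors_translate.
have U0 k y : 0 <= U k y by exact: w0.
have iU k : integ leb (U k) by case: (tU k) => -[].
have hU k : H1 (U k) by exact: H1mu_H1 (tU k).1.1.
have cIU : It leb (U k) @[k --> \oo] --> It leb z.
  by under eq_fun do rewrite It_sh ?(tw _).1.2//; exact: cI.
have cL1 := scheffe iU U0 iz z0 cz cIU.
have UM : {ae leb, forall y k, U k y <= M}.
  by apply/ae_foralln => k; exact: (ae_sh (x (s k)) (wM (s k))).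
have zM : {ae leb, forall y, z y <= M}.
  by apply: filterS2 UM cz => y h1 h2; exact: (lim_le h2 h1).
have DU k : Dr (U k) <= C.
  by apply: le_trans (H1_sh (x (s k)) (H1mu_H1 (tw (s k)).1.1)).2 (tors_Dr (pm _) (tw _)).
have sub k : sqi leb (U k - z) by exact: (psd_domB BL (H1_sqi (hU k)) sz).
have cip : ip leb (U k - z) (U k - z) @[k --> \oo] --> 0.
  have bd k : ip leb (U k - z) (U k - z) <= 2 * M * It leb (fun y => `|U k y - z y|).
    rewrite -ItZ; last exact: integ_abs (integB (iU k) iz).
    apply: It_le_ae; [exact: (sub k).2|by apply: integZ; exact: integ_abs (integB (iU k) iz)|].
    apply: filterS2 UM zM => y h1 h2; rewrite mulrfctE -expr2 -[(U k - z) y]/(U k y - z y).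
    rewrite fctE /GRing.scale/= -real_normK ?num_real// expr2 ler_wpM2r// ler_norml.
    have := h1 k; have := U0 k y; have := z0 y; move: M0 h2; move: (U k y) (z y) => p q *.
    by apply/andP; split; lra.
  apply/cvg_epsP => e e0; have e2 : 0 < e / (2 * M) by rewrite divr_gt0// mulr_gt0.
  have [N hN] := (cvg_epsP _ _).1 cL1 _ e2; exists N => k /hN; rewrite !subr0 => h.
  rewrite ger0_norm ?(psd_ge0 BL)//; apply: le_trans (bd k) _; rewrite mulrC -ler_pdivlMr ?mulr_gt0//.
  exact: le_trans (ler_norm _) h.
have [hz _] := Dr_lsc hU sz (nr_cvg0 cip) DU.
have [q hq e] := H1q_rep hz; have hv := H1q_abs hq; set v := (fun y => `|q y|) in hv.
have ve : {ae leb, forall y, z y = v y} by apply: filterS e => y h; rewrite /v -h ger0_norm.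
have iv : integ leb v by exact: integ_ae iz (H1_mf hv.1) ve.
have v0 y : 0 <= v y by exact: normr_ge0.
have Dv phi : H1 phi -> integ leb phi -> (forall y, 0 <= phi y) -> Da v phi <= It leb phi.
  move=> hp ip0 p0; rewrite -(Da_ae hz hv.1 hp ve).
  apply: (lim_le (Da_weak_cvg hU hz hp (nr_cvg0 cip) DU)) => k.
  exact: tors_le_DaE (tU k) (U0 k) hp ip0 p0.
have [nu [fnu tnu]] := tors_realize hv iv v0 Dv; exists nu; split=> // [k|].
  exact: finite_torsion_translate (cm _) (tw _).
have dE k : d_gamma (translate (x (s k)) (mu (s k))) nu = (It leb (fun y => `|U k y - z y|))%:E.
  rewrite (d_gammaE (tU k) tnu); congr (_%:E); apply: It_ae.
  - exact: integ_mf (integ_abs (integB (iU k) iv)).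
  - exact: integ_mf (integ_abs (integB (iU k) iz)).
  by apply: filterS ve => y ->.
apply: ereal_cvg0 => d d0; have [N hN] := (cvg_epsP _ _).1 cL1 _ d0; exists N => k /hN; rewrite subr0 dE => h.
by rewrite !lee_fin It_ge0//=; exact: le_trans (ler_norm _) h.
Qed.

(** The lost mass is a - int z. For a fixed large rho and k large, half of it lies beyond radius 4
    rho, the cube at [x (s k)] keeps mass delta inside radius rho, and the annulus between carries
    little because z is integrable. *)
Lemma dichotomy_limit (M a : R) (s : nat -> nat) z : 0 < M ->
  (forall k, {ae leb, forall y, w k y <= M}) -> (forall y, 0 <= z y) -> integ leb z ->
  (forall (A : set E) (K : R), measurable A -> (forall y, A y -> `|y| <= K) -> (leb A < +oo)%E ->
     It leb (sh (x (s k)) (w (s k)) * \1_A) @[k --> \oo] --> It leb (z * \1_A)) ->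
  It leb (w (s k)) @[k --> \oo] --> a -> It leb z < a ->
  forall e : R, 0 < e -> exists N, forall k, (N <= k)%N -> split_data (mu (s k)) e.
Proof.
move=> M0 wM z0 iz cz cI za e e0; pose g := Num.min delta ((a - It leb z) / 2).
have az : 0 < a - It leb z by rewrite subr_gt0.
have g0 : 0 < g by rewrite lt_min delta0 divr_gt0.
have [eps [rho0 [eps0 rho00 H]]] := split_one n0 C0 M0 e0 g0.
have mB (r : R) : measurable [set y : E | `|y| < r] by exact: measurable_normlt.
have mn : mf (fun y : E => `|y|) by apply: continuous_measurable_rVR; exact: norm_continuous.
have mgt (r : R) : measurable [set y : E | r < `|y|].
  by apply: (@mset_lt _ _ _ (cst r) (fun y : E => `|y|)) => //; exact: mf_cst.
have mge (r : R) : measurable [set y : E | r <= `|y|].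
  by apply: (@mset_le _ _ _ (cst r) (fun y : E => `|y|)) => //; exact: mf_cst.
have fB (A : set E) (r : R) : measurable A -> A `<=` [set y : E | `|y| < r] -> (leb A < +oo)%E.
  by move=> mA h; apply: le_lt_trans (normlt_fin n r); apply: le_measure; rewrite ?inE.
have tail : It leb (z * \1_[set y : E | k%:R < `|y|]) @[k --> \oo] --> 0.
  rewrite -[X in _ --> X](@It0 _ _ _ leb); apply: (proj2 (It_dom _ _ _ iz _)).
  - by move=> k; apply: mfM; [exact: integ_mf iz|exact: mf_indic].
  - exact: mf_cst.
  - apply: aeW => y; apply: cvg_near_cst; exists (Num.truncn `|y|).+1 => // k /= hk.
    rewrite mulrfctE indicE (_ : (y \in _) = false) ?mulr0//; apply/negbTE/negP => /set_mem /=.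
    rewrite ltNge; apply/negP; rewrite negbK; apply: le_trans (ltW (truncnS_gt _)) _.
    by rewrite ler_nat.
  - move=> k y; rewrite mulrfctE indicE ger0_norm ?mulr_ge0//.
    by case: (y \in _); rewrite ?mulr1 ?mulr0.
have [N1 hN1] := (cvg_epsP _ _).1 tail _ (divr_gt0 eps0 (ltr0n R 2)).
(* N1 makes the tail of z small, 2 puts the unit cube inside the ball of radius rho, and the last
   term reaches the threshold of [split_one]. *)
pose K := maxn N1 (maxn 2 (Num.truncn rho0).+1); pose rho : R := K%:R.
have rr : rho0 <= rho.
  by apply: le_trans (ltW (truncnS_gt _)) _; rewrite ler_nat !leq_max leqnn !orbT.
have r2 : 2 <= rho by rewrite /rho ler_nat !leq_max leqnn orbT.
have r0 : 0 < rho by apply: lt_le_trans rr.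
pose A := [set y : E | rho < `|y| < 4 * rho].
have mA : measurable A.
  rewrite (_ : A = [set y : E | rho < `|y|] `&` [set y : E | `|y| < 4 * rho]).
    exact: measurableI.
  by apply/seteqP; split=> y; rewrite /A /=; [move=> /andP[]|move=> [-> ->]].
have zA : It leb (z * \1_A) <= eps / 2.
  have := hN1 K (leq_maxl _ _); rewrite subr0 => h; apply: le_trans (le_trans (ler_norm _) h).
  apply: It_le; try exact: integM_indic.
  move=> y; rewrite !mulrfctE !indicE; have [/set_mem/andP[yA _]|_] := boolP (y \in A).
    by rewrite mem_set.
  by rewrite mulr0 mulr_ge0.
have cA := cz A (4 * rho) mA (fun y => fun h => ltW (proj2 (andP h))) (fB A (4 * rho) mA (fun y => fun h => proj2 (andP h))).
have cB := cz _ (4 * rho) (mB (4 * rho)) (fun y => @ltW _ _ _ _) (normlt_fin n _).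
have zB : It leb (z * \1_[set y : E | `|y| < 4 * rho]) <= It leb z.
  by apply: It_le => //; [exact: integM_indic|move=> y; apply: mul_indic_le].
have [N2 h2] := (cvg_epsP _ _).1 cA _ (divr_gt0 eps0 (ltr0n R 2)).
have az4 : 0 < (a - It leb z) / 4 by rewrite divr_gt0.
have [N3 h3] := (cvg_epsP _ _).1 cB _ az4.
have [N4 h4] := (cvg_epsP _ _).1 cI _ az4.
exists (maxn N2 (maxn N3 N4)) => k; rewrite !geq_max => /and3P[/h2 k2 /h3 k3 /h4 k4].
have iw : integ leb (w (s k)) by case: (tw (s k)) => -[].
have sE (P Q : set E) : measurable P -> (forall y, Q y <-> P (y + x (s k))) ->
    It leb (sh (x (s k)) (w (s k)) * \1_Q) = It leb (w (s k) * \1_P).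
  by move=> mP; exact: It_sh_indic.
have mshift (P : set E) : measurable P -> measurable [set y | P (y - x (s k))].
  exact: (@mset_sh R n (- x (s k)) P).
apply: (H (mu (s k)) (w (s k)) (x (s k)) rho) => //.
- rewrite -(sE _ A (mshift _ mA)); last by move=> y /=; rewrite addrK.
  by move: k2 zA; move: (It _ _) (It _ _) => p q; rewrite ler_norml => /andP[h5 h6] h7; lra.
- apply: (@le_trans _ _ delta); first by rewrite ge_min lexx.
  apply: le_trans (hx (s k)) _; apply: It_le; try by apply: integM_indic => //; [exact: measurable_cube|exact: mshift (mB rho)].
  + by apply: integM_indic => //; exact: measurable_cube.
  + by apply: integM_indic => //; exact: mshift (mB rho).
  move=> y; rewrite !mulrfctE !indicE; have [/set_mem yC|_] := boolP (y \in cube _ _); last first.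
    by rewrite mulr0 mulr_ge0.
  rewrite mem_set//=; apply: (@le_lt_trans _ _ 1); last by move: r2; lra.
  apply: norm_le_coord => // i; rewrite !mxE; have /andP[h5 h6] := yC i.
  by rewrite ler_norml; apply/andP; split; lra.
- rewrite -(sE _ [set y | 4 * rho <= `|y|] (mshift _ (mge (4 * rho)))); last first.
    by move=> y /=; rewrite addrK.
  set V := sh _ _ in k3 *; have iV : integ leb V by exact: integ_sh.
  have eV : It leb V = It leb (V * \1_[set y : E | `|y| < 4 * rho]) + It leb (V * \1_[set y | 4 * rho <= `|y|]).
    rewrite -ItD; try exact: integM_indic; apply: It_ext => y; rewrite fctE !mulrfctE !indicE.
    have [h|h] := leP (4 * rho) `|y|.
      by rewrite [y \in [set _ | _ <= _]]mem_set// memNset ?mulr0 ?add0r ?mulr1//= ltNge h.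
    by rewrite [y \in [set _ | _ < _]]mem_set// memNset ?mulr0 ?addr0 ?mulr1//= leNgt h.
  apply: (@le_trans _ _ ((a - It leb z) / 2)); first by rewrite ge_min lexx orbT.
  have eW : It leb V = It leb (w (s k)) by rewrite /V It_sh.
  move: k3 k4 zB; rewrite -eW eV !ler_norml.
  move: (It leb (V * _)) (It leb (V * _)) (It leb (z * _)) (It leb z) => p q r' t /andP[h5 h6] /andP[h7 h8] h9.
  by lra.
Qed.

(** z is the local limit of the translated torsion functions and a the limit of their total masses.
    Fatou gives int z <= a, and the two outcomes are equality and strict inequality. *)
Lemma nonvanishing : exists2 s : nat -> nat, {homo s : m k / (m < k)%N} &
  (exists nu : {measure set E -> \bar R}, [/\ forall k, finite_torsion (translate (x (s k)) (mu (s k))),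
    finite_torsion nu & d_gamma (translate (x (s k)) (mu (s k))) nu @[k --> \oo] --> 0%E]) \/
  (forall k, split_data (mu (s k)) (hk R k)).
Proof.
have [M M0 hM] := @tors_uniform_bound R n n0 C.
have wM k : {ae leb, forall y, w k y <= M} by exact: hM (pm k) (tw k) (w0 k).
have hw k : H1 (w k) by exact: H1mu_H1 (tw k).1.1.
pose U k := sh (x k) (w k); have hU k : H1 (U k) by exact: (H1_sh _ (hw k)).1.
have iw k : integ leb (w k) by case: (tw k) => -[].
have iU k : integ leb (U k) by exact: integ_sh.
pose B := Num.max C ((C + nashK R n) * C).
have [||s1 [v [hs1 sv cv mv]]] := @rellich R n U B hU.
- move=> k; rewrite ip_sh; [|exact: H1_sqi (hw k)|exact: H1_sqi (hw k)].
  by apply: le_trans (tors_ip (pm k) (tw k)) _; rewrite le_max lexx orbT.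
- move=> k; apply: le_trans (H1_sh (x k) (hw k)).2 _; apply: le_trans (tors_Dr (pm k) (tw k)) _.
  by rewrite le_max lexx.
have U0 k y : 0 <= U k y by exact: w0.
have v0 : {ae leb, forall y, v y = `|v y|}.
  by apply: filterS cv => y h; rewrite ger0_norm//; apply: (lim_ge h) => k; exact: U0.
pose z y := `|v y|; have sz : sqi leb z by exact: sqi_abs.
have cz : {ae leb, forall y, U (s1 k) y @[k --> \oo] --> z y}.
  by apply: filterS2 cv v0 => y h e; rewrite /z -e.
have bI k : `|It leb (w (s1 k))| <= C.
  by have /andP[h1 h2] := tors_It (pm (s1 k)) (tw (s1 k)); rewrite ger0_norm.
have [s2 hs2 [a ca]] := bw_subseq bI.
pose s := s1 \o s2; have hs : {homo s : m k / (m < k)%N} by exact: homo_comp.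
have czs : {ae leb, forall y, U (s k) y @[k --> \oo] --> z y}.
  by apply: filterS cz => y h; exact: (@cvg_subseq _ (fun k => U (s1 k) y) _ s2 hs2 h).
have mz (A : set E) (K : R) : measurable A -> (forall y, A y -> `|y| <= K) -> (leb A < +oo)%E ->
    It leb (U (s k) * \1_A) @[k --> \oo] --> It leb (z * \1_A).
  move=> mA AK Af; have := @cvg_subseq _ _ _ s2 hs2 (mv A K mA AK Af).
  rewrite (_ : It leb (v * \1_A) = It leb (z * \1_A))//; apply: It_ae.
  - by apply: mfM; [exact: sv.1|exact: mf_indic].
  - by apply: mfM; [exact: sz.1|exact: mf_indic].
  by apply: filterS v0 => y h; rewrite !mulrfctE /z -h.
have IUw k : It leb (U k) = It leb (w k) by rewrite It_sh.
have [iz za] : integ leb z /\ It leb z <= a.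
  have zb e : 0 < e -> integ leb z /\ It leb z <= a + e.
    move=> e0; have [N hN] := (cvg_epsP _ _).1 ca _ e0.
    have zz : (fun y => `|z y|) = z by apply/funext => y; rewrite /z normr_id.
    rewrite -[X in integ leb X]zz -[X in It leb X]zz.
    have [] := @It_fatou _ _ _ leb (fun k => U (s (k + N)%N)) z (a + e); try by [].
    - exact: sz.1.
    - move=> k; rewrite IUw; have := hN (k + N)%N (leq_addl _ _).
      by rewrite ler_norml /s /= => /andP[_ h]; rewrite lerBlDl in h.
    apply: filterS czs => y h; apply: (@cvg_subseq _ (fun k => U (s k) y) _ (fun k => k + N)%N) h => p q pq.
    by rewrite ltn_add2r.
  split; first exact: (zb 1 ltr01).1.
  by apply/ler_addgt0Pr => e /zb[].
have [e|ne] := eqVneq (It leb z) a.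
  exists s => //; left; apply: (@compactness_limit M s z) => //; first by move=> y; exact: normr_ge0.
  by rewrite e.
have zlt : It leb z < a by rewrite lt_neqAle ne.
have Hs := @dichotomy_limit M a s z M0 wM (fun y => normr_ge0 _) iz mz ca zlt.
(* Each tolerance 2^-k is met from some rank on; picking increasing indices, one for each k, sends
   the separation to infinity and the errors to 0. *)
have [|t ht hQ] := @subseq_pick (fun k m => split_data (mu (s m)) (hk R k)).
  move=> k N; have [N' hN'] := Hs _ (hk_gt0 R k); exists (maxn N N'); first exact: leq_maxl.
  by apply: hN'; exact: leq_maxr.
by exists (s \o t); [exact: homo_comp|right].
Qed.

End nonvanishing.

(** * The trichotomy *)

Lemma poinc_le (R : realType) (n : nat) (mu : {measure set 'rV[R]_n -> \bar R}) (C C' : R) :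
  C <= C' -> poinc mu C -> poinc mu C'.
Proof.
move=> CC [C0 h]; split=> [|v hv]; first exact: le_trans CC.
by apply: le_trans (h v hv) _; rewrite ler_wpM2r// (psd_ge0 (psd_E mu) hv.1).
Qed.

(** If the first alternative fails, then from some rank N on every function has a unit cube of mass
    at least a fixed 2^-k. The rank is absorbed in a shift of the sequence, so that centres are
    available for all indices. *)
Lemma vanishing_or_not (R : realType) (n : nat) (w : nat -> 'rV[R]_n -> R) :
  (forall k N, exists2 m, (N <= m)%N & forall a, It (lebesgue_rV R n) (w m * \1_(cube a 1)) <= hk R k) \/
  exists k N (x : nat -> 'rV[R]_n), forall m, hk R k <= It (lebesgue_rV R n) (w (m + N)%N * \1_(cube (x m) 1)).
Proof.
have [h|h] := pselect (forall k N, exists2 m, (N <= m)%N &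
  forall a, It (lebesgue_rV R n) (w m * \1_(cube a 1)) <= hk R k); [by left|right].
move/existsNP: h => [k /existsNP[N h]]; exists k, N.
have /choice[x hx] m : exists a : 'rV[R]_n, hk R k <= It (lebesgue_rV R n) (w (m + N)%N * \1_(cube a 1)); last by exists x.
apply: contrapT => h2; apply: h; exists (m + N)%N; first exact: leq_addl.
move=> a; have [//|h3] := leP (It (lebesgue_rV R n) (w (m + N)%N * \1_(cube a 1))) (hk R k).
by exfalso; apply: h2; exists a; exact: ltW.
Qed.

Local Open Scope ereal_scope.

Theorem theorem3p5 (R : realType) (d : nat) (hd : (0 < d)%N)
    (mu : nat -> {measure set 'rV[R]_d -> \bar R})
    (hmu : forall n, finite_torsion (mu n))
    (hP : ereal_sup [set torsion (mu n) | n in [set: nat]] < +oo) :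
  exists2 s : nat -> nat, {homo s : m n / (m < n)%N} &
  [\/
      exists (x : nat -> 'rV[R]_d) (nu : {measure set 'rV[R]_d -> \bar R}),
        [/\ forall n, finite_torsion (translate (x n) (mu (s n))),
            finite_torsion nu &
            d_gamma (translate (x n) (mu (s n))) nu @[n --> \oo] --> 0],
      [/\ opnorm2 (resolvent (mu (s n))) @[n --> \oo] --> 0,
          'N[lebesgue_rV R d]_+oo[EFin \o torsion_function (mu (s n))]
            @[n --> \oo] --> 0 &
          lambda1 (mu (s n)) @[n --> \oo] --> +oo] |
      exists (mu1 mu2 mu12 : nat -> {measure set 'rV[R]_d -> \bar R}),
        (forall n, [/\ capacitary (mu1 n), capacitary (mu2 n),
                       is_wedge (mu1 n) (mu2 n) (mu12 n) &
                       finite_torsion (mu12 n)]) /\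
        [/\ exists Om1 Om2 : nat -> set 'rV[R]_d,
              (forall n, finiteness_set (mu1 n) (Om1 n) /\
                         finiteness_set (mu2 n) (Om2 n)) /\
              euclidean_dist (Om1 n) (Om2 n) @[n --> \oo] --> +oo%R,
            forall n, cap_le (mu (s n)) (mu12 n),
            d_gamma (mu (s n)) (mu12 n) @[n --> \oo] --> 0 &
            opnorm2 (fun f => (resolvent (mu (s n)) f \- resolvent (mu12 n) f)%R)
              @[n --> \oo] --> 0]].
Proof.
have [P hP'] : exists P : R, forall n, torsion (mu n) <= P%:E.
  have ub n : torsion (mu n) <= ereal_sup [set torsion (mu n) | n in [set: nat]].
    by apply: ereal_sup_ubound; exists n.
  case: (ereal_sup _) hP ub => [r _ ub|//|_ ub]; first by exists r.
  by exists 0%R => n; apply: le_trans (ub n) _; exact: leNye.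
(* 2 P is the constant supplied by [torsion_poinc]; it is enlarged so as to be positive. *)
pose C : R := (`|2 * P| + 1)%R; have C0 : (0 < C)%R by rewrite ltr_wpDl.
have cm n : capacitary (mu n) by case: (hmu n).
have pm n : poinc (mu n) C.
  by apply: poinc_le (torsion_poinc (hP' n)); apply: le_trans (ler_norm _) _; rewrite lerDl.
have /choice[w hw] n := tors_nonneg (cm n) (pm n).
have tw n : tors (mu n) (w n) by case: (hw n). have w0 n x : (0 <= w n x)%R by case: (hw n).
case: (vanishing_or_not w) => [/subseq_pick[s hs hQ]|[k [N [x hx]]]].
  exists s => //; apply: Or32; apply: (@vanishing R d (fun k => mu (s k)) (fun k => w (s k))) => //.
  move=> e e0; have [th th0 h1] := tors_small_L2 hd e0.
  have [dl dl0 h2] := @nash_small R d C th th0.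
  have [N hN] := half_pow_small dl0; exists N => k /hN kN; apply: h1 (tw (s k)) (w0 (s k)) _.
  by apply: h2 (pm _) (tw _) (w0 _) _ => a; exact: le_trans (hQ k a) kN.
have [s hs] := @nonvanishing R d hd (fun m => mu (m + N)%N) (fun m => w (m + N)%N) C (hk R k) x
  C0 (fun m => cm _) (fun m => pm _) (fun m => tw _) (fun m => w0 _) (hk_gt0 R k) hx.
move=> H; exists (fun k => s k + N)%N; first by move=> m l ml; rewrite ltn_add2r; exact: hs.
case: H => [[nu h]|H]; first by apply: Or31; exists (fun k => x (s k)), nu.
apply: Or33; move: H => /choice[mu1 /choice[mu2 /choice[mu12 /choice[Om1 /choice[Om2 H]]]]].
exists mu1, mu2, mu12; split=> [k'|]; first by case: (H k').
have small (e : R) : (0 < e)%R -> exists N', forall k', (N' <= k')%N -> (hk R k' <= e)%R by exact: half_pow_small.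
split.
- exists Om1, Om2; split=> [k'|]; first by case: (H k') => _ [].
  apply/cvgryPge => A; pose a := Num.max 1%R A; have a0 : (0 < a)%R by rewrite lt_max ltr01.
  have [|N' hN] := small a^-1%R; first by rewrite invr_gt0.
  exists N' => // k' /= /hN h; have [_ [_ D _ _ _]] := H k'; apply: le_trans D.
  apply: (@le_trans _ _ a); first by rewrite le_max lexx orbT.
  by rewrite -[a]invrK lef_pV2 ?posrE ?invr_gt0// hk_gt0.
- by move=> k'; case: (H k') => _ [].
- apply: ereal_cvg0 => e /small[N' hN]; exists N' => k' /hN h; have [_ [_ _ _ /andP[-> D] _]] := H k'.
  by apply: le_trans D _; rewrite lee_fin.
- apply: ereal_cvg0 => e /small[N' hN]; exists N' => k' /hN h; have [_ [_ _ _ _ /andP[-> D]]] := H k'.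
  by apply: le_trans D _; rewrite lee_fin.
Qed.
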